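(* Let $\alpha>0$, $\beta>0$ and let $T>0$ be fixed. Let $u_0,g_0,g_1,f$ satisfy the standing assumptions in the context, and suppose in addition that $g_0$, $g_1$ and $f$ are $T$-periodic in time, i.e. $g_k(t+T)=g_k(t)$ ($k=0,1$) and $f(x,t+T)=f(x,t)$ for every $t\ge0$ and $x\ge0$. Let $U(x,t)$ be the solution, given by the integral formula in the context, of $$\partial_tU=\alpha\partial_x^2U-\beta\partial_x^4U+f\ \text{ in }Q,\qquad U(x,0)=u_0(x)\ (x>0),\qquad U(0,t)=g_0(t),\ \ U_x(0,t)=g_1(t)\ (t>0).$$ Then $U$ is eventually $T$-periodic, i.e. for every fixed $x_0>0$, $$\lim_{t\to\infty}[U(x_0,t+T)-U(x_0,t)]=0.$$ More precisely, for every fixed $x_0>0$, $$U(x_0,t+T)-U(x_0,t)=\mathfrak C_1\frac1{t^{1/2}}+\mathfrak C_2\frac1{t^{3/2}}+O(1/t^{5/2}),\quad\text{as }t\to\infty,$$ where $\mathfrak C_1,\mathfrak C_2$ are constants (independent of $t$) which are explicitly expressed in terms of the data.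
   Context: $Q=\mathbb R^+\times\mathbb R^+$, $\mathbb R^+=(0,\infty)$, $\overline Q=[0,\infty)\times[0,\infty)$. $\mathcal S([0,\infty))$ is the space of $C^\infty$ functions on $[0,\infty)$ which, together with all derivatives, are rapidly decreasing as $x\to\infty$. Standing assumptions on the data: $u_0\in\mathcal S([0,\infty))$, $g_0,g_1\in C^\infty([0,\infty))$, and $f\in C^\infty(\overline Q)$ with $f(\cdot,t)\in\mathcal S([0,\infty))$ uniformly for $t$ in compact subsets of $[0,\infty)$, i.e. for all integers $\ell,n\ge0$ and all $t_0>0$, $\sup\{x^\ell|\partial_x^nf(x,t)|:x\ge0,\ 0\le t\le t_0\}<\infty$. Notation: $\omega(\lambda)=\alpha\lambda^2+\beta\lambda^4$; $\hat u_0(\lambda)=\int_0^\infty e^{-i\lambda y}u_0(y)\,dy$ and $\hat f(\lambda,t)=\int_0^\infty e^{-i\lambda y}f(y,t)\,dy$ for $\operatorname{Im}\lambda\le0$; $\widetilde g_j(\omega(\lambda),t)=\int_0^te^{\omega(\lambda)\tau}g_j(\tau)\,d\tau$; $\widetilde{\hat f}(\mu,\omega(\lambda),t)=\int_0^te^{\omega(\lambda)\tau}\hat f(\mu,\tau)\,d\tau$ for $\operatorname{Im}\mu\le0$. $\Omega=\{\lambda:\operatorname{Im}\lambda\ge0,\ \operatorname{Re}(\alpha\lambda^2+\beta\lambda^4)\le0\}$. Its boundary $\partial\Omega$ consists of two curves, one through $0$ (lower) and one through $i\sqrt{\alpha/\beta}$ (upper); it is positively oriented, i.e. the lower curve is traversed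 from left to right and the upper curve from right to left. $\rho(\lambda)=-\sqrt{\lambda^2+\alpha/\beta}$ (principal square root) is the holomorphic branch of the square root of $\lambda^2+\alpha/\beta$ on $\mathbb C-\{i\eta:\eta\in\mathbb R,\ |\eta|\ge\sqrt{\alpha/\beta}\}$ that is negative on $\mathbb R$; $\rho(i\sqrt{\alpha/\beta})=0$ by continuity. It satisfies $\operatorname{Im}[i\rho(\lambda)]\le0$ on $\partial\Omega$. The function $U$ is defined for $x>0$, $t>0$ by $$\begin{aligned}U(x,t)=&\frac1{2\pi}\int_{-\infty}^\infty e^{i\lambda x-\omega(\lambda)t}\hat u_0(\lambda)\,d\lambda+\frac1{2\pi}\int_{\partial\Omega}e^{i\lambda x-\omega(\lambda)t}\left[\frac{i\lambda+\rho(\lambda)}{i\lambda-\rho(\lambda)}\hat u_0(-\lambda)-\frac{2i\lambda}{i\lambda-\rho(\lambda)}\hat u_0(i\rho(\lambda))\right]d\lambda\\&-\frac{\beta i}\pi\int_{\partial\Omega}e^{i\lambda x-\omega(\lambda)t}\lambda[i\lambda+\rho(\lambda)]\big[\rho(\lambda)\widetilde g_0(\omega(\lambda),t)-\widetilde g_1(\omega(\lambda),t)\big]d\lambda+\frac1{2\pi}\int_{-\infty}^\infty e^{i\lambda x-\omega(\lambda)t}\widetilde{\hat f}(\lambda,\omega(\lambda),t)\,d\lambda\\&+\frac1{2\pi}\int_{\partial\Omega}e^{i\lambda x-\omega(\lambda)t}\left[\frac{i\lambda+\rho(\lambda)}{i\lambda-\rho(\lambda)}\widetilde{\hat f}(-\lambda,\omega(\lambda),t)-\frac{2i\lambda}{i\lambda-\rho(\lambda)}\widetilde{\hat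 f}(i\rho(\lambda),\omega(\lambda),t)\right]d\lambda.\end{aligned}$$ *)

(* Defs.v *)
(* Stdlib world: the concrete real numbers, with Coquelicot. *)
From Stdlib Require Import Reals Lra Psatz.
From Coquelicot Require Import Coquelicot.
Open Scope R_scope.

(* Integrals of functions R -> C: [C] viewed as a real normed space. *)
Definition CInt (f : R -> C) (a b : R) : C :=
  RInt (V := C_R_CompleteNormedModule) f a b.

Definition CInt_half (f : R -> C) : C :=
  RInt_gen (V := C_R_CompleteNormedModule) f
    (at_point 0) (Rbar_locally p_infty).

Definition CInt_line (f : R -> C) : C :=
  RInt_gen (V := C_R_CompleteNormedModule) f
    (Rbar_locally m_infty) (Rbar_locally p_infty).

Definition Cexp (z : C) : C :=
  (exp (Re z) * cos (Im z), exp (Re z) * sin (Im z)).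

(* Principal square root: nonnegative real part, and nonnegative imaginary
   part on the cut (-oo, 0). *)
Definition Csqrt (z : C) : C :=
  (sqrt ((Cmod z + Re z) / 2),
   (if Rle_dec 0 (Im z) then 1 else -1) * sqrt ((Cmod z - Re z) / 2)).

(* One-sided at x = 0: only the values on [0, oo) of the function matter. *)
Definition is_derive_half (f : R -> C) (x : R) (l : C) : Prop :=
  filterdiff (U := R_NormedModule) (V := C_R_NormedModule) f
    (within (fun y => 0 <= y) (locally x)) (fun h => scal h l).

Definition derivatives_half (f : R -> C) (D : nat -> R -> C) : Prop :=
  (forall x, 0 <= x -> D 0%nat x = f x) /\
  (forall n x, 0 <= x -> is_derive_half (D n) x (D (S n) x)).

Definition smooth_half (f : R -> C) : Prop :=
  exists D, derivatives_half f D.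

Definition schwartz_half (f : R -> C) : Prop :=
  exists D, derivatives_half f D /\
    forall l n : nat, exists M : R, forall x, 0 <= x ->
      x ^ l * Cmod (D n x) <= M.

(* D m n is the partial derivative of order m in x and n in t; all of them
   are jointly continuous up to the boundary of the closed quadrant. *)
Definition derivatives_quadrant
    (f : R -> R -> C) (D : nat -> nat -> R -> R -> C) : Prop :=
  forall x t, 0 <= x -> 0 <= t ->
    D 0%nat 0%nat x t = f x t /\
    forall m n,
      is_derive_half (fun y => D m n y t) x (D (S m) n x t) /\
      is_derive_half (fun s => D m n x s) t (D m (S n) x t) /\
      filterlim (fun p : R * R => D m n (fst p) (snd p))
        (within (fun p : R * R => 0 <= fst p /\ 0 <= snd p) (locally (x, t)))
        (locally (D m n x t)).

Definition smooth_schwartz_quadrant (f : R -> R -> C) : Prop :=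
  exists D, derivatives_quadrant f D /\
    forall (l n : nat) (t0 : R), 0 < t0 -> exists M : R,
      forall x t, 0 <= x -> 0 <= t <= t0 ->
        x ^ l * Cmod (D n 0%nat x t) <= M.

(* Meaningful for Im l <= 0. *)
Definition hat (u : R -> C) (l : C) : C :=
  CInt_half (fun y => (Cexp (- (Ci * l * RtoC y)) * u y)%C).

Definition tilde (g : R -> C) (w : C) (t : R) : C :=
  CInt (fun tau => (Cexp (w * RtoC tau) * g tau)%C) 0 t.

Definition tilde_hat (f : R -> R -> C) (mu w : C) (t : R) : C :=
  tilde (fun tau => hat (fun y => f y tau) mu) w t.

Section Formula.
Variables (alpha beta : R).

Definition omega (l : C) : C :=
  (RtoC alpha * l ^ 2 + RtoC beta * l ^ 4)%C.

Definition Omega (l : C) : Prop := 0 <= Im l /\ Re (omega l) <= 0.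

Definition rho (l : C) : C := (- Csqrt (l ^ 2 + RtoC (alpha / beta)))%C.

(* With l = a + i b, Re (omega l) is the quadratic
   beta (b^2)^2 - (alpha + 6 beta a^2) b^2 + alpha a^2 + beta a^4 in b^2, so
   that the boundary of Omega is made of the graphs, over the real axis, of the
   square roots of its two roots (see Omega_between). *)
Definition disc (a : R) : R :=
  alpha ^ 2 + 8 * alpha * beta * a ^ 2 + 32 * beta ^ 2 * a ^ 4.

Definition lower (a : R) : R :=
  sqrt ((alpha + 6 * beta * a ^ 2 - sqrt (disc a)) / (2 * beta)).

Definition upper (a : R) : R :=
  sqrt ((alpha + 6 * beta * a ^ 2 + sqrt (disc a)) / (2 * beta)).

(* Integral of F along the graph a |-> a + i b(a), from left to right. *)
Definition graph_int (b : R -> R) (F : C -> C) : C :=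
  CInt_line (fun a => (F (a, b a) * (1, Derive b a))%C).

(* Lower curve from left to right, upper curve from right to left.  [lower] has
   a corner at 0, which does not affect the integral. *)
Definition boundary_int (F : C -> C) : C :=
  (graph_int lower F - graph_int upper F)%C.

Definition U_formula (u0 g0 g1 : R -> C) (f : R -> R -> C) (x t : R) : C :=
  let E l := Cexp (Ci * l * RtoC x - omega l * RtoC t)%C in
  let P l := ((Ci * l + rho l) / (Ci * l - rho l))%C in
  let S l := ((2 * Ci * l) / (Ci * l - rho l))%C in
  ( / (2 * PI) * CInt_line (fun s => E (RtoC s) * hat u0 (RtoC s))
  + / (2 * PI) * boundary_int (fun l =>
        E l * (P l * hat u0 (- l) - S l * hat u0 (Ci * rho l)))
  - (beta * Ci / PI) * boundary_int (fun l =>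
        E l * l * (Ci * l + rho l)
        * (rho l * tilde g0 (omega l) t - tilde g1 (omega l) t))
  + / (2 * PI) * CInt_line (fun s =>
        E (RtoC s) * tilde_hat f (RtoC s) (omega (RtoC s)) t)
  + / (2 * PI) * boundary_int (fun l =>
        E l * (P l * tilde_hat f (- l) (omega l) t
               - S l * tilde_hat f (Ci * rho l) (omega l) t)))%C.

(* The stationary profile: alpha h'' = beta h'''' and h(0) = h'(0) = 0. *)
Definition profile (y : R) : R :=
  let c := sqrt (alpha / beta) in y - (1 - exp (- (c * y))) / c.

(* Coefficients of t^(-1/2) and t^(-3/2) in U(x, t + T) - U(x, t); an expansion
   to this order determines them uniquely.  By periodicity the difference is
   the formula for U with each time integral taken over [0, T].  After the
   lower curve is moved to the real axis, t^(-1/2) comes from the value at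
   l = 0 of the amplitude, where P = -1 and S = 0 make the terms cancel.
   t^(-3/2) comes from the quadratic Taylor coefficient at l = 0 of the
   amplitude times e^(ilx), and from the square root branch point
   i sqrt (alpha / beta). *)
Definition coef1 : C := 0%C.

Definition coef2 (T : R) (g0 g1 : R -> C) (f : R -> R -> C) (x : R) : C :=
  (RtoC (profile x / (2 * sqrt PI * Rpower alpha (3 / 2))) *
   (CInt (fun t => CInt_half (fun y => RtoC (profile y) * f y t)) 0 T
    + alpha * CInt g0 0 T + sqrt (alpha * beta) * CInt g1 0 T))%C.

End Formula.

Lemma Omega_between (alpha beta : R) (l : C) :
  0 < alpha -> 0 < beta ->
  Omega alpha beta l <->
  lower alpha beta (Re l) <= Im l <= upper alpha beta (Re l).
Proof.
intros ha hb; destruct l as [a b]; unfold Omega, lower, upper; cbn [Re Im fst snd].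
set (B := alpha + 6 * beta * a ^ 2).
assert (Ha2 : 0 <= a ^ 2) by nra.
assert (HD : 0 <= disc alpha beta a).
{ unfold disc. assert (0 <= (beta * a^2)^2) by nra.
  assert (0 <= alpha * beta * a^2) by (apply Rmult_le_pos; nra). nra. }
set (s := sqrt (disc alpha beta a)).
assert (Hs : s * s = disc alpha beta a) by (apply sqrt_sqrt; exact HD).
assert (Hs0 : 0 <= s) by apply sqrt_pos.
assert (HB : 0 < B) by (unfold B; nra).
assert (HsB : s <= B).
{ assert (B * B - s * s = 4 * beta * a^2 * (alpha + beta * a^2)) by
    (rewrite Hs; unfold B, disc; ring).
  assert (0 <= 4 * beta * a^2 * (alpha + beta * a^2)).
  { apply Rmult_le_pos; [apply Rmult_le_pos|]; nra. }
  nra. }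
assert (Hre : 4 * beta * Re (omega alpha beta (a, b)) =
   (2 * beta * b^2 - (B - s)) * (2 * beta * b^2 - (B + s))).
{ replace ((2 * beta * b^2 - (B - s)) * (2 * beta * b^2 - (B + s)))
   with ((2 * beta * b^2 - B) ^ 2 - s * s) by ring.
  rewrite Hs; unfold B, disc, omega; simpl; ring. }
assert (Hm : 0 <= (B - s) / (2 * beta)) by (apply Rle_mult_inv_pos; lra).
assert (Hp : 0 <= (B + s) / (2 * beta)) by (apply Rle_mult_inv_pos; lra).
assert (Em : 2 * beta * ((B - s) / (2 * beta)) = B - s) by (field; lra).
assert (Ep : 2 * beta * ((B + s) / (2 * beta)) = B + s) by (field; lra).
set (m := (B - s) / (2 * beta)) in *; set (p := (B + s) / (2 * beta)) in *.
assert (Hmp : m <= p) by nra.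
assert (Hfac : Re (omega alpha beta (a, b)) = beta * ((b^2 - m) * (b^2 - p))).
{ apply Rmult_eq_reg_l with (4 * beta); [|lra].
  rewrite Hre, <- Em, <- Ep; ring. }
rewrite Hfac; split.
- intros [H0 H1].
  assert (H2 : (b^2 - m) * (b^2 - p) <= 0) by nra.
  split; [rewrite <- (sqrt_pow2 b H0) | rewrite <- (sqrt_pow2 b H0)];
    apply sqrt_le_1_alt; nra.
- intros [H0 H1].
  assert (Hb : 0 <= b) by (generalize (sqrt_pos m); lra).
  split; [exact Hb|].
  assert (H2 : m <= b^2).
  { rewrite <- (pow2_sqrt m Hm); apply pow_incr; split; [apply sqrt_pos|lra]. }
  assert (H3 : b^2 <= p).
  { rewrite <- (pow2_sqrt p Hp); apply pow_incr; split; [exact Hb|lra]. }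
  assert (0 <= beta * ((b^2 - m) * (p - b^2))) by
    (apply Rmult_le_pos; [|apply Rmult_le_pos]; lra).
  lra.
Qed.

(* Main.v *)
Require Import Defs.
From Stdlib Require Import Reals Lra Psatz ClassicalEpsilon FunctionalExtensionality.
From Coquelicot Require Import Coquelicot.
Open Scope R_scope.

(** Write s for the root of l^2 + alpha / beta with nonnegative real part, so that rho = - s.  Every term of the formula
superposes sources: at a position y (the boundary data sit at y = 0) and a time tau, each enters U(x, t) through a
contour integral of exp (i l x - omega(l) (t - tau)) times an amplitude in l and s.  Call t - tau the age of the source.

Periodicity leaves few sources in the difference.  The time integral up to t + T, with time shifted by T, contains the
one up to t; what remains are the sources of the period [0, T], whose age t + T - tau is at least t
([duhamel_difference]).  The initial datum contributes the difference of its effects at the ages t + T and t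
([U_difference]).  Hence only the kernels at large age matter.

At a fixed positive age the contours can be moved to the real axis.  Reflection in the imaginary axis conjugates the
integrands, so the right halves suffice.  The lower curve is deformed to the positive half-line within the sector where
Re omega >= 0 ([low_to_real]).  The upper curve starts at the branch point of the root; but in the variable
m = i rho(l) it becomes a curve from 0 in the sector |Im m| <= Re m on which the integrand is holomorphic, while
omega = beta l^2 (l^2 + alpha / beta) keeps its form, so it can be deformed as well ([up_to_real]).  Both deformations
come from [deform_to_half_line].  With all contours on the real axis the contributions add up, by the identity
[source_kernel_real], to
    4 exp (- omega(a) th) phi_a(x) phi_a(y) / (2 a^2 + alpha / beta)
over 2 PI, at frequency a and age th, where phi_a = [eigenfun a] is the generalized eigenfunction vanishing at 0 to
second order; the boundary data give similar kernels with phi_a(x) alone.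

As a tends to 0, phi_a(y) = - a c profile(y) + O(a^3 (1 + y)^3) with c = sqrt (alpha / beta) ([eigenfun_expansion]), so
every kernel is a multiple of a^2 exp (- omega(a) th) up to a relative error O(a^2).  Laplace's method ([laplace]) turns
a^2 into sqrt PI / (4 (alpha th)^(3/2)) with an error O(th^(-5/2)): there is no term of order t^(-1/2), and the
coefficient of t^(-3/2) collects the moments of f against the profile and the boundary data over one period.  Replacing
the ages by t costs O(t^(-5/2)) ([age_shift]); for the same reason the leading terms of the initial datum cancel to that
order.

The exchanges of integrals behind this rest on two kinds of decay in the frequency: on the curves it is exponential
because x > 0, and on the real line, where it is lost at age 0, integration over the age restores it
([kbound_Duhamel]). *)

(** * Calculus of complex-valued functions *)

Notation CV := C_R_CompleteNormedModule.
Notation ccont f p := (@continuous _ (NormedModule.UniformSpace _ C_R_NormedModule) f p).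

Lemma ccont_iff {T : UniformSpace} (f : T -> C) (p : T) :
  ccont f p <->
  continuous (fun q => Re (f q)) p /\ continuous (fun q => Im (f q)) p.
Proof.
split.
- intros H; split; intros P [e He]; apply (H (fun z => P (_ z)));
    exists e; intros z [H1 H2]; apply He; assumption.
- intros [H1 H2] P [e He].
  assert (A1 := H1 (fun u => ball (Re (f p)) e u) (locally_ball _ _)).
  assert (A2 := H2 (fun u => ball (Im (f p)) e u) (locally_ball _ _)).
  unfold filtermap in *.
  generalize (filter_and _ _ A1 A2); apply filter_imp; intros q [B1 B2].
  apply He; split; assumption.
Qed.

Lemma ccont_eps {T : UniformSpace} (f : T -> C) (p : T) :
  ccont f p <-> forall e : posreal, locally p (fun q => Cmod (f q - f p) < e).
Proof.
split.
- intros H e.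
  apply (H (fun z => Cmod (z - f p)%C < e)).
  assert (Hs : 0 < sqrt 2) by (apply sqrt_lt_R0; lra).
  exists (mkposreal (e / sqrt 2) (Rdiv_lt_0_compat _ _ (cond_pos e) Hs)).
  intros z Hz.
  assert (A := C_NormedModule_mixin_compat2 (f p) z _ Hz).
  simpl in A. replace (sqrt 2 * (e / sqrt 2)) with (e : R) in A by (field; lra).
  exact A.
- intros H P [e He]; unfold filtermap.
  generalize (H e); apply filter_imp; intros q Hq.
  apply He. apply (C_NormedModule_mixin_compat1 (f p) (f q) e). exact Hq.
Qed.

Section Continuity.
Context {T : UniformSpace}.
Implicit Types f g : T -> C.

Lemma ccont_const (c : C) (p : T) : ccont (fun _ : T => c) p.
Proof. apply continuous_const. Qed.

Lemma ccont_pair (f g : T -> R) p :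
  continuous f p -> continuous g p -> ccont (fun q => (f q, g q) : C) p.
Proof. intros; apply ccont_iff; split; assumption. Qed.

Lemma ccont_RtoC (f : T -> R) p : continuous f p -> ccont (fun q => RtoC (f q)) p.
Proof. intros; apply ccont_iff; split; [assumption|apply continuous_const]. Qed.

Lemma ccont_plus f g p : ccont f p -> ccont g p -> ccont (fun q => (f q + g q)%C) p.
Proof. intros; apply (continuous_plus (V := C_R_NormedModule)); assumption. Qed.

Lemma ccont_opp f p : ccont f p -> ccont (fun q => (- f q)%C) p.
Proof. intros; apply (continuous_opp (V := C_R_NormedModule)); assumption. Qed.

Lemma ccont_minus f g p : ccont f p -> ccont g p -> ccont (fun q => (f q - g q)%C) p.
Proof. intros; apply ccont_plus; [|apply ccont_opp]; assumption. Qed.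

Lemma ccont_mult f g p : ccont f p -> ccont g p -> ccont (fun q => (f q * g q)%C) p.
Proof.
intros [Hf1 Hf2]%ccont_iff [Hg1 Hg2]%ccont_iff; apply ccont_iff; split.
- apply (continuous_minus (V := R_NormedModule)); apply (continuous_mult (K := R_AbsRing)); assumption.
- apply (continuous_plus (V := R_NormedModule)); apply (continuous_mult (K := R_AbsRing)); assumption.
Qed.

Lemma cont_Rexp (f : T -> R) p : continuous f p -> continuous (fun q => exp (f q)) p.
Proof. intros; apply (continuous_comp f exp); [assumption|apply continuous_exp]. Qed.
Lemma cont_Rcos (f : T -> R) p : continuous f p -> continuous (fun q => cos (f q)) p.
Proof. intros; apply (continuous_comp f cos); [assumption|apply continuous_cos]. Qed.
Lemma cont_Rsin (f : T -> R) p : continuous f p -> continuous (fun q => sin (f q)) p.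
Proof. intros; apply (continuous_comp f sin); [assumption|apply continuous_sin]. Qed.
Lemma cont_Rsqrt (f : T -> R) p : continuous f p -> continuous (fun q => sqrt (f q)) p.
Proof. intros; apply (continuous_comp f sqrt); [assumption|apply continuous_sqrt]. Qed.
Lemma cont_Rabs (f : T -> R) p : continuous f p -> continuous (fun q => Rabs (f q)) p.
Proof. intros; apply (continuous_comp f Rabs); [assumption|apply continuous_Rabs]. Qed.
Lemma cont_Rinv (f : T -> R) p : continuous f p -> f p <> 0 -> continuous (fun q => / f q) p.
Proof. intros; apply (continuous_comp f Rinv); [assumption|apply continuous_Rinv; assumption]. Qed.
Lemma cont_Rplus (f g : T -> R) p :
  continuous f p -> continuous g p -> continuous (fun q => f q + g q) p.
Proof. intros; apply (continuous_plus (V := R_NormedModule)); assumption. Qed.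
Lemma cont_Ropp (f : T -> R) p : continuous f p -> continuous (fun q => - f q) p.
Proof. intros; apply (continuous_opp (V := R_NormedModule)); assumption. Qed.
Lemma cont_Rminus (f g : T -> R) p :
  continuous f p -> continuous g p -> continuous (fun q => f q - g q) p.
Proof. intros; apply (continuous_minus (V := R_NormedModule)); assumption. Qed.
Lemma cont_Rmult (f g : T -> R) p :
  continuous f p -> continuous g p -> continuous (fun q => f q * g q) p.
Proof. intros; apply (continuous_mult (K := R_AbsRing)); assumption. Qed.
Lemma cont_Rpow (f : T -> R) n p : continuous f p -> continuous (fun q => f q ^ n) p.
Proof.
intros H; induction n as [|n IH]; [apply continuous_const|].
apply cont_Rmult; assumption.
Qed.
Lemma cont_Rdiv (f g : T -> R) p :
  continuous f p -> continuous g p -> g p <> 0 -> continuous (fun q => f q / g q) p.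
Proof. intros; apply cont_Rmult; [|apply cont_Rinv]; assumption. Qed.

Lemma cont_Re f p : ccont f p -> continuous (fun q => Re (f q)) p.
Proof. intros H; exact (proj1 (proj1 (ccont_iff f p) H)). Qed.
Lemma cont_Im f p : ccont f p -> continuous (fun q => Im (f q)) p.
Proof. intros H; exact (proj2 (proj1 (ccont_iff f p) H)). Qed.

Lemma cont_Cmod f p : ccont f p -> continuous (fun q => Cmod (f q)) p.
Proof.
intros [H1 H2]%ccont_iff.
apply cont_Rsqrt, cont_Rplus; apply cont_Rpow; assumption.
Qed.

Lemma ccont_Cexp f p : ccont f p -> ccont (fun q => Cexp (f q)) p.
Proof.
intros [H1 H2]%ccont_iff.
apply (ccont_pair (fun q => exp (Re (f q)) * cos (Im (f q)))
  (fun q => exp (Re (f q)) * sin (Im (f q)))); apply cont_Rmult.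
- apply cont_Rexp; assumption.
- apply cont_Rcos; assumption.
- apply cont_Rexp; assumption.
- apply cont_Rsin; assumption.
Qed.

Lemma ccont_inv f p : ccont f p -> f p <> 0%C -> ccont (fun q => (/ f q)%C) p.
Proof.
intros H0 Hn; destruct (proj1 (ccont_iff _ _) H0) as [H1 H2].
assert (N : Re (f p) ^ 2 + Im (f p) ^ 2 <> 0).
{ intros E; apply Hn. rewrite <- Cmod2_alt in E.
  apply Cmod_eq_0. generalize (Cmod_ge_0 (f p)); nra. }
assert (Hd : continuous (fun q => fst (f q) ^ 2 + snd (f q) ^ 2) p)
  by (apply cont_Rplus; apply cont_Rpow; assumption).
apply (ccont_pair (fun q => fst (f q) / (fst (f q) ^ 2 + snd (f q) ^ 2))
  (fun q => - snd (f q) / (fst (f q) ^ 2 + snd (f q) ^ 2))).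
- apply cont_Rdiv; assumption.
- apply cont_Rdiv; [apply cont_Ropp| |]; assumption.
Qed.

Lemma ccont_div f g p :
  ccont f p -> ccont g p -> g p <> 0%C -> ccont (fun q => (f q / g q)%C) p.
Proof. intros; apply ccont_mult; [|apply ccont_inv]; assumption. Qed.

Lemma ccont_pow f n p : ccont f p -> ccont (fun q => (f q ^ n)%C) p.
Proof.
intros H; induction n as [|n IH]; [apply ccont_const|].
apply ccont_mult; assumption.
Qed.

Lemma ccont_conj f p : ccont f p -> ccont (fun q => Cconj (f q)) p.
Proof. intros [H1 H2]%ccont_iff; apply ccont_pair; [|apply cont_Ropp]; assumption. Qed.

End Continuity.

(** Non-vanishing denominators and continuity of abstract functions are left to the caller. *)
Ltac ctac :=
  repeat match goal with
  | |- forall _, _ => intro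
  | H : ?G |- ?G => exact H
  | |- continuous (fun _ => ?c) _ => apply continuous_const
  | |- continuous (fun x => x) _ => apply continuous_id
  | |- continuous (fun q => fst (fst (fst q))) _ => apply (continuous_comp (fun q => fst (fst q)) fst); [|apply continuous_fst]
  | |- continuous (fun q => fst (fst q)) _ => apply (continuous_comp fst fst); [apply continuous_fst|apply continuous_fst]
  | |- continuous (fun q => snd (fst q)) _ => apply (continuous_comp fst snd); [apply continuous_fst|apply continuous_snd]
  | |- continuous (fun q => fst (snd q)) _ => apply (continuous_comp snd fst); [apply continuous_snd|apply continuous_fst]
  | |- continuous (fun q => snd (snd q)) _ => apply (continuous_comp snd snd); [apply continuous_snd|apply continuous_snd]
  | |- continuous (fun q => fst q) _ => apply continuous_fst
  | |- continuous (fun q => snd q) _ => apply continuous_snd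
  | |- continuous fst _ => apply continuous_fst
  | |- continuous snd _ => apply continuous_snd
  | |- ccont (fun q => (_, _)) _ => apply ccont_pair
  | |- ccont (fun q => RtoC _) _ => apply ccont_RtoC
  | |- ccont (fun q => Cplus _ _) _ => apply ccont_plus
  | |- ccont (fun q => Cminus _ _) _ => apply ccont_minus
  | |- ccont (fun q => Copp _) _ => apply ccont_opp
  | |- ccont (fun q => Cmult _ _) _ => apply ccont_mult
  | |- ccont (fun q => Cdiv _ _) _ => apply ccont_div
  | |- ccont (fun q => Cinv _) _ => apply ccont_inv
  | |- ccont (fun q => Cpow _ _) _ => apply ccont_pow
  | |- ccont (fun q => Cexp _) _ => apply ccont_Cexp
  | |- ccont (fun q => Cconj _) _ => apply ccont_conj
  | |- continuous (fun q => Re _) _ => apply cont_Re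
  | |- continuous (fun q => Im _) _ => apply cont_Im
  | |- continuous (fun q => Cmod _) _ => apply cont_Cmod
  | |- continuous (fun q => Rplus _ _) _ => apply cont_Rplus
  | |- continuous (fun q => Rminus _ _) _ => apply cont_Rminus
  | |- continuous (fun q => Ropp _) _ => apply cont_Ropp
  | |- continuous (fun q => Rmult _ _) _ => apply cont_Rmult
  | |- continuous (fun q => Rdiv _ _) _ => apply cont_Rdiv
  | |- continuous (fun q => Rinv _) _ => apply cont_Rinv
  | |- continuous (fun q => pow _ _) _ => apply cont_Rpow
  | |- continuous (fun q => exp _) _ => apply cont_Rexp
  | |- continuous (fun q => cos _) _ => apply cont_Rcos
  | |- continuous (fun q => sin _) _ => apply cont_Rsin
  | |- continuous (fun q => sqrt _) _ => apply cont_Rsqrt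
  | |- continuous (fun q => Rabs _) _ => apply cont_Rabs
  | |- @continuous ?T ?U ?f ?p => lazymatch f with (fun _ => _) => fail | fst => fail | snd => fail
      | _ => change (@continuous T U (fun q => f q) p) end
  end.

(** Componentwise, so that derivatives of explicit curves come from real calculus. Complex
differentiability is only ever used along such curves, see [hol]. *)
Definition cder (z : R -> C) (a : R) (d : C) : Prop :=
  is_derive (fun v => Re (z v)) a (Re d) /\ is_derive (fun v => Im (z v)) a (Im d).

Lemma cder_ext (z w : R -> C) (a : R) d d' :
  (forall v, z v = w v) -> d = d' -> cder z a d -> cder w a d'.
Proof.
intros E <- [H1 H2]; split; [apply is_derive_ext with (2 := H1)|apply is_derive_ext with (2 := H2)];
 intros; now rewrite E.
Qed.

Lemma cder_ext_loc (z w : R -> C) (a : R) d :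
  locally a (fun v => z v = w v) -> cder z a d -> cder w a d.
Proof.
intros E [H1 H2]; split; [apply is_derive_ext_loc with (2 := H1)|apply is_derive_ext_loc with (2 := H2)];
 revert E; apply filter_imp; intros v E; now rewrite E.
Qed.

Lemma is_derive_cont (f : R -> R) x l : is_derive f x l -> continuous f x.
Proof. intros H; apply (ex_derive_continuous (K := R_AbsRing) (V := R_NormedModule) f x). now exists l. Qed.

Lemma cder_continuous (z : R -> C) a d : cder z a d -> ccont z a.
Proof.
intros [H1 H2]; apply ccont_iff; split; eapply is_derive_cont; eassumption.
Qed.

Lemma cder_const c a : cder (fun _ => c) a 0%C.
Proof. split; apply (is_derive_const (K := R_AbsRing) (V := R_NormedModule)). Qed.

Lemma cder_pair (f g : R -> R) a df dg :
  is_derive f a df -> is_derive g a dg -> cder (fun v => (f v, g v) : C) a (df, dg).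
Proof. intros; split; assumption. Qed.

Lemma cder_RtoC (f : R -> R) a df : is_derive f a df -> cder (fun v => RtoC (f v)) a (RtoC df).
Proof. intros; split; [assumption|exact (is_derive_const (K := R_AbsRing) (V := R_NormedModule) 0 a)]. Qed.

Lemma cder_plus (z w : R -> C) (a : R) dz dw :
  cder z a dz -> cder w a dw -> cder (fun v => (z v + w v)%C) a (dz + dw)%C.
Proof. intros [] []; split; apply (is_derive_plus (V := R_NormedModule)); assumption. Qed.

Lemma cder_opp (z : R -> C) a dz : cder z a dz -> cder (fun v => (- z v)%C) a (- dz)%C.
Proof. intros []; split; apply (is_derive_opp (V := R_NormedModule)); assumption. Qed.

Lemma is_derive_Rmult (f g : R -> R) a df dg :
  is_derive f a df -> is_derive g a dg ->
  is_derive (fun v => f v * g v) a (df * g a + f a * dg).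
Proof.
intros H1 H2. apply (is_derive_mult (K := R_AbsRing) f g a df dg H1 H2 Rmult_comm).
Qed.

Lemma is_derive_Rplus (f g : R -> R) a df dg :
  is_derive f a df -> is_derive g a dg -> is_derive (fun v => f v + g v) a (df + dg).
Proof. apply (is_derive_plus (K := R_AbsRing) (V := R_NormedModule)). Qed.

Lemma is_derive_Rminus (f g : R -> R) a df dg :
  is_derive f a df -> is_derive g a dg -> is_derive (fun v => f v - g v) a (df - dg).
Proof. apply (is_derive_minus (K := R_AbsRing) (V := R_NormedModule)). Qed.

Lemma is_derive_Ropp (f : R -> R) a df :
  is_derive f a df -> is_derive (fun v => - f v) a (- df).
Proof. apply (is_derive_opp (K := R_AbsRing) (V := R_NormedModule)). Qed.

Lemma is_derive_Rconst (c a : R) : is_derive (fun _ : R => c) a 0.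
Proof. apply (is_derive_const (K := R_AbsRing) (V := R_NormedModule)). Qed.

Lemma is_derive_eq (f : R -> R) (a l l' : R) : is_derive f a l -> l = l' -> is_derive f a l'.
Proof. now intros H <-. Qed.

Lemma cder_mult (z w : R -> C) (a : R) dz dw :
  cder z a dz -> cder w a dw -> cder (fun v => (z v * w v)%C) a (dz * w a + z a * dw)%C.
Proof.
intros [A1 A2] [B1 B2]; split.
- change (is_derive (fun v => Re (z v) * Re (w v) - Im (z v) * Im (w v)) a
    ((Re dz * Re (w a) - Im dz * Im (w a)) + (Re (z a) * Re dw - Im (z a) * Im dw))).
  eapply is_derive_eq; [apply is_derive_Rminus; apply is_derive_Rmult; eassumption|].
  cbv beta; ring.
- change (is_derive (fun v => Re (z v) * Im (w v) + Im (z v) * Re (w v)) a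
    ((Re dz * Im (w a) + Im dz * Re (w a)) + (Re (z a) * Im dw + Im (z a) * Re dw))).
  eapply is_derive_eq; [apply is_derive_Rplus; apply is_derive_Rmult; eassumption|].
  cbv beta; ring.
Qed.

Lemma cder_pow (z : R -> C) a dz n :
  cder z a dz -> cder (fun v => (z v ^ S n)%C) a (RtoC (INR (S n)) * z a ^ n * dz)%C.
Proof.
intros H; induction n as [|n IH].
- apply cder_ext with (3 := H); [intros; simpl; ring | simpl; ring].
- eapply cder_ext with (3 := cder_mult _ _ _ _ _ H IH); [reflexivity|].
  rewrite !S_INR, !RtoC_plus. simpl. ring.
Qed.

Lemma is_derive_Rexp (f : R -> R) a df :
  is_derive f a df -> is_derive (fun v => exp (f v)) a (exp (f a) * df).
Proof.
intros H; eapply is_derive_eq; [apply (is_derive_comp exp f _ _ _ (is_derive_exp _) H)|].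
unfold scal; simpl; unfold mult; simpl; ring.
Qed.

Lemma is_derive_Rcos (f : R -> R) a df :
  is_derive f a df -> is_derive (fun v => cos (f v)) a (- sin (f a) * df).
Proof.
intros H; eapply is_derive_eq; [apply (is_derive_comp cos f _ _ _ (is_derive_cos _) H)|].
unfold scal; simpl; unfold mult; simpl; ring.
Qed.

Lemma is_derive_Rsin (f : R -> R) a df :
  is_derive f a df -> is_derive (fun v => sin (f v)) a (cos (f a) * df).
Proof.
intros H; eapply is_derive_eq; [apply (is_derive_comp sin f _ _ _ (is_derive_sin _) H)|].
unfold scal; simpl; unfold mult; simpl; ring.
Qed.

Lemma cder_Cexp (z : R -> C) a dz : cder z a dz -> cder (fun v => Cexp (z v)) a (Cexp (z a) * dz)%C.
Proof.
intros [H1 H2].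
assert (E := is_derive_Rexp _ _ _ H1).
assert (Cc := is_derive_Rcos _ _ _ H2).
assert (Ss := is_derive_Rsin _ _ _ H2).
split.
- change (is_derive (fun v => exp (Re (z v)) * cos (Im (z v))) a
   (exp (Re (z a)) * cos (Im (z a)) * Re dz - exp (Re (z a)) * sin (Im (z a)) * Im dz)).
  eapply is_derive_eq; [apply is_derive_Rmult; eassumption|]. cbv beta; ring.
- change (is_derive (fun v => exp (Re (z v)) * sin (Im (z v))) a
   (exp (Re (z a)) * cos (Im (z a)) * Im dz + exp (Re (z a)) * sin (Im (z a)) * Re dz)).
  eapply is_derive_eq; [apply is_derive_Rmult; eassumption|]. cbv beta; ring.
Qed.

Lemma Cmod2_neq0 (z : C) : z <> 0%C -> fst z * fst z + snd z * snd z <> 0.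
Proof.
intros Hn E; apply Hn. apply Cmod_eq_0.
assert (H := Cmod2_alt z). unfold Re, Im in H. generalize (Cmod_ge_0 z); nra.
Qed.

Lemma cder_inv (z : R -> C) (a : R) (dz : C) : z a <> 0%C -> cder z a dz ->
  cder (fun v => (/ z v)%C) a (- dz / (z a * z a))%C.
Proof.
intros Hn [H1 H2].
assert (N := Cmod2_neq0 _ Hn).
assert (M := is_derive_Rplus _ _ _ _ _
   (is_derive_Rmult _ _ _ _ _ H1 H1) (is_derive_Rmult _ _ _ _ _ H2 H2)).
assert (I := is_derive_inv _ _ _ M N). cbv beta in I.
assert (A := is_derive_Rmult _ _ _ _ _ H1 I).
assert (B := is_derive_Rmult _ _ _ _ _ (is_derive_Ropp _ _ _ H2) I).
cbv beta in A, B.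
unfold Re, Im in *.
destruct dz as [d1 d2]; set (x := fst (z a)) in *; set (y := snd (z a)) in *.
split.
- apply is_derive_ext with (fun v => fst (z v) * / (fst (z v) * fst (z v) + snd (z v) * snd (z v))).
  { intros t; unfold Cinv, Re; cbn [fst snd]. unfold Rdiv. do 2 f_equal. simpl; ring. }
  eapply is_derive_eq; [exact A|].
  unfold Re, Cdiv, Cmult, Copp, Cinv; cbn [fst snd]. fold x y. field.
  split; [|exact N]. intros E. apply N. nra.
- apply is_derive_ext with (fun v => - snd (z v) * / (fst (z v) * fst (z v) + snd (z v) * snd (z v))).
  { intros t; unfold Cinv, Im; cbn [fst snd]. unfold Rdiv. do 2 f_equal. simpl; ring. }
  eapply is_derive_eq; [exact B|].
  unfold Im, Cdiv, Cmult, Copp, Cinv; cbn [fst snd]. fold x y. field.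
  split; [|exact N]. intros E. apply N. nra.
Qed.

(** * Integrals of complex-valued functions on compact intervals *)

Lemma is_CInt_pair (f : R -> C) a b (u v : R) :
  is_RInt (fun t => Re (f t)) a b u -> is_RInt (fun t => Im (f t)) a b v ->
  is_RInt (V := CV) f a b (u, v).
Proof. intros; apply (is_RInt_fct_extend_pair (U := R_NormedModule) (V := R_NormedModule) f); assumption. Qed.

Lemma is_CInt_fst (f : R -> C) a b (l : C) :
  is_RInt (V := CV) f a b l -> is_RInt (fun t => Re (f t)) a b (Re l).
Proof. intros; apply (is_RInt_fct_extend_fst (U := R_NormedModule) (V := R_NormedModule) f); assumption. Qed.
Lemma is_CInt_snd (f : R -> C) a b (l : C) :
  is_RInt (V := CV) f a b l -> is_RInt (fun t => Im (f t)) a b (Im l).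
Proof. intros; apply (is_RInt_fct_extend_snd (U := R_NormedModule) (V := R_NormedModule) f); assumption. Qed.

Definition ccont_on (f : R -> C) a b := forall z, Rmin a b <= z <= Rmax a b -> ccont f z.

Lemma is_CInt (f : R -> C) a b : ccont_on f a b -> is_RInt (V := CV) f a b (CInt f a b).
Proof. intros H; apply (RInt_correct (V := CV)), (ex_RInt_continuous (V := CV)); exact H. Qed.

Lemma CInt_unique (f : R -> C) a b l : is_RInt (V := CV) f a b l -> CInt f a b = l.
Proof. apply (is_RInt_unique (V := CV)). Qed.

Lemma CInt_components (f : R -> C) a b : ccont_on f a b ->
  CInt f a b = (RInt (fun t => Re (f t)) a b, RInt (fun t => Im (f t)) a b).
Proof.
intros H; apply CInt_unique, is_CInt_pair; apply (RInt_correct (V := R_CompleteNormedModule)),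
 (ex_RInt_continuous (V := R_CompleteNormedModule)); intros z Hz; [apply cont_Re|apply cont_Im]; auto.
Qed.

Lemma CInt_ext (f g : R -> C) a b :
  (forall x, Rmin a b < x < Rmax a b -> f x = g x) -> CInt f a b = CInt g a b.
Proof. apply (RInt_ext (V := CV)). Qed.

Lemma CInt_plus f g a b : ccont_on f a b -> ccont_on g a b ->
  CInt (fun t => (f t + g t)%C) a b = (CInt f a b + CInt g a b)%C.
Proof.
intros Hf Hg. apply CInt_unique. apply (is_RInt_plus (V := CV)); apply is_CInt; assumption.
Qed.

Lemma is_CInt_mult (c : C) f a b l : is_RInt (V := CV) f a b l ->
  is_RInt (V := CV) (fun t => (c * f t)%C) a b (c * l)%C.
Proof.
intros Hf. assert (H1 := is_CInt_fst _ _ _ _ Hf). assert (H2 := is_CInt_snd _ _ _ _ Hf).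
apply is_CInt_pair.
- apply (is_RInt_minus (V := R_NormedModule)); apply (is_RInt_scal (V := R_NormedModule)); assumption.
- apply (is_RInt_plus (V := R_NormedModule)); apply (is_RInt_scal (V := R_NormedModule)); assumption.
Qed.

Lemma CInt_mult c f a b : ccont_on f a b ->
  CInt (fun t => (c * f t)%C) a b = (c * CInt f a b)%C.
Proof. intros Hf; apply CInt_unique, is_CInt_mult, is_CInt; exact Hf. Qed.

Lemma CInt_minus f g a b : ccont_on f a b -> ccont_on g a b ->
  CInt (fun t => (f t - g t)%C) a b = (CInt f a b - CInt g a b)%C.
Proof.
intros Hf Hg. apply CInt_unique. apply (is_RInt_minus (V := CV)); apply is_CInt; assumption.
Qed.

Lemma CInt_Chasles f a b c : ccont_on f a b -> ccont_on f b c ->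
  CInt f a c = (CInt f a b + CInt f b c)%C.
Proof.
intros H1 H2; apply CInt_unique. apply (is_RInt_Chasles (V := CV) f a b c); apply is_CInt; assumption.
Qed.

Lemma CInt_le (f : R -> C) (g : R -> R) a b lg : a <= b -> ccont_on f a b ->
  (forall x, a <= x <= b -> Cmod (f x) <= g x) -> is_RInt g a b lg ->
  Cmod (CInt f a b) <= lg.
Proof.
intros Hab Hf Hg Hl. rewrite Cmod_norm.
apply (norm_RInt_le (V := CV) f g a b (CInt f a b) lg Hab); [|apply is_CInt; exact Hf|exact Hl].
intros x Hx. generalize (Hg x Hx). rewrite Cmod_norm. exact (fun h => h).
Qed.

Lemma CInt_le_const (f : R -> C) M a b : a <= b -> ccont_on f a b ->
  (forall x, a <= x <= b -> Cmod (f x) <= M) -> Cmod (CInt f a b) <= M * (b - a).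
Proof.
intros Hab Hf Hg. apply CInt_le with (fun _ => M); trivial.
replace (M * (b - a)) with (scal (b - a) M) by (unfold scal; simpl; unfold mult; simpl; ring).
apply (is_RInt_const (V := R_NormedModule)).
Qed.

(** The curves below are only continuous at the corner 0, so nothing is assumed about the derivative
of [F] at the endpoints: [F] minus the primitive of [f] is constant by the mean value theorem, which
needs the interior only. *)
Lemma real_FTC_open (F f : R -> R) a b : a <= b ->
  (forall x, a <= x <= b -> continuous F x) ->
  (forall x, a <= x <= b -> continuous f x) ->
  (forall x, a < x < b -> is_derive F x (f x)) ->
  is_RInt f a b (F b - F a).
Proof.
intros [Hab|<-] HF Hf HD.
2:{ replace (F a - F a) with (@zero R_NormedModule) by (unfold zero; simpl; ring). apply (is_RInt_point (V := R_NormedModule)). }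
assert (Hex : forall x, a <= x <= b -> ex_RInt f a x).
{ intros x Hx; apply (ex_RInt_continuous (V := R_CompleteNormedModule)).
  intros z; rewrite Rmin_left, Rmax_right by lra; intros; apply Hf; lra. }
(* clamping the argument extends f continuously, so that its primitive is differentiable up to the ends *)
pose (fe := fun x => f (Rmax a (Rmin b x))).
assert (Hfe : forall x, continuous fe x).
{ intros x. unfold fe. apply (continuous_comp (fun x => Rmax a (Rmin b x)) f).
  - unfold continuous.
    (* Rmin and Rmax written with absolute values, whose continuity is structural *)
    apply (filterlim_ext (fun x => / 2 * (a + (/2 * (b + x - Rabs (b - x))) + Rabs (a - (/2 * (b + x - Rabs (b - x))))))).
    { intros y. unfold Rmax, Rmin, Rabs. repeat destruct Rle_dec; repeat destruct Rcase_abs; lra. }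
    replace (Rmax a (Rmin b x)) with (/ 2 * (a + (/2 * (b + x - Rabs (b - x))) + Rabs (a - (/2 * (b + x - Rabs (b - x)))))).
    2:{ unfold Rmax, Rmin, Rabs. repeat destruct Rle_dec; repeat destruct Rcase_abs; lra. }
    change (continuous (fun x => / 2 * (a + (/2 * (b + x - Rabs (b - x))) + Rabs (a - (/2 * (b + x - Rabs (b - x)))))) x).
    ctac.
  - apply Hf. unfold Rmax, Rmin. repeat destruct Rle_dec; lra. }
assert (Efe : forall x, a <= x <= b -> fe x = f x).
{ intros x Hx; unfold fe; f_equal. unfold Rmax, Rmin; repeat destruct Rle_dec; lra. }
assert (Hexe : forall u v, ex_RInt fe u v) by (intros; apply (ex_RInt_continuous (V := R_CompleteNormedModule)); auto).
pose (G := fun x => F x - RInt fe a x).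
assert (HG : forall x, is_derive (fun x => RInt fe a x) x (fe x)).
{ intros x; apply (is_derive_RInt (V := R_NormedModule) fe _ a x); [|apply Hfe].
  exists (mkposreal 1 Rlt_0_1); intros y _. apply (RInt_correct (V := R_CompleteNormedModule)), Hexe. }
destruct (MVT_gen G a b (fun _ => 0)) as [c [_ Hc]].
- rewrite Rmin_left, Rmax_right by lra; intros x Hx.
  replace 0 with (f x - fe x) by (rewrite Efe; lra).
  apply (is_derive_minus (V := R_NormedModule)); [apply HD; lra|apply HG].
- rewrite Rmin_left, Rmax_right by lra; intros x Hx.
  apply continuity_pt_filterlim. change (continuous G x). apply cont_Rminus; [apply HF; lra|].
  eapply is_derive_cont; apply HG.
- replace (F b - F a) with (RInt fe a b).
  + apply (is_RInt_ext (V := R_NormedModule) fe).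
    { rewrite Rmin_left, Rmax_right by lra; intros; apply Efe; lra. }
    apply (RInt_correct (V := R_CompleteNormedModule)), Hexe.
  + unfold G in Hc. rewrite (RInt_point (V := R_CompleteNormedModule)) in Hc. unfold zero in Hc; simpl in Hc. lra.
Qed.

Lemma CInt_FTC (F f : R -> C) a b : a <= b ->
  (forall x, a <= x <= b -> ccont F x) ->
  (forall x, a <= x <= b -> ccont f x) ->
  (forall x, a < x < b -> cder F x (f x)) ->
  CInt f a b = (F b - F a)%C.
Proof.
intros Hab HF Hf HD. apply CInt_unique.
apply is_CInt_pair.
- apply (real_FTC_open (fun t => Re (F t)) (fun t => Re (f t)) a b Hab);
   [intros; apply cont_Re, HF|intros; apply cont_Re, Hf|intros; apply HD]; lra.
- apply (real_FTC_open (fun t => Im (F t)) (fun t => Im (f t)) a b Hab);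
   [intros; apply cont_Im, HF|intros; apply cont_Im, Hf|intros; apply HD]; lra.
Qed.

(** * Integrals depending on a parameter *)

(** Uniform continuity in the bounded variable: each [y] has a radius that works for its neighbours,
and compactness leaves finitely many radii. The radii are chosen as a function of [y] in order to
form the covering. *)
Lemma tube_uniform {T : UniformSpace} (h : T -> R -> C) (p : T) a b :
  (forall y, a <= y <= b -> ccont (fun q : T * R => h (fst q) (snd q)) (p, y)) ->
  forall e : posreal,
  locally p (fun p' => forall y, a <= y <= b -> Cmod (h p' y - h p y)%C < e).
Proof.
intros H e.
assert (He : 0 < e / 2) by (generalize (cond_pos e); lra).
assert (D : forall y, exists d : posreal, a <= y <= b ->
  forall p' y', ball p d p' -> Rabs (y' - y) < d -> Cmod (h p' y' - h p y)%C < e / 2).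
{ intros y. destruct (Rle_dec a y) as [h1|h1]; [destruct (Rle_dec y b) as [h2|h2]|];
    try (exists (mkposreal 1 Rlt_0_1); intros; lra).
  destruct (proj1 (ccont_eps _ _) (H y (conj h1 h2)) (mkposreal _ He)) as [d Hd].
  exists d; intros _ p' y' B1 B2. apply (Hd (p', y')). split; [exact B1|exact B2]. }
assert (D2 : forall y, {d : posreal | a <= y <= b ->
  forall p' y', ball p d p' -> Rabs (y' - y) < d -> Cmod (h p' y' - h p y)%C < e / 2}).
{ intros y. apply ClassicalEpsilon.constructive_indefinite_description, D. }
destruct (compactness_value_1d a b (fun y => proj1_sig (D2 y))) as [d Hd].
exists d; intros p' Hp y Hy.
destruct (Rlt_dec (Cmod (h p' y - h p y)%C) e) as [A|A]; [exact A|exfalso].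
apply (Hd y Hy); intros [t [Ht [H1 H2]]].
destruct (D2 t) as [dt Hdt]; simpl in *.
assert (A1 := Hdt Ht p' y (ball_le _ _ _ H2 _ Hp) H1).
assert (A2 := Hdt Ht p y (ball_center _ _) H1).
apply A. replace (h p' y - h p y)%C with ((h p' y - h p t) + - (h p y - h p t))%C by ring.
eapply Rle_lt_trans; [apply Cmod_triangle|]. rewrite Cmod_opp. lra.
Qed.

Lemma ccont_slice {T : UniformSpace} (h : T -> R -> C) p y :
  ccont (fun q : T * R => h (fst q) (snd q)) (p, y) -> ccont (h p) y.
Proof.
intros H. apply (continuous_comp_2 (fun _ : R => p) (fun y : R => y) h).
- apply continuous_const.
- apply continuous_id.
- exact H.
Qed.

Lemma CInt_param_cont {T : UniformSpace} (h : T -> R -> C) (p : T) a b : a <= b ->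
  (forall y, a <= y <= b -> ccont (fun q : T * R => h (fst q) (snd q)) (p, y)) ->
  locally p (fun p' => forall y, a <= y <= b -> ccont (h p') y) ->
  ccont (fun p' => CInt (h p') a b) p.
Proof.
intros Hab H HL. apply ccont_eps; intros e.
assert (He : 0 < e / (1 + (b - a))).
{ apply Rdiv_lt_0_compat; [apply cond_pos|lra]. }
generalize (filter_and _ _ HL (tube_uniform h p a b H (mkposreal _ He))).
apply filter_imp; intros p' [H1 H2].
assert (Hp : ccont_on (h p) a b).
{ intros y Hy; rewrite Rmin_left, Rmax_right in Hy by lra. apply ccont_slice, H, Hy. }
assert (Hp' : ccont_on (h p') a b).
{ intros y Hy; rewrite Rmin_left, Rmax_right in Hy by lra. apply H1, Hy. }
rewrite <- CInt_minus by assumption.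
eapply Rle_lt_trans; [apply (CInt_le_const _ (e / (1 + (b - a))))|].
- exact Hab.
- intros y Hy. apply ccont_minus; [apply Hp'|apply Hp]; exact Hy.
- intros y Hy. left. apply H2, Hy.
- apply Rmult_lt_reg_r with (1 + (b - a)); [lra|].
  replace (e / (1 + (b - a)) * (b - a) * (1 + (b - a))) with (e * (b - a)) by (field; lra).
  generalize (cond_pos e); nra.
Qed.

Lemma cder_eps (z : R -> C) (a : R) (d : C) :
  (forall e : posreal, locally a (fun v =>
     Cmod (z v - z a - RtoC (v - a) * d)%C <= e * Rabs (v - a))) -> cder z a d.
Proof.
intros H; split; (split; [apply (is_linear_scal_l (K := R_AbsRing) (V := R_NormedModule))|]); intros x Hx;
rewrite <- (is_filter_lim_locally_unique (V := R_NormedModule) _ _ Hx); clear x Hx; intros e;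
generalize (H e); apply filter_imp; intros v Hv; (eapply Rle_trans; [|exact Hv]).
- eapply Rle_trans; [|apply re_le_Cmod]. right.
  change (Rabs (Re (z v) - Re (z a) - (v - a) * Re d) = Rabs (Re (z v - z a - RtoC (v - a) * d)%C)).
  f_equal. unfold Re; simpl; ring.
- eapply Rle_trans; [|apply Rmax_Cmod]. eapply Rle_trans; [|apply Rmax_r]. right.
  change (Rabs (Im (z v) - Im (z a) - (v - a) * Im d) = Rabs (Im (z v - z a - RtoC (v - a) * d)%C)).
  f_equal. unfold Im; simpl; ring.
Qed.

Lemma Cmod_le_components (z : C) M : Rabs (Re z) <= M -> Rabs (Im z) <= M -> Cmod z <= 2 * M.
Proof.
intros H1 H2. assert (0 <= M) by (generalize (Rabs_pos (Re z)); lra).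
rewrite <- (sqrt_Rsqr (2 * M)) by lra. apply sqrt_le_1_alt. unfold Rsqr.
assert (Re z ^ 2 <= M ^ 2) by (rewrite <- (Rsqr_pow2 (Re z)), Rsqr_abs, Rsqr_pow2; apply pow_incr; split; [apply Rabs_pos|lra]).
assert (Im z ^ 2 <= M ^ 2) by (rewrite <- (Rsqr_pow2 (Im z)), Rsqr_abs, Rsqr_pow2; apply pow_incr; split; [apply Rabs_pos|lra]).
unfold Re, Im in *. nra.
Qed.

(** The form in which uniform closeness of a derivative to a constant bounds the remainder of a
difference quotient. *)
Lemma cder_mean_value (z dz : R -> C) (d : C) (x y M : R) :
  (forall t, Rabs (t - x) <= Rabs (y - x) -> cder z t (dz t) /\ Cmod (dz t - d)%C <= M) ->
  Cmod (z y - z x - RtoC (y - x) * d)%C <= 2 * (M * Rabs (y - x)).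
Proof.
intros H. apply Cmod_le_components.
- replace (Re (z y - z x - RtoC (y - x) * d)%C) with
    ((Re (z y) - y * Re d) - (Re (z x) - x * Re d)) by (unfold Re; simpl; ring).
  apply (bounded_variation (fun t => Re (z t) - t * Re d) (fun t => Re (dz t) - Re d)).
  intros t Ht. destruct (H t Ht) as [[H1 _] H2]. split.
  + eapply is_derive_eq; [apply is_derive_Rminus; [exact H1|]|].
    * apply (is_derive_Rmult (fun t => t) (fun _ => Re d)); [apply (is_derive_id (K := R_AbsRing))|apply is_derive_Rconst].
    * unfold one; simpl; ring.
  + eapply Rle_trans; [|exact H2]. eapply Rle_trans; [|apply re_le_Cmod]. right; f_equal.
- replace (Im (z y - z x - RtoC (y - x) * d)%C) with
    ((Im (z y) - y * Im d) - (Im (z x) - x * Im d)) by (unfold Im; simpl; ring).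
  apply (bounded_variation (fun t => Im (z t) - t * Im d) (fun t => Im (dz t) - Im d)).
  intros t Ht. destruct (H t Ht) as [[_ H1] H2]. split.
  + eapply is_derive_eq; [apply is_derive_Rminus; [exact H1|]|].
    * apply (is_derive_Rmult (fun t => t) (fun _ => Im d)); [apply (is_derive_id (K := R_AbsRing))|apply is_derive_Rconst].
    * unfold one; simpl; ring.
  + eapply Rle_trans; [|exact H2]. eapply Rle_trans; [|apply Rmax_Cmod].
    eapply Rle_trans; [|apply Rmax_r]. right; f_equal.
Qed.

(** The remainder of [h] over [a - a0] is small uniformly in [s] by [cder_mean_value], because [k]
is close to its value at [a0] uniformly in [s] by [tube_uniform]. *)
Lemma CInt_Leibniz (h k : R -> R -> C) (a0 b c : R) : b <= c ->
  locally a0 (fun a => forall s, b <= s <= c -> cder (fun v => h v s) a (k a s)) ->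
  (forall s, b <= s <= c -> ccont (fun q : R * R => k (fst q) (snd q)) (a0, s)) ->
  locally a0 (fun a => forall s, b <= s <= c -> ccont (h a) s) ->
  cder (fun a => CInt (h a) b c) a0 (CInt (k a0) b c).
Proof.
intros Hbc HD HK HL. apply cder_eps; intros e.
assert (He : 0 < e / (2 * (1 + (c - b)))).
{ apply Rdiv_lt_0_compat; [apply cond_pos|lra]. }
set (e' := mkposreal _ He).
destruct (filter_and _ _ HL (filter_and _ _ HD (tube_uniform k a0 b c HK e'))) as [d Hd].
exists d; intros a Ha.
assert (Hk : ccont_on (k a0) b c).
{ intros s Hs; rewrite Rmin_left, Rmax_right in Hs by lra. apply ccont_slice, HK, Hs. }
assert (Hc : forall a, ball a0 d a -> ccont_on (h a) b c).
{ intros v Hv s Hs; rewrite Rmin_left, Rmax_right in Hs by lra. apply (Hd v Hv), Hs. }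
assert (Hh := Hc a Ha). assert (Hh0 := Hc a0 (ball_center _ _)).
assert (Hm : ccont_on (fun s => (h a s - h a0 s)%C) b c).
{ intros s Hs; apply ccont_minus; [apply Hh|apply Hh0]; exact Hs. }
assert (Hm2 : ccont_on (fun s => (RtoC (a - a0) * k a0 s)%C) b c).
{ intros s Hs; apply ccont_mult; [apply ccont_const|apply Hk; exact Hs]. }
rewrite <- CInt_minus, <- CInt_mult, <- CInt_minus by assumption.
eapply Rle_trans; [apply (CInt_le_const _ (2 * (e' * Rabs (a - a0))))|].
- exact Hbc.
- intros s Hs; apply ccont_minus; [apply Hm|apply Hm2]; exact Hs.
- intros s Hs. apply (cder_mean_value (fun v => h v s) (fun v => k v s)).
  intros t Ht. assert (Bt : ball a0 d t).
  { change (Rabs (t - a0) < d). change (Rabs (a - a0) < d) in Ha. lra. }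
  destruct (Hd t Bt) as [_ [H1 H2]]. split; [apply H1, Hs|left; apply H2, Hs].
- unfold e'; simpl.
  assert (0 <= Rabs (a - a0)) by apply Rabs_pos.
  replace (2 * (e / (2 * (1 + (c - b))) * Rabs (a - a0)) * (c - b)) with
   ((e * Rabs (a - a0)) * ((c - b) / (1 + (c - b)))) by (field; lra).
  rewrite <- (Rmult_1_r (e * Rabs (a - a0))) at 2.
  apply Rmult_le_compat_l; [apply Rmult_le_pos; [left; apply cond_pos|assumption]|].
  apply Rmult_le_reg_r with (1 + (c - b)); [lra|]. unfold Rdiv. rewrite Rmult_assoc, Rinv_l; lra.
Qed.

Lemma cder_CInt (f : R -> C) (b a : R) : (forall x, ccont f x) ->
  cder (fun v => CInt f b v) a (f a).
Proof.
intros H. apply cder_eps; intros e.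
destruct (proj1 (ccont_eps f a) (H a) e) as [d Hd].
exists d; intros v Hv.
assert (Hf : forall u w, ccont_on f u w) by (intros u w z _; apply H).
rewrite (CInt_Chasles f b a v) by apply Hf.
assert (Hmin : forall u w, u <= w -> (forall z, u <= z <= w -> Cmod (f z - f a)%C <= e) ->
   Cmod (CInt f u w - RtoC (w - u) * f a)%C <= e * (w - u)).
{ intros u w Huw Hz.
  replace (CInt f u w - RtoC (w - u) * f a)%C with (CInt (fun z => (f z - f a)%C) u w).
  - apply CInt_le_const; [exact Huw| |exact Hz]. intros z _; apply ccont_minus; [apply H|apply ccont_const].
  - rewrite CInt_minus; [|apply Hf|intros z _; apply ccont_const]. f_equal. f_equal.
    apply CInt_unique. apply (is_RInt_ext (V := CV) (fun _ => f a)); [reflexivity|].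
    replace (RtoC (w - u) * f a)%C with (scal (V := CV) (w - u) (f a)).
    + apply (is_RInt_const (V := CV)).
    + apply injective_projections; unfold scal; simpl; unfold prod_scal, scal; simpl; unfold mult; simpl; ring. }
change (Rabs (v - a) < d) in Hv.
destruct (Rle_dec a v) as [L|L].
- replace (CInt f b a + CInt f a v - CInt f b a - RtoC (v - a) * f a)%C with
    (CInt f a v - RtoC (v - a) * f a)%C by ring.
  rewrite (Rabs_pos_eq (v - a)) in * by lra.
  apply Hmin; [exact L|]. intros z Hz. left. apply Hd. change (Rabs (z - a) < d).
  rewrite Rabs_pos_eq by lra. lra.
- assert (E : CInt f a v = (- CInt f v a)%C).
  { apply CInt_unique. apply (is_RInt_swap (V := CV)). apply is_CInt, Hf. }
  rewrite E.
  replace (CInt f b a + - CInt f v a - CInt f b a - RtoC (v - a) * f a)%C with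
    (- (CInt f v a - RtoC (a - v) * f a))%C by (rewrite !RtoC_minus; ring).
  rewrite Cmod_opp. rewrite <- (Rabs_Ropp (v - a)) in *. replace (- (v - a)) with (a - v) in * by ring.
  rewrite (Rabs_pos_eq (a - v)) in * by lra.
  apply Hmin; [lra|]. intros z Hz. left. apply Hd. change (Rabs (z - a) < d).
  rewrite <- Rabs_Ropp, Rabs_pos_eq by lra. lra.
Qed.

(** Joint continuity, the only regularity that integrands in two real variables need below. *)
Definition jcont (G : R -> R -> C) := forall p : R * R, ccont (fun q : R * R => G (fst q) (snd q)) p.

Lemma jcont_swap G : jcont G -> jcont (fun y a => G a y).
Proof.
intros H p. apply (continuous_comp_2 (fun q : R * R => snd q) (fun q : R * R => fst q) G).
- apply continuous_snd.
- apply continuous_fst.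
- apply (H (snd p, fst p)).
Qed.

Lemma jcont_l G a y : jcont G -> ccont (fun y => G a y) y.
Proof. intros H; apply (ccont_slice G a y), H. Qed.
Lemma jcont_r G a y : jcont G -> ccont (fun a => G a y) a.
Proof. intros H; apply (jcont_l (fun y a => G a y)), jcont_swap, H. Qed.

Lemma CInt_jcont G b c a : b <= c -> jcont G -> ccont (fun a => CInt (G a) b c) a.
Proof.
intros Hbc H; apply CInt_param_cont; [exact Hbc|intros; apply H|].
apply filter_forall; intros; apply jcont_l, H.
Qed.

(** Both iterated integrals have the same derivative with respect to the upper bound [N]. *)
Lemma CInt_Fubini (G : R -> R -> C) N M : 0 <= N -> 0 <= M -> jcont G ->
  CInt (fun a => CInt (fun y => G a y) 0 M) 0 N = CInt (fun y => CInt (fun a => G a y) 0 N) 0 M.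
Proof.
intros HN HM H.
pose (h := fun N y => CInt (fun a => G a y) 0 N).
assert (HL : forall n, 0 <= n -> forall y, ccont (h n) y).
{ intros n Hn y. apply (CInt_jcont (fun y a => G a y)); [exact Hn|apply jcont_swap, H]. }
assert (HL' : forall n y, ccont (h n) y).
{ intros n y; destruct (Rle_dec 0 n) as [L|L]; [apply HL, L|].
  apply continuous_ext with (fun y => (- CInt (fun a => G a y) n 0)%C).
  - intros z; unfold h. symmetry; apply CInt_unique. apply (is_RInt_swap (V := CV)).
    apply is_CInt; intros a _; apply jcont_r, H.
  - apply ccont_opp. apply (CInt_jcont (fun y a => G a y)); [lra|apply jcont_swap, H]. }
assert (D : forall n, cder (fun n => CInt (h n) 0 M) n (CInt (G n) 0 M)).
{ intros n. apply (CInt_Leibniz h G); [exact HM| | |].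
  - apply filter_forall; intros a s _. unfold h. apply (cder_CInt (fun a => G a s)).
    intros x; apply jcont_r, H.
  - intros s _; apply H.
  - apply filter_forall; intros a s _; apply HL'. }
transitivity (CInt (h N) 0 M - CInt (h 0) 0 M)%C.
- apply (CInt_FTC (fun n => CInt (h n) 0 M) (fun n => CInt (G n) 0 M)); [exact HN| | |].
  + intros x _; eapply cder_continuous, D.
  + intros x _; apply CInt_jcont; assumption.
  + intros x _; apply D.
- assert (E : CInt (h 0) 0 M = 0%C).
  { apply Cmod_eq_0. apply Rle_antisym; [|apply Cmod_ge_0].
    replace 0 with (0 * (M - 0)) at 3 by ring. apply CInt_le_const; [exact HM|intros z _; apply HL'|].
    intros y _. unfold h. rewrite (CInt_unique _ _ _ (RtoC 0)); [rewrite Cmod_0; lra|].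
    apply (is_RInt_point (V := CV)). }
  rewrite E. unfold h. ring.
Qed.

(** * Absolutely convergent integrals on the half-line *)

Lemma Cmod_le0 (z : C) : Cmod z <= 0 -> z = RtoC 0.
Proof. intros H; apply Cmod_eq_0, Rle_antisym; [exact H|apply Cmod_ge_0]. Qed.

Notation is_half f l := (is_RInt_gen (V := CV) f (at_point 0) (Rbar_locally p_infty) l).

Lemma is_half_unique (f : R -> C) l : is_half f l -> CInt_half f = l.
Proof. apply (is_RInt_gen_unique (V := CV)). Qed.

Lemma half_prod (P : R * R -> Prop) : (forall b, 0 < b -> P (0, b)) ->
  filter_prod (at_point 0) (Rbar_locally p_infty) P.
Proof.
intros H. exists (fun a => a = 0) (fun b => 0 < b); [reflexivity|exists 0; trivial|].
intros a b -> Hb; apply H, Hb.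
Qed.

Lemma is_half_ext (f g : R -> C) l : (forall a, 0 < a -> f a = g a) -> is_half f l -> is_half g l.
Proof.
intros E H. apply (is_RInt_gen_ext (V := CV)) with (2 := H).
apply half_prod; intros b Hb x; cbn [fst snd]; rewrite Rmin_left, Rmax_right by lra.
intros Hx; apply E; lra.
Qed.

Lemma is_half_plus (f g : R -> C) l m : is_half f l -> is_half g m ->
  is_half (fun a => (f a + g a)%C) (l + m)%C.
Proof. apply (is_RInt_gen_plus (V := CV)). Qed.

Lemma is_half_minus (f g : R -> C) l m : is_half f l -> is_half g m ->
  is_half (fun a => (f a - g a)%C) (l - m)%C.
Proof. apply (is_RInt_gen_minus (V := CV)). Qed.

Lemma is_half_mult (c : C) (f : R -> C) l : is_half f l -> is_half (fun a => (c * f a)%C) (c * l)%C.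
Proof.
intros H P HP.
assert (H' := ccont_mult (T := C_UniformSpace) (fun _ => c) (fun z => z) l (ccont_const _ _) (continuous_id _)).
destruct (H (fun z => P (c * z)%C) (H' P HP)) as [Q R0 HQ HR HH].
exists Q R0; [exact HQ|exact HR|].
intros a b Ha Hb. destruct (HH a b Ha Hb) as [y [Hy1 Hy2]].
exists (c * y)%C; split; [apply is_CInt_mult, Hy1|exact Hy2].
Qed.

(** The inverse square dominates every integrand below, and its tail integral over [N, +oo) is
explicitly 1 / (1 + N), so that convergence, continuity in parameters and exchanges of integrals all
reduce to estimates on compact intervals. Continuity is asked on the whole line; integrands on the
half-line are extended through the absolute value. *)
Definition dom (h : R -> C) (M : R) : Prop :=
  (forall a, ccont h a) /\ (forall a, 0 <= a -> Cmod (h a) <= M * / (1 + a) ^ 2).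

Lemma is_RInt_weight M N N' : 0 <= N -> N <= N' ->
  is_RInt (fun a => M * / (1 + a) ^ 2) N N' (M * (/ (1 + N) - / (1 + N'))).
Proof.
intros H0 H1.
replace (M * (/ (1 + N) - / (1 + N'))) with ((- (M * / (1 + N'))) - (- (M * / (1 + N)))) by ring.
apply (real_FTC_open (fun a => - (M * / (1 + a)))); [exact H1| | |].
- intros; ctac. lra.
- intros; ctac. apply pow_nonzero; lra.
- intros x Hx. auto_derive; [lra|]. field; lra.
Qed.

Lemma dom_cont h M a b : dom h M -> ccont_on h a b.
Proof. intros [H _] z _; apply H. Qed.

Lemma dom_pos h M : dom h M -> 0 <= M.
Proof.
intros [_ H]. specialize (H 0 (Rle_refl 0)). generalize (Cmod_ge_0 (h 0)).
replace ((1 + 0) ^ 2) with 1 in H by ring. lra.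
Qed.

Lemma dom_tail h M N N' : dom h M -> 0 <= N -> N <= N' ->
  Cmod (CInt h N N') <= M * / (1 + N).
Proof.
intros Hd H0 H1. apply Rle_trans with (M * (/ (1 + N) - / (1 + N'))).
- apply CInt_le with (fun a => M * / (1 + a) ^ 2); [exact H1|apply dom_cont with M, Hd| |apply is_RInt_weight; assumption].
  intros x Hx; apply Hd; lra.
- apply Rmult_le_compat_l; [apply dom_pos with h, Hd|].
  assert (0 < / (1 + N')) by (apply Rinv_0_lt_compat; lra). lra.
Qed.

Lemma inv_tail_small M e : 0 <= M -> 0 < e -> exists N0, 0 <= N0 /\ forall N, N0 <= N -> M * / (1 + N) < e.
Proof.
intros HM He. exists (M / e).
assert (0 <= M / e) by (apply Rdiv_le_0_compat; lra).
split; [assumption|]. intros N HN.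
apply Rmult_lt_reg_r with (1 + N); [lra|]. rewrite Rmult_assoc, Rinv_l by lra.
assert (M = e * (M / e)) by (field; lra). nra.
Qed.

Lemma dom_ex h M : dom h M -> exists l, is_half h l.
Proof.
intros Hd.
assert (HC : exists y : CV, filterlim (fun N => CInt h 0 N) (Rbar_locally p_infty) (locally y)).
{ apply (filterlim_locally_cauchy (U := CV)). intros e.
  destruct (inv_tail_small M e (dom_pos _ _ Hd) (cond_pos e)) as [N0 [HN0 HN]].
  exists (fun N => N0 < N); split; [exists N0; trivial|].
  assert (A : forall u v, N0 < u -> u <= v -> Cmod (CInt h 0 v - CInt h 0 u)%C < e).
  { intros u v Hu Huv. rewrite (CInt_Chasles h 0 u v) by (apply dom_cont with M, Hd).
    replace (CInt h 0 u + CInt h u v - CInt h 0 u)%C with (CInt h u v) by ring.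
    eapply Rle_lt_trans; [apply dom_tail; [exact Hd|lra|exact Huv]|]. apply HN; lra. }
  intros u v Hu Hv. destruct (Rle_dec u v) as [L|L].
  - apply (C_NormedModule_mixin_compat1 (CInt h 0 u) (CInt h 0 v) e). apply A; assumption.
  - apply ball_sym. apply (C_NormedModule_mixin_compat1 (CInt h 0 v) (CInt h 0 u) e). apply A; lra. }
destruct HC as [l Hl]. exists l.
intros P HP. 
destruct (Hl P HP) as [N0 HN0].
exists (fun a => a = 0) (fun b => N0 < b); [reflexivity|exists N0; trivial|].
intros a b -> Hb. exists (CInt h 0 b); split; [apply is_CInt, dom_cont with M, Hd|apply HN0, Hb].
Qed.

Lemma dom_is h M : dom h M -> is_half h (CInt_half h).
Proof. intros Hd; destruct (dom_ex h M Hd) as [l Hl]. now rewrite (is_half_unique _ _ Hl). Qed.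

Lemma is_half_approx (h : R -> C) l : (forall a, ccont h a) -> is_half h l ->
  forall e, 0 < e -> exists N0, forall N, N0 <= N -> Cmod (l - CInt h 0 N)%C < e.
Proof.
intros Hc H e He.
destruct (proj1 (ccont_eps (T := C_UniformSpace) (fun z => z) l) (continuous_id _) (mkposreal e He)) as [d Hd].
destruct (H (ball (M := CV) l d) (locally_ball _ _)) as [Q R0 HQ [N0 HN0] HH].
exists (N0 + 1); intros N HN.
destruct (HH 0 N HQ (HN0 N ltac:(lra))) as [y [Hy1 Hy2]]. cbn [fst snd] in Hy1.
rewrite <- (CInt_unique _ _ _ _ Hy1) in Hy2.
replace (l - CInt h 0 N)%C with (- (CInt h 0 N - l))%C by ring. rewrite Cmod_opp.
apply (Hd (CInt h 0 N) Hy2).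
Qed.

Lemma dom_rem h M N : dom h M -> 0 <= N -> Cmod (CInt_half h - CInt h 0 N)%C <= M * / (1 + N).
Proof.
intros Hd HN. apply le_epsilon; intros e He.
destruct (is_half_approx h _ (proj1 Hd) (dom_is _ _ Hd) e He) as [N0 H0].
set (N' := Rmax N N0).
assert (A := H0 N' (Rmax_r _ _)).
assert (B := dom_tail h M N N' Hd HN (Rmax_l _ _)).
rewrite (CInt_Chasles h 0 N N') in A by (apply dom_cont with M, Hd).
replace (CInt_half h - CInt h 0 N)%C with
  ((CInt_half h - (CInt h 0 N + CInt h N N')) + CInt h N N')%C by ring.
eapply Rle_trans; [apply Cmod_triangle|]. lra.
Qed.

Lemma half_le h M : dom h M -> Cmod (CInt_half h) <= M.
Proof.
intros Hd. assert (A := dom_rem h M 0 Hd (Rle_refl 0)).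
rewrite (CInt_unique h 0 0 (RtoC 0)) in A by apply (is_RInt_point (V := CV)).
replace (CInt_half h - RtoC 0)%C with (CInt_half h) in A by ring.
replace (M * / (1 + 0)) with M in A by field. exact A.
Qed.

Lemma half_limit h M v : dom h M ->
  (forall e, 0 < e -> exists N0, forall N, N0 <= N -> Cmod (v - CInt h 0 N)%C <= e) ->
  CInt_half h = v.
Proof.
intros Hd H.
assert (A : Cmod (CInt_half h - v)%C <= 0).
{ apply le_epsilon; intros e He. assert (He2 : 0 < e / 2) by lra.
  destruct (H _ He2) as [N0 H0].
  destruct (inv_tail_small M _ (dom_pos _ _ Hd) He2) as [N1 [P1 H1]].
  set (N := Rmax N0 N1).
  assert (A0 := H0 N (Rmax_l _ _)). assert (A1 := H1 N (Rmax_r _ _)).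
  assert (PN : 0 <= N) by (unfold N; generalize (Rmax_r N0 N1); lra).
  assert (A2 := dom_rem h M N Hd PN).
  replace (CInt_half h - v)%C with ((CInt_half h - CInt h 0 N) + - (v - CInt h 0 N))%C by ring.
  eapply Rle_trans; [apply Cmod_triangle|]. rewrite Cmod_opp. lra. }
apply Cmod_le0 in A. replace (CInt_half h) with ((CInt_half h - v) + v)%C by ring. rewrite A. ring.
Qed.

Lemma half_limit_rate h M v K : dom h M -> 0 <= K ->
  (forall N, 0 <= N -> Cmod (v - CInt h 0 N)%C <= K * / (1 + N)) -> CInt_half h = v.
Proof.
intros Hd HK H. apply half_limit with M; [exact Hd|]. intros e He.
destruct (inv_tail_small K e HK He) as [N0 [P0 H0]]. exists N0; intros N HN.
left; eapply Rle_lt_trans; [apply H; lra|apply H0, HN].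
Qed.

Lemma half_ext (f g : R -> C) M : dom f M -> (forall a, 0 < a -> f a = g a) -> CInt_half g = CInt_half f.
Proof. intros Hd E. apply is_half_unique, is_half_ext with f; [exact E|apply dom_is with M, Hd]. Qed.

Lemma half_plus f g M M' : dom f M -> dom g M' ->
  CInt_half (fun a => (f a + g a)%C) = (CInt_half f + CInt_half g)%C.
Proof. intros; apply is_half_unique, is_half_plus; eapply dom_is; eassumption. Qed.
Lemma half_minus f g M M' : dom f M -> dom g M' ->
  CInt_half (fun a => (f a - g a)%C) = (CInt_half f - CInt_half g)%C.
Proof. intros; apply is_half_unique, is_half_minus; eapply dom_is; eassumption. Qed.
Lemma half_mult c f M : dom f M -> CInt_half (fun a => (c * f a)%C) = (c * CInt_half f)%C.
Proof. intros; apply is_half_unique, is_half_mult; eapply dom_is; eassumption. Qed.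

Lemma weight_pos a : 0 <= a -> 0 < / (1 + a) ^ 2.
Proof. intros; apply Rinv_0_lt_compat, pow_lt; lra. Qed.

Lemma dom_plus f g M M' : dom f M -> dom g M' -> dom (fun a => (f a + g a)%C) (M + M').
Proof.
intros [H1 H2] [H3 H4]; split; [intros; apply ccont_plus; auto|].
intros a Ha; eapply Rle_trans; [apply Cmod_triangle|]. specialize (H2 a Ha); specialize (H4 a Ha). lra.
Qed.

Lemma dom_opp f M : dom f M -> dom (fun a => (- f a)%C) M.
Proof.
intros [H1 H2]; split; [intros; apply ccont_opp; auto|].
intros a Ha; rewrite Cmod_opp; auto.
Qed.

Lemma dom_minus f g M M' : dom f M -> dom g M' -> dom (fun a => (f a - g a)%C) (M + M').
Proof. intros; apply dom_plus; [|apply dom_opp]; assumption. Qed.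

Lemma dom_mult c f M : dom f M -> dom (fun a => (c * f a)%C) (Cmod c * M).
Proof.
intros [H1 H2]; split; [intros; apply ccont_mult; [apply ccont_const|auto]|].
intros a Ha; rewrite Cmod_mult, Rmult_assoc. apply Rmult_le_compat_l; [apply Cmod_ge_0|auto].
Qed.

Lemma dom_conj f M : dom f M -> dom (fun a => Cconj (f a)) M.
Proof.
intros [H1 H2]; split; [intros; apply ccont_conj; auto|].
intros a Ha; rewrite Cmod_conj; auto.
Qed.

(** The two ends of the line tend to infinity independently, so both halves must converge
separately; they do, and the negative half is reflected. *)
Lemma line_fold (F : R -> C) l m : is_half F l -> is_half (fun a => F (- a)) m ->
  CInt_line F = (l + m)%C.
Proof.
intros H1 H2.
cut (is_RInt_gen (V := CV) F (Rbar_locally m_infty) (Rbar_locally p_infty) (l + m)%C).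
{ intros H. exact (is_RInt_gen_unique (V := CV) F _ H). }
replace (l + m)%C with (plus (m : CV) l) by (unfold plus; simpl; apply (Cplus_comm m l)).
apply (is_RInt_gen_Chasles (V := CV)) with 0; [|exact H1].
intros P HP.
destruct (H2 P HP) as [Q R0 HQ [N0 HN0] HH].
exists (fun a => a < - N0) (fun b => b = 0); [exists (- N0); trivial|reflexivity|].
intros a b Ha ->. destruct (HH 0 (- a) HQ (HN0 (- a) ltac:(lra))) as [y [Hy1 Hy2]].
exists y; split; [|exact Hy2]. cbn [fst snd] in *.
apply (is_RInt_swap (V := CV)) in Hy1.
replace y with (opp (opp y : CV)) by apply opp_opp.
apply (is_RInt_ext (V := CV) (fun x => opp (opp (F (- - x) : CV)))).
{ intros x _. rewrite opp_opp. f_equal; ring. }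
apply (is_RInt_opp (V := CV)).
apply (is_RInt_comp_opp (V := CV) (fun x => F (- x))).
rewrite Ropp_0. exact Hy1.
Qed.

(** ** Half-line integrals with a parameter, and exchange of integrals *)

(** A uniform tail bound reduces the question to a compact interval. *)
Lemma half_param_cont {T : UniformSpace} (h : T -> R -> C) (M : R) (p : T) :
  (forall q, ccont (fun q : T * R => h (fst q) (snd q)) q) ->
  locally p (fun p' => forall y, 0 <= y -> Cmod (h p' y) <= M * / (1 + y) ^ 2) ->
  ccont (fun p' => CInt_half (h p')) p.
Proof.
intros Hc Hb.
assert (Hd : locally p (fun p' => dom (h p') M)).
{ revert Hb; apply filter_imp; intros p' H; split; [intros a; apply ccont_slice, Hc|exact H]. }
assert (Hd0 := locally_singleton _ _ Hd).
apply ccont_eps; intros e. assert (He : 0 < e / 4) by (generalize (cond_pos e); lra).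
destruct (inv_tail_small M _ (dom_pos _ _ Hd0) He) as [N [HN H0]].
specialize (H0 N (Rle_refl N)).
assert (Hp : ccont (fun p' => CInt (h p') 0 N) p).
{ apply CInt_param_cont; [exact HN|intros; apply Hc|].
  apply filter_forall; intros q y _; apply ccont_slice, Hc. }
generalize (filter_and _ _ Hd (proj1 (ccont_eps _ _) Hp (mkposreal _ He))).
apply filter_imp; intros q [H1 H2]; cbn [pos] in H2.
assert (A := dom_rem _ _ N H1 HN). assert (B := dom_rem _ _ N Hd0 HN).
replace (CInt_half (h q) - CInt_half (h p))%C with
 ((CInt_half (h q) - CInt (h q) 0 N) + ((CInt (h q) 0 N - CInt (h p) 0 N)
   + - (CInt_half (h p) - CInt (h p) 0 N)))%C by ring.
eapply Rle_lt_trans; [apply Cmod_triangle|].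
assert (C1 := Cmod_triangle (CInt (h q) 0 N - CInt (h p) 0 N) (- (CInt_half (h p) - CInt (h p) 0 N))).
rewrite Cmod_opp in C1. lra.
Qed.

Lemma half_swap_dom (G : R -> R -> C) M : jcont G ->
  (forall a y, 0 <= a -> 0 <= y -> Cmod (G a y) <= M * / (1 + a) ^ 2 * / (1 + y) ^ 2) ->
  forall a, 0 <= a -> dom (G a) (M * / (1 + a) ^ 2).
Proof. intros Hc Hb a Ha; split; [intros; apply jcont_l, Hc|intros; apply Hb; assumption]. Qed.

Lemma pos_ext_cont (G : R -> R -> C) M : jcont G ->
  (forall a y, 0 <= a -> 0 <= y -> Cmod (G a y) <= M * / (1 + a) ^ 2 * / (1 + y) ^ 2) ->
  forall a, ccont (fun a => CInt_half (G (Rabs a))) a.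
Proof.
intros Hc Hb a.
assert (HM : 0 <= M).
{ specialize (Hb 0 0 (Rle_refl 0) (Rle_refl 0)). generalize (Cmod_ge_0 (G 0 0)).
  replace ((1 + 0) ^ 2) with 1 in Hb by ring. lra. }
apply (half_param_cont (fun a => G (Rabs a)) M).
- intros q. apply (continuous_comp_2 (fun q : R * R => Rabs (fst q)) (fun q : R * R => snd q) G).
  + ctac.
  + ctac.
  + apply (Hc (Rabs (fst q), snd q)).
- apply filter_forall; intros a' y Hy. eapply Rle_trans; [apply Hb; [apply Rabs_pos|exact Hy]|].
  apply Rmult_le_compat_r; [left; apply weight_pos, Hy|].
  rewrite <- (Rmult_1_r M) at 2. apply Rmult_le_compat_l; [exact HM|].
  assert (0 <= Rabs a') by apply Rabs_pos.
  rewrite <- Rinv_1. apply Rinv_le_contravar; [lra|]. nra.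
Qed.

Lemma half_swap_dom_outer (G : R -> R -> C) M : jcont G ->
  (forall a y, 0 <= a -> 0 <= y -> Cmod (G a y) <= M * / (1 + a) ^ 2 * / (1 + y) ^ 2) ->
  dom (fun a => CInt_half (G (Rabs a))) M.
Proof.
intros Hc Hb; split; [apply pos_ext_cont with M; assumption|].
intros a Ha. rewrite Rabs_pos_eq by exact Ha. apply half_le, half_swap_dom; assumption.
Qed.

(** The part of the quadrant outside the square [0, N]^2 consists of two strips, each of mass at
most M / (1 + N). *)
Lemma half_swap_approx (G : R -> R -> C) M : jcont G ->
  (forall a y, 0 <= a -> 0 <= y -> Cmod (G a y) <= M * / (1 + a) ^ 2 * / (1 + y) ^ 2) ->
  forall N, 0 <= N ->
  Cmod (CInt_half (fun a => CInt_half (G (Rabs a))) - CInt (fun a => CInt (G a) 0 N) 0 N)%C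
  <= (2 * M) * / (1 + N).
Proof.
intros Hc Hb N HN.
assert (Hd := half_swap_dom_outer G M Hc Hb).
assert (HM := dom_pos _ _ Hd).
assert (A := dom_rem _ _ N Hd HN).
assert (Pos : 0 < / (1 + N)) by (apply Rinv_0_lt_compat; lra).
assert (B : Cmod (CInt (fun a => CInt_half (G (Rabs a))) 0 N - CInt (fun a => CInt (G a) 0 N) 0 N)%C
   <= M * / (1 + N)).
{ rewrite <- CInt_minus; [|apply dom_cont with M, Hd|intros a _; apply CInt_jcont; assumption].
  apply Rle_trans with ((M * / (1 + N)) * (/ (1 + 0) - / (1 + N))).
  - apply CInt_le with (fun a => (M * / (1 + N)) * / (1 + a) ^ 2); [exact HN| | |apply is_RInt_weight; lra].
    + intros a _; apply ccont_minus; [apply Hd|apply CInt_jcont; assumption].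
    + intros a Ha. rewrite Rabs_pos_eq by apply Ha.
      eapply Rle_trans; [apply dom_rem with (2 := HN); apply half_swap_dom with (M := M); [assumption|assumption|apply Ha]|].
      right; ring.
  - rewrite <- (Rmult_1_r (M * / (1 + N))) at 2. apply Rmult_le_compat_l; [nra|].
    rewrite Rplus_0_r, Rinv_1. lra. }
replace (CInt_half (fun a => CInt_half (G (Rabs a))) - CInt (fun a => CInt (G a) 0 N) 0 N)%C with
 ((CInt_half (fun a => CInt_half (G (Rabs a))) - CInt (fun a => CInt_half (G (Rabs a))) 0 N)
  + (CInt (fun a => CInt_half (G (Rabs a))) 0 N - CInt (fun a => CInt (G a) 0 N) 0 N))%C by ring.
eapply Rle_trans; [apply Cmod_triangle|]. lra.
Qed.

(** Both iterated integrals are within O(1 / N) of the integral over the square [0, N]^2, where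
[CInt_Fubini] applies. The absolute values make the outer integrands continuous at negative
arguments. *)
Lemma half_swap (G : R -> R -> C) M : jcont G ->
  (forall a y, 0 <= a -> 0 <= y -> Cmod (G a y) <= M * / (1 + a) ^ 2 * / (1 + y) ^ 2) ->
  CInt_half (fun a => CInt_half (G (Rabs a))) =
  CInt_half (fun y => CInt_half (fun a => G a (Rabs y))).
Proof.
intros Hc Hb.
assert (Hc' := jcont_swap G Hc).
assert (Hb' : forall y a, 0 <= y -> 0 <= a -> Cmod (G a y) <= M * / (1 + y) ^ 2 * / (1 + a) ^ 2).
{ intros y a Hy Ha; eapply Rle_trans; [apply Hb; assumption|]. right; ring. }
assert (HM := dom_pos _ _ (half_swap_dom_outer G M Hc Hb)).
set (v := CInt_half (fun y => CInt_half (fun a => G a (Rabs y)))).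
assert (A : Cmod (CInt_half (fun a => CInt_half (G (Rabs a))) - v)%C <= 0).
{ apply le_epsilon; intros e He.
  destruct (inv_tail_small (4 * M) e ltac:(lra) He) as [N [HN H0]].
  specialize (H0 N (Rle_refl N)).
  assert (A := half_swap_approx G M Hc Hb N HN).
  assert (B := half_swap_approx (fun y a => G a y) M Hc' Hb' N HN).
  change (CInt_half (fun a => CInt_half ((fun y a => G a y) (Rabs a)))) with v in B.
  change (CInt (fun y => CInt ((fun y a => G a y) y) 0 N) 0 N) with
    (CInt (fun y => CInt (fun a => G a y) 0 N) 0 N) in B.
  rewrite <- (CInt_Fubini G N N HN HN Hc) in B.
  set (I := CInt (fun a => CInt (fun y => G a y) 0 N) 0 N) in *.
  change (CInt (fun a => CInt (G a) 0 N) 0 N) with I in A.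
  replace (CInt_half (fun a => CInt_half (G (Rabs a))) - v)%C with
    ((CInt_half (fun a => CInt_half (G (Rabs a))) - I) + - (v - I))%C by ring.
  eapply Rle_trans; [apply Cmod_triangle|]. rewrite Cmod_opp. lra. }
apply Cmod_le0 in A.
replace (CInt_half (fun a => CInt_half (G (Rabs a)))) with
  ((CInt_half (fun a => CInt_half (G (Rabs a))) - v) + v)%C by ring.
rewrite A. ring.
Qed.

Lemma half_CInt_dom (G : R -> R -> C) M T : 0 <= T -> jcont G ->
  (forall a s, 0 <= a -> 0 <= s <= T -> Cmod (G a s) <= M * / (1 + a) ^ 2) ->
  dom (fun a => CInt (G a) 0 T) (M * T).
Proof.
intros HT Hc Hb; split; [intros; apply CInt_jcont; assumption|].
intros a Ha. replace (M * T * / (1 + a) ^ 2) with (M * / (1 + a) ^ 2 * (T - 0)) by ring.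
apply CInt_le_const; [exact HT|intros s _; apply jcont_l, Hc|intros; apply Hb; assumption].
Qed.

(** Fubini on the strip of height [T], by truncation of the unbounded variable. *)
Lemma half_CInt_swap (G : R -> R -> C) M T : 0 <= T -> jcont G ->
  (forall a s, 0 <= a -> 0 <= s <= T -> Cmod (G a s) <= M * / (1 + a) ^ 2) ->
  (forall s, ccont (fun s => CInt_half (fun a => G a s)) s) ->
  CInt_half (fun a => CInt (G a) 0 T) = CInt (fun s => CInt_half (fun a => G a s)) 0 T.
Proof.
intros HT Hc Hb Hs.
assert (Hd : forall s, 0 <= s <= T -> dom (fun a => G a s) M).
{ intros s Hs'; split; [intros; apply jcont_r, Hc|intros; apply Hb; assumption]. }
assert (HM := dom_pos _ _ (Hd 0 ltac:(lra))).
apply half_limit_rate with (M * T) (M * T); [apply half_CInt_dom; assumption|nra|].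
intros N HN.
change (CInt (fun a => CInt (G a) 0 T) 0 N) with (CInt (fun a => CInt (fun s => G a s) 0 T) 0 N).
rewrite (CInt_Fubini G N T HN HT Hc).
rewrite <- CInt_minus; [|intros s _; apply Hs|intros s _; apply (CInt_jcont (fun s a => G a s)); [exact HN|apply jcont_swap, Hc]].
replace (M * T * / (1 + N)) with (M * / (1 + N) * (T - 0)) by ring.
apply CInt_le_const; [exact HT| |].
- intros s _; apply ccont_minus; [apply Hs|apply (CInt_jcont (fun s a => G a s)); [exact HN|apply jcont_swap, Hc]].
- intros s Hs'. apply dom_rem; [apply Hd, Hs'|exact HN].
Qed.

(** * Holomorphic functions and path independence *)

(** Holomorphy as a chain rule along real curves, with a continuous complex derivative. This is all
that the contour deformation uses, and it makes the closure rules below immediate from those of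
[cder]. *)
Definition hol (D : C -> Prop) (F F' : C -> C) : Prop :=
  (forall z, D z -> ccont F z) /\ (forall z, D z -> ccont F' z) /\
  (forall (g : R -> C) (a : R) (dg : C), D (g a) -> cder g a dg ->
     cder (fun v => F (g v)) a (F' (g a) * dg)%C).

Definition holo (D : C -> Prop) (F : C -> C) : Prop := exists F', hol D F F'.

Section HoloRules.
Context (D : C -> Prop).

Lemma holo_const c : holo D (fun _ => c).
Proof.
exists (fun _ => RtoC 0); split; [|split]; intros; [apply ccont_const|apply ccont_const|].
apply cder_ext with (3 := cder_const c a); [reflexivity|ring].
Qed.

Lemma holo_id : holo D (fun z => z).
Proof.
exists (fun _ => RtoC 1); split; [|split]; intros; [apply continuous_id|apply ccont_const|].
apply cder_ext with (3 := H0); [reflexivity|ring].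
Qed.

Lemma holo_plus F G : holo D F -> holo D G -> holo D (fun z => (F z + G z)%C).
Proof.
intros [F' [F1 [F2 F3]]] [G' [G1 [G2 G3]]]. exists (fun z => (F' z + G' z)%C); split; [|split]; intros.
- apply ccont_plus; auto.
- apply ccont_plus; auto.
- eapply cder_ext; [reflexivity| |apply cder_plus; [apply F3|apply G3]; eassumption]. ring.
Qed.

Lemma holo_opp F : holo D F -> holo D (fun z => (- F z)%C).
Proof.
intros [F' [F1 [F2 F3]]]. exists (fun z => (- F' z)%C); split; [|split]; intros.
- apply ccont_opp; auto.
- apply ccont_opp; auto.
- eapply cder_ext; [reflexivity| |apply cder_opp; apply F3; eassumption]. ring.
Qed.

Lemma holo_minus F G : holo D F -> holo D G -> holo D (fun z => (F z - G z)%C).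
Proof. intros; apply holo_plus; [|apply holo_opp]; assumption. Qed.

Lemma holo_mult F G : holo D F -> holo D G -> holo D (fun z => (F z * G z)%C).
Proof.
intros [F' [F1 [F2 F3]]] [G' [G1 [G2 G3]]]. exists (fun z => (F' z * G z + F z * G' z)%C); split; [|split]; intros.
- apply ccont_mult; auto.
- apply ccont_plus; apply ccont_mult; auto.
- eapply cder_ext; [reflexivity| |apply cder_mult; [apply F3|apply G3]; eassumption]. cbv beta; ring.
Qed.

Lemma holo_pow F n : holo D F -> holo D (fun z => (F z ^ n)%C).
Proof. intros H; induction n as [|n IH]; [exact (holo_const (RtoC 1))|exact (holo_mult _ _ H IH)]. Qed.

Lemma holo_Cexp F : holo D F -> holo D (fun z => Cexp (F z)).
Proof.
intros [F' [F1 [F2 F3]]]. exists (fun z => (Cexp (F z) * F' z)%C); split; [|split]; intros.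
- apply ccont_Cexp; auto.
- apply ccont_mult; [apply ccont_Cexp|]; auto.
- eapply cder_ext; [reflexivity| |apply cder_Cexp; apply F3; eassumption]. cbv beta; ring.
Qed.

Lemma Cmult_neq0 (z w : C) : z <> RtoC 0 -> w <> RtoC 0 -> (z * w)%C <> RtoC 0.
Proof.
intros Hz Hw. apply Cmod_gt_0. rewrite Cmod_mult.
apply Rmult_lt_0_compat; apply Cmod_gt_0; assumption.
Qed.

Lemma holo_inv F : holo D F -> (forall z, D z -> F z <> RtoC 0) -> holo D (fun z => (/ F z)%C).
Proof.
intros [F' [F1 [F2 F3]]] N. exists (fun z => (- F' z / (F z * F z))%C); split; [|split]; intros.
- apply ccont_inv; auto.
- apply ccont_div; [apply ccont_opp|apply ccont_mult|apply Cmult_neq0]; auto.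
- eapply cder_ext; [reflexivity| |apply cder_inv; [apply N|apply F3]; eassumption].
  cbv beta; field. apply N; assumption.
Qed.

Lemma holo_div F G : holo D F -> holo D G -> (forall z, D z -> G z <> RtoC 0) ->
  holo D (fun z => (F z / G z)%C).
Proof. intros; apply holo_mult; [|apply holo_inv]; assumption. Qed.
End HoloRules.

(** ** The principal square root *)

Lemma Csqrt_parts (z : C) :
  0 <= (Cmod z + Re z) / 2 /\ 0 <= (Cmod z - Re z) / 2.
Proof.
assert (H := re_le_Cmod z). generalize (Rle_abs (Re z)) (Rle_abs (- Re z)). rewrite Rabs_Ropp. lra.
Qed.

Lemma Cmod_sq z : Cmod z * Cmod z = Re z * Re z + Im z * Im z.
Proof. generalize (Cmod2_alt z). lra. Qed.

Lemma Csqrt_sq (z : C) : (Csqrt z * Csqrt z)%C = z.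
Proof.
destruct (Csqrt_parts z) as [H1 H2].
assert (E : sqrt ((Cmod z + Re z) / 2) * sqrt ((Cmod z - Re z) / 2) = Rabs (Im z) / 2).
{ rewrite <- sqrt_mult by assumption.
  replace ((Cmod z + Re z) / 2 * ((Cmod z - Re z) / 2)) with (Rsqr (Im z / 2)).
  - rewrite sqrt_Rsqr_abs. unfold Rdiv. rewrite Rabs_mult, (Rabs_pos_eq (/ 2)); lra.
  - unfold Rsqr. generalize (Cmod_sq z). nra. }
assert (S1 := sqrt_sqrt _ H1). assert (S2 := sqrt_sqrt _ H2).
unfold Csqrt. apply injective_projections; simpl.
- change (fst z) with (Re z). destruct (Rle_dec 0 (Im z)); nra.
- change (snd z) with (Im z).
  destruct (Rle_dec 0 (Im z)) as [L|L].
  + rewrite Rabs_pos_eq in E by exact L. nra.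
  + rewrite Rabs_left in E by lra. nra.
Qed.

Lemma Csqrt_Re_nonneg z : 0 <= Re (Csqrt z).
Proof. apply sqrt_pos. Qed.

(** Two square roots of the same number differ by a sign, which the half-plane determines. *)
Lemma Csqrt_unique (z w : C) : (w * w)%C = z -> 0 < Re w -> Csqrt z = w.
Proof.
intros E Hw.
assert (P : ((Csqrt z - w) * (Csqrt z + w))%C = RtoC 0).
{ replace ((Csqrt z - w) * (Csqrt z + w))%C with (Csqrt z * Csqrt z - w * w)%C by ring.
  rewrite Csqrt_sq, E. ring. }
assert (N : (Csqrt z + w)%C <> RtoC 0).
{ intros A. apply (f_equal Re) in A. change (Re (Csqrt z) + Re w = 0) in A.
  generalize (Csqrt_Re_nonneg z). lra. }
assert (Z : (Csqrt z - w)%C = RtoC 0).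
{ replace (Csqrt z - w)%C with (((Csqrt z - w) * (Csqrt z + w)) / (Csqrt z + w))%C by (field; exact N).
  rewrite P. field. exact N. }
replace (Csqrt z) with ((Csqrt z - w) + w)%C by ring. rewrite Z. ring.
Qed.

Lemma Csqrt_Re_pos z : 0 < Re z \/ Im z <> 0 -> 0 < Re (Csqrt z).
Proof.
intros H. apply sqrt_lt_R0.
assert (0 < Cmod z + Re z); [|lra].
destruct H as [H|H]; [generalize (Cmod_ge_0 z); lra|].
destruct (Csqrt_parts z) as [H1 H2]. assert (S := Cmod_sq z).
assert (0 < Im z * Im z) by (apply Rsqr_pos_lt; exact H). nra.
Qed.

Lemma Csqrt_neq0 z : 0 < Re z -> Csqrt z <> RtoC 0.
Proof.
intros H E. assert (P := Csqrt_Re_pos z (or_introl H)). rewrite E in P. unfold Re in P; simpl in P; lra.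
Qed.

Lemma C2_neq0 : RtoC 2 <> RtoC 0.
Proof. intros E; apply RtoC_inj in E; lra. Qed.

Lemma Csqrt_conj z : 0 < Re z \/ Im z <> 0 -> Csqrt (Cconj z) = Cconj (Csqrt z).
Proof.
intros H. apply Csqrt_unique.
- rewrite <- (Csqrt_sq z) at 3. apply injective_projections; simpl; ring.
- change (0 < Re (Csqrt z)). apply Csqrt_Re_pos, H.
Qed.

(** For positive real part the imaginary part needs no case distinction on its sign, which gives
smoothness across the positive real axis. *)
Lemma Csqrt_right z : 0 < Re z ->
  Csqrt z = (sqrt ((Cmod z + Re z) / 2), Im z / (2 * sqrt ((Cmod z + Re z) / 2))).
Proof.
intros H. assert (P := Csqrt_Re_pos z (or_introl H)).
assert (S : Re (Csqrt z) * Im (Csqrt z) + Im (Csqrt z) * Re (Csqrt z) = Im z)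
  by exact (f_equal Im (Csqrt_sq z)).
change (sqrt ((Cmod z + Re z) / 2)) with (Re (Csqrt z)).
apply injective_projections; [reflexivity|].
change (Im (Csqrt z) = Im z / (2 * Re (Csqrt z))).
rewrite <- S. field. lra.
Qed.

Lemma open_half_plane (z : C) : 0 < Re z -> locally (T := C_UniformSpace) z (fun w => 0 < Re w).
Proof.
intros H. exists (mkposreal _ H). intros w [Hw _]. change (Rabs (Re w - Re z) < Re z) in Hw.
apply Rabs_def2 in Hw. lra.
Qed.

Lemma ccont_Csqrt_id (z : C) : 0 < Re z -> ccont (Csqrt : C_UniformSpace -> C) z.
Proof.
intros H.
apply (continuous_ext_loc (U := C_R_NormedModule) (T := C_UniformSpace) Csqrt
  (fun w : C_UniformSpace => (sqrt ((Cmod w + Re w) / 2), Im w / (2 * sqrt ((Cmod w + Re w) / 2))) : C) z).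
- generalize (open_half_plane z H). apply filter_imp. intros w Hw. symmetry. apply Csqrt_right, Hw.
- ctac; try lra; try apply continuous_id.
  assert (P := Csqrt_Re_pos z (or_introl H)). unfold Csqrt, Re in P; simpl in P.
  unfold Re. lra.
Qed.

Lemma ccont_Csqrt {T : UniformSpace} (f : T -> C) p : ccont f p -> 0 < Re (f p) ->
  ccont (fun q => Csqrt (f q)) p.
Proof.
intros H1 H2. apply (continuous_comp f Csqrt); [exact H1|apply ccont_Csqrt_id, H2].
Qed.

Lemma cder_unique z a d d' : cder z a d -> cder z a d' -> d = d'.
Proof.
intros [H1 H2] [H3 H4]. apply injective_projections.
- exact (eq_trans (eq_sym (is_derive_unique _ _ _ H1)) (is_derive_unique _ _ _ H3)).
- exact (eq_trans (eq_sym (is_derive_unique _ _ _ H2)) (is_derive_unique _ _ _ H4)).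
Qed.

(** Differentiability follows from the explicit formula [Csqrt_right]; the value of the derivative
then comes for free from differentiating the square. *)
Lemma cder_Csqrt (g : R -> C) a dg : 0 < Re (g a) -> cder g a dg ->
  cder (fun v => Csqrt (g v)) a (dg / (2 * Csqrt (g a)))%C.
Proof.
intros Hp Hg. assert (P := Csqrt_Re_pos _ (or_introl Hp)).
assert (Hn : Csqrt (g a) <> RtoC 0) by (apply Csqrt_neq0, Hp).
assert (Hloc : locally a (fun v => 0 < Re (g v))).
{ apply (cder_continuous _ _ _ Hg (fun w : C => 0 < Re w)). apply open_half_plane, Hp. }
assert (Hex : exists d, cder (fun v => Csqrt (g v)) a d).
{ destruct Hg as [G1 G2].
  assert (M0 : 0 < Re (g a) * Re (g a) + Im (g a) * Im (g a)) by nra.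
  assert (D1 := is_derive_sqrt _ _ _ (is_derive_Rplus _ _ _ _ _ (is_derive_Rmult _ _ _ _ _ G1 G1) (is_derive_Rmult _ _ _ _ _ G2 G2)) M0).
  assert (M1 : 0 < (sqrt (Re (g a) * Re (g a) + Im (g a) * Im (g a)) + Re (g a)) * / 2).
  { generalize (sqrt_pos (Re (g a) * Re (g a) + Im (g a) * Im (g a))). lra. }
  assert (D2 := is_derive_sqrt _ _ _ (is_derive_Rmult _ _ _ _ _ (is_derive_Rplus _ _ _ _ _ D1 G1) (is_derive_Rconst (/ 2) a)) M1).
  assert (M2 := Rgt_not_eq _ _ (sqrt_lt_R0 _ M1)).
  assert (D3 := is_derive_Rmult _ _ _ _ _ (is_derive_Rmult _ _ _ _ _ G2 (is_derive_Rconst (/ 2) a)) (is_derive_inv _ _ _ D2 M2)).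
  eexists. eapply cder_ext_loc; [|exact (cder_pair _ _ _ _ _ D2 D3)].
  revert Hloc; apply filter_imp; intros v Hv. rewrite Csqrt_right by exact Hv.
  assert (E : Cmod (g v) = sqrt (Re (g v) * Re (g v) + Im (g v) * Im (g v))).
  { unfold Cmod, Re, Im. f_equal. ring. }
  rewrite E. unfold Rdiv. f_equal. rewrite Rinv_mult. ring. }
destruct Hex as [d Hd].
assert (E := cder_unique _ _ _ _ (cder_mult _ _ _ _ _ Hd Hd)
  (cder_ext _ _ _ _ _ (fun v => eq_sym (Csqrt_sq (g v))) eq_refl Hg)).
cbv beta in E. replace (dg / (2 * Csqrt (g a)))%C with d; [exact Hd|].
rewrite <- E. field. exact Hn.
Qed.

Lemma holo_Csqrt D F : holo D F -> (forall z, D z -> 0 < Re (F z)) -> holo D (fun z => Csqrt (F z)).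
Proof.
intros [F' [F1 [F2 F3]]] P. exists (fun z => (F' z / (2 * Csqrt (F z)))%C).
assert (N : forall z, D z -> (2 * Csqrt (F z))%C <> RtoC 0).
{ intros z Hz; apply Cmult_neq0; [apply C2_neq0|apply Csqrt_neq0, P, Hz]. }
split; [|split]; intros.
- apply ccont_Csqrt; auto.
- apply ccont_div; [auto|apply ccont_mult; [apply ccont_const|apply ccont_Csqrt; auto]|auto].
- eapply cder_ext; [reflexivity| |apply cder_Csqrt; [apply P|apply F3]; eassumption]. cbv beta; field.
  apply Csqrt_neq0, P, H.
Qed.

(** ** A primitive on a star-shaped domain *)

Section Primitive.
Context (D : C -> Prop) (F : C -> C).
Context (Dopen : forall z, D z -> locally (T := C_UniformSpace) z D).
Context (Dstar : forall z s, D z -> 0 <= s <= 1 -> D (RtoC s * z)%C).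
Context (HF : holo D F).

(** A primitive of [F] vanishing at 0, see [star_primitive_der]: the integral of [F] along the ray
from 0 to [z]. *)
Definition star_primitive (z : C) : C := CInt (fun s => (F (RtoC s * z) * z)%C) 0 1.

Lemma star_primitive_cont {T : UniformSpace} (g : T -> C) p : ccont g p -> D (g p) ->
  ccont (fun q => star_primitive (g q)) p.
Proof.
destruct HF as [F' [F1 [F2 F3]]]. intros Hg Hp.
unfold star_primitive.
apply (CInt_param_cont (fun q s => (F (RtoC s * g q) * g q)%C)); [lra| |].
- intros s Hs.
  assert (Hg' : ccont (fun q : T * R => g (fst q)) (p, s)).
  { apply (continuous_comp fst g); [apply continuous_fst|exact Hg]. }
  apply ccont_mult; [|exact Hg'].
  apply (continuous_comp (fun q : T * R => (RtoC (snd q) * g (fst q))%C : C_UniformSpace) F).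
  + apply (ccont_mult (fun q : T * R => RtoC (snd q))); [ctac|exact Hg'].
  + apply F1, Dstar; assumption.
- generalize (Hg D (Dopen _ Hp)). unfold filtermap; apply filter_imp. intros q Hq s Hs.
  apply ccont_mult; [|apply ccont_const].
  apply (continuous_comp (fun s : R => (RtoC s * g q)%C : C_UniformSpace) F).
  + apply (ccont_mult (fun s : R => RtoC s)); [ctac|apply ccont_const].
  + apply F1, Dstar; assumption.
Qed.

(** The integrand differentiated along the curve is the derivative in [s] of s F(s g) dg, whose
increment over [0, 1] is F(g) dg. *)
Lemma star_primitive_der (g dg : R -> C) a : D (g a) ->
  locally a (fun v => cder g v (dg v)) -> ccont dg a ->
  cder (fun v => star_primitive (g v)) a (F (g a) * dg a)%C.
Proof.
destruct HF as [F' [F1 [F2 F3]]]. intros Ha Hd Hc.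
assert (Hg := cder_continuous _ _ _ (locally_singleton _ _ Hd)).
assert (HDl : locally a (fun v => D (g v))) by exact (Hg D (Dopen _ Ha)).
pose (k := fun v s => (F' (RtoC s * g v) * (RtoC s * dg v) * g v + F (RtoC s * g v) * dg v)%C).
assert (E : CInt (k a) 0 1 = (F (g a) * dg a)%C).
{ assert (C0 : forall s, 0 <= s <= 1 -> ccont (fun s : R => F (RtoC s * g a)%C) s).
  { intros s Hs. apply (continuous_comp (fun s : R => (RtoC s * g a)%C : C_UniformSpace) F).
    + apply (ccont_mult (fun s : R => RtoC s)); [ctac|apply ccont_const].
    + apply F1, Dstar; assumption. }
  assert (C1 : forall s, 0 <= s <= 1 -> ccont (fun s : R => F' (RtoC s * g a)%C) s).
  { intros s Hs. apply (continuous_comp (fun s : R => (RtoC s * g a)%C : C_UniformSpace) F').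
    + apply (ccont_mult (fun s : R => RtoC s)); [ctac|apply ccont_const].
    + apply F2, Dstar; assumption. }
  rewrite (CInt_FTC (fun s => (RtoC s * F (RtoC s * g a) * dg a)%C) (k a)).
  - replace (RtoC 1 * g a)%C with (g a) by ring. ring.
  - lra.
  - intros s Hs. specialize (C0 s Hs). ctac.
  - intros s Hs. specialize (C0 s Hs). specialize (C1 s Hs). unfold k. ctac.
  - intros s Hs. unfold k.
    assert (D1 : cder (fun s : R => (RtoC s * g a)%C) s (g a)).
    { eapply cder_ext; [reflexivity| |apply (cder_mult (fun s : R => RtoC s) (fun _ => g a));
        [apply (cder_RtoC (fun s => s)); apply (is_derive_id (K := R_AbsRing))|apply cder_const]].
      unfold one; simpl. ring. }
    assert (D2 := F3 _ _ _ (Dstar (g a) s Ha ltac:(lra)) D1). cbv beta in D2.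
    eapply cder_ext; [reflexivity| |apply cder_mult; [apply (cder_mult (fun s : R => RtoC s));
      [apply (cder_RtoC (fun s => s)); apply (is_derive_id (K := R_AbsRing))|exact D2]|apply cder_const]].
    unfold one; simpl. ring. }
rewrite <- E. unfold star_primitive.
apply (CInt_Leibniz (fun v s => (F (RtoC s * g v) * g v)%C) k); [lra| | |].
- generalize (filter_and _ _ Hd HDl). apply filter_imp. intros v [V1 V2] s Hs.
  assert (D1 : cder (fun v => (RtoC s * g v)%C) v (RtoC s * dg v)%C).
  { eapply cder_ext; [reflexivity| |apply (cder_mult (fun _ => RtoC s) g); [apply cder_const|exact V1]]. cbv beta; ring. }
  assert (D2 := F3 _ _ _ (Dstar (g v) s V2 Hs) D1). cbv beta in D2.
  unfold k. eapply cder_ext; [reflexivity| |apply cder_mult; [exact D2|exact V1]]. cbv beta; ring.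
- intros s Hs. unfold k.
  assert (Hg' : ccont (fun q : R * R => g (fst q)) (a, s)).
  { apply (continuous_comp fst g); [apply continuous_fst|exact Hg]. }
  assert (Hdg' : ccont (fun q : R * R => dg (fst q)) (a, s)).
  { apply (continuous_comp fst dg); [apply continuous_fst|exact Hc]. }
  assert (C0 : ccont (fun q : R * R => (F (RtoC (snd q) * g (fst q)))%C) (a, s)).
  { apply (continuous_comp (fun q : R * R => (RtoC (snd q) * g (fst q))%C : C_UniformSpace) F).
    + apply (ccont_mult (fun q : R * R => RtoC (snd q))); [ctac|exact Hg'].
    + apply F1, Dstar; assumption. }
  assert (C1 : ccont (fun q : R * R => (F' (RtoC (snd q) * g (fst q)))%C) (a, s)).
  { apply (continuous_comp (fun q : R * R => (RtoC (snd q) * g (fst q))%C : C_UniformSpace) F').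
    + apply (ccont_mult (fun q : R * R => RtoC (snd q))); [ctac|exact Hg'].
    + apply F2, Dstar; assumption. }
  ctac.
- generalize HDl. apply filter_imp. intros v Hv s Hs.
  apply ccont_mult; [|apply ccont_const].
  apply (continuous_comp (fun s : R => (RtoC s * g v)%C : C_UniformSpace) F).
  + apply (ccont_mult (fun s : R => RtoC s)); [ctac|apply ccont_const].
  + apply F1, Dstar; assumption.
Qed.

Lemma star_path_integral (g dg G : R -> C) N : 0 <= N ->
  (forall a, 0 <= a <= N -> ccont g a /\ D (g a)) ->
  (forall a, 0 < a < N -> cder g a (dg a) /\ ccont dg a) ->
  (forall a, 0 <= a <= N -> ccont G a) ->
  (forall a, 0 < a < N -> G a = F (g a) * dg a)%C ->
  CInt G 0 N = (star_primitive (g N) - star_primitive (g 0%R))%C.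
Proof.
intros HN Hg Hd HG E.
apply (CInt_FTC (fun a => star_primitive (g a)) G); [exact HN| |exact HG|].
- intros a Ha. destruct (Hg a Ha). apply star_primitive_cont; assumption.
- intros a Ha. rewrite E by exact Ha. apply star_primitive_der.
  + apply Hg; lra.
  + assert (P : 0 < Rmin a (N - a)) by (apply Rmin_pos; lra).
    exists (mkposreal _ P). intros v Hv. change (Rabs (v - a) < Rmin a (N - a)) in Hv.
    apply Hd. apply Rabs_def2 in Hv. generalize (Rmin_l a (N - a)) (Rmin_r a (N - a)). lra.
  + apply Hd, Ha.
Qed.

Lemma star_primitive_0 : star_primitive (RtoC 0) = RtoC 0.
Proof.
unfold star_primitive. apply CInt_unique.
apply (is_RInt_ext (V := CV) (fun _ => RtoC 0)).
- intros s _. change (RtoC 0 = F (RtoC s * RtoC 0) * RtoC 0)%C. ring.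
- refine (eq_ind _ (fun l => is_RInt (V := CV) (fun _ => RtoC 0) 0 1 l)
    (is_RInt_const (V := CV) 0 1 (RtoC 0)) _ _).
  apply injective_projections; unfold scal; simpl; unfold prod_scal, scal; simpl; unfold mult; simpl; ring.
Qed.

(** Cauchy's theorem for the region between the positive half-line and a curve [g] from 0 to infinity.  Both truncated
integrals are values of the same primitive, whose difference is the integral over the vertical segment from [g N] to
the real axis; the hypothesis with [K] says that this segment contributes nothing in the limit. *)
Lemma deform_to_half_line (g dg G : R -> C) (M1 M2 K : R) :
  (forall a, 0 <= a -> ccont g a /\ D (g a)) -> g 0 = RtoC 0 ->
  (forall a, 0 < a -> cder g a (dg a) /\ ccont dg a) ->
  (forall a, 0 < a -> G a = F (g a) * dg a)%C ->
  dom G M1 -> dom (fun r => F (RtoC r)) M2 ->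
  (forall r, D (RtoC r)) ->
  (forall a v, 0 <= a -> 0 <= v <= 1 -> D (Re (g a), v * Im (g a)) /\
     Cmod (F (Re (g a), v * Im (g a))) * Rabs (Im (g a)) <= K * / (1 + Re (g a))) ->
  (forall a, 0 <= a -> 0 <= Re (g a)) ->
  (forall m, exists A, forall a, A <= a -> m <= Re (g a)) ->
  CInt_half G = CInt_half (fun r => F (RtoC r)).
Proof.
intros Hg G0 Hd HG D1 D2 Dr Hs Hre Hinf.
assert (HK : 0 <= K).
{ destruct (Hs 0 0 ltac:(lra) ltac:(lra)) as [_ A]. rewrite G0 in A. unfold Re, Im in A; simpl in A.
  rewrite Rabs_R0 in A. replace (1 + 0) with 1 in A by ring. rewrite Rinv_1 in A. lra. }
assert (HM2 := dom_pos _ _ D2).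
apply half_limit with M1; [exact D1|]. intros e He.
destruct (inv_tail_small (M2 + K) e ltac:(lra) He) as [m [Hm0 Hm]].
destruct (Hinf m) as [A HA].
exists (Rmax 0 A). intros N HN.
assert (HN0 : 0 <= N) by (generalize (Rmax_l 0 A); lra).
specialize (HA N ltac:(generalize (Rmax_r 0 A); lra)).
specialize (Hm _ HA). specialize (Hre N HN0).
set (x := Re (g N)) in *. set (y := Im (g N)) in *.
assert (E1 : CInt G 0 N = star_primitive (g N)).
{ rewrite (star_path_integral g dg G N HN0).
  - rewrite G0, star_primitive_0. ring.
  - intros; apply Hg; lra.
  - intros; apply Hd; lra.
  - intros; apply D1.
  - intros; apply HG; lra. }
assert (E2 : CInt (fun r => F (RtoC r)) 0 x = star_primitive (RtoC x)).
{ rewrite (star_path_integral (fun r => RtoC r) (fun _ => RtoC 1) (fun r => F (RtoC r)) x Hre).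
  - rewrite star_primitive_0. ring.
  - intros; split; [ctac|apply Dr].
  - intros; split; [apply (cder_RtoC (fun s => s)); apply (is_derive_id (K := R_AbsRing))|apply ccont_const].
  - intros; apply D2.
  - intros; ring. }
assert (E3 : CInt (fun v => (F (x, (v * y)%R) * (0%R, y))%C) 0 1 = (star_primitive (g N) - star_primitive (RtoC x))%C).
{ rewrite (star_path_integral (fun v => (x, v * y) : C) (fun _ => (0, y) : C) (fun v => (F (x, (v * y)%R) * (0%R, y))%C) 1).
  - f_equal; [f_equal|f_equal; f_equal]; apply injective_projections; unfold x, y, Re, Im; simpl; ring.
  - lra.
  - intros v Hv; split; [ctac|apply Hs; assumption].
  - intros v Hv; split; [|apply ccont_const].
    apply (cder_pair (fun _ => x) (fun v => v * y)); [apply is_derive_Rconst|].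
    eapply is_derive_eq; [apply (is_derive_Rmult (fun v => v) (fun _ => y)); [apply (is_derive_id (K := R_AbsRing))|apply is_derive_Rconst]|].
    unfold one; simpl; ring.
  - intros v Hv. apply ccont_mult; [|apply ccont_const].
    destruct HF as [F' [F1 _]].
    apply (continuous_comp (fun v : R => (x, v * y) : C_UniformSpace) F).
    + apply (ccont_pair (fun _ => x) (fun v => v * y)); ctac.
    + apply F1, Hs; assumption.
  - reflexivity. }
assert (B3 : Cmod (CInt (fun v => (F (x, (v * y)%R) * (0%R, y))%C) 0 1) <= K * / (1 + x)).
{ replace (K * / (1 + x)) with (K * / (1 + x) * (1 - 0)) by ring.
  apply CInt_le_const; [lra| |].
  - intros v Hv. rewrite Rmin_left, Rmax_right in Hv by lra. apply ccont_mult; [|apply ccont_const].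
    destruct HF as [F' [F1 _]].
    apply (continuous_comp (fun v : R => (x, v * y) : C_UniformSpace) F).
    + apply (ccont_pair (fun _ => x) (fun v => v * y)); ctac.
    + apply F1, Hs; assumption.
  - intros v Hv. rewrite Cmod_mult.
    replace (Cmod (0, y)) with (Rabs y); [apply Hs; assumption|].
    rewrite <- sqrt_Rsqr_abs. unfold Cmod, Rsqr; simpl. f_equal; ring. }
assert (B2 := dom_rem _ _ x D2 Hre).
rewrite E1.
replace (CInt_half (fun r => F (RtoC r)) - star_primitive (g N))%C with
  ((CInt_half (fun r => F (RtoC r)) - CInt (fun r => F (RtoC r)) 0 x)
   + - (star_primitive (g N) - star_primitive (RtoC x)))%C by (rewrite E2; ring).
rewrite <- E3. eapply Rle_trans; [apply Cmod_triangle|]. rewrite Cmod_opp.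
rewrite Rmult_plus_distr_r in Hm. lra.
Qed.
End Primitive.

(** * Geometry of the two boundary curves *)

Section Curves.
Context (alpha beta : R) (ha : 0 < alpha) (hb : 0 < beta).

Notation c2 := (alpha / beta).
Notation lw := (lower alpha beta).
Notation up := (upper alpha beta).
Notation P a := (alpha + 6 * beta * a ^ 2).
Notation Q a := (sqrt (Defs.disc alpha beta a)).

Lemma c2_pos : 0 < c2.
Proof. apply Rdiv_lt_0_compat; assumption. Qed.

(** As a sum of two squares the discriminant has an obvious lower bound, see [Q_ge]. *)
Lemma disc_eq (a : R) : Defs.disc alpha beta a = (alpha + 4 * (beta * a ^ 2)) ^ 2 + 16 * (beta * a ^ 2) ^ 2.
Proof. unfold Defs.disc; ring. Qed.

Lemma ba2_pos (a : R) : 0 <= beta * a ^ 2.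
Proof. apply Rmult_le_pos; [lra|apply pow2_ge_0]. Qed.

Lemma Q_sq (a : R) : Q a * Q a = Defs.disc alpha beta a.
Proof. apply sqrt_sqrt. rewrite disc_eq. generalize (ba2_pos a); nra. Qed.

Lemma Q_ge (a : R) : alpha + 4 * (beta * a ^ 2) <= Q a.
Proof.
generalize (ba2_pos a) (Q_sq a) (sqrt_pos (Defs.disc alpha beta a)). rewrite disc_eq. intros; nra.
Qed.

Lemma Q_pos (a : R) : 0 < Q a.
Proof. generalize (Q_ge a) (ba2_pos a); lra. Qed.

Lemma Q_le (a : R) : Q a <= P a.
Proof.
generalize (ba2_pos a) (Q_sq a) (sqrt_pos (Defs.disc alpha beta a)). rewrite disc_eq. intros; nra.
Qed.

(** The product of the two roots b^2 of Re (omega (a + i b)), up to a constant. Dividing by the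
larger root gives the smaller one without the cancellation that hides its size near 0. *)
Lemma PQ_prod (a : R) : (P a - Q a) * (P a + Q a) = 4 * (beta * a ^ 2) * (alpha + beta * a ^ 2).
Proof.
replace ((P a - Q a) * (P a + Q a)) with (P a * P a - Q a * Q a) by ring.
rewrite Q_sq. unfold Defs.disc. ring.
Qed.

(** The ratio lower(a) / a. Unlike [lower] it is smooth at 0 and bounded away from 0, which makes
the lower curve a graph with a corner at 0. *)
Definition slope (a : R) : R := sqrt (2 * (alpha + beta * a ^ 2) / (P a + Q a)).

Lemma PQ_pos (a : R) : 0 < P a + Q a.
Proof. generalize (Q_pos a) (ba2_pos a); nra. Qed.

Lemma slope_sq (a : R) : slope a * slope a = 2 * (alpha + beta * a ^ 2) / (P a + Q a).
Proof.
apply sqrt_sqrt. apply Rlt_le, Rdiv_lt_0_compat; [|apply PQ_pos]. generalize (ba2_pos a); lra.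
Qed.

Lemma slope_bounds (a : R) : 2 / 5 <= slope a <= 1.
Proof.
assert (H := slope_sq a). assert (S := sqrt_pos (2 * (alpha + beta * a ^ 2) / (P a + Q a))).
fold (slope a) in S.
assert (A := PQ_pos a). assert (B := ba2_pos a). assert (C0 := Q_le a). assert (D0 := Q_ge a).
assert (E : slope a * slope a * (P a + Q a) = 2 * (alpha + beta * a ^ 2)) by (rewrite H; field; lra).
replace (6 * beta * a ^ 2) with (6 * (beta * a ^ 2)) in * by ring.
set (q := slope a) in *. set (w := Q a) in *. set (v := beta * a ^ 2) in *.
assert (U : 4 / 25 <= q * q) by nra.
assert (V : q * q <= 1) by nra.
split; nra.
Qed.

Lemma lower_sq_arg (a : R) : (P a - Q a) / (2 * beta) = a ^ 2 * (slope a * slope a).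
Proof.
rewrite slope_sq. assert (A := PQ_pos a). assert (H := PQ_prod a).
apply Rmult_eq_reg_r with (2 * beta * (P a + Q a)); [|apply Rgt_not_eq; nra].
transitivity ((P a - Q a) * (P a + Q a)); [field; lra|]. rewrite H. field. lra.
Qed.

Lemma lower_slope (a : R) : 0 <= a -> lw a = a * slope a.
Proof.
intros Ha. unfold lower. rewrite lower_sq_arg.
replace (a ^ 2 * (slope a * slope a)) with (Rsqr (a * slope a)) by (unfold Rsqr; ring).
apply sqrt_Rsqr, Rmult_le_pos; [exact Ha|generalize (slope_bounds a); lra].
Qed.

Lemma lower_sq (a : R) : lw a * lw a = (P a - Q a) / (2 * beta).
Proof.
apply sqrt_sqrt. rewrite lower_sq_arg. apply Rmult_le_pos; [apply pow2_ge_0|].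
generalize (slope_bounds a); nra.
Qed.

Lemma lower_bounds (a : R) : 0 <= a -> 2 / 5 * a <= lw a <= a.
Proof. intros Ha; rewrite lower_slope by exact Ha. generalize (slope_bounds a); nra. Qed.

Lemma upper_sq (a : R) : up a * up a = (P a + Q a) / (2 * beta).
Proof.
apply sqrt_sqrt. apply Rlt_le, Rdiv_lt_0_compat; [apply PQ_pos|lra].
Qed.

Lemma upper_sq_bounds (a : R) : c2 + 5 * a ^ 2 <= up a * up a <= c2 + 6 * a ^ 2.
Proof.
rewrite upper_sq. generalize (Q_ge a) (Q_le a) (ba2_pos a); intros H1 H2 H3.
split; apply Rmult_le_reg_r with (2 * beta); try lra.
- replace ((c2 + 5 * a ^ 2) * (2 * beta)) with (2 * alpha + 10 * (beta * a ^ 2)) by (field; lra).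
  replace ((P a + Q a) / (2 * beta) * (2 * beta)) with (P a + Q a) by (field; lra). nra.
- replace ((c2 + 6 * a ^ 2) * (2 * beta)) with (2 * alpha + 12 * (beta * a ^ 2)) by (field; lra).
  replace ((P a + Q a) / (2 * beta) * (2 * beta)) with (P a + Q a) by (field; lra). nra.
Qed.

Lemma upper_pos (a : R) : 0 < up a.
Proof.
generalize (upper_sq_bounds a) c2_pos (pow2_ge_0 a) (sqrt_pos ((P a + Q a) / (2 * beta))).
fold (up a). intros; nra.
Qed.

Lemma upper_ge (a : R) : a <= up a.
Proof.
generalize (upper_sq_bounds a) c2_pos (pow2_ge_0 a) (upper_pos a). intros.
destruct (Rle_dec a (up a)); [assumption|]. nra.
Qed.

Lemma Re_omega_eq (m n : R) :
  Re (omega alpha beta (m, n)) = alpha * (m ^ 2 - n ^ 2) + beta * (m ^ 4 - 6 * m ^ 2 * n ^ 2 + n ^ 4).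
Proof. unfold omega, Re; simpl; ring. Qed.

Lemma Re_omega_root (a n : R) : (2 * beta * (n * n) - P a) ^ 2 = Q a * Q a ->
  Re (omega alpha beta (a, n)) = 0.
Proof.
intros H. rewrite Q_sq in H. rewrite Re_omega_eq.
apply Rmult_eq_reg_l with (4 * beta); [|lra]. rewrite Rmult_0_r.
transitivity ((2 * beta * (n * n) - P a) ^ 2 - Defs.disc alpha beta a); [unfold Defs.disc; ring|lra].
Qed.

Lemma Re_omega_lower (a : R) : Re (omega alpha beta (a, lw a)) = 0.
Proof.
apply Re_omega_root. rewrite lower_sq.
replace (2 * beta * ((P a - Q a) / (2 * beta))) with (P a - Q a) by (field; lra). ring.
Qed.

Lemma Re_omega_upper (a : R) : Re (omega alpha beta (a, up a)) = 0.
Proof.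
apply Re_omega_root. rewrite upper_sq.
replace (2 * beta * ((P a + Q a) / (2 * beta))) with (P a + Q a) by (field; lra). ring.
Qed.

Lemma lower_even (a : R) : lw (- a) = lw a.
Proof. unfold lower, Defs.disc. do 2 f_equal. f_equal; [f_equal; ring|f_equal; f_equal; ring]. Qed.

Lemma upper_even (a : R) : up (- a) = up a.
Proof. unfold upper, Defs.disc. do 2 f_equal. f_equal; [f_equal; ring|f_equal; f_equal; ring]. Qed.

Definition dlower (a : R) : R :=
  (12 * beta - (8 * alpha * beta + 64 * beta ^ 2 * a ^ 2) / Q a) / (4 * beta * slope a).
Definition dupper (a : R) : R :=
  (12 * beta * a + (8 * alpha * beta * a + 64 * beta ^ 2 * a ^ 3) / Q a) / (4 * beta * up a).

Lemma cont_disc {T : UniformSpace} (f : T -> R) p : continuous f p -> continuous (fun q => Defs.disc alpha beta (f q)) p.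
Proof. intros; unfold Defs.disc; ctac. Qed.

Lemma cont_lower {T : UniformSpace} (f : T -> R) p : continuous f p -> continuous (fun q => lw (f q)) p.
Proof. intros H. assert (A := cont_disc f p H). unfold lower; ctac. lra. Qed.

Lemma cont_upper {T : UniformSpace} (f : T -> R) p : continuous f p -> continuous (fun q => up (f q)) p.
Proof. intros H. assert (A := cont_disc f p H). unfold upper; ctac. lra. Qed.

Lemma cont_slope {T : UniformSpace} (f : T -> R) p : continuous f p -> continuous (fun q => slope (f q)) p.
Proof.
intros H. assert (A := cont_disc f p H). unfold slope; ctac. apply Rgt_not_eq, PQ_pos.
Qed.

Lemma cont_dlower {T : UniformSpace} (f : T -> R) p : continuous f p -> continuous (fun q => dlower (f q)) p.
Proof.
intros H. assert (A := cont_disc f p H). assert (B := cont_slope f p H). unfold dlower; ctac.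
- apply Rgt_not_eq, Q_pos.
- generalize (slope_bounds (f p)); intros; apply Rgt_not_eq; nra.
Qed.

Lemma cont_dupper {T : UniformSpace} (f : T -> R) p : continuous f p -> continuous (fun q => dupper (f q)) p.
Proof.
intros H. assert (A := cont_disc f p H). assert (B := cont_upper f p H). unfold dupper; ctac.
- apply Rgt_not_eq, Q_pos.
- generalize (upper_pos (f p)); intros; apply Rgt_not_eq; nra.
Qed.

Lemma is_derive_Q (a : R) : is_derive (fun a => Q a) a ((8 * alpha * beta * a + 64 * beta ^ 2 * a ^ 3) / Q a).
Proof.
assert (H := Q_pos a).
eapply is_derive_eq; [apply (is_derive_sqrt (Defs.disc alpha beta)) with (df := 16 * alpha * beta * a + 128 * beta ^ 2 * a ^ 3)|].
- unfold Defs.disc; auto_derive; [trivial|ring].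
- rewrite <- Q_sq; nra.
- field. lra.
Qed.

Lemma is_derive_P (a : R) : is_derive (fun a => P a) a (12 * beta * a).
Proof. auto_derive; [trivial|ring]. Qed.

Lemma is_derive_upper (a : R) : is_derive up a (dupper a).
Proof.
assert (H := upper_pos a). assert (H' := Q_pos a).
eapply is_derive_eq; [apply (is_derive_sqrt (fun a => (P a + Q a) / (2 * beta)))|].
- apply is_derive_Rmult; [apply is_derive_Rplus; [apply is_derive_P|apply is_derive_Q]|apply is_derive_Rconst].
- apply Rdiv_lt_0_compat; [apply PQ_pos|lra].
- fold (up a). unfold dupper. field. lra.
Qed.

Lemma is_derive_lower (a : R) : 0 < a -> is_derive lw a (dlower a).
Proof.
intros Ha. assert (H' := Q_pos a). assert (S := slope_bounds a).
eapply is_derive_eq; [apply (is_derive_sqrt (fun a => (P a - Q a) / (2 * beta)))|].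
- apply is_derive_Rmult; [apply is_derive_Rminus; [apply is_derive_P|apply is_derive_Q]|apply is_derive_Rconst].
- rewrite lower_sq_arg. assert (0 < slope a * slope a) by nra. assert (0 < a ^ 2) by nra. nra.
- fold (lw a). rewrite lower_slope by lra. unfold dlower. field. lra.
Qed.

(** Gives the derivatives on the left halves of the two graphs. *)
Lemma is_derive_even (f : R -> R) (a d : R) : (forall v, f (- v) = f v) -> is_derive f a d -> is_derive f (- a) (- d).
Proof.
intros E H. apply is_derive_ext with (fun v => f (- v)); [exact E|].
eapply is_derive_eq; [apply (is_derive_comp (K := R_AbsRing) (V := R_NormedModule) f (fun v => - v) (- a) d (-1))|].
- rewrite Ropp_involutive. exact H.
- auto_derive; [trivial|ring].
- unfold scal; simpl; unfold mult; simpl; ring.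
Qed.

Lemma dlower_bound (a : R) : Rabs (dlower a) <= 15 / 2.
Proof.
assert (S := slope_bounds a). assert (H := Q_pos a). assert (H1 := Q_ge a). assert (H2 := ba2_pos a).
assert (X : 0 <= (8 * alpha * beta + 64 * beta ^ 2 * a ^ 2) / Q a <= 16 * beta).
{ split; [apply Rdiv_le_0_compat; [|exact H]|].
  - assert (0 <= alpha * beta) by nra. assert (0 <= beta * (beta * a ^ 2)) by nra. nra.
  - apply Rmult_le_reg_r with (Q a); [exact H|]. unfold Rdiv. rewrite Rmult_assoc, Rinv_l, Rmult_1_r by lra.
    assert (16 * beta * (alpha + 4 * (beta * a ^ 2)) <= 16 * beta * Q a) by (apply Rmult_le_compat_l; lra).
    assert (0 <= alpha * beta) by nra. nra. }
unfold dlower. set (Y := _ / Q a) in *.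
unfold Rdiv. rewrite Rabs_mult, (Rabs_pos_eq (/ _)).
2:{ left; apply Rinv_0_lt_compat. nra. }
apply Rmult_le_reg_r with (4 * beta * slope a); [nra|].
rewrite Rmult_assoc, Rinv_l, Rmult_1_r by nra.
apply Rabs_le. nra.
Qed.

Lemma dupper_bound (a : R) : 0 <= a -> Rabs (dupper a) <= 7.
Proof.
intros Ha. assert (S := upper_pos a). assert (S' := upper_ge a).
assert (H := Q_pos a). assert (H1 := Q_ge a). assert (H2 := ba2_pos a).
assert (X : 0 <= (8 * alpha * beta * a + 64 * beta ^ 2 * a ^ 3) / Q a <= 16 * beta * a).
{ replace (8 * alpha * beta * a + 64 * beta ^ 2 * a ^ 3) with (a * (8 * (alpha * beta) + 64 * (beta * (beta * a ^ 2)))) by ring.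
  assert (0 <= alpha * beta) by nra. assert (0 <= beta * (beta * a ^ 2)) by nra.
  split; [apply Rdiv_le_0_compat; [|exact H]|].
  - apply Rmult_le_pos; lra.
  - apply Rmult_le_reg_r with (Q a); [exact H|]. unfold Rdiv. rewrite Rmult_assoc, Rinv_l, Rmult_1_r by lra.
    assert (16 * beta * (alpha + 4 * (beta * a ^ 2)) <= 16 * beta * Q a) by (apply Rmult_le_compat_l; lra).
    replace (16 * beta * a * Q a) with (a * (16 * beta * Q a)) by ring.
    apply Rmult_le_compat_l; [exact Ha|]. nra. }
unfold dupper. set (Y := _ / Q a) in *.
unfold Rdiv. rewrite Rabs_mult, (Rabs_pos_eq (/ _)).
2:{ left; apply Rinv_0_lt_compat. nra. }
apply Rmult_le_reg_r with (4 * beta * up a); [nra|].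
rewrite Rmult_assoc, Rinv_l, Rmult_1_r by nra.
assert (0 <= beta * a) by nra.
rewrite Rabs_pos_eq by nra. nra.
Qed.

(** On the sector |n| <= m the real part is decreasing in n^2, so the exponential keeps decaying in
time when the point moves towards the real axis. *)
Lemma Re_omega_sector (m n v : R) : 0 <= Re (omega alpha beta (m, n)) -> n ^ 2 <= m ^ 2 -> 0 <= v <= 1 ->
  0 <= Re (omega alpha beta (m, v * n)).
Proof.
rewrite !Re_omega_eq. intros H Hn Hv.
assert (V : 0 <= v ^ 2 <= 1) by nra.
replace ((v * n) ^ 2) with (v ^ 2 * n ^ 2) by ring.
replace ((v * n) ^ 4) with ((v ^ 2 * n ^ 2) ^ 2) by ring.
replace (m ^ 4) with ((m ^ 2) ^ 2) in * by ring. replace (n ^ 4) with ((n ^ 2) ^ 2) in * by ring.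
assert (M0 := pow2_ge_0 m). assert (N0 := pow2_ge_0 n).
set (X := m ^ 2) in *. set (Y := n ^ 2) in *. set (W := v ^ 2) in *.
assert (0 <= alpha * (Y - W * Y)) by (apply Rmult_le_pos; nra).
assert (Z : 0 <= Y - W * Y) by nra.
assert (0 <= (Y - W * Y) * (6 * X - Y - W * Y)) by (apply Rmult_le_pos; nra).
assert (0 <= beta * ((Y - W * Y) * (6 * X - Y - W * Y))) by (apply Rmult_le_pos; lra).
nra.
Qed.

(** In a sector around the real axis the real quartic term dominates. *)
Lemma Re_omega_flat (m n : R) : 0 <= m -> Rabs n <= m / 3 -> beta * m ^ 4 / 3 <= Re (omega alpha beta (m, n)).
Proof.
rewrite Re_omega_eq. intros Hm Hn.
assert (Y : n ^ 2 <= m ^ 2 / 9).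
{ rewrite <- (pow2_abs n). replace (m ^ 2 / 9) with ((m / 3) ^ 2) by field.
  apply pow_incr; split; [apply Rabs_pos|exact Hn]. }
replace (m ^ 4) with ((m ^ 2) ^ 2) by ring. replace (n ^ 4) with ((n ^ 2) ^ 2) by ring.
assert (M0 := pow2_ge_0 m). assert (N0 := pow2_ge_0 n).
set (X := m ^ 2) in *. set (Z := n ^ 2) in *.
assert (0 <= alpha * (X - Z)) by (apply Rmult_le_pos; lra).
assert (X ^ 2 / 3 <= X ^ 2 - 6 * X * Z + Z ^ 2) by nra.
assert (beta * (X ^ 2 / 3) <= beta * (X ^ 2 - 6 * X * Z + Z ^ 2)) by (apply Rmult_le_compat_l; lra).
lra.
Qed.

End Curves.

(** * From the boundary curves to the real axis *)

Lemma Cmod_Cexp z : Cmod (Cexp z) = exp (Re z).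
Proof.
unfold Cmod, Cexp; cbn [fst snd].
replace ((exp (Re z) * cos (Im z)) ^ 2 + (exp (Re z) * sin (Im z)) ^ 2) with (Rsqr (exp (Re z))).
- apply sqrt_Rsqr. left; apply exp_pos.
- generalize (sin2_cos2 (Im z)). unfold Rsqr. nra.
Qed.

Lemma Cmod_pair_le (a b : R) : Cmod (a, b) <= Rabs a + Rabs b.
Proof.
replace ((a, b) : C) with (RtoC a + Ci * RtoC b)%C by (apply injective_projections; simpl; ring).
eapply Rle_trans; [apply Cmod_triangle|]. rewrite Cmod_mult, Cmod_Ci, !Cmod_R. lra.
Qed.

Lemma Im_Ci z : Im (Ci * z)%C = Re z.
Proof. unfold Im, Re; simpl; ring. Qed.

Lemma Re_Ci z : Re (Ci * z)%C = - Im z.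
Proof. unfold Im, Re; simpl; ring. Qed.

Lemma exp_le_compat u v : u <= v -> exp u <= exp v.
Proof. intros [H| ->]; [left; apply exp_increasing, H|lra]. Qed.

Lemma exp_mult_INR n z : exp (INR n * z) = exp z ^ n.
Proof.
induction n as [|n IH]; [simpl; rewrite Rmult_0_l; apply exp_0|].
rewrite S_INR, Rmult_plus_distr_r, exp_plus, IH. simpl. rewrite Rmult_1_l. ring.
Qed.

(** The inequality exp z >= 1 + z, rescaled and raised to the power n + 2. *)
Lemma exp_dominates_poly (k : R) (n : nat) : 0 < k ->
  exists M, 0 <= M /\ forall a, 0 <= a -> (1 + a) ^ n * exp (- (k * a)) <= M * / (1 + a) ^ 2.
Proof.
intros Hk. set (m := S (S n)).
assert (Hm : 0 < INR m) by (apply lt_0_INR; unfold m; lia).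
set (L := INR m / k). assert (HL : 0 < L) by (apply Rdiv_lt_0_compat; assumption).
exists (L ^ m * exp k). split.
{ apply Rmult_le_pos; [apply pow_le; lra|left; apply exp_pos]. }
intros a Ha.
assert (A : (1 + a) <= L * exp ((1 + a) / L)).
{ assert (E := exp_ineq1_le ((1 + a) / L)).
  assert ((1 + a) = L * ((1 + a) / L)) by (field; lra).
  assert (L * ((1 + a) / L) <= L * exp ((1 + a) / L)) by (apply Rmult_le_compat_l; lra). lra. }
assert (B : (1 + a) ^ m <= L ^ m * exp (k * (1 + a))).
{ eapply Rle_trans; [apply pow_incr; split; [|exact A]; lra|].
  rewrite Rpow_mult_distr, <- exp_mult_INR. right. do 2 f_equal. unfold L. field. split; lra. }
assert (P2 : 0 < (1 + a) ^ 2) by (apply pow_lt; lra).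
apply Rmult_le_reg_r with ((1 + a) ^ 2); [exact P2|].
rewrite (Rmult_assoc _ (/ _)), Rinv_l, Rmult_1_r by lra.
replace ((1 + a) ^ n * exp (- (k * a)) * (1 + a) ^ 2) with ((1 + a) ^ m * exp (- (k * a))) by (unfold m; simpl; ring).
apply Rle_trans with (L ^ m * exp (k * (1 + a)) * exp (- (k * a))).
- apply Rmult_le_compat_r; [left; apply exp_pos|exact B].
- rewrite Rmult_assoc, <- exp_plus. right. do 2 f_equal. ring.
Qed.

(** The root in the closed first quadrant. It is continuous everywhere, and it is the principal root
on the closed upper half-plane, which contains the values met along the right halves of the curves.
The upper curve starts at a zero of the argument, on the boundary of the domain where [Csqrt] is
continuous. *)
Definition csq (z : C) : C := (sqrt ((Cmod z + Re z) / 2), sqrt ((Cmod z - Re z) / 2)).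

Lemma csq_Csqrt z : 0 <= Im z -> Csqrt z = csq z.
Proof.
intros H; unfold Csqrt, csq. destruct (Rle_dec 0 (Im z)) as [L|L]; [|contradiction].
f_equal. apply Rmult_1_l.
Qed.

Lemma ccont_csq {T : UniformSpace} (f : T -> C) p : ccont f p -> ccont (fun q => csq (f q)) p.
Proof. intros H; unfold csq; ctac; lra. Qed.

Section Deformation.
Context (alpha beta x : R) (ha : 0 < alpha) (hb : 0 < beta) (hx : 0 < x).

Notation c2 := (alpha / beta).
Notation om := (omega alpha beta).
Notation lw := (lower alpha beta).
Notation up := (upper alpha beta).
Notation dlw := (dlower alpha beta).
Notation dup := (dupper alpha beta).

Definition sqarg (l : C) : C := (l ^ 2 + RtoC c2)%C.
Definition sq (l : C) : C := Csqrt (sqarg l).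

Lemma sq_sq l : (sq l * sq l)%C = sqarg l.
Proof. apply Csqrt_sq. Qed.

(** A star-shaped neighbourhood of the real axis containing the sectors |Im| <= |Re|, where both
deformations take place. On it [sq] is holomorphic, and 2 l^2 + alpha / beta, the product of the
denominators that occur, does not vanish. *)
Definition region (z : C) : Prop := - (c2 / 2) < Re (z ^ 2)%C.

Lemma region_open z : region z -> locally (T := C_UniformSpace) z region.
Proof.
intros H.
assert (A : continuous (fun w : C_UniformSpace => Re (w ^ 2)%C) z).
{ apply cont_Re, ccont_pow, continuous_id. }
apply (A (fun r => - (c2 / 2) < r)).
exists (mkposreal _ (proj2 (Rlt_0_minus _ _) H)). intros r Hr. change (Rabs (r - Re (z ^ 2)%C) < Re (z ^ 2)%C - - (c2 / 2)) in Hr.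
apply Rabs_def2 in Hr. lra.
Qed.

Lemma region_star z s : region z -> 0 <= s <= 1 -> region (RtoC s * z)%C.
Proof.
unfold region. intros H Hs. assert (C0 := c2_pos alpha beta ha hb).
replace (Re ((RtoC s * z) ^ 2)%C) with (s ^ 2 * Re (z ^ 2)%C) by (unfold Re; simpl; ring).
assert (W : 0 <= s ^ 2 <= 1) by nra. set (X := Re (z ^ 2)%C) in *. set (v := s ^ 2) in *.
destruct (Rle_dec 0 X); nra.
Qed.

Lemma Re_sqr (m n : R) : Re ((m, n) ^ 2)%C = m ^ 2 - n ^ 2.
Proof. unfold Re; simpl; ring. Qed.

Lemma region_sector (m n : R) : n ^ 2 <= m ^ 2 -> region (m, n).
Proof. intros H; unfold region. rewrite Re_sqr. generalize (c2_pos alpha beta ha hb). lra. Qed.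

Lemma region_real (r : R) : region (RtoC r).
Proof. apply region_sector. replace (0 ^ 2) with 0 by ring. apply pow2_ge_0. Qed.

Lemma region_sqarg z : region z -> 0 < Re (sqarg z).
Proof.
unfold region, sqarg. intros H. replace (Re (z ^ 2 + RtoC c2)%C) with (Re (z ^ 2)%C + c2) by reflexivity.
generalize (c2_pos alpha beta ha hb). lra.
Qed.

Lemma region_prod z : region z -> (2 * z ^ 2 + RtoC c2)%C <> RtoC 0.
Proof.
unfold region. intros H E. apply (f_equal Re) in E.
replace (Re (2 * z ^ 2 + RtoC c2)%C) with (2 * Re (z ^ 2)%C + c2) in E by (unfold Re; simpl; ring).
change (Re (RtoC 0)) with 0 in E. lra.
Qed.

Lemma holo_sq : holo region sq.
Proof.
apply (holo_Csqrt region sqarg); [|apply region_sqarg].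
apply holo_plus; [apply (holo_pow region (fun z => z)), holo_id|apply holo_const].
Qed.

Lemma sq_neq0 z : region z -> sq z <> RtoC 0.
Proof. intros H; apply Csqrt_neq0, region_sqarg, H. Qed.

(** The pairs (l, s) met on either contour. In the variable m = i rho(l) that serves the upper curve
the root is s = i m, obtained without extracting a root; hence a predicate on pairs. *)
Definition admissible (l s : C) : Prop :=
  0 <= Im l /\ 0 <= Re s /\ (s * s)%C = (l ^ 2 + RtoC c2)%C /\ c2 <= Cmod (2 * l ^ 2 + RtoC c2)%C.

Lemma Re_le_Cmod_abs z M : M <= Rabs (Re z) -> M <= Cmod z.
Proof. intros H; eapply Rle_trans; [exact H|apply re_le_Cmod]. Qed.

(** Both boundary curves and the lower sector are covered. *)
Lemma admissible_root (m n : R) : 0 <= n -> n ^ 2 <= m ^ 2 \/ m ^ 2 + c2 <= n ^ 2 ->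
  admissible (m, n) (sq (m, n)).
Proof.
intros Hn H. assert (C0 := c2_pos alpha beta ha hb).
split; [exact Hn|split; [apply Csqrt_Re_nonneg|split; [apply sq_sq|]]].
apply Re_le_Cmod_abs.
replace (Re (2 * (m, n) ^ 2 + RtoC c2)%C) with (2 * (m ^ 2 - n ^ 2) + c2) by (unfold Re; simpl; ring).
destruct H; [rewrite Rabs_pos_eq|rewrite Rabs_left]; lra.
Qed.

(** The change of variable l = i sq(m), for which s = i m. *)
Lemma admissible_dual (m n : R) : n <= 0 -> n ^ 2 <= m ^ 2 ->
  admissible (Ci * sq (m, n))%C (Ci * (m, n))%C.
Proof.
intros Hn H. assert (C0 := c2_pos alpha beta ha hb).
assert (S := sq_sq (m, n)). assert (R0 := Csqrt_Re_nonneg (sqarg (m, n))). fold (sq (m, n)) in R0.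
assert (E : ((Ci * sq (m, n)) ^ 2)%C = (- sqarg (m, n))%C).
{ rewrite <- S. replace (- (sq (m, n) * sq (m, n)))%C with ((Ci * Ci) * (sq (m, n) * sq (m, n)))%C.
  - ring.
  - replace (Ci * Ci)%C with (- RtoC 1)%C by (apply injective_projections; simpl; ring). ring. }
split; [|split; [|split]].
- rewrite Im_Ci; exact R0.
- rewrite Re_Ci; change (0 <= - n); lra.
- rewrite E. unfold sqarg. apply injective_projections; simpl; ring.
- rewrite E. apply Re_le_Cmod_abs.
  replace (Re (2 * - sqarg (m, n) + RtoC c2)%C) with (- (2 * (m ^ 2 - n ^ 2) + c2)) by (unfold sqarg, Re; simpl; ring).
  rewrite Rabs_Ropp, Rabs_pos_eq; lra.
Qed.

Lemma root_bound (l s : C) : (s * s)%C = (l ^ 2 + RtoC c2)%C -> Cmod s <= Cmod l + 1 + c2.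
Proof.
intros E. apply (f_equal Cmod) in E. rewrite Cmod_mult in E.
assert (T := Cmod_triangle (l ^ 2) (RtoC c2)). rewrite Cmod_R, Cmod_pow in T.
assert (C0 := c2_pos alpha beta ha hb). rewrite (Rabs_pos_eq c2) in T by lra.
generalize (Cmod_ge_0 l) (Cmod_ge_0 s). intros.
destruct (Rle_dec (Cmod s) (Cmod l + 1 + c2)) as [L|L]; [exact L|]. nra.
Qed.

(** What the deformations need to know of an amplitude [H y l s], where [s] stands for the root of
l^2 + alpha / beta and [y >= 0] is a position in the source. [amp_holo] serves the lower curve and
[amp_dual] the upper one, after the substitution l = i sq(m). *)
Record amplitude (H : R -> C -> C -> C) (B : R) : Prop := {
  amp_holo : forall y, holo region (fun l => H y l (sq l));
  amp_dual : forall y, holo region (fun m => H y (Ci * sq m)%C (Ci * m)%C);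
  amp_bound : forall y l s, 0 <= y -> admissible l s -> Cmod (H y l s) <= B * (1 + Cmod l) ^ 3;
  amp_cont : forall (T : UniformSpace) (y : T -> R) (f g : T -> C) p,
    continuous y p -> ccont f p -> ccont g p -> admissible (f p) (g p) ->
    ccont (fun q => H (y q) (f q) (g q)) p }.

(** The elementary wave of frequency [l] at position [x], after a delay [th]. *)
Definition Ek (th : R) (l : C) : C := Cexp (Ci * l * RtoC x - om l * RtoC th)%C.

Lemma Cmod_Ek th l : Cmod (Ek th l) = exp (- (x * Im l) - Re (om l) * th).
Proof. unfold Ek; rewrite Cmod_Cexp. f_equal. generalize (om l); intros z. unfold Re, Im; simpl; ring. Qed.

Lemma ccont_Ek {T : UniformSpace} (th : T -> R) (f : T -> C) p :
  continuous th p -> ccont f p -> ccont (fun q => Ek (th q) (f q)) p.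
Proof. intros; unfold Ek, omega; ctac. Qed.

Lemma holo_Ek th F : holo region F -> holo region (fun z => Ek th (F z)).
Proof.
intros H. apply holo_Cexp. apply holo_minus.
- apply holo_mult; [|apply holo_const]. apply holo_mult; [apply holo_const|exact H].
- apply holo_mult; [|apply holo_const]. unfold omega.
  apply holo_plus; (apply holo_mult; [apply holo_const|apply holo_pow, H]).
Qed.

(** The integrand along the right half of the graph of [b]; [csq] keeps it continuous up to the
start of the curve. *)
Definition curve_kernel (b db : R -> R) (H : R -> C -> C -> C) (th y a : R) : C :=
  (Ek th (a, b a) * H y (a, b a) (csq (sqarg (a, b a))) * (1, db a))%C.

Definition low_kernel := curve_kernel lw dlw.
Definition up_kernel := curve_kernel up dup.

Lemma Im_sqarg (m n : R) : Im (sqarg (m, n)) = 2 * m * n.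
Proof. unfold sqarg, Im; simpl; ring. Qed.

Lemma sq_csq (m n : R) : 0 <= m -> 0 <= n -> sq (m, n) = csq (sqarg (m, n)).
Proof. intros; apply csq_Csqrt. rewrite Im_sqarg. apply Rmult_le_pos; nra. Qed.

Lemma lower_sector a : 0 <= a -> 0 <= lw a /\ lw a ^ 2 <= a ^ 2.
Proof.
intros Ha. assert (B := lower_bounds alpha beta ha hb a Ha). split; [lra|].
apply pow_incr; lra.
Qed.

Lemma upper_beyond a : a ^ 2 + c2 <= up a ^ 2.
Proof.
replace (up a ^ 2) with (up a * up a) by ring.
generalize (upper_sq_bounds alpha beta ha hb a) (pow2_ge_0 a). lra.
Qed.

Lemma adm_lower a : 0 <= a -> admissible (a, lw a) (csq (sqarg (a, lw a))).
Proof.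
intros Ha. destruct (lower_sector a Ha) as [H1 H2].
rewrite <- sq_csq by assumption. apply admissible_root; auto.
Qed.

Lemma adm_upper a : 0 <= a -> admissible (a, up a) (csq (sqarg (a, up a))).
Proof.
intros Ha. assert (U := upper_pos alpha beta ha hb a).
rewrite <- sq_csq by lra. apply admissible_root; [lra|right; apply upper_beyond].
Qed.

Section Amplitude.
Context (H : R -> C -> C -> C) (B : R) (HH : amplitude H B).

Lemma curve_kernel_cont (b db : R -> R) {T : UniformSpace} (th y a : T -> R) p :
  (forall (a : T -> R) p, continuous a p -> continuous (fun q => b (a q)) p) ->
  (forall (a : T -> R) p, continuous a p -> continuous (fun q => db (a q)) p) ->
  (forall a, 0 <= a -> admissible (a, b a) (csq (sqarg (a, b a)))) ->
  continuous th p -> continuous y p -> continuous a p ->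
  ccont (fun q => curve_kernel b db H (th q) (y q) (Rabs (a q))) p.
Proof.
intros Cb Cdb Ad Hth Hy Ha. unfold curve_kernel.
assert (A : continuous (fun q => Rabs (a q)) p) by ctac.
assert (L : ccont (fun q => (Rabs (a q), b (Rabs (a q))) : C) p).
{ apply ccont_pair; [exact A|apply Cb, A]. }
apply ccont_mult; [apply ccont_mult|].
- apply ccont_Ek; assumption.
- apply (amp_cont _ _ HH); [exact Hy|exact L| |apply Ad, Rabs_pos].
  apply ccont_csq. unfold sqarg. ctac.
- apply ccont_pair; [apply continuous_const|apply Cdb, A].
Qed.

Lemma low_kernel_cont {T : UniformSpace} (th y a : T -> R) p :
  continuous th p -> continuous y p -> continuous a p ->
  ccont (fun q => low_kernel H (th q) (y q) (Rabs (a q))) p.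
Proof.
apply curve_kernel_cont.
- intros; apply cont_lower; assumption.
- intros; apply cont_dlower; assumption.
- apply adm_lower.
Qed.

Lemma up_kernel_cont {T : UniformSpace} (th y a : T -> R) p :
  continuous th p -> continuous y p -> continuous a p ->
  ccont (fun q => up_kernel H (th q) (y q) (Rabs (a q))) p.
Proof.
apply curve_kernel_cont.
- intros; apply cont_upper; assumption.
- intros; apply cont_dupper; assumption.
- apply adm_upper.
Qed.

Lemma amp_B_pos : 0 <= B.
Proof.
assert (A := amp_bound _ _ HH 0 _ _ (Rle_refl 0) (adm_lower 0 (Rle_refl 0))).
assert (C0 := Cmod_ge_0 (0, lw 0)). assert (C1 := Cmod_ge_0 (H 0 (0, lw 0) (csq (sqarg (0, lw 0))))).
assert (0 < (1 + Cmod (0, lw 0)) ^ 3) by (apply pow_lt; lra). nra.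
Qed.

(** On the curves the exponential does not decay in time, but its decay in [x] along the curve is
exponential because the curve recedes from the real axis. *)
Lemma curve_kernel_bound (b db : R -> R) th y a :
  0 <= y -> 0 <= a -> admissible (a, b a) (csq (sqarg (a, b a))) ->
  Re (om (a, b a)) = 0 -> 2 / 5 * a <= b a -> Rabs (b a) <= 1 + c2 + 3 * a -> Rabs (db a) <= 8 ->
  Cmod (curve_kernel b db H th y a) <=
    B * (9 * (4 + c2) ^ 3) * ((1 + a) ^ 3 * exp (- ((2 / 5 * x) * a))).
Proof.
intros Hy Ha Ad Hre Hb1 Hb2 Hdb. assert (C0 := c2_pos alpha beta ha hb).
unfold curve_kernel. rewrite !Cmod_mult, Cmod_Ek, Hre.
assert (A1 : exp (- (x * Im (a, b a)) - 0 * th) <= exp (- (2 / 5 * x * a))).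
{ apply exp_le_compat. unfold Im; simpl. nra. }
assert (A2 := amp_bound _ _ HH y _ _ Hy Ad).
assert (A3 : Cmod (1, db a) <= 9).
{ eapply Rle_trans; [apply Cmod_pair_le|]. rewrite Rabs_R1. lra. }
assert (A4 : (1 + Cmod (a, b a)) ^ 3 <= ((4 + c2) * (1 + a)) ^ 3).
{ apply pow_incr. assert (L := Cmod_pair_le a (b a)). rewrite (Rabs_pos_eq a) in L by exact Ha.
  assert (M := Cmod_ge_0 (a, b a)). split; [lra|]. nra. }
rewrite Rpow_mult_distr in A4.
assert (Bp := amp_B_pos).
assert (A5 : Cmod (H y (a, b a) (csq (sqarg (a, b a)))) <= B * ((4 + c2) ^ 3 * (1 + a) ^ 3)).
{ eapply Rle_trans; [exact A2|]. apply Rmult_le_compat_l; assumption. }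
eapply Rle_trans; [apply Rmult_le_compat; [|apply Cmod_ge_0| |exact A3]|].
- apply Rmult_le_pos; [left; apply exp_pos|apply Cmod_ge_0].
- apply Rmult_le_compat; [left; apply exp_pos|apply Cmod_ge_0|exact A1|exact A5].
- right; ring.
Qed.

Lemma low_kernel_bound th y a : 0 <= y -> 0 <= a ->
  Cmod (low_kernel H th y a) <= B * (9 * (4 + c2) ^ 3) * ((1 + a) ^ 3 * exp (- ((2 / 5 * x) * a))).
Proof.
intros Hy Ha. assert (C0 := c2_pos alpha beta ha hb).
assert (L := lower_bounds alpha beta ha hb a Ha).
apply curve_kernel_bound; [exact Hy|exact Ha|apply adm_lower, Ha|apply Re_omega_lower; assumption|apply L| |].
- rewrite Rabs_pos_eq; lra.
- eapply Rle_trans; [apply dlower_bound; assumption|lra].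
Qed.

Lemma up_kernel_bound th y a : 0 <= y -> 0 <= a ->
  Cmod (up_kernel H th y a) <= B * (9 * (4 + c2) ^ 3) * ((1 + a) ^ 3 * exp (- ((2 / 5 * x) * a))).
Proof.
intros Hy Ha. assert (C0 := c2_pos alpha beta ha hb).
assert (L := upper_sq_bounds alpha beta ha hb a). assert (U := upper_pos alpha beta ha hb a).
assert (G := upper_ge alpha beta ha hb a).
apply curve_kernel_bound; [exact Hy|exact Ha|apply adm_upper, Ha|apply Re_omega_upper; assumption|lra| |].
- rewrite Rabs_pos_eq by lra. destruct (Rle_dec (up a) (1 + c2 + 3 * a)) as [K|K]; [exact K|]. nra.
- eapply Rle_trans; [apply dupper_bound; assumption|lra].
Qed.

Definition real_low (th y : R) (l : C) : C := (Ek th l * H y l (sq l))%C.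
(** The integrand over the upper curve in the variable m = i rho(l), that is l = i sq(m) and dl = i
m / sq(m) dm. *)
Definition real_up (th y : R) (m : C) : C :=
  (Ek th (Ci * sq m) * H y (Ci * sq m) (Ci * m) * (Ci * m / sq m))%C.

Lemma holo_real_low th y : holo region (real_low th y).
Proof.
apply holo_mult; [apply (holo_Ek th (fun z => z)), holo_id|apply (amp_holo _ _ HH)].
Qed.

Lemma holo_real_up th y : holo region (real_up th y).
Proof.
apply holo_mult; [apply holo_mult|].
- apply (holo_Ek th (fun m => (Ci * sq m)%C)). apply holo_mult; [apply holo_const|apply holo_sq].
- apply (amp_dual _ _ HH).
- apply holo_div; [apply holo_mult; [apply holo_const|apply holo_id]|apply holo_sq|apply sq_neq0].
Qed.

Lemma holo_real_cont F (r : R) : holo region F -> ccont (fun r : R => F (RtoC r)) r.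
Proof.
intros [F' [F1 _]]. apply (continuous_comp (fun r : R => RtoC r : C_UniformSpace) F).
- apply (ccont_RtoC (fun r : R => r)). apply continuous_id.
- apply F1, region_real.
Qed.

(** omega(l) = beta l^2 (l^2 + alpha / beta) depends only on the product of l^2 and s^2, and the
substitution replaces l^2 by -s^2 and s^2 by -l^2. *)
Lemma om_dual m : om (Ci * sq m)%C = om m.
Proof.
assert (E : ((Ci * sq m) ^ 2)%C = (- (m ^ 2 + RtoC c2))%C).
{ change (m ^ 2 + RtoC c2)%C with (sqarg m). rewrite <- (sq_sq m).
  replace (- (sq m * sq m))%C with ((Ci * Ci) * (sq m * sq m))%C; [ring|].
  replace (Ci * Ci)%C with (- RtoC 1)%C by (apply injective_projections; simpl; ring). ring. }
unfold omega.
replace ((Ci * sq m) ^ 4)%C with (((Ci * sq m) ^ 2) ^ 2)%C by ring.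
rewrite E. unfold Rdiv. rewrite RtoC_mult, RtoC_inv by lra.
field. intros A; apply RtoC_inj in A; lra.
Qed.

Lemma sq_bounds (m n : R) : 0 <= m -> n ^ 2 <= m ^ 2 ->
  m / 2 <= Re (sq (m, n)) /\ Cmod (m, n) <= Cmod (sq (m, n)) /\
  Cmod (sq (m, n)) <= Cmod (m, n) + 1 + c2.
Proof.
intros Hm Hn. assert (C0 := c2_pos alpha beta ha hb).
assert (S := sq_sq (m, n)). assert (R0 := Csqrt_Re_nonneg (sqarg (m, n))). fold (sq (m, n)) in R0.
set (w := sq (m, n)) in *.
assert (E1 : Re w * Re w - Im w * Im w = m ^ 2 - n ^ 2 + c2).
{ change (Re (w * w)%C = m ^ 2 - n ^ 2 + c2). rewrite S. unfold sqarg, Re; simpl; ring. }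
assert (E2 : Cmod w * Cmod w = Re w * Re w + Im w * Im w) by apply Cmod_sq.
assert (E3 : Cmod (m, n) * Cmod (m, n) = m ^ 2 + n ^ 2).
{ rewrite Cmod_sq. unfold Re, Im; simpl; ring. }
assert (E4 : (Cmod w * Cmod w) ^ 2 = (m ^ 2 - n ^ 2 + c2) ^ 2 + (2 * m * n) ^ 2).
{ rewrite <- Cmod_mult, S, Cmod2_alt. rewrite Im_sqarg. f_equal. f_equal. unfold sqarg, Re; simpl; ring. }
assert (G1 := Cmod_ge_0 w). assert (G2 := Cmod_ge_0 (m, n)).
assert (E5 : Cmod (m, n) * Cmod (m, n) <= Cmod w * Cmod w).
{ rewrite E3. assert (0 <= Cmod w * Cmod w) by nra.
  assert ((m ^ 2 + n ^ 2) ^ 2 <= (Cmod w * Cmod w) ^ 2).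
  { rewrite E4. assert (0 <= c2 * (m ^ 2 - n ^ 2)) by (apply Rmult_le_pos; lra). nra. }
  assert (0 <= m ^ 2 + n ^ 2) by nra. nra. }
split; [|split].
- nra.
- nra.
- apply root_bound. exact S.
Qed.

(** Far from the real axis the integrand decays through exp (i l x), close to it through exp (-
omega t). *)
Lemma real_low_segment th y : 0 < th -> 0 <= y -> exists K, forall m n v, 0 <= m -> 0 <= n -> n ^ 2 <= m ^ 2 ->
  0 <= Re (om (m, n)) -> 0 <= v <= 1 ->
  Cmod (real_low th y (m, v * n)) * Rabs n <= K * / (1 + m).
Proof.
intros Hth Hy. assert (Bp := amp_B_pos).
set (k := Rmin (x / 3) (4 * beta * th / 3)).
assert (Hk : 0 < k) by (apply Rmin_pos; [lra|apply Rdiv_lt_0_compat; [nra|lra]]).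
destruct (exp_dominates_poly k 4 Hk) as [M [HM0 HM]].
exists (8 * B * exp (beta * th) * M). intros m n v Hm Hn Hnm Hre Hv.
assert (Hnm' : n <= m) by (destruct (Rle_dec n m); [assumption|nra]).
assert (Hvn : 0 <= v * n <= n) by nra.
assert (Hvm : (v * n) ^ 2 <= m ^ 2) by (apply pow_incr; lra).
(* the two regimes are separated by the height m / 3 *)
assert (A1 : Cmod (Ek th (m, v * n)) <= exp (beta * th) * exp (- (k * m))).
{ rewrite Cmod_Ek, <- exp_plus. apply exp_le_compat. unfold Im; cbn [snd].
  assert (W := Re_omega_sector alpha beta ha hb m n v Hre Hnm Hv).
  assert (K1 := Rmin_l (x / 3) (4 * beta * th / 3)). assert (K2 := Rmin_r (x / 3) (4 * beta * th / 3)). fold k in K1, K2.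
  assert (0 < beta * th) by nra.
  destruct (Rle_dec (v * n) (m / 3)) as [L|L].
  - assert (F := Re_omega_flat alpha beta ha hb m (v * n) Hm ltac:(rewrite Rabs_pos_eq; lra)).
    assert (F2 : beta * m ^ 4 / 3 * th <= Re (om (m, v * n)) * th) by (apply Rmult_le_compat_r; lra).
    assert (F3 : 4 * m - 3 <= m ^ 4).
    { assert (0 <= (m - 1) ^ 2 * (m ^ 2 + 2 * m + 3)) by (apply Rmult_le_pos; [apply pow2_ge_0|assert (0 <= m ^ 2) by apply pow2_ge_0; lra]). lra. }
    assert (F4 : beta * th / 3 * (4 * m - 3) <= beta * th / 3 * m ^ 4) by (apply Rmult_le_compat_l; lra).
    assert (k * m <= 4 * beta * th / 3 * m) by (apply Rmult_le_compat_r; lra).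
    assert (0 <= x * (v * n)) by nra. nra.
  - assert (0 <= Re (om (m, v * n)) * th) by nra.
    assert (k * m <= x / 3 * m) by (apply Rmult_le_compat_r; lra).
    assert (x * (m / 3) <= x * (v * n)) by (apply Rmult_le_compat_l; lra). nra. }
assert (Ad := admissible_root m (v * n) ltac:(lra) (or_introl Hvm)).
assert (A2 := amp_bound _ _ HH y _ _ Hy Ad).
assert (A3 : (1 + Cmod (m, (v * n)%R)) ^ 3 <= (2 * (1 + m)) ^ 3).
{ apply pow_incr. assert (L := Cmod_pair_le m (v * n)). rewrite !Rabs_pos_eq in L by lra.
  assert (Z := Cmod_ge_0 (m, (v * n)%R)). lra. }
assert (A4 : Cmod (H y (m, (v * n)%R) (sq (m, (v * n)%R))) <= B * (8 * (1 + m) ^ 3)).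
{ eapply Rle_trans; [exact A2|]. apply Rmult_le_compat_l; [exact Bp|]. eapply Rle_trans; [exact A3|].
  right; ring. }
unfold real_low. rewrite Cmod_mult, (Rabs_pos_eq n) by exact Hn.
apply Rle_trans with (exp (beta * th) * exp (- (k * m)) * (B * (8 * (1 + m) ^ 3)) * (1 + m)).
- apply Rmult_le_compat; [|exact Hn| |lra].
  + apply Rmult_le_pos; apply Cmod_ge_0.
  + apply Rmult_le_compat; try apply Cmod_ge_0; assumption.
- replace (exp (beta * th) * exp (- (k * m)) * (B * (8 * (1 + m) ^ 3)) * (1 + m)) with
    (8 * B * exp (beta * th) * ((1 + m) ^ 4 * exp (- (k * m)))) by ring.
  rewrite (Rmult_assoc _ M). assert (0 < exp (beta * th)) by apply exp_pos.
  apply Rmult_le_compat_l; [nra|].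
  eapply Rle_trans; [apply HM, Hm|]. apply Rmult_le_compat_l; [exact HM0|].
  apply Rinv_le_contravar; [lra|]. nra.
Qed.

(** In the variable m the spatial exponential is exp (- sq(m) x), which decays in the whole sector.
*)
Lemma real_up_bound th y : 0 <= th -> 0 <= y -> forall m n, 0 <= m -> n <= 0 -> n ^ 2 <= m ^ 2 ->
  0 <= Re (om (m, n)) ->
  Cmod (real_up th y (m, n)) <= B * (4 + c2) ^ 3 * (1 + m) ^ 3 * exp (- (x / 2 * m)).
Proof.
intros Hth Hy m n Hm Hn Hnm Hre. assert (Bp := amp_B_pos). assert (C0 := c2_pos alpha beta ha hb).
destruct (sq_bounds m n Hm Hnm) as [S1 [S2 S3]].
assert (A1 : Cmod (Ek th (Ci * sq (m, n))%C) <= exp (- (x / 2 * m))).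
{ rewrite Cmod_Ek. apply exp_le_compat. rewrite om_dual.
  rewrite Im_Ci.
  assert (0 <= Re (om (m, n)) * th) by nra.
  assert (x * (m / 2) <= x * Re (sq (m, n))) by (apply Rmult_le_compat_l; lra). lra. }
assert (A2 := amp_bound _ _ HH y _ _ Hy (admissible_dual m n Hn Hnm)).
assert (Hmn : Cmod (m, n) <= 2 * m).
{ eapply Rle_trans; [apply Cmod_pair_le|]. rewrite Rabs_pos_eq, Rabs_left1 by lra.
  assert (- n <= m) by (destruct (Rle_dec (- n) m); [assumption|nra]). lra. }
assert (A3 : (1 + Cmod (Ci * sq (m, n))%C) ^ 3 <= ((4 + c2) * (1 + m)) ^ 3).
{ apply pow_incr. rewrite Cmod_mult, Cmod_Ci, Rmult_1_l. generalize (Cmod_ge_0 (sq (m, n))). split; [lra|]. nra. }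
rewrite Rpow_mult_distr in A3.
assert (A4 : Cmod (H y (Ci * sq (m, n))%C (Ci * (m, n))%C) <= B * ((4 + c2) ^ 3 * (1 + m) ^ 3)).
{ eapply Rle_trans; [exact A2|]. apply Rmult_le_compat_l; assumption. }
assert (N0 := sq_neq0 _ (region_sector m n Hnm)).
assert (A5 : Cmod (Ci * (m, n) / sq (m, n))%C <= 1).
{ rewrite Cmod_div, Cmod_mult, Cmod_Ci, Rmult_1_l by exact N0.
  assert (P0 := proj1 (Cmod_gt_0 _) N0).
  apply Rmult_le_reg_r with (Cmod (sq (m, n))); [exact P0|].
  unfold Rdiv. rewrite Rmult_assoc, Rinv_l, Rmult_1_r, Rmult_1_l by lra. exact S2. }
unfold real_up. rewrite !Cmod_mult.
apply Rle_trans with (exp (- (x / 2 * m)) * (B * ((4 + c2) ^ 3 * (1 + m) ^ 3)) * 1).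
- apply Rmult_le_compat; [|apply Cmod_ge_0| |exact A5].
  + apply Rmult_le_pos; apply Cmod_ge_0.
  + apply Rmult_le_compat; try apply Cmod_ge_0; assumption.
- right; ring.
Qed.

Lemma real_up_segment th y : 0 <= th -> 0 <= y -> exists K, forall m n v, 0 <= m -> n <= 0 -> n ^ 2 <= m ^ 2 ->
  0 <= Re (om (m, n)) -> 0 <= v <= 1 ->
  Cmod (real_up th y (m, v * n)) * Rabs n <= K * / (1 + m).
Proof.
intros Hth Hy. assert (Bp := amp_B_pos). assert (C0 := c2_pos alpha beta ha hb).
destruct (exp_dominates_poly (x / 2) 4 ltac:(lra)) as [M [HM0 HM]].
assert (HC : 0 <= B * (4 + c2) ^ 3) by (apply Rmult_le_pos; [exact Bp|apply pow_le; lra]).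
exists (B * (4 + c2) ^ 3 * M). intros m n v Hm Hn Hnm Hre Hv.
assert (W := Re_omega_sector alpha beta ha hb m n v Hre Hnm Hv).
assert (Hvn : v * n <= 0) by nra.
assert (Hvm : (v * n) ^ 2 <= m ^ 2).
{ replace ((v * n) ^ 2) with (v ^ 2 * n ^ 2) by ring. assert (0 <= v ^ 2 <= 1) by nra.
  generalize (pow2_ge_0 n). nra. }
assert (A := real_up_bound th y Hth Hy m (v * n) Hm Hvn Hvm W).
assert (Hn' : Rabs n <= 1 + m).
{ rewrite Rabs_left1 by lra. destruct (Rle_dec (- n) (1 + m)); [assumption|nra]. }
apply Rle_trans with (B * (4 + c2) ^ 3 * (1 + m) ^ 3 * exp (- (x / 2 * m)) * (1 + m)).
- apply Rmult_le_compat; [apply Cmod_ge_0|apply Rabs_pos|exact A|exact Hn'].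
- replace (B * (4 + c2) ^ 3 * (1 + m) ^ 3 * exp (- (x / 2 * m)) * (1 + m)) with
    (B * (4 + c2) ^ 3 * ((1 + m) ^ 4 * exp (- (x / 2 * m)))) by ring.
  rewrite (Rmult_assoc _ M). apply Rmult_le_compat_l; [exact HC|].
  eapply Rle_trans; [apply HM, Hm|]. apply Rmult_le_compat_l; [exact HM0|].
  apply Rinv_le_contravar; [lra|]. nra.
Qed.

Lemma Re_om_real (r : R) : Re (om (r, 0)) = alpha * r ^ 2 + beta * r ^ 4.
Proof. rewrite Re_omega_eq. ring. Qed.

Lemma Re_om_real_pos (r : R) : 0 <= Re (om (r, 0)).
Proof.
rewrite Re_om_real. assert (0 <= r ^ 2) by apply pow2_ge_0.
replace (r ^ 4) with ((r ^ 2) ^ 2) by ring. assert (0 <= (r ^ 2) ^ 2) by apply pow2_ge_0. nra.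
Qed.

Lemma gauss_exp_bound th r : 0 <= th -> exp (- (x * 0) - Re (om (r, 0)) * th) <= exp (alpha * th) * exp (- (2 * alpha * th * r)).
Proof.
intros Hth. rewrite <- exp_plus. apply exp_le_compat. rewrite Re_om_real.
assert (0 <= r ^ 2) by apply pow2_ge_0.
replace (r ^ 4) with ((r ^ 2) ^ 2) by ring. assert (0 <= (r ^ 2) ^ 2) by apply pow2_ge_0.
assert (2 * r - 1 <= r ^ 2) by (generalize (pow2_ge_0 (r - 1)); lra).
assert (0 <= beta * (r ^ 2) ^ 2 * th) by (apply Rmult_le_pos; nra).
assert (0 <= alpha * th) by nra.
assert (alpha * th * (2 * r - 1) <= alpha * th * r ^ 2) by (apply Rmult_le_compat_l; lra). nra.
Qed.

Lemma real_low_dom th y : 0 < th -> 0 <= y -> exists M, dom (fun r => real_low th y (RtoC r)) M.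
Proof.
intros Hth Hy. assert (Bp := amp_B_pos).
assert (Hk : 0 < 2 * alpha * th) by nra.
destruct (exp_dominates_poly (2 * alpha * th) 3 Hk) as [M [HM0 HM]].
exists (B * exp (alpha * th) * M). split; [intros r; apply holo_real_cont, holo_real_low|].
intros r Hr. unfold real_low. rewrite Cmod_mult, Cmod_Ek. change (RtoC r) with ((r, 0) : C).
assert (Hn : 0 ^ 2 <= r ^ 2) by (replace (0 ^ 2) with 0 by ring; apply pow2_ge_0).
assert (A2 := amp_bound _ _ HH y _ _ Hy (admissible_root r 0 (Rle_refl 0) (or_introl Hn))).
assert (E : Cmod (r, 0) = r).
{ change ((r, 0) : C) with (RtoC r). rewrite Cmod_R. apply Rabs_pos_eq, Hr. }
rewrite E in A2.
apply Rle_trans with (exp (alpha * th) * exp (- (2 * alpha * th * r)) * (B * (1 + r) ^ 3)).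
- apply Rmult_le_compat; [left; apply exp_pos|apply Cmod_ge_0|apply gauss_exp_bound; lra|exact A2].
- replace (exp (alpha * th) * exp (- (2 * alpha * th * r)) * (B * (1 + r) ^ 3)) with
    (B * exp (alpha * th) * ((1 + r) ^ 3 * exp (- (2 * alpha * th * r)))) by ring.
  rewrite (Rmult_assoc _ M). assert (0 < exp (alpha * th)) by apply exp_pos.
  apply Rmult_le_compat_l; [nra|]. apply HM, Hr.
Qed.

Lemma real_up_dom th y : 0 <= th -> 0 <= y -> exists M, dom (fun r => real_up th y (RtoC r)) M.
Proof.
intros Hth Hy. assert (Bp := amp_B_pos). assert (C0 := c2_pos alpha beta ha hb).
destruct (exp_dominates_poly (x / 2) 3 ltac:(lra)) as [M [HM0 HM]].
exists (B * (4 + c2) ^ 3 * M). split; [intros r; apply holo_real_cont, holo_real_up|].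
intros r Hr. assert (HC : 0 <= B * (4 + c2) ^ 3) by (apply Rmult_le_pos; [exact Bp|apply pow_le; lra]).
eapply Rle_trans; [apply (real_up_bound th y Hth Hy r 0 Hr (Rle_refl 0))|].
- replace (0 ^ 2) with 0 by ring; apply pow2_ge_0.
- apply Re_om_real_pos.
- rewrite (Rmult_assoc _ M), (Rmult_assoc (B * _)). apply Rmult_le_compat_l; [exact HC|]. apply HM, Hr.
Qed.

Lemma curve_kernel_dom (k : R -> C) :
  (forall a, ccont (fun a => k (Rabs a)) a) ->
  (forall a, 0 <= a -> Cmod (k a) <= B * (9 * (4 + c2) ^ 3) * ((1 + a) ^ 3 * exp (- ((2 / 5 * x) * a)))) ->
  exists M, dom (fun a => k (Rabs a)) M.
Proof.
intros Hc Hb. assert (Bp := amp_B_pos). assert (C0 := c2_pos alpha beta ha hb).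
destruct (exp_dominates_poly (2 / 5 * x) 3 ltac:(lra)) as [M [HM0 HM]].
exists (B * (9 * (4 + c2) ^ 3) * M). split; [exact Hc|].
intros a Ha. rewrite Rabs_pos_eq by exact Ha. eapply Rle_trans; [apply Hb, Ha|].
rewrite (Rmult_assoc _ M). apply Rmult_le_compat_l; [|apply HM, Ha].
apply Rmult_le_pos; [exact Bp|]. apply Rmult_le_pos; [lra|apply pow_le; lra].
Qed.

Lemma low_kernel_dom th y : 0 <= y -> exists M, dom (fun a => low_kernel H th y (Rabs a)) M.
Proof.
intros Hy; apply curve_kernel_dom.
- intros a. apply (low_kernel_cont (fun _ => th) (fun _ => y) (fun a => a)); ctac.
- intros a Ha; apply low_kernel_bound; assumption.
Qed.

Lemma up_kernel_dom th y : 0 <= y -> exists M, dom (fun a => up_kernel H th y (Rabs a)) M.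
Proof.
intros Hy; apply curve_kernel_dom.
- intros a. apply (up_kernel_cont (fun _ => th) (fun _ => y) (fun a => a)); ctac.
- intros a Ha; apply up_kernel_bound; assumption.
Qed.

(** [deform_to_half_line] in the sector between the real axis and the lower curve, where Re omega >=
0. *)
Lemma low_to_real th y : 0 < th -> 0 <= y ->
  CInt_half (fun a => low_kernel H th y (Rabs a)) = CInt_half (fun r => real_low th y (RtoC r)).
Proof.
intros Hth Hy.
destruct (low_kernel_dom th y Hy) as [M1 D1]. destruct (real_low_dom th y Hth Hy) as [M2 D2].
destruct (real_low_segment th y Hth Hy) as [K HK].
apply (deform_to_half_line region (real_low th y) region_open region_star (holo_real_low th y)
  (fun a => (a, lw a) : C) (fun a => (1, dlw a) : C) (fun a => low_kernel H th y (Rabs a)) M1 M2 K).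
- intros a Ha; split.
  + apply (ccont_pair (fun a => a) lw); [apply continuous_id|apply (cont_lower alpha beta hb (fun a => a)); apply continuous_id].
  + apply region_sector, lower_sector, Ha.
- apply injective_projections; [reflexivity|]. cbn [snd].
  generalize (lower_bounds alpha beta ha hb 0 (Rle_refl 0)). simpl. lra.
- intros a Ha; split.
  + apply (cder_pair (fun a => a) lw); [apply (is_derive_id (K := R_AbsRing))|apply is_derive_lower; assumption].
  + apply (ccont_pair (fun _ => 1) dlw); [apply continuous_const|apply (cont_dlower alpha beta ha hb (fun a => a)); apply continuous_id].
- intros a Ha. rewrite Rabs_pos_eq by lra. unfold low_kernel, curve_kernel, real_low.
  rewrite <- sq_csq; [reflexivity|lra|]. apply lower_sector; lra.
- exact D1.
- exact D2.
- exact region_real.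
- intros a v Ha Hv. destruct (lower_sector a Ha) as [L1 L2]. cbn [Re Im fst snd]. split.
  + apply region_sector. replace ((v * lw a) ^ 2) with (v ^ 2 * lw a ^ 2) by ring.
    assert (0 <= v ^ 2 <= 1) by nra. generalize (pow2_ge_0 (lw a)). nra.
  + apply HK; try assumption. rewrite Re_omega_lower by assumption. lra.
- intros a Ha; exact Ha.
- intros m; exists m; intros a Ha; exact Ha.
Qed.

(** The image of the right half of the upper curve under l |-> i rho(l), a curve in the fourth
quadrant on which Re omega still vanishes. The branch point i sqrt (alpha / beta) goes to 0, where
the curve is only continuous. *)
Definition dual_curve (a : R) : C := (- (Ci * csq (sqarg (a, up a))))%C.

Lemma dual_curve_parts a : Re (dual_curve a) = Im (csq (sqarg (a, up a))) /\
  Im (dual_curve a) = - Re (csq (sqarg (a, up a))).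
Proof. unfold dual_curve, Re, Im; simpl. split; ring. Qed.

Lemma csq_sq z : 0 <= Im z -> (csq z * csq z)%C = z.
Proof. intros Hz; rewrite <- csq_Csqrt by exact Hz. apply Csqrt_sq. Qed.

Lemma dual_curve_sq a : 0 <= a -> (dual_curve a * dual_curve a)%C = (- sqarg (a, up a))%C.
Proof.
intros Ha. assert (U := upper_pos alpha beta ha hb a).
unfold dual_curve. rewrite <- (csq_sq (sqarg (a, up a))) at 3.
- replace (Ci)%C with (0, 1) by reflexivity. apply injective_projections; simpl; ring.
- rewrite Im_sqarg. apply Rmult_le_pos; lra.
Qed.

Lemma dual_curve_sector a : 0 <= a -> 2 * a <= Re (dual_curve a) /\ Im (dual_curve a) <= 0 /\
  Im (dual_curve a) ^ 2 <= Re (dual_curve a) ^ 2.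
Proof.
intros Ha. destruct (dual_curve_parts a) as [E1 E2].
assert (R1 : 0 <= Re (csq (sqarg (a, up a)))) by apply sqrt_pos.
assert (R2 : 0 <= Im (csq (sqarg (a, up a)))) by apply sqrt_pos.
assert (S := f_equal Re (dual_curve_sq a Ha)).
change (Re (dual_curve a * dual_curve a)%C) with
  (Re (dual_curve a) * Re (dual_curve a) - Im (dual_curve a) * Im (dual_curve a)) in S.
assert (X : Re (- sqarg (a, up a))%C = up a * up a - a ^ 2 - c2).
{ unfold sqarg, Re; simpl; ring. }
rewrite X in S. assert (U := upper_sq_bounds alpha beta ha hb a).
rewrite E1, E2 in *. split; [|split]; nra.
Qed.

Lemma dual_curve_om a : 0 <= a -> Re (om (dual_curve a)) = 0.
Proof.
intros Ha.
assert (E : ((dual_curve a) ^ 2)%C = (- sqarg (a, up a))%C).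
{ rewrite <- dual_curve_sq by exact Ha. ring. }
rewrite <- (Re_omega_upper alpha beta ha hb a). f_equal.
unfold omega at 1. replace (dual_curve a ^ 4)%C with ((dual_curve a ^ 2) ^ 2)%C by ring.
rewrite E. unfold omega, sqarg. rewrite RtoC_div by lra.
generalize ((a, up a) : C). intros z. field. intros A; apply RtoC_inj in A; lra.
Qed.

Lemma dual_sq a : 0 <= a -> sq (dual_curve a) = (- (Ci * (a, up a)))%C.
Proof.
intros Ha. unfold sq. apply Csqrt_unique.
- unfold sqarg at 1. replace (dual_curve a ^ 2)%C with (dual_curve a * dual_curve a)%C by ring.
  rewrite dual_curve_sq by exact Ha. unfold sqarg. apply injective_projections; simpl; ring.
- replace (Re (- (Ci * (a, up a)))%C) with (up a) by (unfold Re; simpl; ring).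
  apply upper_pos; assumption.
Qed.

Definition ddual_curve (a : R) : C := (- ((a, up a) * (1, dup a)) / dual_curve a)%C.

Lemma dual_curve_cont a : ccont dual_curve a.
Proof.
unfold dual_curve.
assert (L : ccont (fun a => (a, up a) : C) a).
{ apply (ccont_pair (fun a => a) up); [apply continuous_id|apply (cont_upper alpha beta hb (fun a => a)); apply continuous_id]. }
apply ccont_opp, ccont_mult; [apply ccont_const|apply ccont_csq]. unfold sqarg. ctac.
Qed.

Lemma dual_curve_neq0 a : 0 < a -> dual_curve a <> RtoC 0.
Proof.
intros Ha E. assert (S := dual_curve_sector a (Rlt_le _ _ Ha)). rewrite E in S. unfold Re in S; simpl in S. lra.
Qed.

Lemma dual_curve_der a : 0 < a -> cder dual_curve a (ddual_curve a).
Proof.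
intros Ha.
assert (Eq : forall v, 0 < v -> Csqrt (- sqarg (v, up v))%C = dual_curve v).
{ intros v Hv. apply Csqrt_unique; [apply dual_curve_sq; lra|].
  generalize (dual_curve_sector v (Rlt_le _ _ Hv)). lra. }
assert (L : cder (fun v => (v, up v) : C) a (1, dup a)).
{ apply (cder_pair (fun v => v) up); [apply (is_derive_id (K := R_AbsRing))|apply is_derive_upper; assumption]. }
assert (L2 : cder (fun v => (- sqarg (v, up v))%C) a (- (2 * (a, up a) * (1, dup a)))%C).
{ apply cder_opp. unfold sqarg.
  eapply cder_ext; [reflexivity| |apply cder_plus; [apply cder_pow, L|apply cder_const]].
  replace (INR 2) with 2 by (simpl; lra). generalize ((a, up a) : C) ((1, dup a) : C). intros z w. ring. }
assert (P : 0 < Re (- sqarg (a, up a))%C).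
{ replace (Re (- sqarg (a, up a))%C) with (up a * up a - a ^ 2 - c2) by (unfold sqarg, Re; simpl; ring).
  generalize (upper_sq_bounds alpha beta ha hb a). nra. }
apply (cder_ext_loc (fun v => Csqrt (- sqarg (v, up v))%C)).
- exists (mkposreal _ Ha). intros v Hv. change (Rabs (v - a) < a) in Hv. apply Rabs_def2 in Hv.
  apply Eq. lra.
- eapply cder_ext; [reflexivity| |apply (cder_Csqrt _ _ _ P L2)].
  rewrite Eq by exact Ha. unfold ddual_curve. field. apply dual_curve_neq0, Ha.
Qed.

(** In the variable m = i rho(l) the upper curve becomes a curve in the sector |Im m| <= Re m
starting at 0, and the branch point of the square root disappears from the integrand. It can then be
deformed like the lower one. *)
Lemma up_to_real th y : 0 <= th -> 0 <= y ->
  CInt_half (fun a => up_kernel H th y (Rabs a)) = CInt_half (fun r => real_up th y (RtoC r)).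
Proof.
intros Hth Hy.
destruct (up_kernel_dom th y Hy) as [M1 D1]. destruct (real_up_dom th y Hth Hy) as [M2 D2].
destruct (real_up_segment th y Hth Hy) as [K HK].
assert (Pair : forall z : C, (Re z, Im z) = z) by (intros [u v]; reflexivity).
apply (deform_to_half_line region (real_up th y) region_open region_star (holo_real_up th y)
  dual_curve ddual_curve (fun a => up_kernel H th y (Rabs a)) M1 M2 K).
- intros a Ha; split; [apply dual_curve_cont|].
  rewrite <- Pair. apply region_sector, dual_curve_sector, Ha.
- apply Cmod_eq_0. 
  assert (E : Cmod (dual_curve 0) * Cmod (dual_curve 0) = 0).
  { rewrite <- Cmod_mult, dual_curve_sq by lra.
    assert (U := upper_sq_bounds alpha beta ha hb 0).
    replace (- sqarg (0, up 0))%C with (RtoC 0); [apply Cmod_0|].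
    apply injective_projections; unfold sqarg; simpl; nra. }
  nra.
- intros a Ha; split; [apply dual_curve_der, Ha|]. unfold ddual_curve.
  assert (L : ccont (fun a => (a, up a) : C) a).
  { apply (ccont_pair (fun a => a) up); [apply continuous_id|apply (cont_upper alpha beta hb (fun a => a)); apply continuous_id]. }
  apply ccont_div; [|apply dual_curve_cont|apply dual_curve_neq0, Ha].
  apply ccont_opp, ccont_mult; [exact L|].
  apply (ccont_pair (fun _ => 1) dup); [apply continuous_const|apply (cont_dupper alpha beta ha hb (fun a => a)); apply continuous_id].
- intros a Ha. rewrite Rabs_pos_eq by lra. unfold up_kernel, curve_kernel, real_up.
  rewrite dual_sq by lra.
  assert (I2 : (Ci * Ci)%C = (- RtoC 1)%C) by (apply injective_projections; simpl; ring).
  assert (E1 : (Ci * - (Ci * (a, up a)))%C = (a, up a)).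
  { replace (Ci * - (Ci * (a, up a)))%C with (- ((Ci * Ci) * (a, up a)))%C by ring. rewrite I2. ring. }
  assert (E2 : (Ci * dual_curve a)%C = csq (sqarg (a, up a))).
  { unfold dual_curve. replace (Ci * - (Ci * csq (sqarg (a, up a))))%C with (- ((Ci * Ci) * csq (sqarg (a, up a))))%C by ring.
    rewrite I2. ring. }
  rewrite E1. unfold ddual_curve.
  assert (N1 := dual_curve_neq0 a Ha).
  assert (N2 : ((a, up a) : C) <> RtoC 0).
  { intros E. apply (f_equal fst) in E. simpl in E. lra. }
  assert (N3 : Ci <> RtoC 0) by (intros E; apply (f_equal snd) in E; simpl in E; lra).
  rewrite <- E2. field. repeat split; assumption.
- exact D1.
- exact D2.
- exact region_real.
- intros a v Ha Hv. destruct (dual_curve_sector a Ha) as [L0 [L1 L2]]. split.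
  + apply region_sector. replace ((v * Im (dual_curve a)) ^ 2) with (v ^ 2 * Im (dual_curve a) ^ 2) by ring.
    assert (0 <= v ^ 2 <= 1) by nra. generalize (pow2_ge_0 (Im (dual_curve a))). nra.
  + apply HK; try assumption; [lra|]. rewrite Pair, dual_curve_om by exact Ha. lra.
- intros a Ha. generalize (dual_curve_sector a Ha). lra.
- intros m; exists (Rmax 0 m); intros a Ha.
  assert (0 <= a) by (generalize (Rmax_l 0 m); lra). assert (m <= a) by (generalize (Rmax_r 0 m); lra).
  generalize (dual_curve_sector a ltac:(assumption)). lra.
Qed.

End Amplitude.
End Deformation.

(** * The three amplitudes and their real kernels *)

(** The bracket multiplying the transform of a source at [y], with [rho] written as [- s]: the
reflected wave exp (i l y) and an evanescent wave that restores the second boundary condition. *)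
Definition amp_source (y : R) (l s : C) : C :=
  ((Ci * l - s) / (Ci * l + s) * Cexp (Ci * l * RtoC y) - 2 * Ci * l / (Ci * l + s) * Cexp (- (s * RtoC y)))%C.
(** With [amp_g0], the brackets multiplying the boundary data, up to the factor [i] and with [rho]
written as [- s]. *)
Definition amp_g1 (y : R) (l s : C) : C := (Ci * l * (Ci * l - s))%C.
Definition amp_g0 (y : R) (l s : C) : C := (Ci * l * (Ci * l - s) * s)%C.

Lemma Ci_sqr : (Ci * Ci)%C = (- RtoC 1)%C.
Proof. apply injective_projections; simpl; ring. Qed.

(** Evaluates a quotient of complex numbers given by components from a guess. *)
Lemma Cdiv_unique (z w u : C) : w <> RtoC 0 -> (u * w)%C = z -> (z / w)%C = u.
Proof. intros N <-. field. exact N. Qed.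

Section Amplitudes.
Context (alpha beta : R) (ha : 0 < alpha) (hb : 0 < beta).
Notation c2 := (alpha / beta).
Notation region := (region alpha beta).
Notation root := (sq alpha beta).
Notation admissible := (admissible alpha beta).

(** The second factor grows at most linearly in [l], so this bounds the denominator i l + s = i l -
rho from below. *)
Lemma denominator_prod l s : (s * s)%C = (l ^ 2 + RtoC c2)%C ->
  ((Ci * l + s) * (s - Ci * l))%C = (2 * l ^ 2 + RtoC c2)%C.
Proof.
intros E. replace ((Ci * l + s) * (s - Ci * l))%C with (s * s - (Ci * Ci) * l ^ 2)%C by ring.
rewrite E, Ci_sqr. ring.
Qed.

Lemma denominator_neq0 l s : (s * s)%C = (l ^ 2 + RtoC c2)%C -> (2 * l ^ 2 + RtoC c2)%C <> RtoC 0 ->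
  (Ci * l + s)%C <> RtoC 0.
Proof.
intros E N A. apply N. rewrite <- (denominator_prod l s E), A. ring.
Qed.

Lemma admissible_prod l s : admissible l s -> (2 * l ^ 2 + RtoC c2)%C <> RtoC 0.
Proof.
intros (_ & _ & _ & H) E. rewrite E, Cmod_0 in H. generalize (c2_pos alpha beta ha hb). lra.
Qed.

Lemma dual_denominator m : region m -> (Ci * (Ci * root m) + Ci * m)%C <> RtoC 0.
Proof.
intros Hm A. apply (region_prod alpha beta m Hm).
assert (E := sq_sq alpha beta m). unfold sqarg in E.
replace (2 * m ^ 2 + RtoC c2)%C with (m ^ 2 + (m ^ 2 + RtoC c2))%C by ring. rewrite <- E.
transitivity ((Ci * (Ci * root m) + Ci * m) * (Ci * (Ci * root m) - Ci * m))%C; [|rewrite A; ring].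
replace ((Ci * (Ci * root m) + Ci * m) * (Ci * (Ci * root m) - Ci * m))%C with
  ((Ci * Ci) * (Ci * Ci) * (root m * root m) - (Ci * Ci) * m ^ 2)%C by ring.
rewrite Ci_sqr. ring.
Qed.

Ltac htac := repeat match goal with
  | |- holo _ (fun z => z) => apply holo_id
  | |- holo _ (fun z => Defs.Cexp _) => apply holo_Cexp
  | |- holo _ (fun z => Cplus _ _) => apply holo_plus
  | |- holo _ (fun z => Cminus _ _) => apply holo_minus
  | |- holo _ (fun z => Copp _) => apply holo_opp
  | |- holo _ (fun z => Cmult _ _) => apply holo_mult
  | |- holo _ (fun z => Cdiv _ _) => apply holo_div
  | |- holo _ (fun z => sq _ _ z) => apply (holo_sq alpha beta ha hb)
  | |- holo _ (fun z => ?c) => apply holo_const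
  | |- holo ?D ?f => lazymatch f with (fun _ => _) => fail | _ => change (holo D (fun z => f z)) end
  end.

Lemma amp_poly_bound l s : admissible l s -> Cmod l + Cmod s <= (2 + c2) * (1 + Cmod l).
Proof.
intros Ad. assert (S := root_bound alpha beta ha hb l s (proj1 (proj2 (proj2 Ad)))).
generalize (c2_pos alpha beta ha hb) (Cmod_ge_0 l). intros. nra.
Qed.

Lemma Cmod_CiB l s : Cmod (Ci * l - s)%C <= Cmod l + Cmod s.
Proof.
eapply Rle_trans; [apply Cmod_triangle|]. rewrite Cmod_opp, Cmod_mult, Cmod_Ci. lra.
Qed.

(** Both exponentials are at most 1 in modulus on admissible pairs, and the denominator is bounded
below by [denominator_prod]. *)
Lemma amp_source_ok : amplitude alpha beta amp_source (3 * (2 + c2) ^ 2 / c2).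
Proof.
assert (C0 := c2_pos alpha beta ha hb).
constructor.
- intros y. unfold amp_source. htac; intros z Hz;
    (apply denominator_neq0; [apply sq_sq|apply region_prod, Hz]).
- intros y. unfold amp_source. htac; intros z Hz; apply dual_denominator, Hz.
- intros y l s Hy Ad. destruct (Ad) as (Hl & Hs & E & Hp).
  assert (N := denominator_neq0 l s E (admissible_prod l s Ad)).
  assert (K := amp_poly_bound l s Ad).
  assert (G1 := Cmod_ge_0 l). assert (G2 := Cmod_ge_0 s).
  assert (D : Cmod (/ (Ci * l + s))%C <= (2 + c2) * (1 + Cmod l) / c2).
  { rewrite Cmod_inv by exact N. assert (P0 := proj1 (Cmod_gt_0 _) N).
    assert (Q := f_equal Cmod (denominator_prod l s E)). rewrite Cmod_mult in Q.
    assert (T : Cmod (s - Ci * l)%C <= Cmod l + Cmod s).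
    { replace (s - Ci * l)%C with (- (Ci * l - s))%C by ring. rewrite Cmod_opp. apply Cmod_CiB. }
    apply Rmult_le_reg_r with (c2 * Cmod (Ci * l + s)%C); [apply Rmult_lt_0_compat; assumption|].
    replace (/ Cmod (Ci * l + s)%C * (c2 * Cmod (Ci * l + s)%C)) with c2 by (field; lra).
    replace ((2 + c2) * (1 + Cmod l) / c2 * (c2 * Cmod (Ci * l + s)%C)) with
      (Cmod (Ci * l + s)%C * ((2 + c2) * (1 + Cmod l))) by (field; split; lra).
    eapply Rle_trans; [exact Hp|]. rewrite <- Q. apply Rmult_le_compat_l; lra. }
  assert (X1 : Cmod (Cexp (Ci * l * RtoC y)) <= 1).
  { rewrite Cmod_Cexp, <- exp_0. apply exp_le_compat.
    replace (Re (Ci * l * RtoC y)%C) with (- (Im l * y)) by (unfold Re, Im; simpl; ring). nra. }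
  assert (X2 : Cmod (Cexp (- (s * RtoC y))) <= 1).
  { rewrite Cmod_Cexp, <- exp_0. apply exp_le_compat.
    replace (Re (- (s * RtoC y))%C) with (- (Re s * y)) by (unfold Re, Im; simpl; ring). nra. }
  set (W := (2 + c2) * (1 + Cmod l)) in *.
  assert (HW : 0 <= W) by (unfold W; nra).
  assert (HWc : 0 <= W / c2) by (apply Rdiv_le_0_compat; lra).
  assert (Y1 : Cmod ((Ci * l - s) / (Ci * l + s) * Cexp (Ci * l * RtoC y))%C <= W * (W / c2) * 1).
  { unfold Cdiv. rewrite !Cmod_mult. apply Rmult_le_compat; [|apply Cmod_ge_0| |exact X1].
    - apply Rmult_le_pos; apply Cmod_ge_0.
    - apply Rmult_le_compat; [apply Cmod_ge_0|apply Cmod_ge_0| |exact D].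
      eapply Rle_trans; [apply Cmod_CiB|exact K]. }
  assert (Y2 : Cmod (2 * Ci * l / (Ci * l + s) * Cexp (- (s * RtoC y)))%C <= (2 * W) * (W / c2) * 1).
  { unfold Cdiv. rewrite !Cmod_mult, Cmod_Ci, Cmod_R, Rabs_pos_eq by lra.
    apply Rmult_le_compat; [|apply Cmod_ge_0| |exact X2].
    - apply Rmult_le_pos; [nra|apply Cmod_ge_0].
    - apply Rmult_le_compat; [nra|apply Cmod_ge_0| |exact D]. lra. }
  unfold amp_source. eapply Rle_trans; [apply Cmod_triangle|].
  rewrite (Cmod_opp (2 * Ci * l / (Ci * l + s) * Cexp (- (s * RtoC y)))%C).
  apply Rle_trans with (3 * (W * W) / c2).
  { apply Rle_trans with (W * (W / c2) * 1 + 2 * W * (W / c2) * 1); [lra|]. right. field. lra. }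
  unfold W. apply Rle_trans with (3 * (2 + c2) ^ 2 / c2 * (1 + Cmod l) ^ 2).
  { right. field. lra. }
  apply Rmult_le_compat_l.
  { apply Rdiv_le_0_compat; [|exact C0]. apply Rmult_le_pos; [lra|apply pow_le; lra]. }
  assert (0 <= (1 + Cmod l) ^ 2) by apply pow2_ge_0.
  replace ((1 + Cmod l) ^ 3) with ((1 + Cmod l) ^ 2 * (1 + Cmod l)) by ring. nra.
- intros T y f g p Hy Hf Hg Ad. unfold amp_source. destruct (Ad) as (_ & _ & E & _).
  assert (N := denominator_neq0 _ _ E (admissible_prod _ _ Ad)). ctac.
Qed.

Lemma amp_g0_ok : amplitude alpha beta amp_g0 ((2 + c2) ^ 3).
Proof.
assert (C0 := c2_pos alpha beta ha hb).
constructor.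
- intros y. unfold amp_g0. htac.
- intros y. unfold amp_g0. htac.
- intros y l s Hy Ad. assert (K := amp_poly_bound l s Ad). unfold amp_g0. rewrite !Cmod_mult, Cmod_Ci.
  assert (G1 := Cmod_ge_0 l). assert (G2 := Cmod_ge_0 s). assert (G3 := Cmod_ge_0 (Ci * l - s)%C).
  assert (G4 := Cmod_CiB l s).
  replace ((2 + c2) ^ 3 * (1 + Cmod l) ^ 3) with
   ((2 + c2) * (1 + Cmod l) * ((2 + c2) * (1 + Cmod l)) * ((2 + c2) * (1 + Cmod l))) by ring.
  apply Rmult_le_compat; [nra|exact G2| |lra]. apply Rmult_le_compat; lra.
- intros T y f g p Hy Hf Hg Ad. unfold amp_g0. ctac.
Qed.

Lemma amp_g1_ok : amplitude alpha beta amp_g1 ((2 + c2) ^ 3).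
Proof.
assert (C0 := c2_pos alpha beta ha hb).
constructor.
- intros y. unfold amp_g1. htac.
- intros y. unfold amp_g1. htac.
- intros y l s Hy Ad. assert (K := amp_poly_bound l s Ad). unfold amp_g1. rewrite !Cmod_mult, Cmod_Ci.
  assert (G1 := Cmod_ge_0 l). assert (G2 := Cmod_ge_0 s). assert (G3 := Cmod_ge_0 (Ci * l - s)%C).
  assert (G4 := Cmod_CiB l s).
  replace ((2 + c2) ^ 3 * (1 + Cmod l) ^ 3) with
   ((2 + c2) * (1 + Cmod l) * ((2 + c2) * (1 + Cmod l)) * ((2 + c2) * (1 + Cmod l))) by ring.
  assert (1 <= (2 + c2) * (1 + Cmod l)) by nra.
  rewrite <- (Rmult_1_r (1 * Cmod l * _)).
  apply Rmult_le_compat; [nra|lra| |lra]. apply Rmult_le_compat; lra.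
- intros T y f g p Hy Hf Hg Ad. unfold amp_g1. ctac.
Qed.

(** ** Generalized eigenfunctions *)

Definition freq (a : R) : R := sqrt (a ^ 2 + c2).

Lemma freq_sq a : freq a * freq a = a ^ 2 + c2.
Proof. apply sqrt_sqrt. generalize (pow2_ge_0 a) (c2_pos alpha beta ha hb). lra. Qed.

Lemma freq_pos a : 0 < freq a.
Proof. apply sqrt_lt_R0. generalize (pow2_ge_0 a) (c2_pos alpha beta ha hb). lra. Qed.

(** The bounded solution of beta v_xxxx - alpha v_xx = omega(a) v with v(0) = v_x(0) = 0, unique up
to a factor. *)
Definition eigenfun (a x : R) : R :=
  a * (cos (a * x) - exp (- (freq a * x))) - freq a * sin (a * x).

Lemma sq_real a : root (RtoC a) = RtoC (freq a).
Proof.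
apply Csqrt_unique.
- rewrite <- RtoC_mult, freq_sq. unfold sqarg. rewrite RtoC_plus. simpl. rewrite !RtoC_mult. ring.
- apply freq_pos.
Qed.

Definition omR (a : R) : R := alpha * a ^ 2 + beta * a ^ 4.

Lemma omega_real a : omega alpha beta (RtoC a) = RtoC (omR a).
Proof. unfold omega, omR. apply injective_projections; simpl; ring. Qed.

Lemma Cexp_real r : Cexp (RtoC r) = RtoC (exp r).
Proof. unfold Cexp. simpl. rewrite cos_0, sin_0. apply injective_projections; simpl; ring. Qed.

Lemma Cexp_imag r : Cexp (Ci * RtoC r)%C = (cos r, sin r).
Proof.
unfold Cexp. replace (Re (Ci * RtoC r)%C) with 0 by (unfold Re; simpl; ring).
replace (Im (Ci * RtoC r)%C) with r by (unfold Im; simpl; ring). rewrite exp_0.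
apply injective_projections; simpl; ring.
Qed.

Lemma Cexp_plus z w : Cexp (z + w)%C = (Cexp z * Cexp w)%C.
Proof.
unfold Cexp. replace (Re (z + w)%C) with (Re z + Re w) by reflexivity.
replace (Im (z + w)%C) with (Im z + Im w) by reflexivity.
rewrite exp_plus, cos_plus, sin_plus. apply injective_projections; simpl; ring.
Qed.

Lemma Ek_real x th a : Ek alpha beta x th (RtoC a) = (RtoC (exp (- (omR a * th))) * (cos (a * x), sin (a * x)))%C.
Proof.
unfold Ek. rewrite omega_real.
replace (Ci * RtoC a * RtoC x - RtoC (omR a) * RtoC th)%C with (RtoC (- (omR a * th)) + Ci * RtoC (a * x))%C
  by (rewrite RtoC_opp, !RtoC_mult; ring).
rewrite Cexp_plus, Cexp_real, Cexp_imag. reflexivity.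
Qed.

Lemma Ek_dual x th a : Ek alpha beta x th (Ci * root (RtoC a))%C = RtoC (exp (- (omR a * th)) * exp (- (freq a * x))).
Proof.
unfold Ek. rewrite om_dual by assumption. rewrite omega_real, sq_real.
replace (Ci * (Ci * RtoC (freq a)) * RtoC x - RtoC (omR a) * RtoC th)%C with (RtoC (- (omR a * th)) + RtoC (- (freq a * x)))%C.
- rewrite Cexp_plus, !Cexp_real, RtoC_mult. reflexivity.
- rewrite !RtoC_opp, !RtoC_mult. replace (Ci * (Ci * RtoC (freq a)))%C with ((Ci * Ci) * RtoC (freq a))%C by ring.
  rewrite Ci_sqr. ring.
Qed.

(** The Fourier kernel of the equation on the whole line. *)
Definition line_kernel (x th y a : R) : C :=
  (Ek alpha beta x th (RtoC a) * Cexp (- (Ci * RtoC a * RtoC y)))%C.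

(** Once all contours lie on the real axis, their contributions at the frequencies [a] and [- a] add
up to a multiple of the spectral density of beta d^4 - alpha d^2 on the half-line with clamped
boundary conditions. *)
Lemma source_kernel_real x th y a :
  2 * Re (line_kernel x th y a + (real_low alpha beta x amp_source th y (RtoC a)
    - real_up alpha beta x amp_source th y (RtoC a)))%C =
  4 * (exp (- (omR a * th)) * (eigenfun a x * eigenfun a y / (2 * a ^ 2 + c2))).
Proof.
unfold line_kernel, real_low, real_up. rewrite Ek_dual, Ek_real, sq_real.
assert (S := freq_sq a). assert (P := freq_pos a).
assert (D : 2 * a ^ 2 + c2 = freq a * freq a + a * a) by (rewrite S; ring). rewrite D.
unfold amp_source, eigenfun.
replace (- (Ci * RtoC a * RtoC y))%C with (Ci * RtoC (- (a * y)))%C by (rewrite RtoC_opp, RtoC_mult; ring).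
replace (Ci * RtoC a * RtoC y)%C with (Ci * RtoC (a * y))%C by (rewrite RtoC_mult; ring).
replace (- (RtoC (freq a) * RtoC y))%C with (RtoC (- (freq a * y))) by (rewrite RtoC_opp, RtoC_mult; ring).
replace (Ci * (Ci * RtoC (freq a)) * RtoC y)%C with (RtoC (- (freq a * y))).
2:{ rewrite RtoC_opp, RtoC_mult. replace (Ci * (Ci * RtoC (freq a)))%C with ((Ci * Ci) * RtoC (freq a))%C by ring.
    rewrite Ci_sqr. ring. }
replace (- (Ci * RtoC a * RtoC y))%C with (Ci * RtoC (- (a * y)))%C by (rewrite RtoC_opp, RtoC_mult; ring).
rewrite !Cexp_imag, !Cexp_real, cos_neg, sin_neg.
set (s := freq a) in *. set (E := exp (- (omR a * th))). set (ex := exp (- (s * x))). set (ey := exp (- (s * y))).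
set (cx := cos (a * x)). set (sx := sin (a * x)). set (cy := cos (a * y)). set (sy := sin (a * y)).
assert (N : s * s + a * a <> 0) by nra.
set (A := s * s + a * a) in *.
assert (D1 : (Ci * RtoC a + RtoC s)%C <> RtoC 0).
{ intros Z. apply (f_equal fst) in Z. simpl in Z. lra. }
assert (D2 : (Ci * (Ci * RtoC s) + Ci * RtoC a)%C <> RtoC 0).
{ intros Z. apply (f_equal fst) in Z. simpl in Z. lra. }
assert (D3 : RtoC s <> RtoC 0) by (intros Z; apply RtoC_inj in Z; lra).
rewrite (Cdiv_unique (Ci * RtoC a - RtoC s) _ ((a * a - s * s) / A, 2 * a * s / A) D1)
  by (apply injective_projections; unfold A; simpl; field; exact N).
rewrite (Cdiv_unique (2 * Ci * RtoC a) _ (2 * a * a / A, 2 * a * s / A) D1)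
  by (apply injective_projections; unfold A; simpl; field; exact N).
rewrite (Cdiv_unique (Ci * (Ci * RtoC s) - Ci * RtoC a) _ ((s * s - a * a) / A, 2 * a * s / A) D2)
  by (apply injective_projections; unfold A; simpl; field; exact N).
rewrite (Cdiv_unique (2 * Ci * (Ci * RtoC s)) _ (2 * s * s / A, 2 * a * s / A) D2)
  by (apply injective_projections; unfold A; simpl; field; exact N).
rewrite (Cdiv_unique (Ci * RtoC a) _ (0, a / s) D3)
  by (apply injective_projections; simpl; field; lra).
unfold Re, Cminus, Cplus, Cmult, Copp, RtoC. cbn [fst snd]. clearbody ex ey cx sx cy sy E.
unfold A in *. clear - P N. field. split; [exact N|lra].
Qed.

(** Boundary data act through the derivatives at 0 of the eigenfunction v: the factor [a] is -
v_xx(0) / (2 a^2 + alpha / beta), and the factor a freq(a) in [g0_kernel_real] is v_xxx(0) / (2 a^2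
+ alpha / beta). *)
Lemma g1_kernel_real x th y a :
  2 * Re (real_low alpha beta x amp_g1 th y (RtoC a) - real_up alpha beta x amp_g1 th y (RtoC a))%C =
  - 2 * (exp (- (omR a * th)) * (a * eigenfun a x)).
Proof.
unfold real_low, real_up. rewrite Ek_dual, Ek_real, sq_real.
assert (P := freq_pos a). unfold amp_g1, eigenfun.
set (s := freq a) in *. set (E := exp (- (omR a * th))). set (ex := exp (- (s * x))).
set (cx := cos (a * x)). set (sx := sin (a * x)).
assert (D3 : RtoC s <> RtoC 0) by (intros Z; apply RtoC_inj in Z; lra).
rewrite (Cdiv_unique (Ci * RtoC a) _ (0, a / s) D3)
  by (apply injective_projections; simpl; field; lra).
unfold Re, Cminus, Cplus, Cmult, Copp, Ci, RtoC. cbn [fst snd]. clearbody ex cx sx E. clear - P.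
field. lra.
Qed.

Lemma g0_kernel_real x th y a :
  2 * Re (real_low alpha beta x amp_g0 th y (RtoC a) - real_up alpha beta x amp_g0 th y (RtoC a))%C =
  - 2 * (exp (- (omR a * th)) * (a * freq a * eigenfun a x)).
Proof.
unfold real_low, real_up. rewrite Ek_dual, Ek_real, sq_real.
assert (P := freq_pos a). unfold amp_g0, eigenfun.
set (s := freq a) in *. set (E := exp (- (omR a * th))). set (ex := exp (- (s * x))).
set (cx := cos (a * x)). set (sx := sin (a * x)).
assert (D3 : RtoC s <> RtoC 0) by (intros Z; apply RtoC_inj in Z; lra).
rewrite (Cdiv_unique (Ci * RtoC a) _ (0, a / s) D3)
  by (apply injective_projections; simpl; field; lra).
unfold Re, Cminus, Cplus, Cmult, Copp, Ci, RtoC. cbn [fst snd]. clearbody ex cx sx E. clear - P.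
field. lra.
Qed.

End Amplitudes.

(** * Laplace's method on the half-line *)

Lemma CInt_RtoC (f : R -> R) a b : (forall x, continuous f x) ->
  CInt (fun t => RtoC (f t)) a b = RtoC (RInt f a b).
Proof.
intros H. rewrite CInt_components by (intros z _; apply ccont_RtoC, H).
apply injective_projections; [reflexivity|]. cbn [snd Im RtoC].
rewrite (RInt_const (V := R_CompleteNormedModule)). unfold scal; simpl; unfold mult; simpl. ring.
Qed.

Lemma half_abs_le (h : R -> C) (g : R -> R) M M' : dom h M -> dom (fun a => RtoC (g a)) M' ->
  (forall a, 0 <= a -> Cmod (h a) <= g a) -> Cmod (CInt_half h) <= Re (CInt_half (fun a => RtoC (g a))).
Proof.
intros D1 D2 H. apply le_epsilon; intros e He. assert (He2 : 0 < e / 2) by lra.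
destruct (inv_tail_small M _ (dom_pos _ _ D1) He2) as [N1 [P1 H1]].
destruct (inv_tail_small M' _ (dom_pos _ _ D2) He2) as [N2 [P2 H2]].
set (N := Rmax N1 N2). assert (L1 : N1 <= N) by apply Rmax_l. assert (L2 : N2 <= N) by apply Rmax_r.
assert (A1 := dom_rem _ _ N D1 ltac:(lra)). assert (A2 := dom_rem _ _ N D2 ltac:(lra)).
specialize (H1 N L1). specialize (H2 N L2).
assert (Gc : forall x, continuous g x).
{ intros z. exact (cont_Re _ _ (proj1 D2 z)). }
assert (A3 : Cmod (CInt h 0 N) <= RInt g 0 N).
{ apply CInt_le with g; [lra|apply dom_cont with M, D1|intros; apply H; lra|].
  apply (RInt_correct (V := R_CompleteNormedModule)), (ex_RInt_continuous (V := R_CompleteNormedModule)). intros; apply Gc. }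
rewrite CInt_RtoC in A2 by exact Gc.
assert (A4 := re_le_Cmod (CInt_half (fun a => RtoC (g a)) - RtoC (RInt g 0 N))%C).
replace (Re (CInt_half (fun a => RtoC (g a)) - RtoC (RInt g 0 N))%C) with
  (Re (CInt_half (fun a => RtoC (g a))) - RInt g 0 N) in A4 by reflexivity.
assert (A5 := Rle_abs (- (Re (CInt_half (fun a => RtoC (g a))) - RInt g 0 N))). rewrite Rabs_Ropp in A5.
replace (CInt_half h) with ((CInt_half h - CInt h 0 N) + CInt h 0 N)%C by ring.
eapply Rle_trans; [apply Cmod_triangle|]. lra.
Qed.

(** ** Gaussian moments *)

Lemma gauss_dom (n : nat) (k : R) : 0 < k -> exists M, dom (fun a => RtoC (a ^ n * exp (- (k * a ^ 2)))) M.
Proof.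
intros Hk. destruct (exp_dominates_poly (2 * k) n ltac:(lra)) as [M [HM0 HM]].
exists (exp k * M). split; [intros a; ctac|].
intros a Ha. rewrite Cmod_R, Rabs_pos_eq by (apply Rmult_le_pos; [apply pow_le, Ha|left; apply exp_pos]).
rewrite Rmult_assoc. 
apply Rle_trans with (exp k * ((1 + a) ^ n * exp (- (2 * k * a)))).
- replace (exp k * ((1 + a) ^ n * exp (- (2 * k * a)))) with ((1 + a) ^ n * (exp k * exp (- (2 * k * a)))) by ring.
  rewrite <- exp_plus. apply Rmult_le_compat; [apply pow_le, Ha|left; apply exp_pos|apply pow_incr; lra|].
  apply exp_le_compat. assert (0 <= (a - 1) ^ 2) by apply pow2_ge_0. nra.
- apply Rmult_le_compat_l; [left; apply exp_pos|apply HM, Ha].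
Qed.

Lemma cder_comp_real (z : R -> C) (g : R -> R) a dz dg :
  cder z (g a) dz -> is_derive g a dg -> cder (fun v => z (g v)) a (RtoC dg * dz)%C.
Proof.
intros [H1 H2] Hg. split.
- eapply is_derive_eq; [apply (is_derive_comp (K := R_AbsRing) (V := R_NormedModule) (fun v => Re (z v)) g _ _ _ H1 Hg)|].
  unfold scal, Re; simpl; unfold mult; simpl; ring.
- eapply is_derive_eq; [apply (is_derive_comp (K := R_AbsRing) (V := R_NormedModule) (fun v => Im (z v)) g _ _ _ H2 Hg)|].
  unfold scal, Im; simpl; unfold mult; simpl; ring.
Qed.

Lemma CInt_scale (f : R -> C) (c N : R) : 0 <= N -> (forall a, ccont f a) ->
  CInt (fun t => (RtoC c * f (c * t)%R)%C) 0 N = CInt f 0 (c * N).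
Proof.
intros HN Hf.
assert (D : forall t, cder (fun t => CInt f 0 (c * t)) t (RtoC c * f (c * t)%R)%C).
{ intros t. apply (cder_comp_real (fun v => CInt f 0 v) (fun t => c * t)); [apply cder_CInt, Hf|].
  auto_derive; [trivial|ring]. }
rewrite (CInt_FTC (fun t => CInt f 0 (c * t))); [|exact HN| | |].
- rewrite Rmult_0_r. rewrite (CInt_unique f 0 0 (RtoC 0)) by apply (is_RInt_point (V := CV)). ring.
- intros; eapply cder_continuous, D.
- intros t _. apply ccont_mult; [apply ccont_const|].
  apply (continuous_comp (fun t => c * t) f); [ctac|apply Hf].
- intros; apply D.
Qed.

Notation gauss := (fun t : R => RtoC (exp (- t ^ 2))).

Lemma gauss_cont a : ccont gauss a.
Proof. ctac. Qed.

(** The square of the integral of exp (- t^2) over [0, v] plus the integral of exp (- v^2 (1 + t^2)) / (1 + t^2) over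
[0, 1] has derivative 0 in [v], and is atan 1 = PI / 4 at v = 0.  This evaluates the Gaussian integral without polar coordinates. *)
Lemma gauss_square N : 0 <= N ->
  exists b, 0 <= b <= exp (- N ^ 2) /\ RInt (fun t => exp (- t ^ 2)) 0 N ^ 2 = PI / 4 - b.
Proof.
intros HN.
pose (h := fun v t : R => RtoC (exp (- (v ^ 2 * (1 + t ^ 2))) / (1 + t ^ 2))).
pose (k := fun v t : R => RtoC (- (2 * v) * exp (- (v ^ 2 * (1 + t ^ 2))))).
assert (Pt : forall t : R, 0 < 1 + t ^ 2) by (intros; generalize (pow2_ge_0 t); lra).
assert (Dr : forall w t : R, is_derive (fun w => exp (- (w ^ 2 * (1 + t ^ 2))) / (1 + t ^ 2)) w
  (- (2 * w) * exp (- (w ^ 2 * (1 + t ^ 2))))).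
{ intros w t. auto_derive; [trivial|].
  replace (w * (w * 1) * (1 + t * (t * 1))) with (w ^ 2 * (1 + t ^ 2)) by ring.
  field. generalize (Pt t). simpl. lra. }
assert (Hh : forall v t, ccont (h v) t).
{ intros; unfold h; ctac. apply Rgt_not_eq, Pt. }
assert (Dh : forall v, cder (fun v => CInt (h v) 0 1) v (CInt (k v) 0 1)).
{ intros v. apply (CInt_Leibniz h k); [lra| | |apply filter_forall; intros; apply Hh].
  - apply filter_forall; intros w t _.
    apply (cder_RtoC (fun w => exp (- (w ^ 2 * (1 + t ^ 2))) / (1 + t ^ 2)) w (- (2 * w) * exp (- (w ^ 2 * (1 + t ^ 2))))).
    apply Dr.
  - intros t _; unfold k; ctac. }
assert (Ek : forall v, 0 <= v -> CInt (k v) 0 1 = (- (2 * (gauss v * CInt gauss 0 v)))%C).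
{ intros v Hv. transitivity (CInt (fun t => (- (2 * gauss v) * (RtoC v * gauss (v * t)%R))%C) 0 1).
  - apply CInt_ext. intros t _. unfold k. apply injective_projections; simpl; [|ring].
    replace (- (v * (v * 1) * (1 + t * (t * 1)))) with (- (v * (v * 1)) + - (v * t * (v * t * 1))) by ring.
    rewrite exp_plus. ring.
  - rewrite CInt_mult.
    + rewrite (CInt_scale gauss v 1) by (lra || apply gauss_cont). rewrite Rmult_1_r. ring.
    + intros t _. ctac. }
assert (E : (CInt gauss 0 N * CInt gauss 0 N + CInt (h N) 0 1 = RtoC (PI / 4))%C).
{ assert (DI : forall v, cder (fun v => CInt gauss 0 v) v (gauss v)) by (intros v; apply (cder_CInt gauss), gauss_cont).
  assert (Z : CInt (fun _ => RtoC 0) 0 N =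
    ((CInt gauss 0 N * CInt gauss 0 N + CInt (h N) 0 1) - (CInt gauss 0 0 * CInt gauss 0 0 + CInt (h 0) 0 1))%C).
  { apply (CInt_FTC (fun v => (CInt gauss 0 v * CInt gauss 0 v + CInt (h v) 0 1)%C)); [exact HN| | |].
    - intros v _. apply ccont_plus; [apply ccont_mult; eapply cder_continuous, DI|eapply cder_continuous, Dh].
    - intros; apply ccont_const.
    - intros v Hv. eapply cder_ext; [reflexivity| |apply cder_plus; [apply cder_mult; apply DI|apply Dh]].
      rewrite Ek by lra. cbv beta. ring. }
  assert (Z0 : CInt (fun _ => RtoC 0) 0 N = RtoC 0).
  { rewrite (CInt_RtoC (fun _ => 0)) by (intros; apply continuous_const).
    rewrite (RInt_const (V := R_CompleteNormedModule)). unfold scal; simpl; unfold mult; simpl. f_equal. ring. }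
  assert (I0 : CInt gauss 0 0 = RtoC 0) by (apply CInt_unique, (is_RInt_point (V := CV))).
  assert (H0 : CInt (h 0) 0 1 = RtoC (PI / 4)).
  { rewrite (CInt_FTC (fun t => RtoC (atan t)) (h 0)).
    - rewrite atan_1, atan_0. rewrite <- RtoC_minus. f_equal. ring.
    - lra.
    - intros t _. apply ccont_RtoC. eapply is_derive_cont, is_derive_atan.
    - intros; apply Hh.
    - intros t _. apply cder_RtoC. eapply is_derive_eq; [apply is_derive_atan|].
      replace (- (0 ^ 2 * (1 + t ^ 2))) with 0 by ring. rewrite exp_0. unfold Rsqr. field.
      generalize (Pt t). simpl. lra. }
  rewrite Z0, I0, H0 in Z.
  replace (CInt gauss 0 N * CInt gauss 0 N + CInt (h N) 0 1)%C with
   ((CInt gauss 0 N * CInt gauss 0 N + CInt (h N) 0 1 - (0 * 0 + RtoC (PI / 4))) + RtoC (PI / 4))%C by ring.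
  rewrite <- Z. ring. }
exists (RInt (fun t => exp (- (N ^ 2 * (1 + t ^ 2))) / (1 + t ^ 2)) 0 1).
assert (Hc : forall t, continuous (fun t : R => exp (- (N ^ 2 * (1 + t ^ 2))) / (1 + t ^ 2)) t).
{ intros t; ctac. apply Rgt_not_eq, Pt. }
assert (Hex : ex_RInt (fun t => exp (- (N ^ 2 * (1 + t ^ 2))) / (1 + t ^ 2)) 0 1).
{ apply (ex_RInt_continuous (V := R_CompleteNormedModule)); intros; apply Hc. }
split; [split|].
- apply RInt_ge_0; [lra|exact Hex|]. intros t _. left. apply Rdiv_lt_0_compat; [apply exp_pos|apply Pt].
- replace (exp (- N ^ 2)) with (RInt (fun _ => exp (- N ^ 2)) 0 1).
  + apply RInt_le; [lra|exact Hex|apply ex_RInt_const|]. intros t _.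
    apply Rle_trans with (exp (- (N ^ 2 * (1 + t ^ 2))) / 1).
    * apply Rmult_le_compat_l; [left; apply exp_pos|]. apply Rinv_le_contravar; [lra|]. generalize (pow2_ge_0 t); lra.
    * unfold Rdiv. rewrite Rinv_1, Rmult_1_r. apply exp_le_compat.
      assert (0 <= N ^ 2) by apply pow2_ge_0. assert (0 <= t ^ 2) by apply pow2_ge_0. nra.
  + rewrite (RInt_const (V := R_CompleteNormedModule)). unfold scal; simpl; unfold mult; simpl. ring.
- unfold h in E. rewrite (CInt_RtoC (fun t => exp (- t ^ 2))) in E by (intros; ctac).
  rewrite (CInt_RtoC (fun t => exp (- (N ^ 2 * (1 + t ^ 2))) / (1 + t ^ 2))) in E by exact Hc.
  rewrite <- RtoC_mult, <- RtoC_plus in E. apply RtoC_inj in E. lra.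
Qed.

Lemma exp_sq_small N : 0 <= N -> exp (- N ^ 2) <= 2 * / (1 + N).
Proof.
intros HN. apply Rmult_le_reg_r with (1 + N); [lra|].
rewrite Rmult_assoc, Rinv_l, Rmult_1_r by lra.
assert (A : 1 + N ^ 2 <= exp (N ^ 2)) by apply exp_ineq1_le.
assert (B : exp (- N ^ 2) * exp (N ^ 2) = 1) by (rewrite <- exp_plus, Rplus_opp_l; apply exp_0).
assert (P := exp_pos (- N ^ 2)).
assert (1 + N <= 2 * (1 + N ^ 2)) by (assert (0 <= (N - 1) ^ 2) by apply pow2_ge_0; nra).
assert (exp (- N ^ 2) * (1 + N) <= exp (- N ^ 2) * (2 * exp (N ^ 2))) by (apply Rmult_le_compat_l; lra).
lra.
Qed.

Lemma gauss_erf N : 0 <= N -> Rabs (sqrt PI / 2 - RInt (fun t => exp (- t ^ 2)) 0 N) <= 4 * / (1 + N).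
Proof.
intros HN. destruct (gauss_square N HN) as [b [[Hb0 Hb] E]].
assert (I0 : 0 <= RInt (fun t => exp (- t ^ 2)) 0 N).
{ apply RInt_ge_0; [exact HN| |intros; left; apply exp_pos].
  apply (ex_RInt_continuous (V := R_CompleteNormedModule)); intros; ctac. }
set (I := RInt (fun t => exp (- t ^ 2)) 0 N) in *.
assert (S : sqrt PI * sqrt PI = PI) by (apply sqrt_sqrt; generalize PI_RGT_0; lra).
assert (S1 : 1 <= sqrt PI).
{ rewrite <- sqrt_1. apply sqrt_le_1_alt. generalize PI2_1. lra. }
assert (F := exp_sq_small N HN).
assert (D : (sqrt PI / 2 - I) * (sqrt PI / 2 + I) = b) by nra.
rewrite Rabs_pos_eq by nra. nra.
Qed.

(** The substitution t = sqrt k a in the Gaussian integral. *)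
Lemma gauss_moment0 k : 0 < k ->
  CInt_half (fun a => RtoC (a ^ 0 * exp (- (k * a ^ 2)))) = RtoC (sqrt PI / (2 * sqrt k)).
Proof.
intros Hk. destruct (gauss_dom 0 k Hk) as [M D].
assert (Sk : 0 < sqrt k) by (apply sqrt_lt_R0, Hk). assert (S := sqrt_sqrt k (Rlt_le _ _ Hk)).
set (c := sqrt k) in *.
apply half_limit_rate with M (4 / c * (1 + / c)); [exact D| |].
{ apply Rmult_le_pos; [left; apply Rdiv_lt_0_compat; lra|]. assert (0 < / c) by (apply Rinv_0_lt_compat; lra). lra. }
intros N HN.
assert (E : CInt (fun a => RtoC (a ^ 0 * exp (- (k * a ^ 2)))) 0 N = (RtoC (/ c) * CInt gauss 0 (c * N))%C).
{ rewrite <- (CInt_scale gauss c N HN) by apply gauss_cont. rewrite <- CInt_mult.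
  - apply CInt_ext. intros t _. rewrite <- !RtoC_mult. f_equal. rewrite <- S.
    replace (c * c * t ^ 2) with ((c * t) ^ 2) by ring. field. lra.
  - intros t _. ctac. }
rewrite E, (CInt_RtoC (fun t => exp (- t ^ 2))) by (intros; ctac).
rewrite <- RtoC_mult, <- RtoC_minus, Cmod_R.
replace (sqrt PI / (2 * c) - / c * RInt (fun t => exp (- t ^ 2)) 0 (c * N)) with
  (/ c * (sqrt PI / 2 - RInt (fun t => exp (- t ^ 2)) 0 (c * N))) by (field; lra).
assert (Pc : 0 < / c) by (apply Rinv_0_lt_compat; lra).
rewrite Rabs_mult, (Rabs_pos_eq (/ c)) by lra.
assert (HcN : 0 <= c * N) by nra.
apply Rle_trans with (/ c * (4 * / (1 + c * N))).
{ apply Rmult_le_compat_l; [lra|]. apply gauss_erf, HcN. }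
replace (4 / c * (1 + / c) * / (1 + N)) with (/ c * (4 * ((1 + / c) * / (1 + N)))) by (field; lra).
apply Rmult_le_compat_l; [lra|]. apply Rmult_le_compat_l; [lra|].
apply Rmult_le_reg_r with ((1 + c * N) * (1 + N)); [nra|].
replace (/ (1 + c * N) * ((1 + c * N) * (1 + N))) with (1 + N) by (field; lra).
replace ((1 + / c) * / (1 + N) * ((1 + c * N) * (1 + N))) with ((1 + / c) * (1 + c * N)) by (field; lra).
assert (/ c * (c * N) = N) by (field; lra). nra.
Qed.

Lemma is_derive_gauss_moment (n : nat) (k a : R) : 0 < k ->
  is_derive (fun a => / (2 * k) * (a ^ S n * exp (- (k * a ^ 2)))) a
    (INR (S n) / (2 * k) * (a ^ n * exp (- (k * a ^ 2))) - a ^ S (S n) * exp (- (k * a ^ 2))).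
Proof.
intros Hk.
assert (D1 : is_derive (fun a => a ^ S n) a (INR (S n) * 1 * a ^ n)).
{ apply (is_derive_pow (fun a => a) (S n)). apply (is_derive_id (K := R_AbsRing)). }
assert (D2 : is_derive (fun a => exp (- (k * a ^ 2))) a (exp (- (k * a ^ 2)) * (- (k * (2 * a))))).
{ auto_derive; [trivial|]. replace (a * (a * 1)) with (a ^ 2) by ring. ring. }
eapply is_derive_eq; [apply is_derive_Rmult; [apply is_derive_Rconst|apply is_derive_Rmult; [exact D1|exact D2]]|].
cbv beta. rewrite <- !(tech_pow_Rmult a (S n)), <- !(tech_pow_Rmult a n). field. lra.
Qed.

(** Integration by parts. *)
Lemma gauss_moment_step n k : 0 < k ->
  CInt_half (fun a => RtoC (a ^ (S (S n)) * exp (- (k * a ^ 2)))) =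
  (RtoC (INR (S n) / (2 * k)) * CInt_half (fun a => RtoC (a ^ n * exp (- (k * a ^ 2)))))%C.
Proof.
intros Hk. destruct (gauss_dom (S (S n)) k Hk) as [M2 D2]. destruct (gauss_dom n k Hk) as [M0 D0].
destruct (exp_dominates_poly (2 * k) (S n) ltac:(lra)) as [M1 [HM1 H1]].
assert (Hn : 0 <= INR (S n)) by apply pos_INR.
assert (HM0 := dom_pos _ _ D0).
set (q := INR (S n) / (2 * k)).
assert (Hq : 0 <= q) by (apply Rdiv_le_0_compat; lra).
assert (Ik : 0 < / (2 * k)) by (apply Rinv_0_lt_compat; lra).
apply half_limit_rate with M2 (q * M0 + / (2 * k) * (exp k * M1)); [exact D2| |].
{ apply Rplus_le_le_0_compat; [nra|]. apply Rmult_le_pos; [lra|]. apply Rmult_le_pos; [left; apply exp_pos|exact HM1]. }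
intros N HN.
assert (E : CInt (fun a => RtoC (a ^ (S (S n)) * exp (- (k * a ^ 2)))) 0 N =
  (RtoC q * CInt (fun a => RtoC (a ^ n * exp (- (k * a ^ 2)))) 0 N
   - RtoC (/ (2 * k) * (N ^ (S n) * exp (- (k * N ^ 2)))))%C).
{ assert (F : CInt (fun a => (RtoC q * RtoC (a ^ n * exp (- (k * a ^ 2))) - RtoC (a ^ (S (S n)) * exp (- (k * a ^ 2))))%C) 0 N =
    (RtoC (/ (2 * k) * (N ^ (S n) * exp (- (k * N ^ 2)))) - RtoC (/ (2 * k) * (0 ^ (S n) * exp (- (k * 0 ^ 2)))))%C).
  { apply (CInt_FTC (fun a => RtoC (/ (2 * k) * (a ^ (S n) * exp (- (k * a ^ 2)))))); [exact HN| | |].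
    - intros; ctac.
    - intros; ctac.
    - intros a _. rewrite <- RtoC_mult, <- RtoC_minus.
      apply (cder_RtoC (fun a => / (2 * k) * (a ^ (S n) * exp (- (k * a ^ 2))))).
      apply is_derive_gauss_moment, Hk. }
  replace (0 ^ (S n)) with 0 in F by (simpl; ring).
  rewrite CInt_minus in F; [|intros t _; ctac|intros t _; ctac].
  rewrite (CInt_mult (RtoC q) (fun a => RtoC (a ^ n * exp (- (k * a ^ 2))))) in F by (intros t _; ctac).
  replace (RtoC (/ (2 * k) * (0 * exp (- (k * 0 ^ 2))))) with (RtoC 0) in F by (f_equal; ring).
  set (A := CInt (fun a => RtoC (a ^ (S (S n)) * exp (- (k * a ^ 2)))) 0 N) in *.
  set (B := (RtoC q * CInt (fun a => RtoC (a ^ n * exp (- (k * a ^ 2)))) 0 N)%C) in *.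
  replace A with (B - (B - A))%C by ring. rewrite F. ring. }
rewrite E.
set (I := CInt (fun a => RtoC (a ^ n * exp (- (k * a ^ 2)))) 0 N).
set (J := CInt_half (fun a => RtoC (a ^ n * exp (- (k * a ^ 2))))).
set (b := / (2 * k) * (N ^ (S n) * exp (- (k * N ^ 2)))).
replace (RtoC q * J - (RtoC q * I - RtoC b))%C with (RtoC q * (J - I) + RtoC b)%C by ring.
eapply Rle_trans; [apply Cmod_triangle|]. rewrite Cmod_mult, !Cmod_R, (Rabs_pos_eq q) by exact Hq.
rewrite Rmult_plus_distr_r. apply Rplus_le_compat.
- rewrite Rmult_assoc. apply Rmult_le_compat_l; [exact Hq|]. apply (dom_rem _ _ N D0 HN).
- unfold b. rewrite Rabs_pos_eq.
  2:{ apply Rmult_le_pos; [lra|]. apply Rmult_le_pos; [apply pow_le, HN|left; apply exp_pos]. }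
  rewrite Rmult_assoc. apply Rmult_le_compat_l; [lra|].
  apply Rle_trans with (exp k * ((1 + N) ^ (S n) * exp (- (2 * k * N)))).
  + replace (exp k * ((1 + N) ^ (S n) * exp (- (2 * k * N)))) with ((1 + N) ^ (S n) * (exp k * exp (- (2 * k * N)))) by ring.
    rewrite <- exp_plus. apply Rmult_le_compat; [apply pow_le, HN|left; apply exp_pos|apply pow_incr; lra|].
    apply exp_le_compat. assert (0 <= (N - 1) ^ 2) by apply pow2_ge_0. nra.
  + rewrite (Rmult_assoc (exp k) M1). apply Rmult_le_compat_l; [left; apply exp_pos|].
    eapply Rle_trans; [apply H1, HN|]. apply Rmult_le_compat_l; [exact HM1|].
    apply Rinv_le_contravar; [lra|]. nra.
Qed.

Definition moment (n : nat) (k : R) : C := CInt_half (fun a => RtoC (a ^ n * exp (- (k * a ^ 2)))).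

Lemma moments k : 0 < k ->
  moment 2 k = RtoC (sqrt PI / (4 * (k * sqrt k))) /\
  moment 4 k = RtoC (3 * sqrt PI / (8 * (k ^ 2 * sqrt k))) /\
  moment 6 k = RtoC (15 * sqrt PI / (16 * (k ^ 3 * sqrt k))).
Proof.
intros Hk. assert (Sk : 0 < sqrt k) by (apply sqrt_lt_R0, Hk).
assert (M2 : moment 2 k = RtoC (sqrt PI / (4 * (k * sqrt k)))).
{ unfold moment. rewrite (gauss_moment_step 0 k Hk), gauss_moment0 by exact Hk. rewrite <- RtoC_mult. f_equal.
  simpl. field. lra. }
assert (M4 : moment 4 k = RtoC (3 * sqrt PI / (8 * (k ^ 2 * sqrt k)))).
{ unfold moment. rewrite (gauss_moment_step 2 k Hk). fold (moment 2 k). rewrite M2, <- RtoC_mult. f_equal.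
  simpl. field. lra. }
split; [exact M2|split; [exact M4|]].
unfold moment. rewrite (gauss_moment_step 4 k Hk). fold (moment 4 k). rewrite M4, <- RtoC_mult. f_equal.
simpl. field. lra.
Qed.

Section Laplace.
Context (alpha beta : R) (ha : 0 < alpha) (hb : 0 < beta).
Notation c2 := (alpha / beta).
Notation om := (omR alpha beta).
Notation frq := (freq alpha beta).
Notation eig := (eigenfun alpha beta).
Notation profile := (profile alpha beta).
Notation c := (sqrt (alpha / beta)).

Definition laplace_const : R :=
  3 * sqrt PI / (8 * (alpha ^ 2 * sqrt alpha)) + beta * (15 * sqrt PI / (16 * (alpha ^ 3 * sqrt alpha))).

Lemma laplace_const_pos : 0 <= laplace_const.
Proof.
assert (S := sqrt_lt_R0 _ ha). assert (P0 := sqrt_lt_R0 _ PI_RGT_0).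
assert (0 < alpha ^ 2) by (apply pow_lt, ha). assert (0 < alpha ^ 3) by (apply pow_lt, ha).
apply Rplus_le_le_0_compat; [|apply Rmult_le_pos; [lra|]]; left; apply Rdiv_lt_0_compat; nra.
Qed.

(** The Gaussian moments scale like th^(- (n + 1) / 2). The leading term a^2 gives th^(- 3 / 2);
both the error of order a^4 in [r] and the quartic part of omega, which perturbs the Gaussian by a
factor within beta a^4 th of 1, give th^(- 5 / 2). *)
Lemma laplace (r : R -> R) (A B0 : R) (th : R) : 0 < th -> 0 <= B0 ->
  (forall a, continuous r a) -> (forall a, 0 <= a -> Rabs (r a - A * a ^ 2) <= B0 * a ^ 4) ->
  (exists M, dom (fun a => RtoC (exp (- (om a * th)) * r a)) M) /\
  Cmod (CInt_half (fun a => RtoC (exp (- (om a * th)) * r a))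
    - RtoC (A * (sqrt PI / (4 * (alpha * sqrt alpha))) / (th * sqrt th)))%C
  <= laplace_const * (Rabs A + B0) / (th ^ 2 * sqrt th).
Proof.
intros Hth HB Hc Hr. set (k := alpha * th). assert (Hk : 0 < k) by (apply Rmult_lt_0_compat; assumption).
destruct (gauss_dom 2 k Hk) as [M2 D2]. destruct (gauss_dom 4 k Hk) as [M4 D4]. destruct (gauss_dom 6 k Hk) as [M6 D6].
destruct (moments k Hk) as [E2 [E4 E6]].
set (g := fun a => B0 * (a ^ 4 * exp (- (k * a ^ 2))) + Rabs A * beta * th * (a ^ 6 * exp (- (k * a ^ 2)))).
assert (Eg : forall a, RtoC (g a) = (RtoC B0 * RtoC (a ^ 4 * exp (- (k * a ^ 2))) + RtoC (Rabs A * beta * th) * RtoC (a ^ 6 * exp (- (k * a ^ 2))))%C).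
{ intros a. unfold g. rewrite RtoC_plus, <- !RtoC_mult. reflexivity. }
assert (Dg : exists M, dom (fun a => RtoC (g a)) M).
{ exists (Cmod (RtoC B0) * M4 + Cmod (RtoC (Rabs A * beta * th)) * M6).
  assert (D := dom_plus _ _ _ _ (dom_mult (RtoC B0) _ _ D4) (dom_mult (RtoC (Rabs A * beta * th)) _ _ D6)).
  destruct D as [X1 X2]. split.
  - intros a. apply continuous_ext with (2 := X1 a). intros; symmetry; apply Eg.
  - intros a Ha. rewrite Eg. apply X2, Ha. }
destruct Dg as [Mg Dg].
(* the pointwise error, dominated by g *)
set (d := fun a => RtoC (exp (- (om a * th)) * r a - A * (a ^ 2 * exp (- (k * a ^ 2))))).
assert (Hd : forall a, 0 <= a -> Cmod (d a) <= g a).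
{ intros a Ha. unfold d. rewrite Cmod_R.
  assert (P4 : 0 <= a ^ 4) by (apply pow_le, Ha). assert (P2 : 0 <= a ^ 2) by (apply pow_le, Ha).
  set (e := exp (- (k * a ^ 2))). assert (He : 0 < e) by apply exp_pos.
  assert (Eo : exp (- (om a * th)) = e * exp (- (beta * a ^ 4 * th))).
  { unfold e. rewrite <- exp_plus. f_equal. unfold omR, k. ring. }
  assert (Hz : 0 <= beta * a ^ 4 * th) by (apply Rmult_le_pos; [apply Rmult_le_pos|]; lra).
  set (z := beta * a ^ 4 * th) in *.
  assert (Z1 : 1 - z <= exp (- z)) by (generalize (exp_ineq1_le (- z)); lra).
  assert (Z2 : exp (- z) <= 1) by (rewrite <- exp_0; apply exp_le_compat; lra).
  assert (Z3 := exp_pos (- z)).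
  rewrite Eo.
  replace (e * exp (- z) * r a - A * (a ^ 2 * e)) with (e * (exp (- z) * (r a - A * a ^ 2)) + e * (A * a ^ 2 * (exp (- z) - 1))) by ring.
  eapply Rle_trans; [apply Rabs_triang|]. rewrite !Rabs_mult, (Rabs_pos_eq e), (Rabs_pos_eq (exp (- z))), (Rabs_pos_eq (a ^ 2)) by lra.
  rewrite (Rabs_left1 (exp (- z) - 1)) by lra.
  unfold g. fold e.
  apply Rplus_le_compat.
  - replace (B0 * (a ^ 4 * e)) with (e * (1 * (B0 * a ^ 4))) by ring.
    apply Rmult_le_compat_l; [lra|]. apply Rmult_le_compat; [lra|apply Rabs_pos|exact Z2|apply Hr, Ha].
  - replace (Rabs A * beta * th * (a ^ 6 * e)) with (e * (Rabs A * a ^ 2 * z)) by (unfold z; ring).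
    apply Rmult_le_compat_l; [lra|]. apply Rmult_le_compat_l; [apply Rmult_le_pos; [apply Rabs_pos|lra]|]. lra. }
assert (Dd : dom d Mg).
{ split.
  - intros a. unfold d, omR. assert (X := Hc a). ctac.
  - intros a Ha. eapply Rle_trans; [apply Hd, Ha|].
    destruct Dg as [_ X]. specialize (X a Ha). rewrite Cmod_R in X. generalize (Rle_abs (g a)). lra. }
assert (DA := dom_mult (RtoC A) _ _ D2).
assert (Es : forall a, (d a + RtoC A * RtoC (a ^ 2 * exp (- (k * a ^ 2))))%C = RtoC (exp (- (om a * th)) * r a)).
{ intros a. unfold d. rewrite <- RtoC_mult, <- RtoC_plus. f_equal. ring. }
assert (Ds := dom_plus _ _ _ _ Dd DA).
assert (Df : dom (fun a => RtoC (exp (- (om a * th)) * r a)) (Mg + Cmod (RtoC A) * M2)).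
{ destruct Ds as [X1 X2]. split.
  - intros a. apply continuous_ext with (2 := X1 a). intros; apply Es.
  - intros a Ha. rewrite <- Es. apply X2, Ha. }
split; [exists (Mg + Cmod (RtoC A) * M2); exact Df|].
rewrite <- (half_ext _ (fun a => (d a + RtoC A * RtoC (a ^ 2 * exp (- (k * a ^ 2))))%C) _ Df) by (intros; symmetry; apply Es).
rewrite (half_plus _ _ _ _ Dd DA), (half_mult _ _ _ D2).
change (CInt_half (fun a => RtoC (a ^ 2 * exp (- (k * a ^ 2))))) with (moment 2 k). rewrite E2.
assert (Sa := sqrt_lt_R0 _ ha). assert (St := sqrt_lt_R0 _ Hth).
assert (Sk : sqrt k = sqrt alpha * sqrt th) by (apply sqrt_mult; lra).
replace (CInt_half d + RtoC A * RtoC (sqrt PI / (4 * (k * sqrt k))) - RtoC (A * (sqrt PI / (4 * (alpha * sqrt alpha))) / (th * sqrt th)))%C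
  with (CInt_half d).
2:{ rewrite <- RtoC_mult.
    replace (A * (sqrt PI / (4 * (alpha * sqrt alpha))) / (th * sqrt th)) with (A * (sqrt PI / (4 * (k * sqrt k)))); [ring|].
    rewrite Sk. unfold k. field. repeat split; lra. }
eapply Rle_trans; [apply (half_abs_le d g Mg Mg Dd Dg Hd)|].
assert (Eh : CInt_half (fun a => RtoC (g a)) = (RtoC B0 * moment 4 k + RtoC (Rabs A * beta * th) * moment 6 k)%C).
{ rewrite (half_ext (fun a => (RtoC B0 * RtoC (a ^ 4 * exp (- (k * a ^ 2))) + RtoC (Rabs A * beta * th) * RtoC (a ^ 6 * exp (- (k * a ^ 2))))%C)
    _ _ (dom_plus _ _ _ _ (dom_mult (RtoC B0) _ _ D4) (dom_mult (RtoC (Rabs A * beta * th)) _ _ D6))).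
  - rewrite (half_plus _ _ _ _ (dom_mult (RtoC B0) _ _ D4) (dom_mult (RtoC (Rabs A * beta * th)) _ _ D6)).
    rewrite (half_mult _ _ _ D4), (half_mult _ _ _ D6). reflexivity.
  - intros; symmetry; apply Eg. }
rewrite Eh, E4, E6, <- !RtoC_mult, <- RtoC_plus. cbn [Re RtoC fst].
rewrite Sk. unfold k, laplace_const.
set (u := 3 * sqrt PI / (8 * (alpha ^ 2 * sqrt alpha))).
set (v := 15 * sqrt PI / (16 * (alpha ^ 3 * sqrt alpha))).
replace (B0 * (3 * sqrt PI / (8 * ((alpha * th) ^ 2 * (sqrt alpha * sqrt th)))) + Rabs A * beta * th * (15 * sqrt PI / (16 * ((alpha * th) ^ 3 * (sqrt alpha * sqrt th)))))
  with ((B0 * u + Rabs A * beta * v) / (th ^ 2 * sqrt th)).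
2:{ unfold u, v. field. repeat split; lra. }
assert (P0 := sqrt_lt_R0 _ PI_RGT_0).
assert (a2 : 0 < alpha ^ 2) by (apply pow_lt, ha). assert (a3 : 0 < alpha ^ 3) by (apply pow_lt, ha).
assert (Hu : 0 <= u) by (left; apply Rdiv_lt_0_compat; nra).
assert (Hv : 0 <= v) by (left; apply Rdiv_lt_0_compat; nra).
assert (HA := Rabs_pos A).
apply Rmult_le_compat_r.
- left. apply Rinv_0_lt_compat. apply Rmult_lt_0_compat; [apply pow_lt, Hth|exact St].
- assert (0 <= beta * v) by (apply Rmult_le_pos; lra). nra.
Qed.

(** ** Small-frequency expansion of the eigenfunctions *)

Lemma c_pos : 0 < c.
Proof. apply sqrt_lt_R0, c2_pos; assumption. Qed.

Lemma c_sq : c * c = c2.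
Proof. apply sqrt_sqrt. left; apply c2_pos; assumption. Qed.

Lemma freq_bounds a : 0 <= a -> c <= frq a /\ frq a <= c + a /\ frq a - c <= a ^ 2 / (2 * c).
Proof.
intros Ha. assert (P := freq_pos alpha beta ha hb a). assert (S := freq_sq alpha beta ha hb a).
assert (C := c_pos). assert (Cs := c_sq). rewrite <- Cs in S.
assert (H1 : c <= frq a) by nra.
assert (H2 : frq a <= c + a) by nra.
split; [exact H1|split; [exact H2|]].
apply Rmult_le_reg_r with (2 * c); [lra|].
replace (a ^ 2 / (2 * c) * (2 * c)) with (a ^ 2) by (field; lra). nra.
Qed.

Lemma sin_abs_le z : Rabs (sin z) <= Rabs z.
Proof.
destruct (Rle_dec 0 z) as [H|H].
- rewrite (Rabs_pos_eq z) by exact H.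
  destruct (Req_dec z 0) as [->|N]; [rewrite sin_0, Rabs_R0; lra|].
  assert (S : sin z < z) by (apply sin_lt_x; lra).
  destruct (Rle_dec 1 z) as [L|L]; [generalize (SIN_bound z); intros; apply Rabs_le; lra|].
  assert (0 <= sin z) by (apply sin_ge_0; [lra|generalize PI2_1; lra]).
  rewrite Rabs_pos_eq; lra.
- rewrite <- (Rabs_Ropp z), <- (Rabs_Ropp (sin z)), <- sin_neg.
  assert (S : sin (- z) < - z) by (apply sin_lt_x; lra). rewrite (Rabs_pos_eq (- z)) by lra.
  destruct (Rle_dec 1 (- z)) as [L|L]; [generalize (SIN_bound (- z)); intros; apply Rabs_le; lra|].
  assert (0 <= sin (- z)) by (apply sin_ge_0; [lra|generalize PI2_1; lra]).
  rewrite Rabs_pos_eq; lra.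
Qed.

Lemma one_minus_cos_le z : 0 <= 1 - cos z <= z ^ 2 / 2.
Proof.
replace z with (2 * (z / 2)) at 1 2 by field. rewrite cos_2a_sin.
assert (A := sin_abs_le (z / 2)).
assert (B : Rsqr (sin (z / 2)) <= Rsqr (z / 2)) by (apply Rsqr_le_abs_1, A).
unfold Rsqr in B. generalize (Rle_0_sqr (sin (z / 2))). unfold Rsqr. nra.
Qed.

Lemma sin_cubic z : 0 <= z -> Rabs (sin z - z) <= z ^ 3 / 2.
Proof.
intros Hz.
destruct (MVT_gen (fun t => sin t - t) 0 z (fun t => cos t - 1)) as [w [Hw E]].
- intros t _. auto_derive; [trivial|ring].
- intros t _. apply continuity_pt_filterlim. change (continuous (fun t => sin t - t) t). ctac.
- rewrite Rmin_left, Rmax_right in Hw by lra. rewrite sin_0 in E.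
  replace (sin z - z) with ((cos w - 1) * (z - 0)) by lra.
  rewrite Rabs_mult, (Rabs_pos_eq (z - 0)) by lra.
  assert (B := one_minus_cos_le w). rewrite Rabs_left1 by lra.
  assert (w ^ 2 <= z ^ 2) by (apply pow_incr; lra).
  replace (z ^ 3 / 2) with (z ^ 2 / 2 * (z - 0)) by field.
  apply Rmult_le_compat_r; lra.
Qed.

Lemma exp_diff_le u v : 0 <= u <= v -> 0 <= exp (- u) - exp (- v) <= v - u.
Proof.
intros H. split.
- assert (exp (- v) <= exp (- u)) by (apply exp_le_compat; lra). lra.
- replace (exp (- v)) with (exp (- u) * exp (- (v - u))) by (rewrite <- exp_plus; f_equal; ring).
  assert (A := exp_ineq1_le (- (v - u))). assert (B := exp_pos (- u)).
  assert (C : exp (- u) <= 1) by (rewrite <- exp_0; apply exp_le_compat; lra).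
  assert (exp (- u) * (1 - (v - u)) <= exp (- u) * exp (- (v - u))) by (apply Rmult_le_compat_l; lra). nra.
Qed.

Lemma profile_bounds y : 0 <= y -> 0 <= profile y <= y.
Proof.
intros Hy. unfold Defs.profile. assert (C := c_pos).
assert (E := exp_diff_le 0 (c * y) ltac:(nra)). rewrite Ropp_0, exp_0 in E.
assert (0 <= (1 - exp (- (c * y))) / c <= y); [|lra]. split.
- apply Rdiv_le_0_compat; lra.
- apply Rmult_le_reg_r with c; [exact C|]. unfold Rdiv. rewrite Rmult_assoc, Rinv_l, Rmult_1_r by lra. lra.
Qed.

Definition eig_const : R := 1 / 2 + 1 / c + c / 2.

Lemma eig_const_pos : 0 < eig_const.
Proof. unfold eig_const. assert (C := c_pos). assert (0 < 1 / c) by (apply Rdiv_lt_0_compat; lra). lra. Qed.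

(** For small [a] the eigenfunction is close to - a c times the stationary solution [profile]; the
error is cubic and not quadratic in [a] because [eigenfun] is odd in [a]. *)
Lemma eigenfun_expansion a y : 0 <= a -> 0 <= y ->
  Rabs (eig a y + a * c * profile y) <= eig_const * (1 + y) ^ 3 * a ^ 3.
Proof.
intros Ha Hy. assert (C := c_pos). destruct (freq_bounds a Ha) as [F1 [F2 F3]].
assert (E := exp_diff_le (c * y) (frq a * y) ltac:(nra)).
assert (K := one_minus_cos_le (a * y)). assert (S := sin_cubic (a * y) ltac:(nra)).
assert (S1 := sin_abs_le (a * y)). rewrite (Rabs_pos_eq (a * y)) in S1 by nra.
unfold eigenfun, Defs.profile.
replace (a * (cos (a * y) - exp (- (frq a * y))) - frq a * sin (a * y) + a * c * (y - (1 - exp (- (c * y))) / c))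
 with (- (a * (1 - cos (a * y))) + (a * (exp (- (c * y)) - exp (- (frq a * y))) + (- ((frq a - c) * sin (a * y)) + - (c * (sin (a * y) - a * y))))) by (field; lra).
assert (B1 : Rabs (- (a * (1 - cos (a * y)))) <= a ^ 3 * (y ^ 2 / 2)).
{ rewrite Rabs_Ropp, Rabs_mult, !Rabs_pos_eq by lra.
  replace (a ^ 3 * (y ^ 2 / 2)) with (a * ((a * y) ^ 2 / 2)) by field. apply Rmult_le_compat_l; lra. }
assert (Q : (frq a - c) * y <= a ^ 2 * y / (2 * c)).
{ replace (a ^ 2 * y / (2 * c)) with (a ^ 2 / (2 * c) * y) by (field; lra). apply Rmult_le_compat_r; lra. }
assert (B2 : Rabs (a * (exp (- (c * y)) - exp (- (frq a * y)))) <= a ^ 3 * (y / (2 * c))).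
{ rewrite Rabs_mult, !Rabs_pos_eq by lra.
  replace (a ^ 3 * (y / (2 * c))) with (a * (a ^ 2 * y / (2 * c))) by (field; lra). apply Rmult_le_compat_l; lra. }
assert (B3 : Rabs (- ((frq a - c) * sin (a * y))) <= a ^ 3 * (y / (2 * c))).
{ rewrite Rabs_Ropp, Rabs_mult, (Rabs_pos_eq (frq a - c)) by lra.
  apply Rle_trans with ((frq a - c) * (a * y)); [apply Rmult_le_compat_l; lra|].
  replace (a ^ 3 * (y / (2 * c))) with (a * (a ^ 2 * y / (2 * c))) by (field; lra).
  replace ((frq a - c) * (a * y)) with (a * ((frq a - c) * y)) by ring. apply Rmult_le_compat_l; lra. }
assert (B4 : Rabs (- (c * (sin (a * y) - a * y))) <= a ^ 3 * (c * y ^ 3 / 2)).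
{ rewrite Rabs_Ropp, Rabs_mult, (Rabs_pos_eq c) by lra.
  replace (a ^ 3 * (c * y ^ 3 / 2)) with (c * ((a * y) ^ 3 / 2)) by field. apply Rmult_le_compat_l; lra. }
assert (T1 := Rabs_triang (- (a * (1 - cos (a * y)))) (a * (exp (- (c * y)) - exp (- (frq a * y))) + (- ((frq a - c) * sin (a * y)) + - (c * (sin (a * y) - a * y))))).
assert (T2 := Rabs_triang (a * (exp (- (c * y)) - exp (- (frq a * y)))) (- ((frq a - c) * sin (a * y)) + - (c * (sin (a * y) - a * y)))).
assert (T3 := Rabs_triang (- ((frq a - c) * sin (a * y))) (- (c * (sin (a * y) - a * y)))).
apply Rle_trans with (a ^ 3 * (y ^ 2 / 2 + y / c + c * y ^ 3 / 2)).
{ replace (a ^ 3 * (y ^ 2 / 2 + y / c + c * y ^ 3 / 2)) with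
    (a ^ 3 * (y ^ 2 / 2) + (a ^ 3 * (y / (2 * c)) + (a ^ 3 * (y / (2 * c)) + a ^ 3 * (c * y ^ 3 / 2)))) by (field; lra). lra. }
rewrite (Rmult_comm _ (a ^ 3)). apply Rmult_le_compat_l; [apply pow_le, Ha|].
unfold eig_const.
assert (Y1 : 0 <= y ^ 2) by apply pow2_ge_0. assert (Y2 : 0 <= y ^ 3) by (apply pow_le, Hy).
assert (Y3 : (1 + y) ^ 3 = 1 + 3 * y + 3 * y ^ 2 + y ^ 3) by ring.
assert (Ic : 0 < / c) by (apply Rinv_0_lt_compat, C).
unfold Rdiv. rewrite Y3.
assert (/ c * y <= / c * (1 + 3 * y + 3 * y ^ 2 + y ^ 3)) by (apply Rmult_le_compat_l; lra).
assert (c * y ^ 3 <= c * (1 + 3 * y + 3 * y ^ 2 + y ^ 3)) by (apply Rmult_le_compat_l; lra).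
lra.
Qed.

Lemma eigenfun_bound a y : 0 <= a -> 0 <= y -> Rabs (eig a y) <= (3 + c) * (1 + y) * a.
Proof.
intros Ha Hy. assert (C := c_pos). destruct (freq_bounds a Ha) as [F1 [F2 F3]].
unfold eigenfun.
assert (B1 : Rabs (a * (cos (a * y) - exp (- (frq a * y)))) <= a * 2).
{ rewrite Rabs_mult, (Rabs_pos_eq a) by lra. apply Rmult_le_compat_l; [lra|].
  assert (X := COS_bound (a * y)). assert (Y := exp_pos (- (frq a * y))).
  assert (Z : exp (- (frq a * y)) <= 1) by (rewrite <- exp_0; apply exp_le_compat; nra).
  apply Rabs_le; lra. }
assert (B2 : Rabs (frq a * sin (a * y)) <= c * (a * y) + a).
{ rewrite Rabs_mult, (Rabs_pos_eq (frq a)) by lra.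
  assert (S1 := sin_abs_le (a * y)). rewrite (Rabs_pos_eq (a * y)) in S1 by nra.
  assert (S2 : Rabs (sin (a * y)) <= 1) by (apply Rabs_le; generalize (SIN_bound (a * y)); lra).
  assert (S0 := Rabs_pos (sin (a * y))).
  apply Rle_trans with ((c + a) * Rabs (sin (a * y))); [apply Rmult_le_compat_r; lra|].
  rewrite Rmult_plus_distr_r. apply Rplus_le_compat; [apply Rmult_le_compat_l; lra|].
  apply Rle_trans with (a * 1); [apply Rmult_le_compat_l; lra|lra]. }
unfold Rminus at 1. eapply Rle_trans; [apply Rabs_triang|]. rewrite Rabs_Ropp.
assert (0 <= a * y) by nra. nra.
Qed.

Lemma cont_freq {T : UniformSpace} (f : T -> R) p : continuous f p -> continuous (fun q => frq (f q)) p.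
Proof. intros H; unfold freq; ctac. Qed.

Lemma cont_eigenfun {T : UniformSpace} (f g : T -> R) p : continuous f p -> continuous g p ->
  continuous (fun q => eig (f q) (g q)) p.
Proof. intros H H'. assert (A := cont_freq f p H). unfold eigenfun; ctac. Qed.

Lemma Rabs_div_le n m w w0 : 0 < w0 -> w0 <= w -> Rabs n <= m -> Rabs (n / w) <= m / w0.
Proof.
intros H0 H1 H2. unfold Rdiv. rewrite Rabs_mult, (Rabs_pos_eq (/ w)) by (left; apply Rinv_0_lt_compat; lra).
apply Rmult_le_compat; [apply Rabs_pos|left; apply Rinv_0_lt_compat; lra|exact H2|].
apply Rinv_le_contravar; assumption.
Qed.

Definition source_const (x : R) : R :=
  ((3 + c) * (eig_const * (1 + x) ^ 3) + c * x * eig_const + 2 * x) / c2.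

(** The two factors each vanish to first order at a = 0, hence the absence of a term of order 1:
this is why there is no t^(- 1 / 2) in the expansion. *)
Lemma source_expansion x a y : 0 <= x -> 0 <= a -> 0 <= y ->
  Rabs (eig a x * eig a y / (2 * a ^ 2 + c2) - profile x * profile y * a ^ 2)
  <= source_const x * (1 + y) ^ 3 * a ^ 4.
Proof.
intros Hx Ha Hy. assert (C := c_pos). assert (C2 := c2_pos alpha beta ha hb). assert (Cs := c_sq).
assert (E1 := eigenfun_expansion a x Ha Hx). assert (E2 := eigenfun_expansion a y Ha Hy).
assert (B2 := eigenfun_bound a y Ha Hy).
assert (P1 := profile_bounds x Hx). assert (P2 := profile_bounds y Hy). assert (K := eig_const_pos).
set (fx := eig a x) in *. set (fy := eig a y) in *. set (px := profile x) in *. set (py := profile y) in *.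
set (W := 2 * a ^ 2 + c2). assert (HW : c2 <= W) by (unfold W; generalize (pow2_ge_0 a); lra).
assert (a2 : 0 <= a ^ 2) by apply pow2_ge_0.
assert (a3 : 0 <= a ^ 3) by (apply pow_le, Ha). assert (a4 : 0 <= a ^ 4) by (apply pow_le, Ha).
(* replace each eigenfunction by its leading term in turn, then W by c2 *)
replace (fx * fy / W - px * py * a ^ 2) with
  (((fx + a * c * px) * fy + - (a * c * px * (fy + a * c * py)) + - (2 * a ^ 4 * (px * py))) / W).
2:{ unfold W. set (cc := c) in *. rewrite <- Cs. field. nra. }
set (Y := 1 + y). assert (HY : 1 <= Y) by (unfold Y; lra).
assert (Y3 : Y <= Y ^ 3) by nra.
assert (N1 : Rabs ((fx + a * c * px) * fy) <= (3 + c) * (eig_const * (1 + x) ^ 3) * Y ^ 3 * a ^ 4).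
{ rewrite Rabs_mult.
  apply Rle_trans with ((eig_const * (1 + x) ^ 3 * a ^ 3) * ((3 + c) * Y * a)).
  - apply Rmult_le_compat; try apply Rabs_pos; assumption.
  - replace ((eig_const * (1 + x) ^ 3 * a ^ 3) * ((3 + c) * Y * a)) with
      (((3 + c) * (eig_const * (1 + x) ^ 3) * a ^ 4) * Y) by ring.
    replace ((3 + c) * (eig_const * (1 + x) ^ 3) * Y ^ 3 * a ^ 4) with
      (((3 + c) * (eig_const * (1 + x) ^ 3) * a ^ 4) * Y ^ 3) by ring.
    apply Rmult_le_compat_l; [|exact Y3].
    assert (0 <= (1 + x) ^ 3) by (apply pow_le; lra).
    repeat apply Rmult_le_pos; lra. }
assert (N2 : Rabs (- (a * c * px * (fy + a * c * py))) <= (c * x * eig_const) * Y ^ 3 * a ^ 4).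
{ rewrite Rabs_Ropp, Rabs_mult, (Rabs_pos_eq (a * c * px)) by (repeat apply Rmult_le_pos; lra).
  apply Rle_trans with ((a * c * x) * (eig_const * Y ^ 3 * a ^ 3)).
  - apply Rmult_le_compat; [repeat apply Rmult_le_pos; lra|apply Rabs_pos| |exact E2].
    apply Rmult_le_compat_l; [apply Rmult_le_pos; lra|lra].
  - right; ring. }
assert (N3 : Rabs (- (2 * a ^ 4 * (px * py))) <= (2 * x) * Y ^ 3 * a ^ 4).
{ rewrite Rabs_Ropp, Rabs_pos_eq by (repeat apply Rmult_le_pos; lra).
  replace ((2 * x) * Y ^ 3 * a ^ 4) with (2 * a ^ 4 * (x * Y ^ 3)) by ring.
  apply Rmult_le_compat_l; [lra|]. apply Rmult_le_compat; unfold Y in *; lra. }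
assert (N : Rabs ((fx + a * c * px) * fy + - (a * c * px * (fy + a * c * py)) + - (2 * a ^ 4 * (px * py)))
   <= ((3 + c) * (eig_const * (1 + x) ^ 3) + c * x * eig_const + 2 * x) * Y ^ 3 * a ^ 4).
{ eapply Rle_trans; [apply Rabs_triang|]. assert (T := Rabs_triang ((fx + a * c * px) * fy) (- (a * c * px * (fy + a * c * py)))).
  replace (((3 + c) * (eig_const * (1 + x) ^ 3) + c * x * eig_const + 2 * x) * Y ^ 3 * a ^ 4) with
   ((3 + c) * (eig_const * (1 + x) ^ 3) * Y ^ 3 * a ^ 4 + (c * x * eig_const) * Y ^ 3 * a ^ 4 + (2 * x) * Y ^ 3 * a ^ 4) by ring.
  lra. }
replace (source_const x * Y ^ 3 * a ^ 4) with
  ((((3 + c) * (eig_const * (1 + x) ^ 3) + c * x * eig_const + 2 * x) * Y ^ 3 * a ^ 4) / c2).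
- apply Rabs_div_le; assumption.
- unfold source_const. set (cc := c). field. lra.
Qed.

Lemma g1_expansion x a : 0 <= x -> 0 <= a ->
  Rabs (a * eig a x - - (c * profile x) * a ^ 2) <= eig_const * (1 + x) ^ 3 * a ^ 4.
Proof.
intros Hx Ha. assert (E1 := eigenfun_expansion a x Ha Hx).
replace (a * eig a x - - (c * profile x) * a ^ 2) with (a * (eig a x + a * c * profile x)) by ring.
rewrite Rabs_mult, (Rabs_pos_eq a) by exact Ha.
replace (eig_const * (1 + x) ^ 3 * a ^ 4) with (a * (eig_const * (1 + x) ^ 3 * a ^ 3)) by ring.
apply Rmult_le_compat_l; assumption.
Qed.

Lemma g0_expansion x a : 0 <= x -> 0 <= a ->
  Rabs (a * frq a * eig a x - - (c2 * profile x) * a ^ 2)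
  <= ((3 + c) * (1 + x) / (2 * c) + c * (eig_const * (1 + x) ^ 3)) * a ^ 4.
Proof.
intros Hx Ha. assert (C := c_pos). assert (Cs := c_sq). assert (E1 := eigenfun_expansion a x Ha Hx).
assert (B1 := eigenfun_bound a x Ha Hx). destruct (freq_bounds a Ha) as [F1 [F2 F3]].
replace (a * frq a * eig a x - - (c2 * profile x) * a ^ 2) with (a * frq a * eig a x - - (c * c * profile x) * a ^ 2)
  by (rewrite Cs; reflexivity).
replace (a * frq a * eig a x - - (c * c * profile x) * a ^ 2) with
  (a * ((frq a - c) * eig a x) + a * c * (eig a x + a * c * profile x)) by ring.
eapply Rle_trans; [apply Rabs_triang|]. rewrite Rmult_plus_distr_r. apply Rplus_le_compat.
- rewrite !Rabs_mult, (Rabs_pos_eq a), (Rabs_pos_eq (frq a - c)) by lra.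
  replace ((3 + c) * (1 + x) / (2 * c) * a ^ 4) with (a * (a ^ 2 / (2 * c) * ((3 + c) * (1 + x) * a))) by (field; lra).
  apply Rmult_le_compat_l; [exact Ha|]. apply Rmult_le_compat; [lra|apply Rabs_pos|exact F3|exact B1].
- rewrite Rabs_mult, (Rabs_pos_eq (a * c)) by (apply Rmult_le_pos; lra).
  replace (c * (eig_const * (1 + x) ^ 3) * a ^ 4) with (a * c * (eig_const * (1 + x) ^ 3 * a ^ 3)) by ring.
  apply Rmult_le_compat_l; [apply Rmult_le_pos; lra|exact E1].
Qed.

End Laplace.

(** * Periodic sources *)

Section Duhamel.
Context (alpha beta : R) (ha : 0 < alpha) (hb : 0 < beta).
Notation om := (omR alpha beta).

(** A bound valid for both types of kernels: the inverse square covers those on the curves, which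
decay exponentially in [a] uniformly in time, and the exponential covers those on the real line,
which decay for positive times only. *)
Definition kbound (th a : R) : R := / (1 + a) ^ 2 + exp (- (om a * th)).

Lemma om_pos a : 0 <= om a.
Proof.
unfold omR. assert (0 <= a ^ 2) by apply pow2_ge_0. replace (a ^ 4) with ((a ^ 2) ^ 2) by ring.
assert (0 <= (a ^ 2) ^ 2) by apply pow2_ge_0. nra.
Qed.

Lemma kbound_pos th a : 0 <= a -> 0 < kbound th a.
Proof. intros Ha; unfold kbound. generalize (weight_pos a Ha) (exp_pos (- (om a * th))). lra. Qed.

Lemma kbound_le2 th a : 0 <= th -> 0 <= a -> kbound th a <= 2.
Proof.
intros Ht Ha; unfold kbound.
assert (/ (1 + a) ^ 2 <= 1) by (rewrite <- Rinv_1; apply Rinv_le_contravar; [lra|nra]).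
assert (exp (- (om a * th)) <= 1).
{ rewrite <- exp_0. apply exp_le_compat. assert (H0 := om_pos a). nra. }
lra.
Qed.

(** For times bounded away from 0 the Gaussian factor is itself dominated by the inverse square. *)
Lemma kbound_late t0 : 0 < t0 -> exists K, 0 <= K /\ forall th a, t0 <= th -> 0 <= a -> kbound th a <= K * / (1 + a) ^ 2.
Proof.
intros H0. assert (Hk : 0 < 2 * (alpha * t0)) by nra.
destruct (exp_dominates_poly (2 * (alpha * t0)) 0 Hk) as [M [HM0 HM]].
exists (1 + exp (alpha * t0) * M). split.
{ assert (0 < exp (alpha * t0)) by apply exp_pos. nra. }
intros th a Ht Ha. unfold kbound. rewrite Rmult_plus_distr_r, Rmult_1_l. apply Rplus_le_compat_l.
apply Rle_trans with (exp (alpha * t0) * ((1 + a) ^ 0 * exp (- (2 * (alpha * t0) * a)))).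
- simpl. rewrite Rmult_1_l, <- exp_plus. apply exp_le_compat. unfold omR.
  assert (0 <= a ^ 2) by apply pow2_ge_0. assert (0 <= a ^ 4) by (apply pow_le, Ha).
  assert (2 * a - 1 <= a ^ 2) by (generalize (pow2_ge_0 (a - 1)); lra).
  assert (alpha * t0 * (2 * a - 1) <= alpha * t0 * a ^ 2) by (apply Rmult_le_compat_l; nra).
  assert (alpha * a ^ 2 * t0 <= alpha * a ^ 2 * th) by (apply Rmult_le_compat_l; nra).
  assert (0 <= beta * a ^ 4 * th) by (apply Rmult_le_pos; nra). nra.
- rewrite (Rmult_assoc _ M). apply Rmult_le_compat_l; [left; apply exp_pos|]. apply HM, Ha.
Qed.

(** At the final time the kernel does not decay in the frequency, but integrating exp (- omega th)
in time gains a factor 1 / omega, which makes the source term integrable over the frequencies. *)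
Lemma kbound_Duhamel t : 0 <= t -> exists K, 0 <= K /\ forall a, 0 <= a ->
  exists J, is_RInt (fun tau => kbound (t - tau) a) 0 t J /\ J <= K * / (1 + a) ^ 2.
Proof.
intros Ht. exists (t + (4 * t + 4 / beta)). split.
{ assert (0 < 4 / beta) by (apply Rdiv_lt_0_compat; lra). lra. }
intros a Ha. exists (RInt (fun tau => kbound (t - tau) a) 0 t).
assert (Hc : forall s, continuous (fun tau => kbound (t - tau) a) s) by (intros; unfold kbound, omR; ctac; apply pow_nonzero; lra).
assert (Hex : ex_RInt (fun tau => kbound (t - tau) a) 0 t).
{ apply (ex_RInt_continuous (V := R_CompleteNormedModule)); intros; apply Hc. }
split; [apply (RInt_correct (V := R_CompleteNormedModule)), Hex|].
assert (W := weight_pos a Ha).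
assert (Hexe : ex_RInt (fun tau => exp (- (om a * (t - tau)))) 0 t).
{ apply (ex_RInt_continuous (V := R_CompleteNormedModule)); intros; unfold omR; ctac. }
assert (E : RInt (fun tau => kbound (t - tau) a) 0 t = t * / (1 + a) ^ 2 + RInt (fun tau => exp (- (om a * (t - tau)))) 0 t).
{ unfold kbound. rewrite (RInt_plus (V := R_CompleteNormedModule)); [|apply ex_RInt_const|exact Hexe].
  rewrite (RInt_const (V := R_CompleteNormedModule)). unfold plus, scal; simpl; unfold mult; simpl. f_equal. ring. }
rewrite E, Rmult_plus_distr_r. apply Rplus_le_compat_l.
destruct (Rle_dec a 1) as [L|L].
- apply Rle_trans with t.
  + replace t with (RInt (fun _ => 1) 0 t) at 2.
    * apply RInt_le; [exact Ht|exact Hexe|apply ex_RInt_const|]. intros s Hs.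
      rewrite <- exp_0. apply exp_le_compat. generalize (om_pos a). nra.
    * rewrite (RInt_const (V := R_CompleteNormedModule)). unfold scal; simpl; unfold mult; simpl. ring.
  + assert (/ 4 <= / (1 + a) ^ 2).
    { apply Rinv_le_contravar; [nra|]. nra. }
    assert (0 < 4 / beta) by (apply Rdiv_lt_0_compat; lra). nra.
- assert (O : beta * a ^ 4 <= om a) by (unfold omR; assert (0 <= a ^ 2) by apply pow2_ge_0; nra).
  assert (a4 : 1 <= a ^ 4) by (apply pow_R1_Rle; lra).
  assert (O0 : 0 < om a) by nra.
  assert (V : RInt (fun tau => exp (- (om a * (t - tau)))) 0 t = (1 - exp (- (om a * t))) / om a).
  { apply is_RInt_unique.
    replace ((1 - exp (- (om a * t))) / om a) with (exp (- (om a * (t - t))) / om a - exp (- (om a * (t - 0))) / om a).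
    - apply (real_FTC_open (fun tau => exp (- (om a * (t - tau))) / om a)); [exact Ht| | |].
      + intros; unfold omR in *; ctac. lra.
      + intros; unfold omR in *; ctac.
      + intros s _. eapply is_derive_eq; [apply (is_derive_Rmult (fun tau => exp (- (om a * (t - tau)))) (fun _ => / om a));
          [apply is_derive_Rexp|apply is_derive_Rconst]|].
        * instantiate (1 := om a). generalize (om a). intros z. auto_derive; [trivial|ring].
        * cbv beta. field. lra.
    - replace (- (om a * (t - t))) with 0 by ring. rewrite exp_0. replace (t - 0) with t by ring. field. lra. }
  rewrite V. assert (Pe := exp_pos (- (om a * t))).
  apply Rle_trans with (/ (beta * a ^ 2)).
  + apply Rle_trans with (1 / om a).
    * apply Rmult_le_compat_r; [left; apply Rinv_0_lt_compat; lra|lra].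
    * unfold Rdiv. rewrite Rmult_1_l. apply Rinv_le_contravar; [nra|].
      assert (beta * a ^ 2 <= beta * a ^ 4); [|lra]. apply Rmult_le_compat_l; [lra|].
      replace (a ^ 4) with (a ^ 2 * a ^ 2) by ring. assert (1 <= a ^ 2) by nra. nra.
  + assert (X : / (beta * a ^ 2) <= 4 / beta * / (1 + a) ^ 2).
    { unfold Rdiv. rewrite Rinv_mult.
      replace (4 * / beta * / (1 + a) ^ 2) with (/ beta * (4 * / (1 + a) ^ 2)) by ring.
      apply Rmult_le_compat_l; [left; apply Rinv_0_lt_compat; lra|].
      apply Rmult_le_reg_r with (a ^ 2 * (1 + a) ^ 2); [nra|].
      replace (/ a ^ 2 * (a ^ 2 * (1 + a) ^ 2)) with ((1 + a) ^ 2) by (field; lra).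
      replace (4 * / (1 + a) ^ 2 * (a ^ 2 * (1 + a) ^ 2)) with (4 * a ^ 2) by (field; lra). nra. }
    assert (0 <= 4 * t * / (1 + a) ^ 2) by nra. nra.
Qed.

(** Kernels [k th y a] after a delay [th], for a source at [y] and a frequency [a]; extended evenly
to negative [a]. *)
Record kernel_ok (k : R -> R -> R -> C) (M : R) : Prop := {
  kernel_cont : forall (T : UniformSpace) (th y a : T -> R) p,
    continuous th p -> continuous y p -> continuous a p ->
    ccont (fun q => k (th q) (y q) (Rabs (a q))) p;
  kernel_bound : forall th y a, 0 <= th -> 0 <= y -> 0 <= a -> Cmod (k th y a) <= M * kbound th a }.

Lemma kernel_ok_conj k M : kernel_ok k M -> kernel_ok (fun th y a => Cconj (k th y a)) M.
Proof.
intros [H1 H2]; constructor.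
- intros; apply ccont_conj, H1; assumption.
- intros; rewrite Cmod_conj; apply H2; assumption.
Qed.

(** [W th tau a]: response at frequency [a], after a delay [th], to the source at time [tau]. *)
Record response (T : R) (W : R -> R -> R -> C) (M : R) : Prop := {
  response_cont : forall (U : UniformSpace) (th tau a : U -> R) p,
    continuous th p -> continuous tau p -> continuous a p ->
    ccont (fun q => W (th q) (tau q) (a q)) p;
  response_bound : forall th tau a, 0 <= th -> 0 <= a -> Cmod (W th tau a) <= M * kbound th a;
  response_periodic : forall th tau a, 0 <= tau -> W th (tau + T) a = W th tau a }.

Lemma response_plus T W1 W2 M1 M2 : response T W1 M1 -> response T W2 M2 ->
  response T (fun th tau a => (W1 th tau a + W2 th tau a)%C) (M1 + M2).
Proof.
intros [A1 A2 A3] [B1 B2 B3]; constructor.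
- intros; apply ccont_plus; [apply A1|apply B1]; assumption.
- intros; eapply Rle_trans; [apply Cmod_triangle|]. rewrite Rmult_plus_distr_r.
  apply Rplus_le_compat; [apply A2|apply B2]; assumption.
- intros; rewrite A3, B3; trivial.
Qed.

Lemma response_opp T W M : response T W M -> response T (fun th tau a => (- W th tau a)%C) M.
Proof.
intros [A1 A2 A3]; constructor.
- intros; apply ccont_opp, A1; assumption.
- intros; rewrite Cmod_opp; apply A2; assumption.
- intros; rewrite A3; trivial.
Qed.

Lemma response_minus T W1 W2 M1 M2 : response T W1 M1 -> response T W2 M2 ->
  response T (fun th tau a => (W1 th tau a - W2 th tau a)%C) (M1 + M2).
Proof. intros; apply response_plus; [|apply response_opp]; assumption. Qed.

Lemma response_M_pos T W M : response T W M -> 0 <= M.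
Proof.
intros H. assert (A := response_bound _ _ _ H 0 0 0 (Rle_refl 0) (Rle_refl 0)).
assert (B := kbound_pos 0 0 (Rle_refl 0)). generalize (Cmod_ge_0 (W 0 0 0)). nra.
Qed.

(** The time integral in the formula at one frequency, each source entering with its age [t - tau].
*)
Definition duhamel (W : R -> R -> R -> C) (t a : R) : C := CInt (fun tau => W (t - tau) tau a) 0 t.

Section OneResponse.
Context (T : R) (W : R -> R -> R -> C) (M : R) (hT : 0 < T) (HW : response T W M).

Lemma duhamel_jcont (t : R) : jcont (fun a tau => W (t - tau) tau a).
Proof. intros p. apply (response_cont _ _ _ HW); ctac. Qed.

Lemma duhamel_dom t : 0 <= t -> exists K, dom (duhamel W t) K.
Proof.
intros Ht. destruct (kbound_Duhamel t Ht) as [K [HK0 HK]].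
assert (HM := response_M_pos _ _ _ HW).
exists (M * K). split.
- intros a. apply (CInt_jcont (fun a tau => W (t - tau) tau a)); [exact Ht|apply duhamel_jcont].
- intros a Ha. destruct (HK a Ha) as [J [J1 J2]].
  apply Rle_trans with (M * J).
  + apply CInt_le with (fun tau => M * kbound (t - tau) a); [exact Ht| | |].
    * intros s _. apply (response_cont _ _ _ HW); ctac.
    * intros s Hs. apply (response_bound _ _ _ HW); lra.
    * apply (is_RInt_scal (V := R_NormedModule)). exact J1.
  + rewrite (Rmult_assoc M K). apply Rmult_le_compat_l; assumption.
Qed.

Lemma CInt_shift (h : R -> C) (s N : R) : 0 <= N -> (forall a, ccont h a) ->
  CInt h s (N + s) = CInt (fun t => h (t + s)) 0 N.
Proof.
intros HN Hc.
assert (D : forall t, cder (fun t => CInt h s (t + s)) t (h (t + s))).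
{ intros t. eapply cder_ext; [reflexivity| |apply (cder_comp_real (fun v => CInt h s v) (fun t => t + s)); [apply cder_CInt, Hc|]].
  - instantiate (1 := 1). ring.
  - auto_derive; [trivial|ring]. }
rewrite (CInt_FTC (fun t => CInt h s (t + s)) (fun t => h (t + s))); [|exact HN| | |].
- rewrite Rplus_0_l, (CInt_unique h s s (RtoC 0)) by apply (is_RInt_point (V := CV)). ring.
- intros; eapply cder_continuous, D.
- intros t _. apply (continuous_comp (fun t => t + s) h); [ctac|apply Hc].
- intros; apply D.
Qed.

(** Shifting time by [T], the integral up to [t] becomes the integral from [T] to [t + T], and
periodicity leaves the sources unchanged. *)
Lemma duhamel_difference_pointwise t a : 0 <= t ->
  (duhamel W (t + T) a - duhamel W t a)%C = CInt (fun tau => W (t + T - tau) tau a) 0 T.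
Proof.
intros Ht. unfold duhamel.
assert (Hc : forall s, ccont (fun tau => W (t + T - tau) tau a) s).
{ intros s. apply (response_cont _ _ _ HW); ctac. }
rewrite (CInt_Chasles _ 0 T (t + T)) by (intros s _; apply Hc).
rewrite (CInt_shift (fun tau => W (t + T - tau) tau a) T t Ht Hc).
rewrite (CInt_ext (fun s => W (t + T - (s + T)) (s + T) a) (fun s => W (t - s) s a)).
- ring.
- rewrite Rmin_left, Rmax_right by lra. intros s Hs.
  rewrite (response_periodic _ _ _ HW) by lra. f_equal. ring.
Qed.

(** By periodicity only the sources of one period survive in the difference, and they have age at
least [t], so that frequencies and times can be exchanged. The absolute value keeps the age above
[t] for [s] beyond [T]. *)
Lemma duhamel_difference t : 0 < t ->
  (forall s, ccont (fun s => CInt_half (fun a => W (t + Rabs (T - s)) s (Rabs a))) s) /\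
  (CInt_half (duhamel W (t + T)) - CInt_half (duhamel W t))%C =
  CInt (fun s => CInt_half (fun a => W (t + Rabs (T - s)) s (Rabs a))) 0 T.
Proof.
intros Ht. destruct (kbound_late t Ht) as [K [HK0 HK]]. assert (HM := response_M_pos _ _ _ HW).
assert (Hb : forall s a, 0 <= a -> Cmod (W (t + Rabs (T - s)) s (Rabs a)) <= M * K * / (1 + a) ^ 2).
{ intros s a Ha. rewrite (Rabs_pos_eq a) by exact Ha. assert (P0 := Rabs_pos (T - s)).
  eapply Rle_trans; [apply (response_bound _ _ _ HW); lra|]. rewrite (Rmult_assoc M K).
  apply Rmult_le_compat_l; [exact HM|]. apply HK; lra. }
assert (Hc : forall s, ccont (fun s => CInt_half (fun a => W (t + Rabs (T - s)) s (Rabs a))) s).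
{ intros s. apply (half_param_cont (fun s a => W (t + Rabs (T - s)) s (Rabs a)) (M * K)).
  - intros q. apply (response_cont _ _ _ HW); ctac.
  - apply filter_forall; intros s'; apply Hb. }
split; [exact Hc|].
destruct (duhamel_dom (t + T) ltac:(lra)) as [K1 D1]. destruct (duhamel_dom t ltac:(lra)) as [K2 D2].
rewrite <- (half_minus _ _ _ _ D1 D2).
assert (Jc : jcont (fun a s => W (t + Rabs (T - s)) s (Rabs a))).
{ intros p. apply (response_cont _ _ _ HW); ctac. }
rewrite <- (half_CInt_swap (fun a s => W (t + Rabs (T - s)) s (Rabs a)) (M * K) T); [|lra|exact Jc|intros; apply Hb; assumption|exact Hc].
apply (half_ext _ _ _ (half_CInt_dom (fun a s => W (t + Rabs (T - s)) s (Rabs a)) (M * K) T ltac:(lra) Jc ltac:(intros; apply Hb; assumption))).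
intros a Ha. rewrite duhamel_difference_pointwise by lra. apply CInt_ext.
rewrite Rmin_left, Rmax_right by lra. intros s Hs. rewrite !Rabs_pos_eq by lra. f_equal. ring.
Qed.

Lemma response_dom_late t s : 0 < t -> exists K, dom (fun a => W t s (Rabs a)) K.
Proof.
intros Ht. destruct (kbound_late t Ht) as [K [HK0 HK]]. assert (HM := response_M_pos _ _ _ HW).
exists (M * K). split.
- intros a. apply (response_cont _ _ _ HW); ctac.
- intros a Ha. rewrite Rabs_pos_eq by exact Ha. eapply Rle_trans; [apply (response_bound _ _ _ HW); lra|].
  rewrite (Rmult_assoc M K). apply Rmult_le_compat_l; [exact HM|]. apply HK; lra.
Qed.
End OneResponse.

Lemma duhamel_plus T W1 W2 M1 M2 t : response T W1 M1 -> response T W2 M2 -> 0 <= t ->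
  CInt_half (duhamel (fun th tau a => (W1 th tau a + W2 th tau a)%C) t) =
  (CInt_half (duhamel W1 t) + CInt_half (duhamel W2 t))%C.
Proof.
intros H1 H2 Ht. destruct (duhamel_dom _ _ _ H1 t Ht) as [K1 D1]. destruct (duhamel_dom _ _ _ H2 t Ht) as [K2 D2].
rewrite <- (half_plus _ _ _ _ D1 D2).
apply (half_ext _ _ _ (dom_plus _ _ _ _ D1 D2)). intros a Ha. unfold duhamel.
symmetry; apply CInt_plus; intros s _; [apply (response_cont _ _ _ H1)|apply (response_cont _ _ _ H2)]; ctac.
Qed.

Lemma duhamel_minus T W1 W2 M1 M2 t : response T W1 M1 -> response T W2 M2 -> 0 <= t ->
  CInt_half (duhamel (fun th tau a => (W1 th tau a - W2 th tau a)%C) t) =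
  (CInt_half (duhamel W1 t) - CInt_half (duhamel W2 t))%C.
Proof.
intros H1 H2 Ht. destruct (duhamel_dom _ _ _ H1 t Ht) as [K1 D1]. destruct (duhamel_dom _ _ _ H2 t Ht) as [K2 D2].
rewrite <- (half_minus _ _ _ _ D1 D2).
apply (half_ext _ _ _ (dom_minus _ _ _ _ D1 D2)). intros a Ha. unfold duhamel.
symmetry; apply CInt_minus; intros s _; [apply (response_cont _ _ _ H1)|apply (response_cont _ _ _ H2)]; ctac.
Qed.

(** ** Responses to distributed sources and to boundary data *)

Definition source_response (k : R -> R -> R -> C) (v : R -> R -> C) (th tau a : R) : C :=
  CInt_half (fun y => (k (Rabs th) y (Rabs a) * v tau y)%C).

Definition boundary_response (k : R -> R -> R -> C) (g : R -> C) (th tau a : R) : C :=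
  (k (Rabs th) 0 (Rabs a) * g tau)%C.

Section Source.
Context (k : R -> R -> R -> C) (M : R) (Hk : kernel_ok k M).

Lemma kernel_M_pos : 0 <= M.
Proof.
assert (A := kernel_bound _ _ Hk 0 0 0 (Rle_refl 0) (Rle_refl 0) (Rle_refl 0)).
assert (B := kbound_pos 0 0 (Rle_refl 0)). generalize (Cmod_ge_0 (k 0 0 0)). nra.
Qed.

Context (v : R -> R -> C) (Mv : R) (Hv : jcont v)
  (Hvb : forall tau y, 0 <= y -> Cmod (v tau y) <= Mv * / (1 + y) ^ 2).

Lemma source_Mv_pos : 0 <= Mv.
Proof.
assert (A := Hvb 0 0 (Rle_refl 0)). generalize (Cmod_ge_0 (v 0 0)).
replace ((1 + 0) ^ 2) with 1 in A by ring. lra.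
Qed.

Lemma source_integrand_bound th tau a y : 0 <= th -> 0 <= a -> 0 <= y ->
  Cmod (k th y a * v tau y)%C <= M * Mv * kbound th a * / (1 + y) ^ 2.
Proof.
intros Ht Ha Hy. rewrite Cmod_mult.
replace (M * Mv * kbound th a * / (1 + y) ^ 2) with ((M * kbound th a) * (Mv * / (1 + y) ^ 2)) by ring.
apply Rmult_le_compat; try apply Cmod_ge_0; [apply (kernel_bound _ _ Hk); assumption|apply Hvb, Hy].
Qed.

Lemma source_integrand_dom th tau a : dom (fun y => (k (Rabs th) y (Rabs a) * v tau y)%C) (M * Mv * kbound (Rabs th) (Rabs a)).
Proof.
split.
- intros y. apply ccont_mult.
  + apply (kernel_cont _ _ Hk R_UniformSpace (fun _ => Rabs th) (fun y => y) (fun _ => a)); ctac.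
  + apply jcont_l, Hv.
- intros y Hy. apply source_integrand_bound; [apply Rabs_pos|apply Rabs_pos|exact Hy].
Qed.

Lemma source_response_ok T : (forall tau y, 0 <= tau -> v (tau + T) y = v tau y) ->
  response T (source_response k v) (M * Mv).
Proof.
intros Hp. assert (HM := kernel_M_pos). assert (HMv := source_Mv_pos).
assert (Hcont : forall q : (R * R) * R, ccont (fun q : (R * R) * R => source_response k v (fst (fst q)) (snd (fst q)) (snd q)) q).
{ intros q. apply (half_param_cont (fun (q : (R * R) * R) y => (k (Rabs (fst (fst q))) y (Rabs (snd q)) * v (snd (fst q)) y)%C) (M * Mv * 2)).
  - intros p. apply ccont_mult.
    + apply (kernel_cont _ _ Hk); ctac.
    + apply (continuous_comp_2 (fun p : ((R * R) * R) * R => snd (fst (fst p))) (fun p => snd p) v).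
      * apply (continuous_comp fst (fun r : (R * R) * R => snd (fst r))); ctac.
      * ctac.
      * apply (Hv (snd (fst (fst p)), snd p)).
  - apply filter_forall; intros p y Hy.
    eapply Rle_trans; [apply source_integrand_bound; [apply Rabs_pos|apply Rabs_pos|exact Hy]|].
    apply Rmult_le_compat_r; [left; apply weight_pos, Hy|]. apply Rmult_le_compat_l; [nra|].
    apply kbound_le2; apply Rabs_pos. }
constructor.
- intros U th tau a p H1 H2 H3.
  apply (continuous_comp (fun q => ((th q, tau q), a q)) (fun q : (R * R) * R => source_response k v (fst (fst q)) (snd (fst q)) (snd q))); [|apply Hcont].
  apply (continuous_comp_2 (fun q => (th q, tau q)) a (fun u w => (u, w))); [|exact H3|].
  + apply (continuous_comp_2 th tau (fun u w => (u, w))); [exact H1|exact H2|].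
    apply (continuous_ext (fun q => q)); [intros []; reflexivity|apply continuous_id].
  + apply (continuous_ext (fun q => q)); [intros []; reflexivity|apply continuous_id].
- intros th tau a Ht Ha. eapply Rle_trans; [apply half_le, source_integrand_dom|].
  rewrite !Rabs_pos_eq by assumption. lra.
- intros th tau a Htau. unfold source_response. f_equal.
  apply FunctionalExtensionality.functional_extensionality. intros y. rewrite Hp by exact Htau. reflexivity.
Qed.

(** A positive age makes the kernel integrable in the frequency, so that positions and frequencies
can be exchanged: the source is tested against a space-time kernel, which can be deformed for each
position separately. *)
Lemma source_swap t tau : 0 < t ->
  (exists K, dom (fun y => CInt_half (fun a => k t (Rabs y) (Rabs a) * v tau (Rabs y))%C) K) /\
  CInt_half (fun a => source_response k v t tau (Rabs a)) =
  CInt_half (fun y => (CInt_half (fun a => k t (Rabs y) (Rabs a)) * v tau (Rabs y))%C).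
Proof.
intros Ht. destruct (kbound_late t Ht) as [K [HK0 HK]].
assert (HM := kernel_M_pos). assert (HMv := source_Mv_pos).
pose (G := fun a y => (k t y (Rabs a) * v tau y)%C).
assert (Gc : jcont G).
{ intros p. apply ccont_mult; [apply (kernel_cont _ _ Hk); ctac|].
  apply (continuous_comp snd (v tau)); [apply continuous_snd|apply jcont_l, Hv]. }
assert (Gb : forall a y, 0 <= a -> 0 <= y -> Cmod (G a y) <= (M * Mv * K) * / (1 + a) ^ 2 * / (1 + y) ^ 2).
{ intros a y Ha Hy. unfold G. rewrite (Rabs_pos_eq a) by exact Ha.
  eapply Rle_trans; [apply source_integrand_bound; lra|].
  apply Rmult_le_compat_r; [left; apply weight_pos, Hy|].
  rewrite (Rmult_assoc (M * Mv)). apply Rmult_le_compat_l; [nra|]. apply HK; lra. }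
assert (Gb' : forall y a, 0 <= y -> 0 <= a -> Cmod (G a y) <= (M * Mv * K) * / (1 + y) ^ 2 * / (1 + a) ^ 2).
{ intros y a Hy Ha. eapply Rle_trans; [apply Gb; assumption|]. right; ring. }
assert (D1 := half_swap_dom_outer G _ Gc Gb).
assert (D2 := half_swap_dom_outer (fun y a => G a y) _ (jcont_swap G Gc) Gb').
split; [exists (M * Mv * K); exact D2|].
transitivity (CInt_half (fun a => CInt_half (G (Rabs a)))).
{ apply (half_ext _ _ _ D1). intros a Ha. unfold source_response, G. rewrite (Rabs_pos_eq t) by lra. reflexivity. }
rewrite (half_swap G _ Gc Gb). symmetry. apply (half_ext _ _ _ D2). intros y Hy. unfold G.
assert (Dk : dom (fun a => k t (Rabs y) (Rabs a)) (M * K)).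
{ split.
  - intros a. apply (kernel_cont _ _ Hk); ctac.
  - intros a Ha. rewrite (Rabs_pos_eq a) by exact Ha.
    eapply Rle_trans; [apply (kernel_bound _ _ Hk); [lra|apply Rabs_pos|exact Ha]|].
    rewrite (Rmult_assoc M K). apply Rmult_le_compat_l; [exact HM|]. apply HK; lra. }
transitivity (CInt_half (fun a => (v tau (Rabs y) * k t (Rabs y) (Rabs a))%C)).
- apply (half_ext _ _ _ (dom_mult (v tau (Rabs y)) _ _ Dk)). intros; ring.
- rewrite (half_mult _ _ _ Dk). ring.
Qed.

Lemma kernel_dom_late t y : 0 < t -> exists K, dom (fun a => k t (Rabs y) (Rabs a)) K.
Proof.
intros Ht. destruct (kbound_late t Ht) as [K [HK0 HK]]. exists (M * K). split.
- intros a. apply (kernel_cont _ _ Hk); ctac.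
- intros a Ha. rewrite (Rabs_pos_eq a) by exact Ha.
  eapply Rle_trans; [apply (kernel_bound _ _ Hk); [lra|apply Rabs_pos|exact Ha]|].
  rewrite (Rmult_assoc M K). apply Rmult_le_compat_l; [exact kernel_M_pos|]. apply HK; lra.
Qed.
End Source.

Lemma boundary_response_ok k M (g : R -> C) Mg T : kernel_ok k M ->
  (forall s, ccont g s) -> (forall s, Cmod (g s) <= Mg) -> (forall s, 0 <= s -> g (s + T) = g s) ->
  response T (boundary_response k g) (M * Mg).
Proof.
intros Hk Hc Hb Hp. assert (HM := kernel_M_pos k M Hk).
constructor.
- intros U th tau a p H1 H2 H3. apply ccont_mult.
  + apply (kernel_cont _ _ Hk U (fun q => Rabs (th q)) (fun _ => 0)); ctac.
  + apply (continuous_comp tau g); [exact H2|apply Hc].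
- intros th tau a Ht Ha. unfold boundary_response. rewrite Cmod_mult, !Rabs_pos_eq by assumption.
  replace (M * Mg * kbound th a) with ((M * kbound th a) * Mg) by ring.
  apply Rmult_le_compat; try apply Cmod_ge_0; [apply (kernel_bound _ _ Hk); lra|apply Hb].
- intros th tau a Htau. unfold boundary_response. rewrite Hp by exact Htau. reflexivity.
Qed.

End Duhamel.

(** * The integral formula in terms of real kernels *)

Lemma Cconj_plus z w : Cconj (z + w)%C = (Cconj z + Cconj w)%C.
Proof. apply injective_projections; simpl; ring. Qed.
Lemma Cconj_opp z : Cconj (- z)%C = (- Cconj z)%C.
Proof. apply injective_projections; simpl; ring. Qed.
Lemma Cconj_minus z w : Cconj (z - w)%C = (Cconj z - Cconj w)%C.
Proof. unfold Cminus. rewrite Cconj_plus, Cconj_opp. reflexivity. Qed.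
Lemma Cconj_mult z w : Cconj (z * w)%C = (Cconj z * Cconj w)%C.
Proof. apply injective_projections; simpl; ring. Qed.
Lemma Cconj_inv z : Cconj (/ z)%C = (/ Cconj z)%C.
Proof. unfold Cinv, Cconj; simpl. replace (- snd z * (- snd z * 1)) with (snd z * (snd z * 1)) by ring.
apply injective_projections; simpl; unfold Rdiv; ring. Qed.
Lemma Cconj_div z w : Cconj (z / w)%C = (Cconj z / Cconj w)%C.
Proof. unfold Cdiv. rewrite Cconj_mult, Cconj_inv. reflexivity. Qed.
Lemma Cconj_RtoC r : Cconj (RtoC r) = RtoC r.
Proof. apply injective_projections; simpl; ring. Qed.
Lemma Cconj_Ci : Cconj Ci = (- Ci)%C.
Proof. apply injective_projections; simpl; ring. Qed.
Lemma Cconj_pow z n : Cconj (z ^ n)%C = ((Cconj z) ^ n)%C.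
Proof. induction n as [|n IH]; [apply Cconj_RtoC|]. simpl. rewrite Cconj_mult, IH. reflexivity. Qed.
Lemma Cconj_Cexp z : Cconj (Cexp z) = Cexp (Cconj z).
Proof.
unfold Cexp. replace (Re (Cconj z)) with (Re z) by reflexivity. replace (Im (Cconj z)) with (- Im z) by reflexivity.
rewrite cos_neg, sin_neg. apply injective_projections; simpl; ring.
Qed.
Lemma Cconj_sum z : (z + Cconj z)%C = RtoC (2 * Re z).
Proof. apply injective_projections; unfold Re; simpl; ring. Qed.

Lemma CInt_conj f a b : ccont_on f a b -> CInt (fun t => Cconj (f t)) a b = Cconj (CInt f a b).
Proof.
intros H. assert (A := is_CInt f a b H). apply CInt_unique. apply (is_CInt_pair _ a b (Re (CInt f a b)) (- Im (CInt f a b))).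
- apply (is_CInt_fst f a b _ A).
- apply (is_RInt_opp (V := R_NormedModule)). apply (is_CInt_snd f a b _ A).
Qed.

Lemma half_conj f M : dom f M -> CInt_half (fun a => Cconj (f a)) = Cconj (CInt_half f).
Proof.
intros D. apply half_limit_rate with M M; [apply dom_conj, D|apply dom_pos with f, D|].
intros N HN. rewrite CInt_conj by (apply dom_cont with M, D).
rewrite <- Cconj_minus, Cmod_conj. apply dom_rem; assumption.
Qed.

(** The derivative of an even function is odd, so the left half of the graph carries the velocity
(1, - db). *)
Lemma graph_fold (b db : R -> R) (F : C -> C) (Rr Ll : R -> C) (r l : C) :
  (forall a, b (- a) = b a) -> (forall a, 0 < a -> is_derive b a (db a)) ->
  is_half Rr r -> is_half Ll l ->
  (forall a, 0 < a -> (F (a, b a) * (1, db a))%C = Rr a) ->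
  (forall a, 0 < a -> (F (- a, b a)%R * (1, (- db a)%R))%C = Ll a) ->
  graph_int b F = (r + l)%C.
Proof.
intros Eb Db Hr Hl E1 E2. apply line_fold.
- apply is_half_ext with (2 := Hr). intros a Ha. rewrite <- E1 by exact Ha.
  do 2 f_equal. symmetry. apply is_derive_unique, Db, Ha.
- apply is_half_ext with (2 := Hl). intros a Ha. rewrite <- E2 by exact Ha. rewrite Eb.
  do 2 f_equal. symmetry. apply is_derive_unique, is_derive_even; [exact Eb|apply Db, Ha].
Qed.

Section Formula.
Context (alpha beta x : R) (ha : 0 < alpha) (hb : 0 < beta) (hx : 0 < x).
Notation om := (omega alpha beta).
Notation root := (sq alpha beta).
Notation E := (Ek alpha beta x).
Notation rho := (rho alpha beta).

(** ** Reflection in the imaginary axis is complex conjugation *)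

Lemma reflect_point (a b : R) : ((- a)%R, b) = (- Cconj (a, b))%C.
Proof. apply injective_projections; simpl; ring. Qed.

Lemma omega_reflect l : om (- Cconj l)%C = Cconj (om l).
Proof.
unfold omega. rewrite Cconj_plus, !Cconj_mult, !Cconj_RtoC, !Cconj_pow. ring.
Qed.

Lemma Ek_reflect th l : E th (- Cconj l)%C = Cconj (E th l).
Proof.
unfold Ek. rewrite omega_reflect, Cconj_Cexp, Cconj_minus, !Cconj_mult, !Cconj_RtoC, Cconj_Ci. f_equal. ring.
Qed.

(** For positive [a] and [b] the argument of the root is off the cut, where the root commutes with
conjugation. *)
Lemma sq_reflect (a b : R) : 0 < a -> 0 < b -> root ((- a)%R, b) = Cconj (root (a, b)).
Proof.
intros Ha Hb. unfold sq. rewrite reflect_point.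
replace (sqarg alpha beta (- Cconj (a, b))%C) with (Cconj (sqarg alpha beta (a, b))).
- apply Csqrt_conj. right. rewrite Im_sqarg. nra.
- unfold sqarg. rewrite Cconj_plus, Cconj_pow, Cconj_RtoC. ring.
Qed.

(** With [Ek_reflect] and [sq_reflect], makes the whole integrand conjugate under reflection in the
imaginary axis. *)
Definition reflects (H : R -> C -> C -> C) : Prop :=
  forall y l s, H y (- Cconj l)%C (Cconj s) = Cconj (H y l s).

Lemma amp_source_reflects : reflects amp_source.
Proof.
intros y l s. unfold amp_source.
rewrite Cconj_minus, !Cconj_mult, !Cconj_div, Cconj_minus, !Cconj_plus, !Cconj_Cexp, !Cconj_opp, !Cconj_mult, !Cconj_RtoC, Cconj_Ci.
replace (Ci * - Cconj l)%C with (- Ci * Cconj l)%C by ring.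
replace (RtoC 2 * Ci * - Cconj l)%C with (RtoC 2 * - Ci * Cconj l)%C by ring. reflexivity.
Qed.

Lemma amp_g1_reflects : reflects amp_g1.
Proof. intros y l s. unfold amp_g1. rewrite !Cconj_mult, Cconj_minus, !Cconj_mult, Cconj_Ci. ring. Qed.
Lemma amp_g0_reflects : reflects amp_g0.
Proof. intros y l s. unfold amp_g0. rewrite !Cconj_mult, Cconj_minus, !Cconj_mult, Cconj_Ci. ring. Qed.

(** The integrand at one point [l] of a contour with velocity [d]. *)
Definition point_kernel (H : R -> C -> C -> C) (d l : C) (th y : R) : C := (E th l * H y l (root l) * d)%C.

Lemma point_right (b db : R -> R) H th y a : 0 < a -> 0 < b a ->
  point_kernel H (1, db a) (a, b a) th y = curve_kernel alpha beta x b db H th y a.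
Proof.
intros Ha Hb. unfold point_kernel, curve_kernel. rewrite (sq_csq alpha beta) by lra. reflexivity.
Qed.

Lemma point_left (b db : R -> R) H th y a : reflects H -> 0 < a -> 0 < b a ->
  point_kernel H (1, (- db a)%R) ((- a)%R, b a) th y = Cconj (curve_kernel alpha beta x b db H th y a).
Proof.
intros HR Ha Hb. rewrite <- point_right by assumption. unfold point_kernel.
rewrite sq_reflect, reflect_point, Ek_reflect, HR by assumption.
rewrite !Cconj_mult. f_equal.
Qed.

(** ** The bracket in the formula as an integral against the source *)

Lemma wave_bound (mu : C) y : Im mu <= 0 -> 0 <= y -> Cmod (Cexp (- (Ci * mu * RtoC y))) <= 1.
Proof.
intros Hm Hy. rewrite Cmod_Cexp, <- exp_0. apply exp_le_compat.
replace (Re (- (Ci * mu * RtoC y))%C) with (Im mu * y) by (unfold Re, Im; simpl; ring). nra.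
Qed.

Lemma wave_dom (u : R -> C) M mu : dom u M -> Im mu <= 0 ->
  dom (fun y => (Cexp (- (Ci * mu * RtoC y)) * u y)%C) M.
Proof.
intros [H1 H2] Hm. split.
- intros y. assert (A := H1 y). ctac.
- intros y Hy. rewrite Cmod_mult. rewrite <- (Rmult_1_l (M * _)).
  apply Rmult_le_compat; try apply Cmod_ge_0; [apply wave_bound; assumption|apply H2, Hy].
Qed.

Lemma hat_half (u0 u : R -> C) M mu : dom u M -> (forall y, 0 < y -> u0 y = u y) -> Im mu <= 0 ->
  hat u0 mu = CInt_half (fun y => (Cexp (- (Ci * mu * RtoC y)) * u y)%C).
Proof.
intros D E0 Hm. apply (half_ext _ _ _ (wave_dom u M mu D Hm)). intros y Hy. rewrite E0 by exact Hy. reflexivity.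
Qed.

(** The transform at i rho(l) makes sense because the principal root has nonnegative real part. *)
Lemma dual_arg_sq l : Im (Ci * rho l)%C <= 0.
Proof.
change (rho l) with (- root l)%C. rewrite Im_Ci. change (Re (- root l)%C) with (- Re (root l)).
generalize (Csqrt_Re_nonneg (sqarg alpha beta l)). unfold sq. lra.
Qed.

Notation P l := ((Ci * l + rho l) / (Ci * l - rho l))%C.
Notation S l := ((2 * Ci * l) / (Ci * l - rho l))%C.

Lemma source_point (u : R -> C) M (l d : C) th : dom u M -> 0 <= Im l ->
  (E th l * (P l * CInt_half (fun y => (Cexp (- (Ci * (- l) * RtoC y)) * u y)%C)
    - S l * CInt_half (fun y => (Cexp (- (Ci * (Ci * rho l) * RtoC y)) * u y)%C)) * d)%C =
  CInt_half (fun y => (point_kernel amp_source d l th y * u y)%C).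
Proof.
intros D Hl.
assert (Hm : Im (- l)%C <= 0) by (change (Im (- l)%C) with (- Im l); lra).
assert (D1 := wave_dom u M (- l)%C D Hm). assert (D2 := wave_dom u M _ D (dual_arg_sq l)).
assert (D3 := dom_minus _ _ _ _ (dom_mult (E th l * P l * d)%C _ _ D1) (dom_mult (E th l * S l * d)%C _ _ D2)).
rewrite (half_ext _ (fun y => (point_kernel amp_source d l th y * u y)%C) _ D3).
- rewrite (half_minus _ _ _ _ (dom_mult (E th l * P l * d)%C _ _ D1) (dom_mult (E th l * S l * d)%C _ _ D2)).
  rewrite (half_mult (E th l * P l * d)%C _ _ D1), (half_mult (E th l * S l * d)%C _ _ D2).
  set (I1 := CInt_half (fun y => (Cexp (- (Ci * - l * RtoC y)) * u y)%C)).
  set (I2 := CInt_half (fun y => (Cexp (- (Ci * (Ci * rho l) * RtoC y)) * u y)%C)).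
  set (p := P l). set (q := S l). ring.
- intros y _. unfold point_kernel, amp_source.
  change (rho l) with (- root l)%C. set (s := root l).
  replace (Ci * l - - s)%C with (Ci * l + s)%C by ring.
  replace (Ci * l + - s)%C with (Ci * l - s)%C by ring.
  replace (- (Ci * - l * RtoC y))%C with (Ci * l * RtoC y)%C by ring.
  replace (- (Ci * (Ci * - s) * RtoC y))%C with ((Ci * Ci) * (s * RtoC y))%C by ring.
  rewrite Ci_sqr. replace (- RtoC 1 * (s * RtoC y))%C with (- (s * RtoC y))%C by ring.
  set (p := ((Ci * l - s) / (Ci * l + s))%C). set (q := (2 * Ci * l / (Ci * l + s))%C). ring.
Qed.

Lemma E_shift t tau l : (E t l * Cexp (om l * RtoC tau))%C = E (t - tau) l.
Proof. unfold Ek. rewrite <- Cexp_plus. f_equal. rewrite RtoC_minus. ring. Qed.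

Section Data.
Context (u0 : R -> C) (u : R -> C) (Mu : R) (Du : dom u Mu) (Eu : forall y, 0 < y -> u0 y = u y).
Context (f v : R -> R -> C) (Mv : R) (Hv : jcont v)
  (Hvb : forall tau y, 0 <= y -> Cmod (v tau y) <= Mv * / (1 + y) ^ 2)
  (Ev : forall tau y, 0 < tau -> 0 < y -> f y tau = v tau y).

Lemma v_dom tau : dom (v tau) Mv.
Proof. split; [intros; apply jcont_l, Hv|intros; apply Hvb; assumption]. Qed.

Lemma hat_point (l d : C) t : 0 <= Im l ->
  (E t l * (P l * hat u0 (- l) - S l * hat u0 (Ci * rho l)) * d)%C =
  CInt_half (fun y => (point_kernel amp_source d l t y * u y)%C).
Proof.
intros Hl. rewrite (hat_half u0 u Mu (- l)%C Du Eu), (hat_half u0 u Mu (Ci * rho l)%C Du Eu).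
- apply source_point with Mu; assumption.
- apply dual_arg_sq.
- change (Im (- l)%C) with (- Im l); lra.
Qed.

Definition wave (mu : C) (tau : R) : C := CInt_half (fun y => (Cexp (- (Ci * mu * RtoC y)) * v tau y)%C).

Lemma wave_cont mu tau : Im mu <= 0 -> ccont (wave mu) tau.
Proof.
intros Hm. apply (half_param_cont (fun tau y => (Cexp (- (Ci * mu * RtoC y)) * v tau y)%C) Mv).
- intros q. assert (A := Hv q). ctac.
- apply filter_forall; intros s y Hy. apply (wave_dom (v s) Mv mu (v_dom s) Hm), Hy.
Qed.

Lemma tilde_hat_wave mu w t : Im mu <= 0 -> 0 <= t ->
  tilde_hat f mu w t = CInt (fun tau => (Cexp (w * RtoC tau) * wave mu tau)%C) 0 t.
Proof.
intros Hm Ht. apply CInt_ext. rewrite Rmin_left, Rmax_right by lra. intros s Hs.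
rewrite (hat_half (fun y => f y s) (v s) Mv mu (v_dom s)); [reflexivity| |exact Hm].
intros y Hy; apply Ev; lra.
Qed.

Lemma wave_int_cont mu w s : Im mu <= 0 -> ccont (fun tau => (Cexp (w * RtoC tau) * wave mu tau)%C) s.
Proof. intros Hm. assert (A := wave_cont mu s Hm). ctac. Qed.

Lemma tilde_hat_point (l d : C) t : 0 <= Im l -> 0 <= t ->
  (E t l * (P l * tilde_hat f (- l) (om l) t - S l * tilde_hat f (Ci * rho l) (om l) t) * d)%C =
  CInt (fun tau => CInt_half (fun y => (point_kernel amp_source d l (t - tau) y * v tau y)%C)) 0 t.
Proof.
intros Hl Ht.
assert (Hm : Im (- l)%C <= 0) by (change (Im (- l)%C) with (- Im l); lra).
rewrite (tilde_hat_wave (- l)%C (om l) t Hm Ht), (tilde_hat_wave (Ci * rho l)%C (om l) t (dual_arg_sq l) Ht).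
assert (C1 : ccont_on (fun tau => (Cexp (om l * RtoC tau) * wave (- l) tau)%C) 0 t) by (intros s _; apply wave_int_cont, Hm).
assert (C2 : ccont_on (fun tau => (Cexp (om l * RtoC tau) * wave (Ci * rho l) tau)%C) 0 t) by (intros s _; apply wave_int_cont, dual_arg_sq).
transitivity (CInt (fun tau => ((E t l * P l * d) * (Cexp (om l * RtoC tau) * wave (- l) tau)
   - (E t l * S l * d) * (Cexp (om l * RtoC tau) * wave (Ci * rho l) tau))%C) 0 t).
- rewrite CInt_minus.
  + rewrite (CInt_mult (E t l * P l * d)%C _ _ _ C1), (CInt_mult (E t l * S l * d)%C _ _ _ C2).
    set (p := P l). set (q := S l). ring.
  + intros s Hs; apply ccont_mult; [apply ccont_const|apply C1, Hs].
  + intros s Hs; apply ccont_mult; [apply ccont_const|apply C2, Hs].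
- apply CInt_ext. intros s _. rewrite <- (source_point (v s) Mv l d (t - s) (v_dom s) Hl).
  rewrite <- (E_shift t s l). unfold wave. set (p := P l). set (q := S l). ring.
Qed.

Lemma hat_line (s : R) t : (E t (RtoC s) * hat u0 (RtoC s))%C =
  CInt_half (fun y => (E t (RtoC s) * Cexp (- (Ci * RtoC s * RtoC y)) * u y)%C).
Proof.
assert (Hm : Im (RtoC s) <= 0) by (simpl; lra).
rewrite (hat_half u0 u Mu (RtoC s) Du Eu Hm), <- (half_mult _ _ _ (wave_dom u Mu (RtoC s) Du Hm)).
symmetry. apply (half_ext _ _ _ (dom_mult (E t (RtoC s)) _ _ (wave_dom u Mu (RtoC s) Du Hm))). intros; ring.
Qed.

Lemma tilde_hat_line (s : R) t : 0 <= t ->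
  (E t (RtoC s) * tilde_hat f (RtoC s) (om (RtoC s)) t)%C =
  CInt (fun tau => CInt_half (fun y => (E (t - tau) (RtoC s) * Cexp (- (Ci * RtoC s * RtoC y)) * v tau y)%C)) 0 t.
Proof.
intros Ht. assert (Hm : Im (RtoC s) <= 0) by (simpl; lra).
rewrite (tilde_hat_wave (RtoC s) (om (RtoC s)) t Hm Ht), <- CInt_mult by (intros r _; apply wave_int_cont, Hm).
apply CInt_ext. intros r _. rewrite <- (E_shift t r (RtoC s)).
transitivity ((E t (RtoC s) * Cexp (om (RtoC s) * RtoC r)) * wave (RtoC s) r)%C; [ring|].
unfold wave. rewrite <- (half_mult _ _ _ (wave_dom (v r) Mv (RtoC s) (v_dom r) Hm)).
symmetry. apply (half_ext _ _ _ (dom_mult (E t (RtoC s) * Cexp (om (RtoC s) * RtoC r)) _ _ (wave_dom (v r) Mv (RtoC s) (v_dom r) Hm))).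
intros; ring.
Qed.
End Data.

Lemma tilde_point (g0 g1 h0 h1 : R -> C) (l d : C) t : 0 <= t ->
  (forall s, ccont h0 s) -> (forall s, ccont h1 s) ->
  (forall s, 0 < s -> g0 s = h0 s) -> (forall s, 0 < s -> g1 s = h1 s) ->
  (E t l * l * (Ci * l + rho l) * (rho l * tilde g0 (om l) t - tilde g1 (om l) t) * d)%C =
  (Ci * CInt (fun tau => (point_kernel amp_g0 d l (t - tau) 0 * h0 tau + point_kernel amp_g1 d l (t - tau) 0 * h1 tau)%C) 0 t)%C.
Proof.
intros Ht Hc0 Hc1 E0 E1.
assert (G : forall g h : R -> C, (forall s, 0 < s -> g s = h s) -> tilde g (om l) t = CInt (fun tau => (Cexp (om l * RtoC tau) * h tau)%C) 0 t).
{ intros g h Eq. apply CInt_ext. rewrite Rmin_left, Rmax_right by lra. intros s Hs. rewrite Eq by lra. reflexivity. }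
rewrite (G g0 h0 E0), (G g1 h1 E1).
assert (C0 : ccont_on (fun tau => (Cexp (om l * RtoC tau) * h0 tau)%C) 0 t).
{ intros s _. assert (A := Hc0 s). ctac. }
assert (C1 : ccont_on (fun tau => (Cexp (om l * RtoC tau) * h1 tau)%C) 0 t).
{ intros s _. assert (A := Hc1 s). ctac. }
change (rho l) with (- root l)%C. set (s := root l).
transitivity (Ci * CInt (fun tau => ((E t l * (Ci * l * (Ci * l - s) * s) * d) * (Cexp (om l * RtoC tau) * h0 tau)
   + (E t l * (Ci * l * (Ci * l - s)) * d) * (Cexp (om l * RtoC tau) * h1 tau))%C) 0 t)%C.
- rewrite CInt_plus.
  + rewrite (CInt_mult _ _ _ _ C0), (CInt_mult _ _ _ _ C1).
    set (I0 := CInt (fun tau => (Cexp (om l * RtoC tau) * h0 tau)%C) 0 t).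
    set (I1 := CInt (fun tau => (Cexp (om l * RtoC tau) * h1 tau)%C) 0 t).
    transitivity ((- (Ci * Ci)) * - (E t l * l * (Ci * l + - s) * (- s * I0 - I1) * d) * (- RtoC 1))%C.
    * rewrite Ci_sqr. ring.
    * ring.
  + intros r Hr; apply ccont_mult; [apply ccont_const|apply C0, Hr].
  + intros r Hr; apply ccont_mult; [apply ccont_const|apply C1, Hr].
- f_equal. apply CInt_ext. intros r _. unfold point_kernel, amp_g0, amp_g1. fold s.
  rewrite <- (E_shift t r l). ring.
Qed.

End Formula.

(** * Deformed kernels and their sum *)

Section Assembly.
Context (alpha beta x : R) (ha : 0 < alpha) (hb : 0 < beta) (hx : 0 < x).
Notation c2 := (alpha / beta).
Notation omr := (omR alpha beta).
Notation E := (Ek alpha beta x).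
Notation lowK := (low_kernel alpha beta x).
Notation upK := (up_kernel alpha beta x).
Notation lineK := (line_kernel alpha beta x).
Notation kernel_ok := (kernel_ok alpha beta).
Notation conjK k := (fun th y a => Cconj (k th y a)).

Lemma curve_kernel_ok (k : R -> R -> R -> C) B : 0 <= B ->
  (forall (T : UniformSpace) (th y a : T -> R) p,
    continuous th p -> continuous y p -> continuous a p -> ccont (fun q => k (th q) (y q) (Rabs (a q))) p) ->
  (forall th y a, 0 <= y -> 0 <= a -> Cmod (k th y a) <= B * ((1 + a) ^ 3 * exp (- ((2 / 5 * x) * a)))) ->
  exists M, kernel_ok k M.
Proof.
intros HB Hc Hb. destruct (exp_dominates_poly (2 / 5 * x) 3 ltac:(lra)) as [M [HM0 HM]].
exists (B * M). constructor; [exact Hc|].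
intros th y a Ht Hy Ha. eapply Rle_trans; [apply Hb; assumption|]. rewrite (Rmult_assoc B M).
apply Rmult_le_compat_l; [exact HB|]. eapply Rle_trans; [apply HM, Ha|].
apply Rmult_le_compat_l; [exact HM0|]. unfold kbound. generalize (exp_pos (- (omr a * th))). lra.
Qed.

Lemma curve_const_pos B : 0 <= B -> 0 <= B * (9 * (4 + c2) ^ 3).
Proof.
intros HB. assert (C0 := c2_pos alpha beta ha hb). apply Rmult_le_pos; [exact HB|].
apply Rmult_le_pos; [lra|apply pow_le; lra].
Qed.

Lemma low_ok H B : amplitude alpha beta H B -> exists M, kernel_ok (lowK H) M.
Proof.
intros HH. assert (HB := amp_B_pos alpha beta ha hb H B HH).
apply (curve_kernel_ok _ (B * (9 * (4 + c2) ^ 3))); [apply curve_const_pos, HB| |].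
- intros; apply (low_kernel_cont alpha beta x ha hb H B HH); assumption.
- intros; apply (low_kernel_bound alpha beta x ha hb hx H B HH); assumption.
Qed.

Lemma up_ok H B : amplitude alpha beta H B -> exists M, kernel_ok (upK H) M.
Proof.
intros HH. assert (HB := amp_B_pos alpha beta ha hb H B HH).
apply (curve_kernel_ok _ (B * (9 * (4 + c2) ^ 3))); [apply curve_const_pos, HB| |].
- intros; apply (up_kernel_cont alpha beta x ha hb H B HH); assumption.
- intros; apply (up_kernel_bound alpha beta x ha hb hx H B HH); assumption.
Qed.

Lemma line_ok : kernel_ok lineK 1.
Proof.
constructor.
- intros T th y a p H1 H2 H3. unfold line_kernel.
  apply ccont_mult; [apply ccont_Ek; ctac|ctac].
- intros th y a Ht Hy Ha. unfold line_kernel. rewrite Cmod_mult, Cmod_Ek.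
  assert (W := wave_bound (RtoC a) y (Rle_refl 0) Hy).
  rewrite omega_real. change (Re (RtoC (omr a))) with (omr a). change (Im (RtoC a)) with 0.
  replace (- (x * 0) - omr a * th) with (- (omr a * th)) by ring.
  rewrite Rmult_1_l. unfold kbound. assert (Pe := exp_pos (- (omr a * th))). assert (Pw := weight_pos a Ha).
  apply Rle_trans with (exp (- (omr a * th)) * 1); [apply Rmult_le_compat_l; lra|lra].
Qed.

Lemma line_reflect th y a :
  (E th (RtoC (- a)) * Cexp (- (Ci * RtoC (- a) * RtoC y)))%C = Cconj (lineK th y a).
Proof.
unfold line_kernel. rewrite Cconj_mult, <- Ek_reflect, Cconj_Cexp, Cconj_opp, !Cconj_mult, !Cconj_RtoC, Cconj_Ci.
rewrite !RtoC_opp. f_equal. f_equal. ring.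
Qed.

(** ** Total real kernels *)

(** The kernels of the solution in spectral form, for sources in the interior and for the two
boundary data. *)
Definition source_heat (th y : R) : C :=
  CInt_half (fun a => RtoC (4 * (exp (- (omr a * th)) * (eigenfun alpha beta a x * eigenfun alpha beta a y / (2 * a ^ 2 + c2))))).
Definition g1_heat (th : R) : C :=
  CInt_half (fun a => RtoC (- 2 * (exp (- (omr a * th)) * (a * eigenfun alpha beta a x)))).
Definition g0_heat (th : R) : C :=
  CInt_half (fun a => RtoC (- 2 * (exp (- (omr a * th)) * (a * freq alpha beta a * eigenfun alpha beta a x)))).

Lemma half_twice_Re (h : R -> C) M (r : R -> R) : dom h M -> (forall a, 0 < a -> 2 * Re (h a) = r a) ->
  CInt_half (fun a => RtoC (r a)) = (CInt_half h + Cconj (CInt_half h))%C.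
Proof.
intros D Er. rewrite <- (half_conj h M D), <- (half_plus _ _ _ _ D (dom_conj _ _ D)).
apply (half_ext _ _ _ (dom_plus _ _ _ _ D (dom_conj _ _ D))). intros a Ha. rewrite <- Er by exact Ha. apply Cconj_sum.
Qed.

(** Left halves of the curves are conjugates of right halves, so after deformation to the positive
real axis twice the real part remains. *)
Lemma curve_heat H B th y (r : R -> R) : amplitude alpha beta H B -> 0 < th -> 0 <= y ->
  (forall a, 2 * Re (real_low alpha beta x H th y (RtoC a) - real_up alpha beta x H th y (RtoC a))%C = r a) ->
  (CInt_half (fun a => lowK H th y (Rabs a)) + CInt_half (fun a => conjK (lowK H) th y (Rabs a))
   - (CInt_half (fun a => upK H th y (Rabs a)) + CInt_half (fun a => conjK (upK H) th y (Rabs a))))%C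
  = CInt_half (fun a => RtoC (r a)).
Proof.
intros HH Hth Hy Er.
destruct (low_kernel_dom alpha beta x ha hb hx H B HH th y Hy) as [M1 D1].
destruct (up_kernel_dom alpha beta x ha hb hx H B HH th y Hy) as [M2 D2].
rewrite (half_conj _ _ D1), (half_conj _ _ D2).
rewrite (low_to_real alpha beta x ha hb hx H B HH th y Hth Hy).
rewrite (up_to_real alpha beta x ha hb hx H B HH th y ltac:(lra) Hy).
destruct (real_low_dom alpha beta x ha hb H B HH th y Hth Hy) as [M3 D3].
destruct (real_up_dom alpha beta x ha hb hx H B HH th y ltac:(lra) Hy) as [M4 D4].
rewrite (half_twice_Re _ _ r (dom_minus _ _ _ _ D3 D4)) by (intros; apply Er).
rewrite (half_minus _ _ _ _ D3 D4), Cconj_minus. ring.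
Qed.

Lemma source_heat_eq th y : 0 < th -> 0 <= y ->
  (CInt_half (fun a => lineK th y (Rabs a)) + CInt_half (fun a => conjK lineK th y (Rabs a))
   + (CInt_half (fun a => lowK amp_source th y (Rabs a)) + CInt_half (fun a => conjK (lowK amp_source) th y (Rabs a))
     - (CInt_half (fun a => upK amp_source th y (Rabs a)) + CInt_half (fun a => conjK (upK amp_source) th y (Rabs a)))))%C
  = source_heat th y.
Proof.
intros Hth Hy. assert (HH := amp_source_ok alpha beta ha hb).
destruct (kernel_dom_late alpha beta ha hb lineK 1 line_ok th y Hth) as [M0 D0].
rewrite (Rabs_pos_eq y) in D0 by exact Hy.
destruct (real_low_dom alpha beta x ha hb _ _ HH th y Hth Hy) as [M3 D3].
destruct (real_up_dom alpha beta x ha hb hx _ _ HH th y ltac:(lra) Hy) as [M4 D4].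
assert (D34 := dom_minus _ _ _ _ D3 D4).
rewrite (curve_heat _ _ th y (fun a => 2 * Re (real_low alpha beta x amp_source th y (RtoC a) - real_up alpha beta x amp_source th y (RtoC a))%C) HH Hth Hy)
  by reflexivity.
rewrite (half_conj _ _ D0).
rewrite (half_twice_Re _ _ _ D34) by reflexivity.
unfold source_heat. symmetry.
rewrite (half_twice_Re (fun a => (lineK th y (Rabs a) + (real_low alpha beta x amp_source th y (RtoC a) - real_up alpha beta x amp_source th y (RtoC a)))%C)
  (M0 + (M3 + M4))).
- rewrite (half_plus _ _ _ _ D0 D34), Cconj_plus. ring.
- exact (dom_plus _ _ _ _ D0 D34).
- intros a Ha. rewrite Rabs_pos_eq by lra. apply source_kernel_real; assumption.
Qed.

Lemma g1_heat_eq th : 0 < th ->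
  (CInt_half (fun a => lowK amp_g1 th 0 (Rabs a)) + CInt_half (fun a => conjK (lowK amp_g1) th 0 (Rabs a))
   - (CInt_half (fun a => upK amp_g1 th 0 (Rabs a)) + CInt_half (fun a => conjK (upK amp_g1) th 0 (Rabs a))))%C
  = g1_heat th.
Proof.
intros Hth. apply (curve_heat _ _ th 0 _ (amp_g1_ok alpha beta ha hb) Hth (Rle_refl 0)).
intros a. apply g1_kernel_real; assumption.
Qed.

Lemma g0_heat_eq th : 0 < th ->
  (CInt_half (fun a => lowK amp_g0 th 0 (Rabs a)) + CInt_half (fun a => conjK (lowK amp_g0) th 0 (Rabs a))
   - (CInt_half (fun a => upK amp_g0 th 0 (Rabs a)) + CInt_half (fun a => conjK (upK amp_g0) th 0 (Rabs a))))%C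
  = g0_heat th.
Proof.
intros Hth. apply (curve_heat _ _ th 0 _ (amp_g0_ok alpha beta ha hb) Hth (Rle_refl 0)).
intros a. apply g0_kernel_real; assumption.
Qed.

Lemma lower_pos a : 0 < a -> 0 < lower alpha beta a.
Proof. intros Ha. generalize (lower_bounds alpha beta ha hb a (Rlt_le _ _ Ha)). lra. Qed.

(** ** The source terms of the formula *)

Section Source.
Context (v : R -> R -> C) (Mv : R) (Hv : jcont v)
  (Hvb : forall tau y, 0 <= y -> Cmod (v tau y) <= Mv * / (1 + y) ^ 2).
Notation SR k := (source_response k v).

(** The six kernels of the formula are swapped with the integral over positions one by one, and only
then added up: deformation of the contours takes place inside the integral over positions. *)
Lemma source_total th tau : 0 < th ->
  (exists K, dom (fun y => (source_heat th (Rabs y) * v tau (Rabs y))%C) K) /\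
  (CInt_half (fun a => SR lineK th tau (Rabs a)) + CInt_half (fun a => SR (conjK lineK) th tau (Rabs a))
   + (CInt_half (fun a => SR (lowK amp_source) th tau (Rabs a)) + CInt_half (fun a => SR (conjK (lowK amp_source)) th tau (Rabs a))
     - (CInt_half (fun a => SR (upK amp_source) th tau (Rabs a)) + CInt_half (fun a => SR (conjK (upK amp_source)) th tau (Rabs a)))))%C
  = CInt_half (fun y => (source_heat th (Rabs y) * v tau (Rabs y))%C).
Proof.
intros Hth. assert (HH := amp_source_ok alpha beta ha hb).
destruct (low_ok _ _ HH) as [M1 K1]. destruct (up_ok _ _ HH) as [M2 K2].
destruct (source_swap alpha beta ha hb _ _ line_ok v Mv Hv Hvb th tau Hth) as [[B0 D0] S0].
destruct (source_swap alpha beta ha hb _ _ (kernel_ok_conj alpha beta _ _ line_ok) v Mv Hv Hvb th tau Hth) as [[B0' D0'] S0'].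
destruct (source_swap alpha beta ha hb _ _ K1 v Mv Hv Hvb th tau Hth) as [[B1 D1] S1].
destruct (source_swap alpha beta ha hb _ _ (kernel_ok_conj alpha beta _ _ K1) v Mv Hv Hvb th tau Hth) as [[B1' D1'] S1'].
destruct (source_swap alpha beta ha hb _ _ K2 v Mv Hv Hvb th tau Hth) as [[B2 D2] S2].
destruct (source_swap alpha beta ha hb _ _ (kernel_ok_conj alpha beta _ _ K2) v Mv Hv Hvb th tau Hth) as [[B2' D2'] S2'].
assert (Z : forall (k : R -> R -> R -> C) M, kernel_ok k M -> forall y,
  CInt_half (fun a => (k th (Rabs y) (Rabs a) * v tau (Rabs y))%C) =
  (CInt_half (fun a => k th (Rabs y) (Rabs a)) * v tau (Rabs y))%C).
{ intros k M Hk y. destruct (kernel_dom_late alpha beta ha hb k M Hk th y Hth) as [K D].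
  rewrite (Cmult_comm (CInt_half _)), <- (half_mult _ _ _ D).
  apply (half_ext _ _ _ (dom_mult (v tau (Rabs y)) _ _ D)). intros; ring. }
assert (DD := dom_plus _ _ _ _ (dom_plus _ _ _ _ D0 D0') (dom_minus _ _ _ _ (dom_plus _ _ _ _ D1 D1') (dom_plus _ _ _ _ D2 D2'))).
set (tot := fun y => _) in DD. set (K := B0 + B0' + (B1 + B1' + (B2 + B2'))) in DD.
assert (Et : forall y, tot y = (source_heat th (Rabs y) * v tau (Rabs y))%C).
{ intros y. unfold tot. rewrite (Z _ _ line_ok), (Z _ _ (kernel_ok_conj alpha beta _ _ line_ok)), (Z _ _ K1), (Z _ _ (kernel_ok_conj alpha beta _ _ K1)),
    (Z _ _ K2), (Z _ _ (kernel_ok_conj alpha beta _ _ K2)).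
  rewrite <- (source_heat_eq th (Rabs y) Hth (Rabs_pos y)). ring. }
split.
- exists K. destruct DD as [X1 X2]. split.
  + intros y. apply continuous_ext with (2 := X1 y). exact Et.
  + intros y Hy. rewrite <- Et. apply X2, Hy.
- rewrite S0, S0', S1, S1', S2, S2'.
  transitivity (CInt_half tot).
  2:{ symmetry. apply (half_ext _ _ _ DD). intros; apply Et. }
  unfold tot.
  rewrite (half_plus _ _ _ _ (dom_plus _ _ _ _ D0 D0') (dom_minus _ _ _ _ (dom_plus _ _ _ _ D1 D1') (dom_plus _ _ _ _ D2 D2'))).
  rewrite (half_plus _ _ _ _ D0 D0'), (half_minus _ _ _ _ (dom_plus _ _ _ _ D1 D1') (dom_plus _ _ _ _ D2 D2')).
  rewrite (half_plus _ _ _ _ D1 D1'), (half_plus _ _ _ _ D2 D2').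
  assert (Zi : forall (k : R -> R -> R -> C) M Bk, kernel_ok k M -> dom (fun y => CInt_half (fun a => (k th (Rabs y) (Rabs a) * v tau (Rabs y))%C)) Bk ->
    CInt_half (fun y => (CInt_half (fun a => k th (Rabs y) (Rabs a)) * v tau (Rabs y))%C) =
    CInt_half (fun y => CInt_half (fun a => (k th (Rabs y) (Rabs a) * v tau (Rabs y))%C))).
  { intros k M Bk Hk Dk. apply (half_ext _ _ _ Dk). intros y _. apply (Z k M Hk). }
  rewrite (Zi _ _ _ line_ok D0), (Zi _ _ _ (kernel_ok_conj alpha beta _ _ line_ok) D0'), (Zi _ _ _ K1 D1), (Zi _ _ _ (kernel_ok_conj alpha beta _ _ K1) D1'),
    (Zi _ _ _ K2 D2), (Zi _ _ _ (kernel_ok_conj alpha beta _ _ K2) D2').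
  reflexivity.
Qed.
End Source.

End Assembly.

(** * The difference over one period *)

Section Parts.
Context (alpha beta x : R) (ha : 0 < alpha) (hb : 0 < beta) (hx : 0 < x).
Notation om := (omega alpha beta).
Notation E := (Ek alpha beta x).
Notation rho := (rho alpha beta).
Notation lowK := (low_kernel alpha beta x).
Notation upK := (up_kernel alpha beta x).
Notation lineK := (line_kernel alpha beta x).
Notation kernel_ok := (kernel_ok alpha beta).
Notation response := (response alpha beta).
Notation conjK k := (fun th y a => Cconj (k th y a)).
Notation P l := ((Ci * l + rho l) / (Ci * l - rho l))%C.
Notation S l := ((2 * Ci * l) / (Ci * l - rho l))%C.

Context (T : R) (hT : 0 < T).

Lemma half_response W M t s : response T W M -> 0 < t ->
  is_half (fun a => W t s (Rabs a)) (CInt_half (fun a => W t s (Rabs a))).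
Proof.
intros H Ht. destruct (response_dom_late alpha beta ha hb T W M H t s Ht) as [K D]. apply dom_is with K, D.
Qed.

Lemma half_duhamel W M t : response T W M -> 0 <= t ->
  is_half (duhamel W t) (CInt_half (duhamel W t)).
Proof.
intros H Ht. destruct (duhamel_dom alpha beta ha hb T W M H t Ht) as [K D]. apply dom_is with K, D.
Qed.

Section Data.
Context (u0 : R -> C) (u : R -> C) (Mu : R) (Du : dom u Mu) (Eu : forall y, 0 < y -> u0 y = u y).
Context (f v : R -> R -> C) (Mv : R) (Hv : jcont v)
  (Hvb : forall tau y, 0 <= y -> Cmod (v tau y) <= Mv * / (1 + y) ^ 2)
  (Ev : forall tau y, 0 < tau -> 0 < y -> f y tau = v tau y)
  (Hvp : forall tau y, 0 <= tau -> v (tau + T) y = v tau y).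
Context (g0 g1 h0 h1 : R -> C) (Mg : R)
  (Hc0 : forall s, ccont h0 s) (Hc1 : forall s, ccont h1 s)
  (Hb0 : forall s, Cmod (h0 s) <= Mg) (Hb1 : forall s, Cmod (h1 s) <= Mg)
  (E0 : forall s, 0 < s -> g0 s = h0 s) (E1 : forall s, 0 < s -> g1 s = h1 s)
  (Hp0 : forall s, 0 <= s -> h0 (s + T) = h0 s) (Hp1 : forall s, 0 <= s -> h1 (s + T) = h1 s).

(** Lets the lemmas on source terms apply to the initial datum. *)
Definition steady (tau y : R) : C := u y.

Lemma steady_jcont : jcont steady.
Proof. intros p. apply (continuous_comp (fun q : R * R => snd q) u); [ctac|apply Du]. Qed.
Lemma steady_bound tau y : 0 <= y -> Cmod (steady tau y) <= Mu * / (1 + y) ^ 2.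
Proof. apply Du. Qed.

Definition u_integrand (t : R) (l : C) : C :=
  (E t l * (P l * hat u0 (- l) - S l * hat u0 (Ci * rho l)))%C.
Definition f_integrand (t : R) (l : C) : C :=
  (E t l * (P l * tilde_hat f (- l) (om l) t - S l * tilde_hat f (Ci * rho l) (om l) t))%C.
Definition g_integrand (t : R) (l : C) : C :=
  (E t l * l * (Ci * l + rho l) * (rho l * tilde g0 (om l) t - tilde g1 (om l) t))%C.

Definition g_response (K : (R -> C -> C -> C) -> R -> R -> R -> C) (th tau a : R) : C :=
  (boundary_response (K amp_g0) h0 th tau a + boundary_response (K amp_g1) h1 th tau a)%C.

Section Curve.
Context (b db : R -> R) (Eb : forall a, b (- a) = b a) (Db : forall a, 0 < a -> is_derive b a (db a))
  (Pb : forall a, 0 < a -> 0 < b a).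
Notation K := (curve_kernel alpha beta x b db).

Lemma Rabs_id a : 0 < a -> Rabs a = a.
Proof. intros; apply Rabs_pos_eq; lra. Qed.

Lemma u_graph M t : kernel_ok (K amp_source) M -> 0 < t ->
  graph_int b (u_integrand t) =
  (CInt_half (fun a => source_response (K amp_source) steady t 0 (Rabs a))
   + CInt_half (fun a => source_response (conjK (K amp_source)) steady t 0 (Rabs a)))%C.
Proof.
intros HK Ht.
assert (R1 := source_response_ok alpha beta ha hb _ _ HK steady Mu steady_jcont steady_bound T (fun _ _ _ => eq_refl)).
assert (R2 := source_response_ok alpha beta ha hb _ _ (kernel_ok_conj alpha beta _ _ HK) steady Mu steady_jcont steady_bound T (fun _ _ _ => eq_refl)).
apply (graph_fold b db _ _ _ _ _ Eb Db (half_response _ _ t 0 R1 Ht) (half_response _ _ t 0 R2 Ht)).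
- intros a Ha. unfold u_integrand.
  rewrite (hat_point alpha beta x u0 u Mu Du Eu (a, b a) (1, db a) t) by (simpl; generalize (Pb a Ha); lra).
  unfold source_response. rewrite !(Rabs_id a Ha), ?Rabs_id by lra. f_equal. apply functional_extensionality; intros y.
  rewrite point_right by auto. reflexivity.
- intros a Ha. unfold u_integrand.
  rewrite (hat_point alpha beta x u0 u Mu Du Eu ((- a)%R, b a) (1, (- db a)%R) t) by (simpl; generalize (Pb a Ha); lra).
  unfold source_response. rewrite !(Rabs_id a Ha), ?Rabs_id by lra. f_equal. apply functional_extensionality; intros y.
  rewrite point_left by (auto; apply amp_source_reflects). reflexivity.
Qed.

Lemma f_graph M t : kernel_ok (K amp_source) M -> 0 <= t ->
  graph_int b (f_integrand t) =
  (CInt_half (duhamel (source_response (K amp_source) v) t)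
   + CInt_half (duhamel (source_response (conjK (K amp_source)) v) t))%C.
Proof.
intros HK Ht.
assert (R1 := source_response_ok alpha beta ha hb _ _ HK v Mv Hv Hvb T Hvp).
assert (R2 := source_response_ok alpha beta ha hb _ _ (kernel_ok_conj alpha beta _ _ HK) v Mv Hv Hvb T Hvp).
apply (graph_fold b db _ _ _ _ _ Eb Db (half_duhamel _ _ t R1 Ht) (half_duhamel _ _ t R2 Ht)).
- intros a Ha. unfold f_integrand.
  rewrite (tilde_hat_point alpha beta x f v Mv Hv Hvb Ev (a, b a) (1, db a) t) by (simpl; generalize (Pb a Ha); lra).
  apply CInt_ext. rewrite Rmin_left, Rmax_right by lra. intros s Hs.
  unfold source_response. rewrite !(Rabs_id a Ha), ?Rabs_id by lra. f_equal. apply functional_extensionality; intros y.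
  rewrite point_right by auto. reflexivity.
- intros a Ha. unfold f_integrand.
  rewrite (tilde_hat_point alpha beta x f v Mv Hv Hvb Ev ((- a)%R, b a) (1, (- db a)%R) t) by (simpl; generalize (Pb a Ha); lra).
  apply CInt_ext. rewrite Rmin_left, Rmax_right by lra. intros s Hs.
  unfold source_response. rewrite !(Rabs_id a Ha), ?Rabs_id by lra. f_equal. apply functional_extensionality; intros y.
  rewrite point_left by (auto; apply amp_source_reflects). reflexivity.
Qed.

Lemma g_graph M0 M1 t : kernel_ok (K amp_g0) M0 -> kernel_ok (K amp_g1) M1 -> 0 <= t ->
  graph_int b (g_integrand t) =
  (Ci * CInt_half (duhamel (g_response K) t) + Ci * CInt_half (duhamel (g_response (fun H => conjK (K H))) t))%C.
Proof.
intros HK0 HK1 Ht.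
assert (R1 := response_plus alpha beta T _ _ _ _
  (boundary_response_ok alpha beta _ _ h0 Mg T HK0 Hc0 Hb0 Hp0) (boundary_response_ok alpha beta _ _ h1 Mg T HK1 Hc1 Hb1 Hp1)).
assert (R2 := response_plus alpha beta T _ _ _ _
  (boundary_response_ok alpha beta _ _ h0 Mg T (kernel_ok_conj alpha beta _ _ HK0) Hc0 Hb0 Hp0)
  (boundary_response_ok alpha beta _ _ h1 Mg T (kernel_ok_conj alpha beta _ _ HK1) Hc1 Hb1 Hp1)).
apply (graph_fold b db _ _ _ _ _ Eb Db (is_half_mult Ci _ _ (half_duhamel _ _ t R1 Ht)) (is_half_mult Ci _ _ (half_duhamel _ _ t R2 Ht))).
- intros a Ha. unfold g_integrand.
  rewrite (tilde_point alpha beta x g0 g1 h0 h1 (a, b a) (1, db a) t Ht Hc0 Hc1 E0 E1).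
  f_equal. apply CInt_ext. rewrite Rmin_left, Rmax_right by lra. intros s Hs.
  unfold boundary_response. rewrite !(Rabs_id a Ha), ?Rabs_id by lra. rewrite !point_right by auto. reflexivity.
- intros a Ha. unfold g_integrand.
  rewrite (tilde_point alpha beta x g0 g1 h0 h1 ((- a)%R, b a) (1, (- db a)%R) t Ht Hc0 Hc1 E0 E1).
  f_equal. apply CInt_ext. rewrite Rmin_left, Rmax_right by lra. intros s Hs.
  unfold boundary_response. rewrite !(Rabs_id a Ha), ?Rabs_id by lra.
  rewrite (point_left alpha beta x b db amp_g0) by (auto; apply amp_g0_reflects).
  rewrite (point_left alpha beta x b db amp_g1) by (auto; apply amp_g1_reflects). reflexivity.
Qed.
End Curve.

Lemma u_line t : 0 < t ->
  CInt_line (fun s => (E t (RtoC s) * hat u0 (RtoC s))%C) =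
  (CInt_half (fun a => source_response lineK steady t 0 (Rabs a))
   + CInt_half (fun a => source_response (conjK lineK) steady t 0 (Rabs a)))%C.
Proof.
intros Ht. assert (HK := line_ok alpha beta x).
assert (R1 := source_response_ok alpha beta ha hb _ _ HK steady Mu steady_jcont steady_bound T (fun _ _ _ => eq_refl)).
assert (R2 := source_response_ok alpha beta ha hb _ _ (kernel_ok_conj alpha beta _ _ HK) steady Mu steady_jcont steady_bound T (fun _ _ _ => eq_refl)).
apply line_fold; [apply is_half_ext with (2 := half_response _ _ t 0 R1 Ht)|apply is_half_ext with (2 := half_response _ _ t 0 R2 Ht)];
  intros a Ha; rewrite (hat_line alpha beta x u0 u Mu Du Eu); unfold source_response; rewrite !(Rabs_id a Ha), ?Rabs_id by lra; f_equal;
  apply functional_extensionality; intros y.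
rewrite <- line_reflect; reflexivity.
Qed.

Lemma f_line t : 0 <= t ->
  CInt_line (fun s => (E t (RtoC s) * tilde_hat f (RtoC s) (om (RtoC s)) t)%C) =
  (CInt_half (duhamel (source_response lineK v) t) + CInt_half (duhamel (source_response (conjK lineK) v) t))%C.
Proof.
intros Ht. assert (HK := line_ok alpha beta x).
assert (R1 := source_response_ok alpha beta ha hb _ _ HK v Mv Hv Hvb T Hvp).
assert (R2 := source_response_ok alpha beta ha hb _ _ (kernel_ok_conj alpha beta _ _ HK) v Mv Hv Hvb T Hvp).
apply line_fold; [apply is_half_ext with (2 := half_duhamel _ _ t R1 Ht)|apply is_half_ext with (2 := half_duhamel _ _ t R2 Ht)];
  intros a Ha; rewrite (tilde_hat_line alpha beta x f v Mv Hv Hvb Ev _ t Ht); apply CInt_ext;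
  rewrite Rmin_left, Rmax_right by lra; intros s Hs; unfold source_response; rewrite !(Rabs_id a Ha), ?Rabs_id by lra; f_equal;
  apply functional_extensionality; intros y.
rewrite <- line_reflect; reflexivity.
Qed.

Lemma u_part t : 0 < t ->
  (CInt_line (fun s => (E t (RtoC s) * hat u0 (RtoC s))%C) + boundary_int alpha beta (u_integrand t))%C =
  CInt_half (fun y => (source_heat alpha beta x t (Rabs y) * u (Rabs y))%C).
Proof.
intros Ht. assert (HH := amp_source_ok alpha beta ha hb).
destruct (low_ok alpha beta x ha hb hx _ _ HH) as [M1 K1]. destruct (up_ok alpha beta x ha hb hx _ _ HH) as [M2 K2].
unfold boundary_int. rewrite (u_line t Ht).
rewrite (u_graph _ _ (lower_even alpha beta) (is_derive_lower alpha beta ha hb) (lower_pos alpha beta ha hb) M1 t K1 Ht).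
rewrite (u_graph _ _ (upper_even alpha beta) (fun a _ => is_derive_upper alpha beta ha hb a) (fun a _ => upper_pos alpha beta ha hb a) M2 t K2 Ht).
exact (proj2 (source_total alpha beta x ha hb hx steady Mu steady_jcont steady_bound t 0 Ht)).
Qed.

Definition f_response (th tau a : R) : C :=
  (source_response lineK v th tau a + source_response (conjK lineK) v th tau a
   + (source_response (lowK amp_source) v th tau a + source_response (conjK (lowK amp_source)) v th tau a
      - (source_response (upK amp_source) v th tau a + source_response (conjK (upK amp_source)) v th tau a)))%C.

Lemma f_part : (exists M, response T f_response M) /\ forall t, 0 <= t ->
  (CInt_line (fun s => (E t (RtoC s) * tilde_hat f (RtoC s) (om (RtoC s)) t)%C) + boundary_int alpha beta (f_integrand t))%C =
  CInt_half (duhamel f_response t).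
Proof.
assert (HH := amp_source_ok alpha beta ha hb). assert (K0 := line_ok alpha beta x).
destruct (low_ok alpha beta x ha hb hx _ _ HH) as [M1 K1]. destruct (up_ok alpha beta x ha hb hx _ _ HH) as [M2 K2].
assert (R0 := source_response_ok alpha beta ha hb _ _ K0 v Mv Hv Hvb T Hvp).
assert (R0' := source_response_ok alpha beta ha hb _ _ (kernel_ok_conj alpha beta _ _ K0) v Mv Hv Hvb T Hvp).
assert (R1 := source_response_ok alpha beta ha hb _ _ K1 v Mv Hv Hvb T Hvp).
assert (R1' := source_response_ok alpha beta ha hb _ _ (kernel_ok_conj alpha beta _ _ K1) v Mv Hv Hvb T Hvp).
assert (R2 := source_response_ok alpha beta ha hb _ _ K2 v Mv Hv Hvb T Hvp).
assert (R2' := source_response_ok alpha beta ha hb _ _ (kernel_ok_conj alpha beta _ _ K2) v Mv Hv Hvb T Hvp).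
assert (Q0 := response_plus alpha beta T _ _ _ _ R0 R0').
assert (Q1 := response_plus alpha beta T _ _ _ _ R1 R1').
assert (Q2 := response_plus alpha beta T _ _ _ _ R2 R2').
assert (Q := response_plus alpha beta T _ _ _ _ Q0 (response_minus alpha beta T _ _ _ _ Q1 Q2)).
split; [eexists; exact Q|].
intros t Ht. unfold boundary_int. rewrite (f_line t Ht).
rewrite (f_graph _ _ (lower_even alpha beta) (is_derive_lower alpha beta ha hb) (lower_pos alpha beta ha hb) M1 t K1 Ht).
rewrite (f_graph _ _ (upper_even alpha beta) (fun a _ => is_derive_upper alpha beta ha hb a) (fun a _ => upper_pos alpha beta ha hb a) M2 t K2 Ht).
unfold f_response.
rewrite (duhamel_plus alpha beta ha hb T _ _ _ _ t Q0 (response_minus alpha beta T _ _ _ _ Q1 Q2) Ht).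
rewrite (duhamel_minus alpha beta ha hb T _ _ _ _ t Q1 Q2 Ht).
rewrite (duhamel_plus alpha beta ha hb T _ _ _ _ t R0 R0' Ht), (duhamel_plus alpha beta ha hb T _ _ _ _ t R1 R1' Ht), (duhamel_plus alpha beta ha hb T _ _ _ _ t R2 R2' Ht).
reflexivity.
Qed.

Lemma f_response_total th tau : 0 < th ->
  (exists K, dom (fun y => (source_heat alpha beta x th (Rabs y) * v tau (Rabs y))%C) K) /\
  CInt_half (fun a => f_response th tau (Rabs a)) =
  CInt_half (fun y => (source_heat alpha beta x th (Rabs y) * v tau (Rabs y))%C).
Proof.
intros Hth. assert (HH := amp_source_ok alpha beta ha hb). assert (K0 := line_ok alpha beta x).
destruct (low_ok alpha beta x ha hb hx _ _ HH) as [M1 K1]. destruct (up_ok alpha beta x ha hb hx _ _ HH) as [M2 K2].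
destruct (source_total alpha beta x ha hb hx v Mv Hv Hvb th tau Hth) as [X1 X2].
split; [exact X1|]. rewrite <- X2. clear X1 X2.
assert (D : forall k M, kernel_ok k M -> exists K, dom (fun a => source_response k v th tau (Rabs a)) K).
{ intros k M Hk. apply (response_dom_late alpha beta ha hb T _ _ (source_response_ok alpha beta ha hb _ _ Hk v Mv Hv Hvb T Hvp) th tau Hth). }
destruct (D _ _ K0) as [B0 D0]. destruct (D _ _ (kernel_ok_conj alpha beta _ _ K0)) as [B0' D0'].
destruct (D _ _ K1) as [B1 D1]. destruct (D _ _ (kernel_ok_conj alpha beta _ _ K1)) as [B1' D1'].
destruct (D _ _ K2) as [B2 D2]. destruct (D _ _ (kernel_ok_conj alpha beta _ _ K2)) as [B2' D2'].
unfold f_response.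
rewrite (half_plus _ _ _ _ (dom_plus _ _ _ _ D0 D0') (dom_minus _ _ _ _ (dom_plus _ _ _ _ D1 D1') (dom_plus _ _ _ _ D2 D2'))).
rewrite (half_plus _ _ _ _ D0 D0'), (half_minus _ _ _ _ (dom_plus _ _ _ _ D1 D1') (dom_plus _ _ _ _ D2 D2')).
rewrite (half_plus _ _ _ _ D1 D1'), (half_plus _ _ _ _ D2 D2'). reflexivity.
Qed.

Definition g_total_response (th tau a : R) : C :=
  (g_response lowK th tau a + g_response (fun H => conjK (lowK H)) th tau a
   - (g_response upK th tau a + g_response (fun H => conjK (upK H)) th tau a))%C.

Lemma g_part : (exists M, response T g_total_response M) /\ forall t, 0 <= t ->
  boundary_int alpha beta (g_integrand t) = (Ci * CInt_half (duhamel g_total_response t))%C.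
Proof.
destruct (low_ok alpha beta x ha hb hx _ _ (amp_g0_ok alpha beta ha hb)) as [M10 K10].
destruct (low_ok alpha beta x ha hb hx _ _ (amp_g1_ok alpha beta ha hb)) as [M11 K11].
destruct (up_ok alpha beta x ha hb hx _ _ (amp_g0_ok alpha beta ha hb)) as [M20 K20].
destruct (up_ok alpha beta x ha hb hx _ _ (amp_g1_ok alpha beta ha hb)) as [M21 K21].
assert (RR : forall k k' M M', kernel_ok k M -> kernel_ok k' M' ->
  response T (fun th tau a => (boundary_response k h0 th tau a + boundary_response k' h1 th tau a)%C) (M * Mg + M' * Mg)).
{ intros k k' M M' Hk Hk'. apply response_plus; apply boundary_response_ok; assumption. }
assert (R1 := RR _ _ _ _ K10 K11). assert (R1' := RR _ _ _ _ (kernel_ok_conj alpha beta _ _ K10) (kernel_ok_conj alpha beta _ _ K11)).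
assert (R2 := RR _ _ _ _ K20 K21). assert (R2' := RR _ _ _ _ (kernel_ok_conj alpha beta _ _ K20) (kernel_ok_conj alpha beta _ _ K21)).
assert (Q1 := response_plus alpha beta T _ _ _ _ R1 R1').
assert (Q2 := response_plus alpha beta T _ _ _ _ R2 R2').
split; [eexists; exact (response_minus alpha beta T _ _ _ _ Q1 Q2)|].
intros t Ht. unfold boundary_int.
rewrite (g_graph _ _ (lower_even alpha beta) (is_derive_lower alpha beta ha hb) (lower_pos alpha beta ha hb) M10 M11 t K10 K11 Ht).
rewrite (g_graph _ _ (upper_even alpha beta) (fun a _ => is_derive_upper alpha beta ha hb a) (fun a _ => upper_pos alpha beta ha hb a) M20 M21 t K20 K21 Ht).
assert (X : CInt_half (duhamel g_total_response t) =
  (CInt_half (duhamel (g_response lowK) t) + CInt_half (duhamel (g_response (fun H => conjK (lowK H))) t)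
   - (CInt_half (duhamel (g_response upK) t) + CInt_half (duhamel (g_response (fun H => conjK (upK H))) t)))%C).
{ unfold g_total_response, g_response.
  rewrite <- (duhamel_plus alpha beta ha hb T _ _ _ _ t R1 R1' Ht), <- (duhamel_plus alpha beta ha hb T _ _ _ _ t R2 R2' Ht).
  rewrite <- (duhamel_minus alpha beta ha hb T _ _ _ _ t Q1 Q2 Ht). reflexivity. }
rewrite X. change (curve_kernel alpha beta x (lower alpha beta) (dlower alpha beta)) with lowK.
change (curve_kernel alpha beta x (upper alpha beta) (dupper alpha beta)) with upK. ring.
Qed.

Lemma g_response_total th tau : 0 < th ->
  CInt_half (fun a => g_total_response th tau (Rabs a)) =
  (g0_heat alpha beta x th * h0 tau + g1_heat alpha beta x th * h1 tau)%C.
Proof.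
intros Hth.
rewrite <- (g0_heat_eq alpha beta x ha hb hx th Hth), <- (g1_heat_eq alpha beta x ha hb hx th Hth).
assert (D : forall k M, kernel_ok k M -> exists K, dom (fun a => k th 0 (Rabs a)) K).
{ intros k M Hk. destruct (kernel_dom_late alpha beta ha hb k M Hk th 0 Hth) as [K X]. rewrite Rabs_R0 in X. exists K; exact X. }
destruct (low_ok alpha beta x ha hb hx _ _ (amp_g0_ok alpha beta ha hb)) as [M10 K10].
destruct (low_ok alpha beta x ha hb hx _ _ (amp_g1_ok alpha beta ha hb)) as [M11 K11].
destruct (up_ok alpha beta x ha hb hx _ _ (amp_g0_ok alpha beta ha hb)) as [M20 K20].
destruct (up_ok alpha beta x ha hb hx _ _ (amp_g1_ok alpha beta ha hb)) as [M21 K21].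
assert (Z : forall k k' M M', kernel_ok k M -> kernel_ok k' M' ->
  (exists K, dom (fun a => (h0 tau * k th 0 (Rabs a) + h1 tau * k' th 0 (Rabs a))%C) K) /\
  CInt_half (fun a => (h0 tau * k th 0 (Rabs a) + h1 tau * k' th 0 (Rabs a))%C) =
  (CInt_half (fun a => k th 0 (Rabs a)) * h0 tau + CInt_half (fun a => k' th 0 (Rabs a)) * h1 tau)%C).
{ intros k k' M M' Hk Hk'. destruct (D _ _ Hk) as [B1 D1]. destruct (D _ _ Hk') as [B2 D2].
  split; [eexists; exact (dom_plus _ _ _ _ (dom_mult (h0 tau) _ _ D1) (dom_mult (h1 tau) _ _ D2))|].
  rewrite (half_plus _ _ _ _ (dom_mult (h0 tau) _ _ D1) (dom_mult (h1 tau) _ _ D2)), (half_mult _ _ _ D1), (half_mult _ _ _ D2). ring. }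
destruct (Z _ _ _ _ K10 K11) as [[B1 D1] Z1].
destruct (Z _ _ _ _ (kernel_ok_conj alpha beta _ _ K10) (kernel_ok_conj alpha beta _ _ K11)) as [[B1' D1'] Z1'].
destruct (Z _ _ _ _ K20 K21) as [[B2 D2] Z2].
destruct (Z _ _ _ _ (kernel_ok_conj alpha beta _ _ K20) (kernel_ok_conj alpha beta _ _ K21)) as [[B2' D2'] Z2'].
assert (DD := dom_minus _ _ _ _ (dom_plus _ _ _ _ D1 D1') (dom_plus _ _ _ _ D2 D2')).
rewrite (half_ext _ (fun a => g_total_response th tau (Rabs a)) _ DD).
- rewrite (half_minus _ _ _ _ (dom_plus _ _ _ _ D1 D1') (dom_plus _ _ _ _ D2 D2')).
  rewrite (half_plus _ _ _ _ D1 D1'), (half_plus _ _ _ _ D2 D2'). rewrite Z1, Z1', Z2, Z2'. ring.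
- intros a Ha. unfold g_total_response, g_response, boundary_response. rewrite !(Rabs_id a Ha), ?Rabs_id by lra. ring.
Qed.

(** The initial datum enters through two ages, while by [duhamel_difference] the periodic data enter
through the sources of a single period. *)
Lemma U_difference t : 0 < t ->
  (forall s, ccont (fun s => CInt_half (fun a => f_response (t + Rabs (T - s)) s (Rabs a))) s) /\
  (forall s, ccont (fun s => CInt_half (fun a => g_total_response (t + Rabs (T - s)) s (Rabs a))) s) /\
  (U_formula alpha beta u0 g0 g1 f x (t + T) - U_formula alpha beta u0 g0 g1 f x t)%C =
  (/ (2 * PI) * (CInt_half (fun y => (source_heat alpha beta x (t + T) (Rabs y) * u (Rabs y))%C)
                 - CInt_half (fun y => (source_heat alpha beta x t (Rabs y) * u (Rabs y))%C))
   + / (2 * PI) * CInt (fun s => CInt_half (fun a => f_response (t + Rabs (T - s)) s (Rabs a))) 0 T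
   + beta / PI * CInt (fun s => CInt_half (fun a => g_total_response (t + Rabs (T - s)) s (Rabs a))) 0 T)%C.
Proof.
intros Ht. destruct f_part as [[Mf Rf] Ff]. destruct g_part as [[Mgg Rg] Fg].
destruct (duhamel_difference alpha beta ha hb T _ _ hT Rf t Ht) as [Cf Df].
destruct (duhamel_difference alpha beta ha hb T _ _ hT Rg t Ht) as [Cg Dg].
split; [exact Cf|split; [exact Cg|]].
assert (EU : forall t, 0 < t -> U_formula alpha beta u0 g0 g1 f x t =
  (/ (2 * PI) * CInt_half (fun y => (source_heat alpha beta x t (Rabs y) * u (Rabs y))%C)
   + / (2 * PI) * CInt_half (duhamel f_response t) + beta / PI * CInt_half (duhamel g_total_response t))%C).
{ intros r Hr. rewrite <- (u_part r Hr), <- (Ff r ltac:(lra)).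
  assert (G := Fg r ltac:(lra)).
  assert (G' : CInt_half (duhamel g_total_response r) = (- (Ci * boundary_int alpha beta (g_integrand r)))%C).
  { rewrite G. replace (- (Ci * (Ci * CInt_half (duhamel g_total_response r))))%C with
      (- (Ci * Ci) * CInt_half (duhamel g_total_response r))%C by ring. rewrite Ci_sqr. ring. }
  rewrite G'. unfold U_formula.
  change (fun l => (Cexp (Ci * l * RtoC x - om l * RtoC r) * (P l * hat u0 (- l) - S l * hat u0 (Ci * rho l)))%C) with (u_integrand r).
  change (fun l => (Cexp (Ci * l * RtoC x - om l * RtoC r) * (P l * tilde_hat f (- l) (om l) r - S l * tilde_hat f (Ci * rho l) (om l) r))%C) with (f_integrand r).
  change (fun l => (Cexp (Ci * l * RtoC x - om l * RtoC r) * l * (Ci * l + rho l) * (rho l * tilde g0 (om l) r - tilde g1 (om l) r))%C) with (g_integrand r).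
  change (fun s : R => (Cexp (Ci * RtoC s * RtoC x - om (RtoC s) * RtoC r) * hat u0 (RtoC s))%C) with (fun s : R => (E r (RtoC s) * hat u0 (RtoC s))%C).
  change (fun s : R => (Cexp (Ci * RtoC s * RtoC x - om (RtoC s) * RtoC r) * tilde_hat f (RtoC s) (om (RtoC s)) r)%C) with
    (fun s : R => (E r (RtoC s) * tilde_hat f (RtoC s) (om (RtoC s)) r)%C).
  unfold Cdiv. ring. }
rewrite (EU (t + T)), (EU t) by lra. rewrite <- Df, <- Dg. ring.
Qed.

End Data.
End Parts.

(** * Asymptotics of the difference *)

Section Asymptotics.
Context (alpha beta x : R) (ha : 0 < alpha) (hb : 0 < beta) (hx : 0 < x).
Notation c2 := (alpha / beta).
Notation c := (sqrt (alpha / beta)).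
Notation profile := (profile alpha beta).

(** The factor of th^(- 3 / 2) in [laplace]. *)
Definition kappa : R := sqrt PI / (4 * (alpha * sqrt alpha)).

Lemma half_RtoC_scale (m : R) (r : R -> R) M : dom (fun a => RtoC (r a)) M ->
  CInt_half (fun a => RtoC (m * r a)) = (RtoC m * CInt_half (fun a => RtoC (r a)))%C.
Proof.
intros D. rewrite <- (half_mult _ _ _ D). apply (half_ext _ _ _ (dom_mult (RtoC m) _ _ D)).
intros; symmetry; apply RtoC_mult.
Qed.

Lemma laplace_scaled (m : R) (r : R -> R) (A B0 : R) (th : R) : 0 < th -> 0 <= B0 ->
  (forall a, continuous r a) -> (forall a, 0 <= a -> Rabs (r a - A * a ^ 2) <= B0 * a ^ 4) ->
  Cmod (CInt_half (fun a => RtoC (m * (exp (- (omR alpha beta a * th)) * r a))) - RtoC (m * A * kappa / (th * sqrt th)))%C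
  <= Rabs m * (laplace_const alpha beta * (Rabs A + B0)) / (th ^ 2 * sqrt th).
Proof.
intros Hth HB Hc Hr. destruct (laplace alpha beta ha hb r A B0 th Hth HB Hc Hr) as [[M D] L].
rewrite (half_RtoC_scale m _ M D).
replace (RtoC (m * A * kappa / (th * sqrt th))) with (RtoC m * RtoC (A * kappa / (th * sqrt th)))%C
  by (rewrite <- RtoC_mult; f_equal; unfold Rdiv; ring).
set (I := CInt_half _) in *. unfold kappa.
replace (RtoC m * I - RtoC m * RtoC (A * (sqrt PI / (4 * (alpha * sqrt alpha))) / (th * sqrt th)))%C with
  (RtoC m * (I - RtoC (A * (sqrt PI / (4 * (alpha * sqrt alpha))) / (th * sqrt th))))%C by ring.
rewrite Cmod_mult, Cmod_R. unfold Rdiv. rewrite (Rmult_assoc (Rabs m)).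
apply Rmult_le_compat_l; [apply Rabs_pos|exact L].
Qed.

Definition source_err : R := 4 * (laplace_const alpha beta * (x + source_const alpha beta x)).

Lemma source_const_pos : 0 <= source_const alpha beta x.
Proof.
unfold source_const. assert (C0 := c_pos alpha beta ha hb). assert (K := eig_const_pos alpha beta ha hb).
apply Rdiv_le_0_compat; [|apply c2_pos; assumption].
assert (0 <= (1 + x) ^ 3) by (apply pow_le; lra).
assert (0 <= eig_const alpha beta * (1 + x) ^ 3) by (apply Rmult_le_pos; lra).
assert (0 <= c * x * eig_const alpha beta) by (apply Rmult_le_pos; [apply Rmult_le_pos|]; lra).
assert (0 <= (3 + c) * (eig_const alpha beta * (1 + x) ^ 3)) by (apply Rmult_le_pos; lra). lra.
Qed.

Lemma source_err_pos : 0 <= source_err.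
Proof.
unfold source_err. assert (L := laplace_const_pos alpha beta ha hb). assert (S := source_const_pos).
apply Rmult_le_pos; [lra|]. apply Rmult_le_pos; lra.
Qed.

(** [laplace] applied to [source_expansion]; the cube of 1 + y is what the source must compensate by
its decay. *)
Lemma source_heat_asym th y : 0 < th -> 0 <= y ->
  Cmod (source_heat alpha beta x th y - RtoC (4 * kappa * profile x / (th * sqrt th)) * RtoC (profile y))%C
  <= source_err * (1 + y) ^ 3 / (th ^ 2 * sqrt th).
Proof.
intros Hth Hy. assert (P1 := profile_bounds alpha beta ha hb x (Rlt_le _ _ hx)). assert (P2 := profile_bounds alpha beta ha hb y Hy).
assert (Sc := source_const_pos). assert (L := laplace_const_pos alpha beta ha hb).
assert (Y1 : 0 <= (1 + y) ^ 3) by (apply pow_le; lra).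
assert (A := laplace_scaled 4 (fun a => eigenfun alpha beta a x * eigenfun alpha beta a y / (2 * a ^ 2 + c2))
  (profile x * profile y) (source_const alpha beta x * (1 + y) ^ 3) th Hth ltac:(nra)).
replace (RtoC (4 * kappa * profile x / (th * sqrt th)) * RtoC (profile y))%C with (RtoC (4 * (profile x * profile y) * kappa / (th * sqrt th)))
  by (rewrite <- RtoC_mult; f_equal; unfold Rdiv; ring).
eapply Rle_trans; [apply A|].
- intros a. apply cont_Rdiv; [apply cont_Rmult; apply cont_eigenfun; ctac|ctac|].
  generalize (pow2_ge_0 a) (c2_pos alpha beta ha hb). lra.
- intros a Ha. apply source_expansion; lra.
- assert (St := sqrt_lt_R0 _ Hth). apply Rmult_le_compat_r.
  + left; apply Rinv_0_lt_compat, Rmult_lt_0_compat; [apply pow_lt, Hth|exact St].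
  + rewrite (Rabs_pos_eq 4) by lra. rewrite Rabs_pos_eq by nra. unfold source_err.
    replace (4 * (laplace_const alpha beta * (x + source_const alpha beta x)) * (1 + y) ^ 3) with
      (4 * (laplace_const alpha beta * (x * (1 + y) ^ 3 + source_const alpha beta x * (1 + y) ^ 3))) by ring.
    apply Rmult_le_compat_l; [lra|]. apply Rmult_le_compat_l; [exact L|]. apply Rplus_le_compat_r.
    apply Rmult_le_compat; try lra.
    assert (1 + y <= (1 + y) ^ 3) by (assert (1 <= (1 + y) ^ 2) by nra; nra). lra.
Qed.

Definition g1_err : R := 2 * (laplace_const alpha beta * (c * x + eig_const alpha beta * (1 + x) ^ 3)).
Definition g0_err : R := 2 * (laplace_const alpha beta *
  (c2 * x + ((3 + c) * (1 + x) / (2 * c) + c * (eig_const alpha beta * (1 + x) ^ 3)))).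

Lemma g1_heat_asym th : 0 < th ->
  Cmod (g1_heat alpha beta x th - RtoC (2 * c * kappa * profile x / (th * sqrt th)))%C <= g1_err / (th ^ 2 * sqrt th).
Proof.
intros Hth. assert (P1 := profile_bounds alpha beta ha hb x (Rlt_le _ _ hx)).
assert (C0 := c_pos alpha beta ha hb). assert (K := eig_const_pos alpha beta ha hb). assert (L := laplace_const_pos alpha beta ha hb).
assert (X1 : 0 <= (1 + x) ^ 3) by (apply pow_le; lra).
assert (A := laplace_scaled (-2) (fun a => a * eigenfun alpha beta a x) (- (c * profile x)) (eig_const alpha beta * (1 + x) ^ 3) th Hth ltac:(nra)).
replace (2 * c * kappa * profile x / (th * sqrt th)) with (-2 * - (c * profile x) * kappa / (th * sqrt th)) by (unfold Rdiv; ring).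
eapply Rle_trans; [apply A|].
- intros a. apply cont_Rmult; [ctac|apply cont_eigenfun; ctac].
- intros a Ha. apply g1_expansion; lra.
- assert (St := sqrt_lt_R0 _ Hth). apply Rmult_le_compat_r.
  + left; apply Rinv_0_lt_compat, Rmult_lt_0_compat; [apply pow_lt, Hth|exact St].
  + rewrite (Rabs_left (-2)) by lra. rewrite Rabs_Ropp, Rabs_pos_eq by nra. unfold g1_err.
    replace (- -2) with 2 by ring.
    apply Rmult_le_compat_l; [lra|]. apply Rmult_le_compat_l; [exact L|]. apply Rplus_le_compat_r.
    apply Rmult_le_compat_l; lra.
Qed.

Lemma g0_heat_asym th : 0 < th ->
  Cmod (g0_heat alpha beta x th - RtoC (2 * c2 * kappa * profile x / (th * sqrt th)))%C <= g0_err / (th ^ 2 * sqrt th).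
Proof.
intros Hth. assert (P1 := profile_bounds alpha beta ha hb x (Rlt_le _ _ hx)).
assert (C0 := c_pos alpha beta ha hb). assert (C2 := c2_pos alpha beta ha hb).
assert (K := eig_const_pos alpha beta ha hb). assert (L := laplace_const_pos alpha beta ha hb).
assert (X1 : 0 <= (1 + x) ^ 3) by (apply pow_le; lra).
assert (B1 : 0 <= (3 + c) * (1 + x) / (2 * c)) by (apply Rdiv_le_0_compat; nra).
assert (B2 : 0 <= c * (eig_const alpha beta * (1 + x) ^ 3)) by (apply Rmult_le_pos; nra).
assert (A := laplace_scaled (-2) (fun a => a * freq alpha beta a * eigenfun alpha beta a x) (- (c2 * profile x))
  ((3 + c) * (1 + x) / (2 * c) + c * (eig_const alpha beta * (1 + x) ^ 3)) th Hth ltac:(lra)).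
replace (2 * c2 * kappa * profile x / (th * sqrt th)) with (-2 * - (c2 * profile x) * kappa / (th * sqrt th))
  by (unfold Rdiv; ring).
eapply Rle_trans; [apply A|].
- intros a. apply cont_Rmult; [apply cont_Rmult; [ctac|apply cont_freq; ctac]|apply cont_eigenfun; ctac].
- intros a Ha. apply g0_expansion; lra.
- assert (St := sqrt_lt_R0 _ Hth). apply Rmult_le_compat_r.
  + left; apply Rinv_0_lt_compat, Rmult_lt_0_compat; [apply pow_lt, Hth|exact St].
  + rewrite (Rabs_left (-2)) by lra. rewrite Rabs_Ropp, (Rabs_pos_eq (c2 * profile x)) by nra. unfold g0_err.
    replace (- -2) with 2 by ring.
    apply Rmult_le_compat_l; [lra|]. apply Rmult_le_compat_l; [exact L|]. apply Rplus_le_compat_r.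
    apply Rmult_le_compat_l; lra.
Qed.

(** The function t^(- 3 / 2) has a derivative of order t^(- 5 / 2). *)
Lemma decay_shift t d T : 0 < t -> 0 <= d <= T ->
  Rabs (/ ((t + d) * sqrt (t + d)) - / (t * sqrt t)) <= 3 * T / (t ^ 2 * sqrt t).
Proof.
intros Ht Hd. assert (A0 := sqrt_lt_R0 _ Ht). assert (B0 := sqrt_lt_R0 (t + d) ltac:(lra)).
assert (A1 := sqrt_sqrt t ltac:(lra)). assert (B1 := sqrt_sqrt (t + d) ltac:(lra)).
set (p := sqrt t) in *. set (q := sqrt (t + d)) in *.
assert (Hpq : p <= q) by (apply sqrt_le_1_alt; lra).
rewrite <- B1, <- A1.
replace (/ (q * q * q) - / (p * p * p)) with (- ((q - p) * (q * q + p * q + p * p) / (p ^ 3 * q ^ 3))) by (field; lra).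
assert (P3 : 0 < p ^ 3) by (apply pow_lt, A0). assert (Q3 : 0 < q ^ 3) by (apply pow_lt, B0).
rewrite Rabs_Ropp, Rabs_pos_eq.
2:{ apply Rdiv_le_0_compat; [apply Rmult_le_pos; nra|apply Rmult_lt_0_compat; assumption]. }
assert (D0 : (q - p) * (q + p) = d) by lra.
assert (D1 : (q - p) * p <= T) by nra.
assert (P5 : 0 < (p * p) ^ 2 * p) by (apply Rmult_lt_0_compat; [apply pow_lt; nra|exact A0]).
apply Rmult_le_reg_r with (((p * p) ^ 2 * p) * q ^ 3); [apply Rmult_lt_0_compat; assumption|].
replace ((q - p) * (q * q + p * q + p * p) / (p ^ 3 * q ^ 3) * ((p * p) ^ 2 * p * q ^ 3)) with
  (((q - p) * p) * (p * (q * q + p * q + p * p))) by (field; lra).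
replace (3 * T / ((p * p) ^ 2 * p) * ((p * p) ^ 2 * p * q ^ 3)) with (T * (3 * q ^ 3)) by (field; lra).
apply Rmult_le_compat; [nra|nra|exact D1|].
assert (p * (q * q + p * q + p * p) <= q * (3 * (q * q))); [|nra].
apply Rmult_le_compat; nra.
Qed.

(** The moment through which a source enters the leading term. *)
Definition profile_moment (w : R -> C) : C := CInt_half (fun y => (RtoC (profile y) * w y)%C).

Lemma cont_profile {T : UniformSpace} (g : T -> R) p : continuous g p -> continuous (fun q => profile (g q)) p.
Proof.
intros H. unfold Defs.profile. ctac. apply Rgt_not_eq. apply (c_pos alpha beta ha hb).
Qed.

Lemma weighted (w : R -> C) Mw k y : (k <= 3)%nat -> 0 <= y -> Cmod (w y) <= Mw * / (1 + y) ^ 5 ->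
  (1 + y) ^ k * Cmod (w y) <= Mw * / (1 + y) ^ 2.
Proof.
intros Hk Hy H. assert (Y : 1 <= 1 + y) by lra.
assert (P5 : 0 < (1 + y) ^ 5) by (apply pow_lt; lra).
assert (HM : 0 <= Mw).
{ apply Rmult_le_reg_r with (/ (1 + y) ^ 5); [apply Rinv_0_lt_compat, P5|].
  generalize (Cmod_ge_0 (w y)). lra. }
apply Rle_trans with ((1 + y) ^ 3 * (Mw * / (1 + y) ^ 5)).
- apply Rmult_le_compat; [apply pow_le; lra|apply Cmod_ge_0|apply Rle_pow; assumption|exact H].
- right. field. lra.
Qed.

Lemma profile_moment_dom (w : R -> C) Mw : (forall y, ccont w y) ->
  (forall y, 0 <= y -> Cmod (w y) <= Mw * / (1 + y) ^ 5) ->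
  dom (fun y => (RtoC (profile y) * w y)%C) Mw.
Proof.
intros Hc Hb. split.
- intros y. apply ccont_mult; [apply ccont_RtoC, cont_profile, continuous_id|apply Hc].
- intros y Hy. rewrite Cmod_mult, Cmod_R.
  assert (P2 := profile_bounds alpha beta ha hb y Hy). rewrite Rabs_pos_eq by lra.
  eapply Rle_trans; [|apply (weighted w Mw 1 y); [lia|exact Hy|apply Hb, Hy]].
  apply Rmult_le_compat_r; [apply Cmod_ge_0|simpl; lra].
Qed.

(** The source decays like (1 + y)^(-5): three powers absorb the growth of the error, two give
integrability. *)
Lemma source_integral_asym (w : R -> C) Mw K th : 0 < th -> (forall y, ccont w y) ->
  (forall y, 0 <= y -> Cmod (w y) <= Mw * / (1 + y) ^ 5) ->
  dom (fun y => (source_heat alpha beta x th (Rabs y) * w (Rabs y))%C) K ->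
  Cmod (CInt_half (fun y => (source_heat alpha beta x th (Rabs y) * w (Rabs y))%C)
     - RtoC (4 * kappa * profile x / (th * sqrt th)) * profile_moment w)%C
  <= source_err * Mw / (th ^ 2 * sqrt th).
Proof.
intros Hth Hc Hb D. assert (Dm := profile_moment_dom w Mw Hc Hb).
set (m := 4 * kappa * profile x / (th * sqrt th)).
unfold profile_moment. rewrite <- (half_mult (RtoC m) _ _ Dm), <- (half_minus _ _ _ _ D (dom_mult (RtoC m) _ _ Dm)).
assert (DD := dom_minus _ _ _ _ D (dom_mult (RtoC m) _ _ Dm)).
apply half_le. split; [apply DD|].
intros y Hy. rewrite Rabs_pos_eq by exact Hy.
replace (source_heat alpha beta x th y * w y - RtoC m * (RtoC (profile y) * w y))%C with
  ((source_heat alpha beta x th y - RtoC m * RtoC (profile y)) * w y)%C by ring.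
rewrite Cmod_mult.
apply Rle_trans with (source_err * (1 + y) ^ 3 / (th ^ 2 * sqrt th) * Cmod (w y)).
- apply Rmult_le_compat_r; [apply Cmod_ge_0|apply source_heat_asym; assumption].
- assert (Wt := weighted w Mw 3 y ltac:(lia) Hy (Hb y Hy)).
  assert (St := sqrt_lt_R0 _ Hth). assert (Z : 0 < th ^ 2 * sqrt th) by (apply Rmult_lt_0_compat; [apply pow_lt, Hth|exact St]).
  replace (source_err * (1 + y) ^ 3 / (th ^ 2 * sqrt th) * Cmod (w y)) with
   ((source_err / (th ^ 2 * sqrt th)) * ((1 + y) ^ 3 * Cmod (w y))) by (unfold Rdiv; ring).
  replace (source_err * Mw / (th ^ 2 * sqrt th) * / (1 + y) ^ 2) with
   ((source_err / (th ^ 2 * sqrt th)) * (Mw * / (1 + y) ^ 2)) by (unfold Rdiv; ring).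
  apply Rmult_le_compat_l; [|exact Wt]. apply Rdiv_le_0_compat; [apply source_err_pos|exact Z].
Qed.

(** Replacing the exact age [t + d] of a source by [t] is harmless at the order considered. *)
Lemma age_shift (z m : C) (k e Mm t d T : R) : 0 < t -> 0 <= d <= T -> 0 <= e -> Cmod m <= Mm ->
  Cmod (z - RtoC (k / ((t + d) * sqrt (t + d))) * m)%C <= e / ((t + d) ^ 2 * sqrt (t + d)) ->
  Cmod (z - RtoC (k / (t * sqrt t)) * m)%C <= (e + Rabs k * (3 * T) * Mm) / (t ^ 2 * sqrt t).
Proof.
intros Ht Hd He Hm Hz. assert (A := decay_shift t d T Ht Hd).
assert (St := sqrt_lt_R0 _ Ht). assert (Sd := sqrt_lt_R0 (t + d) ltac:(lra)).
assert (Hs : sqrt t <= sqrt (t + d)) by (apply sqrt_le_1_alt; lra).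
assert (Z : 0 < t ^ 2 * sqrt t) by (apply Rmult_lt_0_compat; [apply pow_lt, Ht|exact St]).
assert (Z' : t ^ 2 * sqrt t <= (t + d) ^ 2 * sqrt (t + d)).
{ apply Rmult_le_compat; [apply pow_le; lra|lra|apply pow_incr; lra|exact Hs]. }
replace (z - RtoC (k / (t * sqrt t)) * m)%C with
  ((z - RtoC (k / ((t + d) * sqrt (t + d))) * m) + RtoC (k * (/ ((t + d) * sqrt (t + d)) - / (t * sqrt t))) * m)%C.
2:{ unfold Rdiv. rewrite Rmult_minus_distr_l, RtoC_minus. ring. }
eapply Rle_trans; [apply Cmod_triangle|]. rewrite Cmod_mult, Cmod_R, Rabs_mult.
replace ((e + Rabs k * (3 * T) * Mm) / (t ^ 2 * sqrt t)) with
  (e / (t ^ 2 * sqrt t) + Rabs k * (3 * T / (t ^ 2 * sqrt t)) * Mm) by (unfold Rdiv; ring).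
apply Rplus_le_compat.
- eapply Rle_trans; [exact Hz|]. unfold Rdiv. apply Rmult_le_compat_l; [exact He|]. apply Rinv_le_contravar; assumption.
- apply Rmult_le_compat; [apply Rmult_le_pos; apply Rabs_pos|apply Cmod_ge_0| |exact Hm].
  apply Rmult_le_compat_l; [apply Rabs_pos|exact A].
Qed.

Lemma period_asym (X q : R -> C) (k K t T : R) : 0 < T ->
  (forall s, ccont X s) -> (forall s, ccont q s) ->
  (forall s, 0 <= s <= T -> Cmod (X s - RtoC (k / (t * sqrt t)) * q s)%C <= K / (t ^ 2 * sqrt t)) ->
  Cmod (CInt X 0 T - RtoC (k / (t * sqrt t)) * CInt q 0 T)%C <= K * T / (t ^ 2 * sqrt t).
Proof.
intros HT HX Hq H.
rewrite <- CInt_mult, <- CInt_minus.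
- replace (K * T / (t ^ 2 * sqrt t)) with (K / (t ^ 2 * sqrt t) * (T - 0)) by (unfold Rdiv; ring).
  apply CInt_le_const; [lra| |exact H].
  intros s _. apply ccont_minus; [apply HX|apply ccont_mult; [apply ccont_const|apply Hq]].
- intros s _; apply HX.
- intros s _; apply ccont_mult; [apply ccont_const|apply Hq].
- intros s _; apply Hq.
Qed.

End Asymptotics.

(** * Regularity and decay of the data *)

Lemma within_abs (p : R) : filterlim Rabs (locally p) (within (fun y => 0 <= y) (locally (Rabs p))).
Proof.
intros P H. unfold within in H. generalize (continuous_Rabs p _ H). unfold filtermap.
apply filter_imp. intros y Hy. apply Hy, Rabs_pos.
Qed.

Lemma is_derive_half_cont (f : R -> C) (y : R) (l : C) : is_derive_half f y l ->
  filterlim f (within (fun y => 0 <= y) (locally y)) (locally (T := C_R_NormedModule) (f y)).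
Proof.
intros H.
apply (@filterdiff_continuous_aux R_AbsRing R_NormedModule C_R_NormedModule
  (within (fun y => 0 <= y) (locally (T := R_NormedModule) y)) (within_filter _ _ _ (@filter_filter _ _ (locally_filter y)))).
- eexists; exact H.
- apply filter_le_within.
Qed.

(** One-sided regularity at 0 is turned into continuity on the whole line by even extension. *)
Lemma smooth_half_abs_cont (f : R -> C) : smooth_half f -> forall p, ccont (fun y => f (Rabs y)) p.
Proof.
intros [D [E HD]] p.
apply continuous_ext with (fun y => D 0%nat (Rabs y)); [intros y; apply E, Rabs_pos|].
unfold continuous. apply filterlim_comp with (1 := within_abs p).
apply (is_derive_half_cont (D 0%nat) (Rabs p) (D 1%nat (Rabs p))), HD, Rabs_pos.
Qed.

(** The fifth power is the one needed in [source_integral_asym]. *)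
Lemma moment_bounds_weight (z : C) (y M0 M5 : R) : 0 <= y -> y ^ 0 * Cmod z <= M0 -> y ^ 5 * Cmod z <= M5 ->
  Cmod z <= (32 * (M0 + M5)) * / (1 + y) ^ 5.
Proof.
intros Hy H0 H5. assert (P5 : 0 < (1 + y) ^ 5) by (apply pow_lt; lra).
apply Rmult_le_reg_r with ((1 + y) ^ 5); [exact P5|].
rewrite (Rmult_assoc _ (/ _)), Rinv_l, Rmult_1_r by lra.
assert (G := Cmod_ge_0 z). simpl (y ^ 0) in H0. rewrite Rmult_1_l in H0.
assert (B : (1 + y) ^ 5 <= 32 * (1 + y ^ 5)).
{ assert (Y5 : 0 <= y ^ 5) by (apply pow_le, Hy).
  destruct (Rle_dec y 1) as [L|L].
  - apply Rle_trans with (2 ^ 5); [apply pow_incr; lra|lra].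
  - apply Rle_trans with ((2 * y) ^ 5); [apply pow_incr; lra|]. rewrite Rpow_mult_distr. lra. }
rewrite Rmult_comm. apply Rle_trans with (32 * (1 + y ^ 5) * Cmod z); [apply Rmult_le_compat_r; assumption|]. lra.
Qed.

(** By induction on the number of periods. *)
Lemma periodic_bound (phi : R -> R) (T M : R) : 0 < T ->
  (forall s, 0 <= s -> phi (s + T) = phi s) -> (forall s, 0 <= s <= T -> phi s <= M) ->
  forall s, 0 <= s -> phi s <= M.
Proof.
intros HT Hp Hb.
assert (A : forall n s, 0 <= s <= INR n * T + T -> phi s <= M).
{ induction n as [|n IH]; intros s Hs.
  - apply Hb. simpl in Hs. lra.
  - rewrite S_INR in Hs. destruct (Rle_dec s T) as [L|L]; [apply Hb; lra|].
    replace s with ((s - T) + T) by ring. rewrite Hp by lra. apply IH. lra. }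
intros s Hs. destruct (nfloor_ex (s / T)) as [n [_ Hn]]; [apply Rdiv_le_0_compat; lra|].
apply (A n). split; [exact Hs|].
assert (s = s / T * T) by (field; lra). nra.
Qed.

Lemma periodic_data (g : R -> C) T : 0 < T -> smooth_half g -> (forall s, 0 <= s -> g (s + T) = g s) ->
  (forall s, ccont (fun s => g (Rabs s)) s) /\ (exists M, 0 <= M /\ forall s, Cmod (g (Rabs s)) <= M).
Proof.
intros HT Hg Hp. assert (Hc := smooth_half_abs_cont g Hg). split; [exact Hc|].
destruct (continuity_ab_maj (fun s => Cmod (g (Rabs s))) 0 T) as [s0 [Hs0 _]]; [lra| |].
{ intros s _. apply continuity_pt_filterlim. apply (cont_Cmod (fun s => g (Rabs s)) s), Hc. }
exists (Cmod (g (Rabs s0))). split; [apply Cmod_ge_0|].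
intros s. apply (periodic_bound (fun s => Cmod (g s)) T); [exact HT| | |apply Rabs_pos].
- intros r Hr. rewrite Hp by exact Hr. reflexivity.
- intros r Hr. generalize (Hs0 r Hr). rewrite (Rabs_pos_eq r) by lra. trivial.
Qed.

Lemma schwartz_data (u0 : R -> C) : schwartz_half u0 ->
  (forall y, ccont (fun y => u0 (Rabs y)) y) /\
  exists M, forall y, 0 <= y -> Cmod (u0 (Rabs y)) <= M * / (1 + y) ^ 5.
Proof.
intros [D [[E HD] HB]]. split.
- apply smooth_half_abs_cont. exists D; split; assumption.
- destruct (HB 0%nat 0%nat) as [M0 H0]. destruct (HB 5%nat 0%nat) as [M5 H5].
  exists (32 * (M0 + M5)). intros y Hy. rewrite Rabs_pos_eq by exact Hy.
  rewrite <- E by exact Hy. apply moment_bounds_weight; auto.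
Qed.

Lemma source_data (f : R -> R -> C) T : 0 < T -> smooth_schwartz_quadrant f ->
  (forall y s, 0 <= y -> 0 <= s -> f y (s + T) = f y s) ->
  jcont (fun tau y => f (Rabs y) (Rabs tau)) /\
  exists M, 0 <= M /\ forall tau y, 0 <= y -> Cmod (f (Rabs y) (Rabs tau)) <= M * / (1 + y) ^ 5.
Proof.
intros HT [D [HD HB]] Hp. split.
- intros p.
  apply continuous_ext with (fun q : R * R => D 0%nat 0%nat (Rabs (snd q)) (Rabs (fst q))).
  { intros q. apply HD; apply Rabs_pos. }
  destruct (HD (Rabs (snd p)) (Rabs (fst p)) (Rabs_pos _) (Rabs_pos _)) as [_ H].
  destruct (H 0%nat 0%nat) as [_ [_ Hc]].
  unfold continuous.
  apply (filterlim_comp _ _ _ (fun q : R * R => (Rabs (snd q), Rabs (fst q))) (fun r : R * R => D 0%nat 0%nat (fst r) (snd r))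
    (locally p) (within (fun r : R * R => 0 <= fst r /\ 0 <= snd r) (locally (Rabs (snd p), Rabs (fst p))))); [|exact Hc].
  intros Q HQ. unfold within in HQ.
  assert (C1 : continuous (fun q : R * R => Rabs (snd q)) p) by ctac.
  assert (C2 : continuous (fun q : R * R => Rabs (fst q)) p) by ctac.
  destruct HQ as [e He]. unfold filtermap.
  assert (L1 : locally p (fun q => ball (Rabs (snd p)) e (Rabs (snd q)))) by exact (C1 _ (locally_ball _ e)).
  assert (L2 : locally p (fun q => ball (Rabs (fst p)) e (Rabs (fst q)))) by exact (C2 _ (locally_ball _ e)).
  generalize (filter_and _ _ L1 L2).
  apply filter_imp. intros q [B1 B2]. apply He; [split; assumption|]. split; apply Rabs_pos.
- destruct (HB 0%nat 0%nat T HT) as [M0 H0]. destruct (HB 5%nat 0%nat T HT) as [M5 H5].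
  set (M := 32 * (M0 + M5)).
  assert (Hb : forall tau y, 0 <= y -> Cmod (f (Rabs y) (Rabs tau)) <= M * / (1 + y) ^ 5).
  { intros tau y Hy. rewrite (Rabs_pos_eq y) by exact Hy.
    apply (periodic_bound (fun s => Cmod (f y s)) T); [exact HT| | |apply Rabs_pos].
    - intros s Hs. rewrite Hp by assumption. reflexivity.
    - intros s Hs. destruct (HD y s Hy ltac:(lra)) as [<- _]. apply moment_bounds_weight; auto. }
  exists M. split; [|exact Hb].
  specialize (Hb 0 0 (Rle_refl 0)). generalize (Cmod_ge_0 (f (Rabs 0) (Rabs 0))).
  replace ((1 + 0) ^ 5) with 1 in Hb by ring. lra.
Qed.

Lemma weight5_le y M : 0 <= M -> 0 <= y -> M * / (1 + y) ^ 5 <= M * / (1 + y) ^ 2.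
Proof.
intros HM Hy. apply Rmult_le_compat_l; [exact HM|].
apply Rinv_le_contravar; [apply pow_lt; lra|apply Rle_pow; [lra|lia]].
Qed.

Lemma Rpower_half t : 0 < t -> Rpower t (1 / 2) = sqrt t.
Proof. intros H. replace (1 / 2) with (/ 2) by lra. apply Rpower_sqrt, H. Qed.

Lemma Rpower_3_2 t : 0 < t -> Rpower t (3 / 2) = t * sqrt t.
Proof.
intros H. replace (3 / 2) with (1 + 1 / 2) by lra. rewrite Rpower_plus, Rpower_1, Rpower_half by exact H. reflexivity.
Qed.

Lemma Rpower_5_2 t : 0 < t -> Rpower t (5 / 2) = t ^ 2 * sqrt t.
Proof.
intros H. replace (5 / 2) with (1 + 3 / 2) by lra. rewrite Rpower_plus, Rpower_1, Rpower_3_2 by exact H. ring.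
Qed.

(** * The expansion of the difference *)

Theorem theorem9
  (alpha beta T : R) (u0 g0 g1 : R -> C) (f : R -> R -> C)
  (halpha : 0 < alpha) (hbeta : 0 < beta) (hT : 0 < T)
  (hu0 : schwartz_half u0) (hg0 : smooth_half g0) (hg1 : smooth_half g1)
  (hf : smooth_schwartz_quadrant f)
  (hg0T : forall t, 0 <= t -> g0 (t + T) = g0 t)
  (hg1T : forall t, 0 <= t -> g1 (t + T) = g1 t)
  (hfT : forall x t, 0 <= x -> 0 <= t -> f x (t + T) = f x t) :
  forall x0 : R, 0 < x0 ->
    filterlim
      (fun t : R => (U_formula alpha beta u0 g0 g1 f x0 (t + T)
                     - U_formula alpha beta u0 g0 g1 f x0 t)%C)
      (Rbar_locally p_infty) (locally (RtoC 0)) /\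
    exists C1 C2 : C,
      C1 = coef1 /\ C2 = coef2 alpha beta T g0 g1 f x0 /\
      exists M t1 : R, 0 < t1 /\ forall t : R, t1 <= t ->
        Cmod (U_formula alpha beta u0 g0 g1 f x0 (t + T)
              - U_formula alpha beta u0 g0 g1 f x0 t
              - (C1 / RtoC (Rpower t (1 / 2)) + C2 / RtoC (Rpower t (3 / 2))))%C
        <= M / Rpower t (5 / 2).
Proof.
intros x hx.
destruct (schwartz_data u0 hu0) as [Cu [Mu Bu]].
destruct (periodic_data g0 T hT hg0 hg0T) as [C0 [M0 [PM0 B0]]].
destruct (periodic_data g1 T hT hg1 hg1T) as [C1 [M1 [PM1 B1]]].
destruct (source_data f T hT hf hfT) as [Cv [Mv [PMv Bv]]].
(* even extensions, which are continuous on the line and agree with the data on positive arguments *)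
set (u := fun y => u0 (Rabs y)) in *. set (v := fun tau y => f (Rabs y) (Rabs tau)) in *.
set (h0 := fun s => g0 (Rabs s)) in *. set (h1 := fun s => g1 (Rabs s)) in *.
set (V := fun t : R => (U_formula alpha beta u0 g0 g1 f x (t + T) - U_formula alpha beta u0 g0 g1 f x t)%C).
assert (PMu : 0 <= Mu).
{ specialize (Bu 0 (Rle_refl 0)). generalize (Cmod_ge_0 (u0 (Rabs 0))). replace ((1 + 0) ^ 5) with 1 in Bu by ring. lra. }
assert (Du : dom u Mu).
{ split; [exact Cu|]. intros y Hy. eapply Rle_trans; [apply Bu, Hy|apply weight5_le; assumption]. }
assert (Eu : forall y, 0 < y -> u0 y = u y) by (intros y Hy; unfold u; rewrite Rabs_pos_eq by lra; reflexivity).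
assert (Bv2 : forall tau y, 0 <= y -> Cmod (v tau y) <= Mv * / (1 + y) ^ 2).
{ intros tau y Hy. eapply Rle_trans; [apply Bv, Hy|apply weight5_le; assumption]. }
assert (Ev : forall tau y, 0 < tau -> 0 < y -> f y tau = v tau y) by (intros; unfold v; rewrite !Rabs_pos_eq by lra; reflexivity).
assert (Vp : forall tau y, 0 <= tau -> v (tau + T) y = v tau y).
{ intros tau y Ht. unfold v. rewrite (Rabs_pos_eq (tau + T)), (Rabs_pos_eq tau) by lra. apply hfT; [apply Rabs_pos|exact Ht]. }
set (Mg := Rmax M0 M1).
assert (B0' : forall s, Cmod (h0 s) <= Mg) by (intros s; eapply Rle_trans; [apply B0|apply Rmax_l]).
assert (B1' : forall s, Cmod (h1 s) <= Mg) by (intros s; eapply Rle_trans; [apply B1|apply Rmax_r]).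
assert (E0 : forall s, 0 < s -> g0 s = h0 s) by (intros; unfold h0; rewrite Rabs_pos_eq by lra; reflexivity).
assert (E1 : forall s, 0 < s -> g1 s = h1 s) by (intros; unfold h1; rewrite Rabs_pos_eq by lra; reflexivity).
assert (P0 : forall s, 0 <= s -> h0 (s + T) = h0 s) by (intros; unfold h0; rewrite !Rabs_pos_eq by lra; apply hg0T; lra).
assert (P1 : forall s, 0 <= s -> h1 (s + T) = h1 s) by (intros; unfold h1; rewrite !Rabs_pos_eq by lra; apply hg1T; lra).
assert (UD := U_difference alpha beta x halpha hbeta hx T hT u0 u Mu Du Eu f v Mv Cv Bv2 Ev Vp g0 g1 h0 h1 Mg C0 C1 B0' B1' E0 E1 P0 P1).
set (X := fun t s => CInt_half (fun a => f_response alpha beta x v (t + Rabs (T - s)) s (Rabs a))) in UD.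
set (Y := fun t s => CInt_half (fun a => g_total_response alpha beta x h0 h1 (t + Rabs (T - s)) s (Rabs a))) in UD.
set (Uu := fun th => CInt_half (fun y => (source_heat alpha beta x th (Rabs y) * u (Rabs y))%C)) in UD.
set (px := profile alpha beta x). set (k := 4 * kappa alpha * px).
set (q := fun s => profile_moment alpha beta (v s)).
set (c := sqrt (alpha / beta)).
assert (Cq : forall s, ccont q s).
{ intros s. apply (half_param_cont (fun s y => (RtoC (profile alpha beta y) * v s y)%C) Mv).
  - intros r. apply ccont_mult; [|apply Cv]. apply ccont_RtoC, (cont_profile alpha beta halpha hbeta). ctac.
  - apply filter_forall. intros s'. apply (profile_moment_dom alpha beta halpha hbeta (v s') Mv); [intros; apply jcont_l, Cv|apply Bv]. }
assert (Bq : forall s, Cmod (q s) <= Mv).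
{ intros s. apply half_le, profile_moment_dom; [assumption|assumption|intros; apply jcont_l, Cv|apply Bv]. }
assert (Bmu : Cmod (profile_moment alpha beta u) <= Mu).
{ apply half_le, profile_moment_dom; assumption. }
assert (SE := source_err_pos alpha beta x halpha hbeta hx).
(* the leading terms of the initial datum at the times t + T and t cancel up to O(t^(-5/2)) *)
assert (KU : exists K, forall t, 0 < t -> Cmod (Uu (t + T)%R - Uu t)%C <= K / (t ^ 2 * sqrt t)).
{ exists ((source_err alpha beta x * Mu + Rabs k * (3 * T) * Mu) + source_err alpha beta x * Mu). intros t Ht.
  assert (A : forall th, 0 < th -> Cmod (Uu th - RtoC (k / (th * sqrt th)) * profile_moment alpha beta u)%C <= source_err alpha beta x * Mu / (th ^ 2 * sqrt th)).
  { intros th Hth. destruct (source_total alpha beta x halpha hbeta hx (steady u) Mu (steady_jcont u Mu Du) (steady_bound u Mu Du) th 0 Hth) as [[K D] _].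
    apply (source_integral_asym alpha beta x halpha hbeta hx u Mu K th Hth Cu Bu D). }
  assert (A1 := age_shift (Uu (t + T)) (profile_moment alpha beta u) k (source_err alpha beta x * Mu) Mu t T T Ht ltac:(lra) (Rmult_le_pos _ _ SE PMu) Bmu (A (t + T) ltac:(lra))).
  assert (A2 := A t Ht).
  replace (Uu (t + T)%R - Uu t)%C with ((Uu (t + T)%R - RtoC (k / (t * sqrt t)) * profile_moment alpha beta u) + - (Uu t - RtoC (k / (t * sqrt t)) * profile_moment alpha beta u))%C by ring.
  eapply Rle_trans; [apply Cmod_triangle|]. rewrite Cmod_opp.
  apply (Rle_trans _ _ _ (Rplus_le_compat _ _ _ _ A1 A2)). right. unfold Rdiv. ring. }
(* interior sources: one profile moment for each time in the period *)
assert (KX : exists K, forall t, 0 < t -> Cmod (CInt (X t) 0 T - RtoC (k / (t * sqrt t)) * CInt q 0 T)%C <= K / (t ^ 2 * sqrt t)).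
{ exists ((source_err alpha beta x * Mv + Rabs k * (3 * T) * Mv) * T). intros t Ht.
  destruct (UD t Ht) as [CX _].
  apply period_asym; [exact hT|exact CX|exact Cq|]. intros s Hs.
  set (d := Rabs (T - s)). assert (Hd : 0 <= d <= T) by (unfold d; rewrite Rabs_pos_eq; lra).
  destruct (f_response_total alpha beta x halpha hbeta hx T v Mv Cv Bv2 Vp (t + d) s ltac:(lra)) as [[K D] E].
  apply (age_shift _ _ _ _ _ t d T Ht Hd); [nra|apply Bq|].
  unfold X. fold d. rewrite E.
  apply (source_integral_asym alpha beta x halpha hbeta hx (v s) Mv K (t + d)); [lra|intros; apply jcont_l, Cv|apply Bv|exact D]. }
(* the combination (alpha / beta) g0 + sqrt (alpha / beta) g1 is, after multiplication by beta, the one in coef2 *)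
assert (KY : exists K, forall t, 0 < t -> Cmod (CInt (Y t) 0 T - RtoC (2 * kappa alpha * px / (t * sqrt t)) *
    CInt (fun s => (RtoC (alpha / beta) * h0 s + RtoC c * h1 s)%C) 0 T)%C <= K / (t ^ 2 * sqrt t)).
{ set (q' := fun s => (RtoC (alpha / beta) * h0 s + RtoC c * h1 s)%C).
  assert (Cp := c_pos alpha beta halpha hbeta). fold c in Cp. assert (C2p := c2_pos alpha beta halpha hbeta).
  assert (PMg : 0 <= Mg) by (unfold Mg; generalize (Rmax_l M0 M1); lra).
  assert (Bq' : forall s, Cmod (q' s) <= alpha / beta * Mg + c * Mg).
  { intros s. unfold q'. eapply Rle_trans; [apply Cmod_triangle|]. rewrite !Cmod_mult, !Cmod_R, !Rabs_pos_eq by lra.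
    apply Rplus_le_compat; apply Rmult_le_compat_l; try lra; auto. }
  assert (Cq' : forall s, ccont q' s).
  { intros s. assert (A := C0 s). assert (B := C1 s). unfold q'. ctac. }
  exists (((Rabs (g0_err alpha beta x) + Rabs (g1_err alpha beta x)) * Mg + Rabs (2 * kappa alpha * px) * (3 * T) * (alpha / beta * Mg + c * Mg)) * T).
  intros t Ht. destruct (UD t Ht) as [_ [CY _]].
  apply period_asym; [exact hT|exact CY|exact Cq'|]. intros s Hs.
  set (d := Rabs (T - s)). assert (Hd : 0 <= d <= T) by (unfold d; rewrite Rabs_pos_eq; lra).
  apply (age_shift _ _ _ _ _ t d T Ht Hd); [|apply Bq'|].
  { assert (Z1 := Rabs_pos (g0_err alpha beta x)). assert (Z2 := Rabs_pos (g1_err alpha beta x)). nra. }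
  unfold Y. fold d. rewrite (g_response_total alpha beta x halpha hbeta hx h0 h1 (t + d) s) by lra.
  assert (Hth : 0 < t + d) by lra. set (th := t + d) in *.
  assert (A0 := g0_heat_asym alpha beta x halpha hbeta hx th Hth). assert (A1 := g1_heat_asym alpha beta x halpha hbeta hx th Hth).
  fold c px in A0, A1.
  assert (Sth := sqrt_lt_R0 _ Hth). assert (Z : 0 < th ^ 2 * sqrt th) by (apply Rmult_lt_0_compat; [apply pow_lt, Hth|exact Sth]).
  set (G0 := g0_heat alpha beta x th) in *. set (G1 := g1_heat alpha beta x th) in *.
  replace (G0 * h0 s + G1 * h1 s - RtoC (2 * kappa alpha * px / (th * sqrt th)) * q' s)%C with
    ((G0 - RtoC (2 * (alpha / beta) * kappa alpha * px / (th * sqrt th))) * h0 s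
     + (G1 - RtoC (2 * c * kappa alpha * px / (th * sqrt th))) * h1 s)%C.
  2:{ unfold q'.
      replace (2 * (alpha / beta) * kappa alpha * px / (th * sqrt th)) with ((2 * kappa alpha * px / (th * sqrt th)) * (alpha / beta)) by (unfold Rdiv; ring).
      replace (2 * c * kappa alpha * px / (th * sqrt th)) with ((2 * kappa alpha * px / (th * sqrt th)) * c) by (unfold Rdiv; ring).
      rewrite !RtoC_mult. ring. }
  eapply Rle_trans; [apply Cmod_triangle|]. rewrite !Cmod_mult.
  assert (W : forall e, e / (th ^ 2 * sqrt th) <= Rabs e / (th ^ 2 * sqrt th)).
  { intros e. apply Rmult_le_compat_r; [left; apply Rinv_0_lt_compat, Z|apply Rle_abs]. }
  replace ((Rabs (g0_err alpha beta x) + Rabs (g1_err alpha beta x)) * Mg / (th ^ 2 * sqrt th)) with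
    (Rabs (g0_err alpha beta x) / (th ^ 2 * sqrt th) * Mg + Rabs (g1_err alpha beta x) / (th ^ 2 * sqrt th) * Mg) by (unfold Rdiv; ring).
  apply Rplus_le_compat; apply Rmult_le_compat; try apply Cmod_ge_0; try apply B0'; try apply B1'.
  - eapply Rle_trans; [exact A0|apply W].
  - eapply Rle_trans; [exact A1|apply W]. }
destruct KU as [KU HU]. destruct KX as [KX HX]. destruct KY as [KY HY].
assert (PiP := PI_RGT_0). assert (Spi := sqrt_lt_R0 _ PiP). assert (Spi2 := sqrt_sqrt PI (Rlt_le _ _ PiP)).
set (M := / (2 * PI) * KU + / (2 * PI) * KX + beta / PI * KY).
assert (Pi2 : 0 < / (2 * PI)) by (apply Rinv_0_lt_compat; lra).
assert (Pb : 0 < beta / PI) by (apply Rdiv_lt_0_compat; lra).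
assert (Main : forall t, 0 < t -> Cmod (V t - coef2 alpha beta T g0 g1 f x / RtoC (t * sqrt t))%C <= M / (t ^ 2 * sqrt t)).
{ intros t Ht. destruct (UD t Ht) as [_ [_ E]]. unfold V. rewrite E. clear E.
  specialize (HU t Ht). specialize (HX t Ht). specialize (HY t Ht).
  assert (St := sqrt_lt_R0 _ Ht). assert (Sa := sqrt_lt_R0 _ halpha).
  assert (Eq : CInt (fun s => CInt_half (fun y => (RtoC (profile alpha beta y) * f y s)%C)) 0 T = CInt q 0 T).
  { apply CInt_ext. rewrite Rmin_left, Rmax_right by lra. intros s Hs.
    apply (half_ext _ _ Mv); [apply profile_moment_dom; [assumption|assumption|intros; apply jcont_l, Cv|apply Bv]|].
    intros y Hy. rewrite Ev by lra. reflexivity. }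
  assert (Eg0 : CInt g0 0 T = CInt h0 0 T).
  { apply CInt_ext. rewrite Rmin_left, Rmax_right by lra. intros s Hs. apply E0; lra. }
  assert (Eg1 : CInt g1 0 T = CInt h1 0 T).
  { apply CInt_ext. rewrite Rmin_left, Rmax_right by lra. intros s Hs. apply E1; lra. }
  assert (Eh : CInt (fun s => (RtoC (alpha / beta) * h0 s + RtoC c * h1 s)%C) 0 T = (RtoC (alpha / beta) * CInt h0 0 T + RtoC c * CInt h1 0 T)%C).
  { rewrite CInt_plus, !CInt_mult; [reflexivity|intros s _; apply C1|intros s _; apply C0| |];
      intros s _; apply ccont_mult; try apply ccont_const; [apply C0|apply C1]. }
  rewrite Eh in HY.
  assert (Ec : (coef2 alpha beta T g0 g1 f x / RtoC (t * sqrt t))%C =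
    (RtoC (/ (2 * PI)) * (RtoC (k / (t * sqrt t)) * CInt q 0 T)
     + RtoC (beta / PI) * (RtoC (2 * kappa alpha * px / (t * sqrt t)) * (RtoC (alpha / beta) * CInt h0 0 T + RtoC c * CInt h1 0 T)))%C).
  { unfold coef2. rewrite Eq, Eg0, Eg1, Rpower_3_2 by exact halpha. fold px.
    assert (Nt : RtoC (t * sqrt t) <> RtoC 0) by (intros Z; apply RtoC_inj in Z; nra).
    assert (Ek1 : / (2 * PI) * (k / (t * sqrt t)) = px / (2 * sqrt PI * (alpha * sqrt alpha)) * / (t * sqrt t)).
    { unfold k, kappa. rewrite <- Spi2 at 1. field. repeat split; lra. }
    assert (Ek2 : beta / PI * (2 * kappa alpha * px / (t * sqrt t)) * (alpha / beta) = px / (2 * sqrt PI * (alpha * sqrt alpha)) * / (t * sqrt t) * alpha).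
    { unfold kappa. rewrite <- Spi2 at 1. field. repeat split; lra. }
    assert (Sab : sqrt (alpha * beta) = beta * c).
    { unfold c. apply sqrt_lem_1.
      - nra.
      - apply Rmult_le_pos; [lra|apply sqrt_pos].
      - replace (beta * sqrt (alpha / beta) * (beta * sqrt (alpha / beta))) with (beta * beta * (sqrt (alpha / beta) * sqrt (alpha / beta))) by ring.
        rewrite sqrt_sqrt by (left; apply c2_pos; assumption). field. lra. }
    assert (Ek3 : beta / PI * (2 * kappa alpha * px / (t * sqrt t)) * c = px / (2 * sqrt PI * (alpha * sqrt alpha)) * / (t * sqrt t) * sqrt (alpha * beta)).
    { rewrite Sab. unfold kappa. rewrite <- Spi2 at 1. field. repeat split; lra. }
    set (J := CInt q 0 T). set (J0 := CInt h0 0 T). set (J1 := CInt h1 0 T).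
    transitivity (RtoC (/ (2 * PI) * (k / (t * sqrt t))) * J
      + (RtoC (beta / PI * (2 * kappa alpha * px / (t * sqrt t)) * (alpha / beta)) * J0 + RtoC (beta / PI * (2 * kappa alpha * px / (t * sqrt t)) * c) * J1))%C.
    - rewrite Ek1, Ek2, Ek3. unfold Cdiv. rewrite <- RtoC_inv by nra. rewrite !RtoC_mult. ring.
    - rewrite !RtoC_mult. ring. }
  rewrite Ec.
  replace (/ (2 * PI))%C with (RtoC (/ (2 * PI))) by (rewrite RtoC_inv, RtoC_mult by lra; reflexivity).
  replace (beta / PI)%C with (RtoC (beta / PI)) by (rewrite RtoC_div by lra; reflexivity).
  change (CInt_half (fun y => (source_heat alpha beta x (t + T) (Rabs y) * u (Rabs y))%C)) with (Uu (t + T)).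
  change (CInt_half (fun y => (source_heat alpha beta x t (Rabs y) * u (Rabs y))%C)) with (Uu t).
  change (CInt (fun s => CInt_half (fun a => f_response alpha beta x v (t + Rabs (T - s)) s (Rabs a))) 0 T) with (CInt (X t) 0 T).
  change (CInt (fun s => CInt_half (fun a => g_total_response alpha beta x h0 h1 (t + Rabs (T - s)) s (Rabs a))) 0 T) with (CInt (Y t) 0 T).
  match goal with |- Cmod ?z <= _ => replace z with
    (RtoC (/ (2 * PI)) * (Uu (t + T)%R - Uu t)
     + (RtoC (/ (2 * PI)) * (CInt (X t) 0 T - RtoC (k / (t * sqrt t)) * CInt q 0 T)
     + RtoC (beta / PI) * (CInt (Y t) 0 T - RtoC (2 * kappa alpha * px / (t * sqrt t)) * (RtoC (alpha / beta) * CInt h0 0 T + RtoC c * CInt h1 0 T))))%C by ring end.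
  eapply Rle_trans; [apply Cmod_triangle|]. eapply Rle_trans; [apply Rplus_le_compat_l, Cmod_triangle|].
  rewrite !Cmod_mult, !Cmod_R, (Rabs_pos_eq (/ (2 * PI))), (Rabs_pos_eq (beta / PI)) by lra.
  replace (M / (t ^ 2 * sqrt t)) with (/ (2 * PI) * (KU / (t ^ 2 * sqrt t)) + (/ (2 * PI) * (KX / (t ^ 2 * sqrt t)) + beta / PI * (KY / (t ^ 2 * sqrt t))))
    by (unfold M, Rdiv; ring).
  apply Rplus_le_compat; [|apply Rplus_le_compat]; apply Rmult_le_compat_l; lra. }
split.
- intros P [e He]. unfold filtermap.
  set (A := Cmod (coef2 alpha beta T g0 g1 f x) + Rabs M).
  assert (PA : 0 <= A) by (unfold A; generalize (Cmod_ge_0 (coef2 alpha beta T g0 g1 f x)) (Rabs_pos M); lra).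
  exists (Rmax 1 (A / e)). intros t Ht.
  assert (T1 : 1 < t) by (generalize (Rmax_l 1 (A / e)); lra). assert (T2 : A / e < t) by (generalize (Rmax_r 1 (A / e)); lra).
  apply He. apply (C_NormedModule_mixin_compat1 (RtoC 0) (V t) e).
  change (Cmod (V t - RtoC 0)%C < e). replace (V t - RtoC 0)%C with (V t) by ring.
  assert (S1 : 1 <= sqrt t) by (rewrite <- sqrt_1; apply sqrt_le_1_alt; lra).
  apply Rle_lt_trans with (A / t).
  + specialize (Main t ltac:(lra)).
    assert (Nt : RtoC (t * sqrt t) <> RtoC 0) by (intros Z; apply RtoC_inj in Z; nra).
    replace (V t) with ((V t - coef2 alpha beta T g0 g1 f x / RtoC (t * sqrt t)) + coef2 alpha beta T g0 g1 f x / RtoC (t * sqrt t))%C by ring.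
    eapply Rle_trans; [apply Cmod_triangle|]. rewrite Cmod_div by exact Nt. rewrite Cmod_R, Rabs_pos_eq by nra.
    unfold A, Rdiv. rewrite Rmult_plus_distr_r, Rplus_comm. apply Rplus_le_compat.
    * apply Rmult_le_compat_l; [apply Cmod_ge_0|]. apply Rinv_le_contravar; [lra|nra].
    * eapply Rle_trans; [exact Main|]. unfold Rdiv. apply Rmult_le_compat; [|left; apply Rinv_0_lt_compat; nra|apply Rle_abs|apply Rinv_le_contravar; [lra|]].
      -- assert (Cz := Cmod_ge_0 (V t - coef2 alpha beta T g0 g1 f x / RtoC (t * sqrt t))%C).
         assert (Z : 0 < t ^ 2 * sqrt t) by nra.
         apply Rmult_le_reg_r with (/ (t ^ 2 * sqrt t)); [apply Rinv_0_lt_compat, Z|]. unfold Rdiv in Main. lra.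
      -- assert (t <= t ^ 2) by nra. nra.
  + apply Rmult_lt_reg_r with t; [lra|]. unfold Rdiv. rewrite Rmult_assoc, Rinv_l, Rmult_1_r by lra.
    assert (A = e * (A / e)) by (field; generalize (cond_pos e); lra). generalize (cond_pos e). nra.
- exists coef1, (coef2 alpha beta T g0 g1 f x). split; [reflexivity|split; [reflexivity|]].
  exists M, 1. split; [lra|]. intros t Ht.
  rewrite Rpower_5_2, Rpower_3_2 by lra.
  replace (coef1 / RtoC (Rpower t (1 / 2)) + coef2 alpha beta T g0 g1 f x / RtoC (t * sqrt t))%C with
    (coef2 alpha beta T g0 g1 f x / RtoC (t * sqrt t))%C by (unfold coef1, Cdiv; ring).
  apply Main. lra.
Qed.
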